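(* Let $x_0\in\mathbb{R}$. Suppose that there exists $\gamma\in(0,1)$ such that $b,\sigma\in\mathcal{C}^{1+\gamma}(\mathbb{R})$, and that there exists $\sigma_0>0$ such that $|\sigma(x)|\ge\sigma_0$ for all $x\in\mathbb{R}$. For $H\in(\tfrac12,1)$ let $X^H=\{X^H_t\}_{t\ge 0}$ be the solution of $$X^H_t = x_0+\int_0^t b(X^H_s)\,ds+\int_0^t\sigma(X^H_s)\circ dB^H_s,$$ and let $X=X^{1/2}=\{X_t\}_{t\geq 0}$ be the solution of the Stratonovich stochastic differential equation $$X_t = x_0+\int_0^t b(X_s)\,ds+\int_0^t\sigma(X_s)\circ dB_s .$$ Let $\varphi:\mathbb{R}\to\mathbb{R}$ be bounded and Hölder continuous of order $2+\beta$ for some $\beta>0$. Then for any $T>0$ there exists $C_T>0$ such that $$\forall H\in[\tfrac12,1),\qquad \sup_{t\in[0,T]}\left|\mathbb{E}\,\varphi(X^H_t)-\mathbb{E}\,\varphi(X_t)\right|\le C_T\,(H-\tfrac12).$$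
   Context: For $H\in(0,1)$, the fractional Brownian motion $\{B^H_t\}_{t\ge0}$ with Hurst parameter $H$ is the centred Gaussian process with covariance $R_H(s,t)=\tfrac12\left(s^{2H}+t^{2H}-|t-s|^{2H}\right)$, $s,t\ge 0$; $B=B^{1/2}$ is a standard Brownian motion. All processes are real-valued. For $H\in(\tfrac12,1)$ the integral $\int\sigma(X^H_s)\circ dB^H_s$ is a pathwise Stieltjes integral in the sense of Young; for $H=\tfrac12$ it is the classical Stratonovich integral. $\mathcal{C}^{1+\gamma}(\mathbb{R})$ denotes the usual Hölder space: bounded differentiable functions whose derivative is bounded and globally $\gamma$-Hölder continuous. ''Hölder continuous of order $2+\beta$'' means belonging to the corresponding Hölder space of order $2+\beta$ (for $\beta\in(0,1)$: twice differentiable with bounded derivatives up to order two and globally $\beta$-Hölder second derivative). *)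

(* Defs.v *)
From HB Require Import structures.
From mathcomp Require Import all_boot all_order all_algebra.
From mathcomp Require Import all_classical all_reals all_analysis.

Set Implicit Arguments.
Unset Strict Implicit.
Unset Printing Implicit Defensive.

Import Order.TTheory GRing.Theory Num.Theory.
Import numFieldNormedType.Exports.

Local Open Scope classical_set_scope.
Local Open Scope ring_scope.

(* All processes are indexed by R; only the times t >= 0 are ever used. *)

Section HoelderRegularity.
Context {R : realType}.

Definition hoelder_on (A : set R) (alpha : R) (f : R -> R) : Prop :=
  exists K : R, forall x y, A x -> A y -> `|f x - f y| <= K * `|x - y| `^ alpha.

(* The decomposition r = k + alpha with 0 < alpha <= 1 is unique, so this is
   C^{1+gamma} for r = 1 + gamma with 0 < gamma < 1. An integer order r = k + 1
   is read as C^{k,1}, i.e. a Lipschitz k-th derivative. *)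
Definition hoelder_space (r : R) (f : R -> R) : Prop :=
  exists (k : nat) (alpha : R),
    [/\ 0 < alpha <= 1 /\ r = k%:R + alpha,
        forall (i : nat) (x : R), (i < k)%N -> derivable (derive1n i f) x 1,
        forall i : nat, (i <= k)%N -> bounded_fun (derive1n i f) &
        hoelder_on [set: R] alpha (derive1n k f)].

End HoelderRegularity.

Section Partitions.
Context {R : realType}.

(* For itv_partition a b s, the points are a = t_0 < ... < t_(size s) = b. *)
Definition ppoint (a b : R) (s : seq R) (i : nat) : R := nth b (a :: s) i.

Definition mesh_lt (a b : R) (s : seq R) (delta : R) : Prop :=
  forall i : nat, (i < size s)%N ->
    ppoint a b s i.+1 - ppoint a b s i < delta.

Definition increment (a b : R) (s : seq R) (g : R -> R) (i : nat) : R :=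
  g (ppoint a b s i.+1) - g (ppoint a b s i).

(* int_a^b f dg as the limit of Riemann-Stieltjes sums with arbitrary tags. *)
Definition is_stieltjes_integral (f g : R -> R) (a b I : R) : Prop :=
  forall e : R, 0 < e -> exists2 delta : R, 0 < delta &
    forall (s : seq R) (xi : nat -> R),
      itv_partition a b s -> mesh_lt a b s delta ->
      (forall i : nat, (i < size s)%N ->
         ppoint a b s i <= xi i <= ppoint a b s i.+1) ->
      `|\sum_(0 <= i < size s) f (xi i) * increment a b s g i - I| < e.

(* Young's setting: Hoelder exponents with alpha + beta > 1. *)
Definition is_young_integral (f g : R -> R) (a b I : R) : Prop :=
  (exists alpha beta : R,
     [/\ 0 < alpha <= 1, 0 < beta <= 1, 1 < alpha + beta,
         hoelder_on `[a, b] alpha f & hoelder_on `[a, b] beta g]) /\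
  is_stieltjes_integral f g a b I.

End Partitions.

Section Processes.
Context {d : measure_display} {Omega : measurableType d} {R : realType}.
Variable P : probability Omega R.
Implicit Types B X Y J K S : R -> Omega -> R.

Definition is_process X : Prop :=
  forall t : R, 0 <= t -> measurable_fun [set: Omega] (X t).

Definition continuous_paths X : Prop :=
  {ae P, forall w, {within `[0, +oo[, continuous (fun t => X t w)}}.

(* The degenerate laws are singled out because the library's normal_prob m 0 is
   not the Dirac mass at m. *)
Definition is_gaussian (Z : Omega -> R) : Prop :=
  measurable_fun [set: Omega] Z /\
  exists m s : R, forall A : set R, measurable A ->
    P (Z @^-1` A) = if s == 0 then \d_m A else normal_prob m s A.

Definition is_gaussian_process B : Prop :=
  forall (n : nat) (c t : 'I_n -> R), (forall i, 0 <= t i) ->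
    is_gaussian (fun w => \sum_(i < n) c i * B (t i) w).

Definition fbm_covariance (H s t : R) : R :=
  2^-1 * (s `^ (2 * H) + t `^ (2 * H) - `|t - s| `^ (2 * H)).

Definition is_fbm (H : R) B : Prop :=
  [/\ is_process B,
      is_gaussian_process B,
      forall t : R, 0 <= t -> ('E_P[B t] = 0)%E &
      forall s t : R, 0 <= s -> 0 <= t ->
        covariance P (B s) (B t) = (fbm_covariance H s t)%:E].

Definition is_filtration (F : R -> set (set Omega)) : Prop :=
  [/\ forall t : R, 0 <= t -> sigma_algebra [set: Omega] (F t),
      forall t : R, 0 <= t -> F t `<=` measurable &
      forall s t : R, 0 <= s -> s <= t -> F s `<=` F t].

Definition adapted (F : R -> set (set Omega)) X : Prop :=
  forall t : R, 0 <= t -> forall A : set R, measurable A -> F t (X t @^-1` A).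

Definition is_brownian_motion (F : R -> set (set Omega)) B : Prop :=
  [/\ is_fbm 2^-1 B, continuous_paths B, adapted F B &
      forall s t : R, 0 <= s -> s <= t ->
        forall (E : set Omega) (A : set R), F s E -> measurable A ->
          P (E `&` (B t \- B s) @^-1` A) =
          (P E * P ((B t \- B s)%R @^-1` A))%E].

(* Convergence in probability to Z, as the mesh of the partition s of [0, t]
   tends to 0, of the random variables Sigma s. *)
Definition cvg_in_probability_mesh (t : R) (Sigma : seq R -> Omega -> R)
    (Z : Omega -> R) : Prop :=
  forall e eta : R, 0 < e -> 0 < eta -> exists2 delta : R, 0 < delta &
    forall s : seq R, itv_partition 0 t s -> mesh_lt 0 t s delta ->
      (P [set w | (e < `|Sigma s w - Z w|)%R] <= eta%:E)%E.

Definition left_sum Y B (t : R) (s : seq R) (w : Omega) : R :=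
  \sum_(0 <= i < size s)
    Y (ppoint 0 t s i) w * increment 0 t s (fun u => B u w) i.

Definition cross_sum Y B (t : R) (s : seq R) (w : Omega) : R :=
  \sum_(0 <= i < size s)
    increment 0 t s (fun u => Y u w) i * increment 0 t s (fun u => B u w) i.

(* J is the Ito integral process int_0^. Y dB of a continuous adapted integrand
   Y against the F-Brownian motion B; for such Y it is the limit in probability
   of the nonanticipating Riemann sums. *)
Definition is_ito_integral (F : R -> set (set Omega)) Y B J : Prop :=
  [/\ is_filtration F /\ is_brownian_motion F B,
      adapted F Y /\ continuous_paths Y,
      is_process J /\ continuous_paths J &
      forall t : R, 0 <= t -> cvg_in_probability_mesh t (left_sum Y B t) (J t)].

(* K is the covariation process [Y, B], a continuous process of locally finite
   variation. *)
Definition is_covariation Y B K : Prop :=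
  [/\ is_process K, continuous_paths K,
      {ae P, forall w, forall t : R, 0 <= t ->
         bounded_variation 0 t (fun u => K u w)} &
      forall t : R, 0 <= t -> cvg_in_probability_mesh t (cross_sum Y B t) (K t)].

(* int Y o dB = int Y dB + [Y, B] / 2, equivalently the limit of the sums of
   (Y_(t_i) + Y_(t_(i+1))) / 2 * (B_(t_(i+1)) - B_(t_i)). *)
Definition is_stratonovich_integral (F : R -> set (set Omega)) Y B S : Prop :=
  exists J K, [/\ is_ito_integral F Y B J, is_covariation Y B K &
    forall (t : R) (w : Omega), 0 <= t -> S t w = J t w + 2^-1 * K t w].

Definition drift_integral (b : R -> R) X (t : R) (w : Omega) : R :=
  (\int[lebesgue_measure]_(s in `[0, t]) b (X s w))%R.

Definition young_solution (b sigma : R -> R) (x0 : R) B X : Prop :=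
  [/\ is_process X, continuous_paths X &
      {ae P, forall w, forall t : R, 0 <= t -> exists2 I : R,
         is_young_integral (fun s => sigma (X s w)) (fun s => B s w) 0 t I &
         X t w = x0 + drift_integral b X t w + I}].

(* The finite variation of the covariation term makes every solution a
   continuous semimartingale. The filtration is arbitrary, so strong solutions
   (F the completed filtration of B) are included. *)
Definition stratonovich_solution (b sigma : R -> R) (x0 : R) B X : Prop :=
  exists (F : R -> set (set Omega)) (S : R -> Omega -> R),
    [/\ is_filtration F, adapted F X, continuous_paths X,
        is_stratonovich_integral F (fun t w => sigma (X t w)) B S &
        {ae P, forall w, forall t : R, 0 <= t ->
           X t w = x0 + drift_integral b X t w + S t w}].

End Processes.

(* Main.v *)
Require Import Defs.
From HB Require Import structures.
From mathcomp Require Import all_boot all_order all_algebra.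
From mathcomp Require Import all_classical all_reals all_analysis.
From mathcomp Require Import measurable_realfun ring lra zify.

Set Implicit Arguments.
Unset Strict Implicit.
Unset Printing Implicit Defensive.

Import Order.TTheory GRing.Theory Num.Theory.
Import numFieldNormedType.Exports.

Local Open Scope classical_set_scope.
Local Open Scope ring_scope.

(** The function [Phi] with [Phi' = 1 / sigma] turns both equations into one with
    additive noise, [Y_t = Phi x0 + int_0^t bt(Y_s) ds + (B_t - B_0)], with the same
    drift [bt = (b / sigma) o Phi^-1], and [phi(X) = (phi o Phi^-1)(Y)]. For Young
    integrals the chain rule holds because [Phi(X) - int b / sigma - B] has
    increments [o(h)] over time steps [h]; for the Stratonovich integral one identifies
    [[sigma(X), B]] with [int (sigma' sigma)(X) ds] and expands [Phi(X)] to second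
    order along uniform grids.

    For additive noise the Euler scheme is a function of finitely many Gaussian
    increments [D_0, D_1, ...] of the noise. The expectation for fractional noise is
    compared with that for Brownian noise by a backward recursion that replaces one
    increment at a time. With [w] the value function of the remaining Brownian
    steps, a step contributes [E w'(p) D_k + (E D_k^2 - h) E w''(p) / 2] up to lower
    order, and Gaussian integration by parts turns the first term into
    [E w''(p) sum_(j < k) Cov(D_j, D_k)] up to the tangent flow of the scheme.
    With [(E D_k^2 - h) / 2] these covariances add up to
    [(t_(k+1)^(2 H) - t_k^(2 H) - h) / 2], which sums over [k] to [O(2 H - 1)]. The second
    derivative of [w] is bounded uniformly in the mesh because the heat kernel
    gains a derivative at the integrable cost [1 / sqrt s]. *)

(** * Integration of real-valued functions *)

(** The transformed drift has only one bounded derivative, so the value functions cannot be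
    differentiated twice through the flow: Duhamel's formula for [w'] puts the second derivative on
    the heat kernel instead. No third derivative is available either, and the modulus of [w''] keeps
    an offset proportional to a free radius [r]; the mesh tends to 0 with [r] fixed, and [r] tends
    to 0 afterwards. The rate comes from the power function: with [q = 2 H - 1], increments of
    [t ^ q] and distances [|t ^ q - 1|] carry a factor [q]. For fixed [H > 1/2] the variance
    [h ^ (2 H)] of one increment is [o(h)], so terms quadratic in a single increment go into the
    error, and the Brownian [h / 2] is matched by covariances between different increments.
    Splitting each past increment into its regression on [D_k] and an independent rest reduces
    Gaussian integration by parts to Stein's identity in one real variable. Since a Gaussian process
    is given by the laws of single linear combinations, independence of uncorrelated variables is
    derived from expectations of cosines. *)

Section real_integral.
Context d (T : measurableType d) (R : realType) (mu : {measure set T -> \bar R}).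
Implicit Types f g : T -> R.

Definition rint f := mu.-integrable setT (EFin \o f).

Lemma rint_measurable f : rint f -> measurable_fun setT f.
Proof. by move/integrableP=> [/measurable_EFinP]. Qed.

Lemma rintD f g : rint f -> rint g -> rint (fun w => f w + g w).
Proof. by move=> hf hg; apply: (integrableD measurableT hf hg). Qed.

Lemma rintB f g : rint f -> rint g -> rint (fun w => f w - g w).
Proof. by move=> hf hg; apply: (integrableB measurableT hf hg). Qed.

Lemma rintZ r f : rint f -> rint (fun w => r * f w).
Proof. by move=> hf; apply: (integrableZl measurableT r hf). Qed.

Lemma rintZr r f : rint f -> rint (fun w => f w * r).
Proof. by move=> hf; under eq_fun do rewrite mulrC; exact: rintZ. Qed.

Lemma rint_le f g : measurable_fun setT f -> rint g ->
  (forall w, `|f w| <= g w) -> rint f.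
Proof.
move=> mf hg fg; apply: (le_integrable measurableT _ _ hg).
  exact/measurable_EFinP.
by move=> x _; rewrite /= lee_fin (le_trans (fg x))// ler_norm.
Qed.

Lemma rint_abs f : rint f -> rint (fun w => `|f w|).
Proof. by move=> hf; exact: (integrable_norm hf). Qed.

Lemma rint_sum (I : Type) (r : seq I) (F : I -> T -> R) : rint (fun=> 0) ->
  (forall i, rint (F i)) -> rint (fun w => \sum_(i <- r) F i w).
Proof.
move=> h0 h; elim: r => [|i r ih].
  by under eq_fun do rewrite big_nil.
by under eq_fun do rewrite big_cons; exact: rintD.
Qed.

Lemma rint0 : rint (fun=> 0).
Proof. exact: integrable0. Qed.

Lemma RintD f g : rint f -> rint g ->
  \int[mu]_w (f w + g w) = \int[mu]_w f w + \int[mu]_w g w.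
Proof. by move=> hf hg; apply: RintegralD. Qed.

Lemma RintB f g : rint f -> rint g ->
  \int[mu]_w (f w - g w) = \int[mu]_w f w - \int[mu]_w g w.
Proof. by move=> hf hg; apply: RintegralB. Qed.

Lemma RintZ r f : rint f -> \int[mu]_w (r * f w) = r * \int[mu]_w f w.
Proof. by move=> hf; apply: RintegralZl. Qed.

Lemma RintZr r f : rint f -> \int[mu]_w (f w * r) = \int[mu]_w f w * r.
Proof. by move=> hf; apply: RintegralZr. Qed.

Lemma Rint_le f g : rint f -> rint g -> (forall w, f w <= g w) ->
  \int[mu]_w f w <= \int[mu]_w g w.
Proof. by move=> hf hg h; apply: le_Rintegral. Qed.

Lemma Rint_abs_le f g : rint f -> rint g -> (forall w, `|f w| <= g w) ->
  `|\int[mu]_w f w| <= \int[mu]_w g w.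
Proof.
move=> hf hg h; apply: le_trans (le_normr_Rintegral _ hf) _ => //.
by apply: Rint_le => //; exact: rint_abs.
Qed.

Lemma Rint_ge0 f : (forall w, 0 <= f w) -> 0 <= \int[mu]_w f w.
Proof. by move=> h; apply: Rintegral_ge0. Qed.

Lemma Rint_eq f g : (forall w, f w = g w) -> \int[mu]_w f w = \int[mu]_w g w.
Proof. by move=> h; apply: eq_Rintegral => w _. Qed.

Lemma Rint_sum (I : Type) (r : seq I) (F : I -> T -> R) :
  (forall i, rint (F i)) ->
  \int[mu]_w (\sum_(i <- r) F i w) = \sum_(i <- r) \int[mu]_w F i w.
Proof.
move=> h; elim: r => [|i r ih].
  rewrite big_nil (@Rint_eq _ (fun=> 0)) ?Rintegral_cst ?mul0r//.
  by move=> w; rewrite big_nil.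
rewrite big_cons -ih -RintD//; last exact: rint_sum rint0 h.
by apply: Rint_eq => w; rewrite big_cons.
Qed.

Lemma rint_EFin f : rint f -> (\int[mu]_w (f w)%:E)%E = (\int[mu]_w f w)%:E.
Proof. by move=> hf; rewrite /Rintegral fineK//; apply: integrable_fin_num. Qed.

Lemma Rint_ae_eq f g : measurable_fun setT f -> measurable_fun setT g ->
  {ae mu, forall w, f w = g w} -> \int[mu]_w f w = \int[mu]_w g w.
Proof.
move=> mf mg fg; rewrite /Rintegral; congr fine; apply: ae_eq_integral => //.
- exact/measurable_EFinP.
- exact/measurable_EFinP.
- by case: fg => N [mN N0 hN]; exists N; split => // w /=; apply: contra_notP => h;
    move=> _; congr EFin; apply: contra_notP h => ?; exact: hN.
Qed.

Lemma Rint_dominated (f_ : nat -> T -> R) f g :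
  (forall n, measurable_fun setT (f_ n)) -> measurable_fun setT f ->
  {ae mu, forall w, f_ n w @[n --> \oo] --> f w} -> rint g ->
  (forall n w, `|f_ n w| <= g w) ->
  (\int[mu]_w f_ n w) @[n --> \oo] --> \int[mu]_w f w.
Proof.
move=> mf_ mf cf hg fg.
have [||||h1 _ h2] := @dominated_convergence _ _ _ mu _ measurableT
  (fun n => EFin \o f_ n) (EFin \o f) (EFin \o g) _ _ _ hg.
- by move=> n; exact/measurable_EFinP.
- exact/measurable_EFinP.
- case: cf => N [mN N0 hN]; exists N; split => // w /= h; apply: hN => /= h'.
  by apply: h => _; apply: cvg_comp; [exact: h'|].
- by apply: aeW => w n _; rewrite /= lee_fin.
- apply: (@fine_cvg _ _ _ _ _ (\int[mu]_w f w)).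
  by rewrite fineK//; apply: integrable_fin_num.
Qed.

End real_integral.

Section probability_integral.
Context d (T : measurableType d) (R : realType) (P : probability T R).
Implicit Types f g : T -> R.

Lemma rint_cst (r : R) : rint P (fun=> r).
Proof.
by apply: finite_measure_integrable_cst.
Qed.

Lemma rint_bounded (C : R) f : measurable_fun setT f -> (forall w, `|f w| <= C) ->
  rint P f.
Proof. by move=> mf h; apply: (rint_le mf (rint_cst C)). Qed.

Lemma Rint_cst (r : R) : \int[P]_w r = r.
Proof.
rewrite Rintegral_cst//.
by have /= -> := @probability_setT _ _ _ P; rewrite mulr1.
Qed.

Lemma Rint_abs_leC (C : R) f : measurable_fun setT f -> (forall w, `|f w| <= C) ->
  `|\int[P]_w f w| <= C.
Proof.
move=> mf h; rewrite -[C]Rint_cst; apply: Rint_abs_le => //; last exact: rint_cst.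
exact: rint_bounded h.
Qed.

Lemma rint_sq f : measurable_fun setT f -> rint P (fun w => f w ^+ 2) -> rint P f.
Proof.
move=> mf h; apply: (rint_le mf (rintD (rint_cst 1) h)) => w.
rewrite -(ger0_norm (sqr_ge0 (f w))) normrX; set a := `|_|.
have : 0 <= (a - 1) ^+ 2 by exact: sqr_ge0.
have : 0 <= a by rewrite normr_ge0.
nra.
Qed.

Lemma rint_mul f g : measurable_fun setT f -> measurable_fun setT g ->
  rint P (fun w => f w ^+ 2) -> rint P (fun w => g w ^+ 2) ->
  rint P (fun w => f w * g w).
Proof.
move=> mf mg hf hg; apply: (rint_le _ (rintD hf hg)); first exact: measurable_funM.
move=> w; rewrite normrM -(ger0_norm (sqr_ge0 (f w))) -(ger0_norm (sqr_ge0 (g w))).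
rewrite !normrX; set a := `|_|; set b := `|_|.
have : 0 <= (a - b) ^+ 2 by exact: sqr_ge0.
have : 0 <= a by rewrite normr_ge0.
have : 0 <= b by rewrite normr_ge0.
nra.
Qed.

Lemma Rint_abs_sq f : measurable_fun setT f -> rint P (fun w => f w ^+ 2) ->
  \int[P]_w `|f w| <= Num.sqrt (\int[P]_w f w ^+ 2).
Proof.
move=> mf h; set s := Num.sqrt _.
have V0 : 0 <= \int[P]_w f w ^+ 2 by apply: Rint_ge0 => w; exact: sqr_ge0.
have s2 : s ^+ 2 = \int[P]_w f w ^+ 2 by rewrite sqr_sqrtr.
have s0 : 0 <= s by exact: sqrtr_ge0.
have hf := rint_sq mf h.
(* The integrated inequality [|a| <= a ^+ 2 / (2 c) + c / 2] replaces Cauchy-Schwarz: [c = s] gives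
   the claim, and arbitrarily small [c] covers [s = 0]. *)
have key (c : R) : 0 < c -> \int[P]_w `|f w| <= (s ^+ 2 / c + c) / 2.
  move=> c0; have -> : (s ^+ 2 / c + c) / 2 = \int[P]_w (f w ^+ 2 * ((2 * c)^-1) + c / 2).
    rewrite RintD; [|exact: rintZr|exact: rint_cst].
    by rewrite RintZr// Rint_cst -s2; field; lra.
  apply: Rint_le; first exact: rint_abs.
    by apply: rintD; [exact: rintZr|exact: rint_cst].
  move=> w; rewrite -(ger0_norm (sqr_ge0 (f w))) normrX; set a := `|f w|.
  have -> : a ^+ 2 / (2 * c) + c / 2 = (a ^+ 2 + c ^+ 2) / (2 * c) by field; lra.
  rewrite ler_pdivlMr; last by lra.
  have : 0 <= (a - c) ^+ 2 by exact: sqr_ge0.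
  nra.
have [s00|sn0] := eqVneq s 0.
  rewrite s00; apply/ler_addgt0Pl => e e0; rewrite addr0.
  apply: le_trans (key e e0) _; rewrite s00 expr0n/= mul0r add0r; lra.
have sp : 0 < s by rewrite lt_def sn0.
apply: le_trans (key s sp) _.
have -> : s ^+ 2 / s = s by field; lra.
lra.
Qed.

End probability_integral.

(** * Mean value bounds and differentiation under the integral *)

Section calculus.
Context {R : realType}.
Implicit Types f g : R -> R.

Lemma is_derive_continuous f (df : R -> R) :
  (forall x, is_derive x (1 : R) f (df x)) -> continuous f.
Proof.
by move=> h x; apply/differentiable_continuous/derivable1_diffP; case: (h x).
Qed.

Lemma is_derive_MVT f (df : R -> R) (C a b : R) :
  (forall x, is_derive x (1 : R) f (df x)) -> (forall x, `|df x| <= C) ->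
  `|f b - f a| <= C * `|b - a|.
Proof.
move=> hf hC; wlog ab : a b / a <= b.
  move=> H; case: (leP a b) => [/H//|/ltW /H].
  by rewrite (distrC (f a)) (distrC a).
have [|c _ ->] := @MVT_segment _ f df a b ab.
- by apply: continuous_subspaceT; exact: is_derive_continuous hf.
- by rewrite normrM ler_wpM2r.
Qed.

Lemma is_derive_integral d (T : measurableType d) (P : probability T R)
    (f f' : R -> T -> R) (g : T -> R) (a : R) :
  (forall x, rint P (f x)) ->
  (forall x w, is_derive x (1 : R) (f ^~ w) (f' x w)) ->
  rint P g -> (forall x w, `|x - a| < 1 -> `|f' x w| <= g w) ->
  is_derive a (1 : R) (fun x => \int[P]_w f x w) (\int[P]_w f' a w).
Proof.
move=> hf hd hg fg.
have g0 w : 0 <= g w.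
  by apply: le_trans (fg a w _); rewrite ?subrr ?normr0.
have E x w : partial1of2 f x w = f' x w.
  by rewrite /partial1of2 derive1E; case: (hd x w).
have aI : a \in `]a - 1, a + 1[ by rewrite /= in_itv/=; apply/andP; split; lra.
have nI x : x \in `]a - 1, a + 1[ -> `|x - a| < 1.
  by rewrite /= in_itv/= => /andP[? ?]; rewrite ltr_norml; apply/andP; split; lra.
have h1 := @derivable_under_integral _ _ _ P f setT measurableT a _ _ aI
  (fun x _ => hf x) (fun x y _ _ => @ex_derive _ _ _ _ _ _ _ (hd x y)) g g0 hg.
have h2 := @differentiation_under_integral _ _ _ P f setT measurableT a _ _ aI
  (fun x _ => hf x) (fun x y _ _ => @ex_derive _ _ _ _ _ _ _ (hd x y)) g g0 hg.
have b x y : x \in `]a - 1, a + 1[ -> setT y -> `|partial1of2 f x y| <= g y.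
  by move=> xI _; rewrite E; apply: fg; exact: nI.
apply: DeriveDef; first exact: h1.
rewrite -derive1E h2//; apply: Rint_eq => w; exact: E.
Qed.

End calculus.

(** * The normal distribution *)

Section lebesgue_derivative.
Context {R : realType}.
Notation leb := (@lebesgue_measure R).

Lemma continuous_measurable (f : R -> R) : continuous f -> measurable_fun setT f.
Proof. exact: continuous_measurable_fun. Qed.

Lemma Rintegral_FTC (F h : R -> R) (a b : R) : a < b ->
  (forall x, is_derive x (1 : R) F (h x)) -> continuous h ->
  \int[leb]_(x in `[a, b]) h x = F b - F a.
Proof.
move=> ab hd hc; rewrite /Rintegral (@continuous_FTC2 _ h F a b ab)//.
- by apply: continuous_subspaceT.
- split; first by move=> x _; case: (hd x).
  + by apply: cvg_at_right_filter; exact: (is_derive_continuous hd).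
  + by apply: cvg_at_left_filter; exact: (is_derive_continuous hd).
- by move=> x _; rewrite derive1E; case: (hd x).
Qed.

(** The fundamental theorem on [[m - n, m + n]], then dominated convergence; the values of [F] along
    two integer sequences suffice. This is integration by parts on the line without boundary
    terms. *)
Lemma Rintegral_derivative0 (F h : R -> R) (m : R) :
  (forall x, is_derive x (1 : R) F (h x)) -> continuous h -> rint leb h ->
  F (m + n%:R) @[n --> \oo] --> 0 -> F (m - n%:R) @[n --> \oo] --> 0 ->
  \int[leb]_x h x = 0.
Proof.
move=> hd hc hi F1 F2.
pose f n := h \_ `[m - n%:R, m + n%:R].
have c1 : (\int[leb]_x f n x) @[n --> \oo] --> \int[leb]_x h x.
  apply: (Rint_dominated (mu := leb) (g := fun x => `|h x|)).
  - move=> n; apply/(measurable_restrictT h) => //.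
    by apply: measurable_funTS; exact: continuous_measurable.
  - exact: continuous_measurable.
  - apply: aeW => x; apply: cvg_near_cst; near=> n.
    rewrite /f patchE ifT// inE/= in_itv/=.
    have : `|x - m| <= n%:R by near: n; exact: nbhs_infty_ger.
    by rewrite ler_norml => /andP[? ?]; apply/andP; split; lra.
  - exact: rint_abs.
  - by move=> n x; rewrite /f patchE; case: ifPn; rewrite ?normr0.
have c2 : (\int[leb]_x f n x) @[n --> \oo] --> (0 - 0 : R).
  have c3 := cvgB F1 F2.
  suff /near_eq_cvg/cvg_trans : \forall n \near \oo,
      F (m + n%:R) - F (m - n%:R) = \int[leb]_x f n x by apply; exact: c3.
  near=> n; rewrite /f -Rintegral_mkcond (@Rintegral_FTC F)//.
  have : (0 < n)%N by near: n; exists 1%N.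
  by rewrite -(ltr_nat R) => ?; lra.
by rewrite -(cvg_lim (@Rhausdorff R) c1) (cvg_lim (@Rhausdorff R) c2) subrr.
Unshelve. all: by end_near. Qed.

End lebesgue_derivative.

Section normal_law.
Context {R : realType}.
Variables (m s : R).
Hypothesis s0 : s != 0.
Notation leb := (@lebesgue_measure R).
Notation gam := (normal_prob m s).
Notation p := (normal_pdf m s).

(** Change of variables comes with the Radon-Nikodym derivative; it equals the density almost
    everywhere because both have the same integral over every measurable set. *)
Lemma ge0_integral_normal (f : R -> \bar R) : (forall x, 0 <= f x)%E ->
  measurable_fun setT f ->
  (\int[gam]_x f x = \int[leb]_x (f x * (p x)%:E))%E.
Proof.
move=> f0 mf.
rewrite -(@Radon_Nikodym_SigmaFinite.change_of_variables _ _ _ gam leb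
  (normal_prob_dominates m s) f setT)//.
have dom := normal_prob_dominates m s.
apply: ae_eq_integral => //.
- apply: emeasurable_funM => //.
  exact: measurable_int (Radon_Nikodym_SigmaFinite.f_integrable dom).
- apply: emeasurable_funM => //; apply/measurable_EFinP.
  exact: measurable_normal_pdf.
- apply: ae_eqe_mul2l; apply: integral_ae_eq => //.
  + exact: (Radon_Nikodym_SigmaFinite.f_integrable dom).
  + by apply/measurable_EFinP; exact: measurable_normal_pdf.
  + by move=> E _ mE; rewrite -Radon_Nikodym_SigmaFinite.f_integral.
Qed.

Lemma p_ge0 x : 0 <= p x.
Proof. exact: normal_pdf_ge0. Qed.

Lemma rint_normal (f : R -> R) : measurable_fun setT f ->
  rint leb (fun x => f x * p x) -> rint gam f.
Proof.
move=> mf /integrableP[_ fi]; apply/integrableP; split; first exact/measurable_EFinP.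
rewrite ge0_integral_normal//=; last first.
  by apply/measurable_EFinP; apply: measurableT_comp.
apply: le_lt_trans fi; apply: ge0_le_integral => //.
- by move=> x _; rewrite mule_ge0 ?lee_fin ?p_ge0.
- apply: emeasurable_funM; apply/measurable_EFinP; last exact: measurable_normal_pdf.
  exact: measurableT_comp.
- apply/measurable_EFinP; apply: measurableT_comp => //.
  by apply: measurable_funM => //; exact: measurable_normal_pdf.
- by move=> x _; rewrite /= -EFinM lee_fin normrM (ger0_norm (p_ge0 x)).
Qed.

Lemma Rint_normal (f : R -> R) : measurable_fun setT f ->
  rint leb (fun x => f x * p x) -> \int[gam]_x f x = \int[leb]_x (f x * p x).
Proof.
move=> mf fi; have fg := rint_normal mf fi.
have E (g : R -> R) : (forall x, 0 <= g x) -> measurable_fun setT g ->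
    \int[gam]_x g x = \int[leb]_x (g x * p x).
  move=> g0 mg; rewrite /Rintegral ge0_integral_normal//; last exact/measurable_EFinP.
have mp : measurable_fun setT p by exact: measurable_normal_pdf.
have ma : measurable_fun setT (fun x => `|f x|) by exact: measurableT_comp.
have ip : rint leb p by exact: integrable_normal_pdf.
have ia : rint leb (fun x => `|f x| * p x).
  have := rint_abs fi; congr (rint _ _); apply/funext => x.
  by rewrite normrM (ger0_norm (p_ge0 x)).
(* Reduction to nonnegative integrands: [f = (|f| + f) - |f|]. *)
have -> : \int[gam]_x f x = \int[gam]_x (`|f x| + f x) - \int[gam]_x `|f x|.
  by rewrite RintD//; [ring|exact: rint_abs].
rewrite !E//; last 2 first.
- by move=> x; have := ler_norm (- f x); rewrite normrN; lra.
- by apply: measurable_funD.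
rewrite -RintB//; last first.
  have := rintD ia fi; congr (rint _ _); apply/funext => x; ring.
by apply: Rint_eq => x; ring.
Qed.

(** The square root of the density up to a constant: [p = normal_peak s * q ^+ 2]. One factor [q]
    absorbs polynomial growth while the other stays integrable. *)
Let q x := expR (- ((x - m) ^+ 2 / (4 * s ^+ 2))).

Let s2 : 0 < s ^+ 2.
Proof. by rewrite exprn_even_gt0. Qed.

Let rint_q : rint leb q.
Proof.
have sq0 : Num.sqrt 2 * s != 0 by rewrite mulf_neq0// gt_eqF// sqrtr_gt0.
have h := integrable_normal_pdf m (Num.sqrt 2 * s).
have h' : rint leb (normal_pdf m (Num.sqrt 2 * s)) by exact: h.
have := rintZ (normal_peak (Num.sqrt 2 * s))^-1 h'.
congr (rint _ _); apply/funext => x.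
rewrite (normal_pdfE m sq0) /= mulrA mulVf ?mul1r; last first.
  by rewrite gt_eqF// normal_peak_gt0.
rewrite /normal_fun /q exprMn sqr_sqrtr// mulNr; congr (expR (- (_ / _))).
ring.
Qed.

Let pE x : p x = normal_peak s * (q x ^+ 2).
Proof.
rewrite (normal_pdfE m s0) /= /normal_fun /q -expRM_natl; congr (_ * expR _).
by rewrite mulr2n; field; rewrite s0/= gt_eqF// addr_gt0.
Qed.

Let sq_q x : (x - m) ^+ 2 * q x <= 4 * s ^+ 2.
Proof.
rewrite /q expRN ler_pdivrMr ?expR_gt0//.
set u := _ / _.
have -> : (x - m) ^+ 2 = 4 * s ^+ 2 * u by rewrite /u; field.
rewrite ler_wpM2l//; first by nra.
by apply: le_trans (expR_ge1Dx u); lra.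
Qed.

Let q_le1 x : q x <= 1.
Proof.
by rewrite /q -[leRHS]expR0 ler_expR oppr_le0 divr_ge0 ?sqr_ge0// mulr_ge0// ltW.
Qed.

Let q_ge0 x : 0 <= q x.
Proof. exact: expR_ge0. Qed.

(* The Gaussian weight absorbs quadratic growth, leaving the weight [q]. *)
Let bound_p (f : R -> R) (A B : R) x : 0 <= A -> 0 <= B ->
  `|f x| <= A + B * (x - m) ^+ 2 ->
  `|f x * p x| <= normal_peak s * (A + B * (4 * s ^+ 2)) * q x.
Proof.
move=> A0 B0 fx; rewrite normrM (ger0_norm (p_ge0 x)) pE.
have k0 := normal_peak_ge0 s.
have -> : `|f x| * (normal_peak s * q x ^+ 2) = normal_peak s * (`|f x| * q x) * q x by ring.
rewrite ler_wpM2r//; rewrite ler_wpM2l//.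
apply: le_trans (_ : (A + B * (x - m) ^+ 2) * q x <= _); first by rewrite ler_wpM2r.
rewrite mulrDl -mulrA; apply: lerD; last by rewrite ler_wpM2l.
by rewrite ler_piMr.
Qed.

Lemma rint_normal_quad (f : R -> R) (A B : R) : 0 <= A -> 0 <= B ->
  measurable_fun setT f -> (forall x, `|f x| <= A + B * (x - m) ^+ 2) ->
  rint gam f.
Proof.
move=> A0 B0 mf h; apply: rint_normal => //.
apply: (rint_le (mu := leb) (g := fun x => normal_peak s * (A + B * (4 * s ^+ 2)) * q x)).
- by apply: measurable_funM => //; exact: measurable_normal_pdf.
- exact: rintZ.
- by move=> x; exact: bound_p.
Qed.

Let is_derive_p x : is_derive x (1 : R) p (- ((x - m) / s ^+ 2) * p x).
Proof.
have -> : p = fun x => normal_peak s * expR (- ((x - m) ^+ 2 / (2 * s ^+ 2))).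
  apply/funext => y; rewrite (normal_pdfE m s0) /= /normal_fun.
  by congr (_ * expR _); rewrite mulNr mulr2n -mulr2n mulr_natl.
apply: is_derive_eq; by rewrite /GRing.scale /=; field.
Qed.

Let q_cvg0 : q (m + n%:R) @[n --> \oo] --> 0.
Proof.
apply/cvgrPdist_lt => e e0; near=> n.
rewrite sub0r normrN ger0_norm// /q addrAC subrr add0r expRN.
have n0 : 4 * s ^+ 2 / e < n%:R by near: n; exact: nbhs_infty_gtr.
have n1 : (1 <= n)%N by near: n; exists 1%N.
have n2 : (1 : R) <= n%:R by rewrite ler1n.
rewrite invf_plt ?posrE ?expR_gt0//.
apply: lt_le_trans (expR_ge1Dx _).
apply: (@lt_trans _ _ (n%:R / (4 * s ^+ 2))).
  rewrite ltr_pdivlMr; last by rewrite mulr_gt0.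
  by rewrite mulrC.
apply: (@le_lt_trans _ _ (n%:R ^+ 2 / (4 * s ^+ 2))); last lra.
by rewrite ler_wpM2r ?invr_ge0; nra.
Unshelve. all: by end_near. Qed.

(** Stein's identity. The product [g p] has derivative [g' p - (x - m) g p / s ^+ 2] and vanishes at
    infinity, so this derivative integrates to zero. A bounded [g'] lets [g] grow at most linearly,
    which [bound_p] absorbs. *)
Lemma normal_ibp (g g' : R -> R) (C : R) :
  (forall x, is_derive x (1 : R) g (g' x)) -> continuous g' ->
  (forall x, `|g' x| <= C) ->
  \int[gam]_x ((x - m) * g x) = s ^+ 2 * \int[gam]_x g' x.
Proof.
move=> hd cg' hC.
have C0 : 0 <= C by apply: le_trans (hC 0).
have cg := is_derive_continuous hd.
have mg := continuous_measurable cg; have mg' := continuous_measurable cg'.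
have gb x : `|g x| <= `|g m| + C * `|x - m|.
  rewrite -[g x](subrK (g m)) addrC; apply: le_trans (ler_normD _ _) _.
  by rewrite lerD2l; apply: is_derive_MVT hd hC.
have gb2 x : `|g x| <= (`|g m| + C) + C * (x - m) ^+ 2.
  apply: le_trans (gb x) _; rewrite -normr_id -(ger0_norm (sqr_ge0 (x - m))) normrX normr_id.
  set a := `|x - m|; have a0 : 0 <= a by rewrite normr_ge0.
  have : 0 <= (a - 1) ^+ 2 by exact: sqr_ge0.
  nra.
have gb3 x : `|(x - m) * g x| <= `|g m| + (`|g m| + C) * (x - m) ^+ 2.
  rewrite normrM; apply: le_trans (ler_wpM2l (normr_ge0 _) (gb x)) _.
  rewrite -(ger0_norm (sqr_ge0 (x - m))) normrX.
  set a := `|x - m|; have a0 : 0 <= a by rewrite normr_ge0.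
  set b := `|g m|; have b0 : 0 <= b by rewrite normr_ge0.
  have : 0 <= b * (a - 1) ^+ 2 by rewrite mulr_ge0// sqr_ge0.
  have : 0 <= b * a ^+ 2 by rewrite mulr_ge0// sqr_ge0.
  nra.
have mp : measurable_fun setT p by exact: measurable_normal_pdf.
have mx : measurable_fun setT (fun x : R => x - m).
  by apply: measurable_funB => //.
have i1 : rint leb (fun x => g' x * p x).
  apply: (rint_le (mu := leb) (g := fun x => normal_peak s * (C + 0 * (4 * s ^+ 2)) * q x)).
  - exact: measurable_funM.
  - exact: rintZ.
  - by move=> x; apply: bound_p => //; rewrite mul0r addr0.
have gm0 : 0 <= `|g m| by exact: normr_ge0.
have i2 : rint leb (fun x => ((x - m) * g x) * p x).
  apply: (rint_le (mu := leb)
    (g := fun x => normal_peak s * (`|g m| + (`|g m| + C) * (4 * s ^+ 2)) * q x)).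
  - by apply: measurable_funM => //; exact: measurable_funM.
  - exact: rintZ.
  - by move=> x; apply: (bound_p (f := fun x => (x - m) * g x)) => //; lra.
rewrite !Rint_normal//; last exact: measurable_funM.
have gp x : `|g x * p x| <= normal_peak s * (`|g m| + C + C * (4 * s ^+ 2)) * q x.
  by apply: bound_p => //; lra.
have q_even x : q (m - x) = q (m + x).
  by rewrite /q addrAC subrr add0r sqrrN addrAC subrr add0r.
have h : \int[leb]_x (g' x * p x - ((x - m) * g x) * p x * (s ^+ 2)^-1) = 0.
  apply: (@Rintegral_derivative0 _ (fun x => g x * p x) _ m).
  - move=> x; have := is_deriveM (hd x) (is_derive_p x).
    congr (is_derive _ _ _ _).
    by rewrite /GRing.scale/=; field.
  - have cp : continuous p by exact: is_derive_continuous is_derive_p.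
    move=> x; apply: cvgB; first by apply: cvgM; [exact: cg'|exact: cp].
    apply: cvgMl; apply: cvgM; last exact: cp.
    by apply: cvgM; [apply: cvgB; [exact: cvg_id|exact: cvg_cst]|exact: cg].
  - by apply: rintB => //; exact: rintZr.
  - apply: (@squeeze_cvgr _ _ _ _ (fun n => - (normal_peak s * (`|g m| + C + C * (4 * s ^+ 2)) * q (m + n%:R)))
      (fun n => normal_peak s * (`|g m| + C + C * (4 * s ^+ 2)) * q (m + n%:R))).
    + by apply: nearW => n; have := gp (m + n%:R); rewrite ler_norml.
    + by rewrite -[X in _ --> X]oppr0; apply: cvgN; rewrite -[X in _ --> X](mulr0 (normal_peak s * (`|g m| + C + C * (4 * s ^+ 2)))); apply: cvgMr.
    + by rewrite -[X in _ --> X](mulr0 (normal_peak s * (`|g m| + C + C * (4 * s ^+ 2)))); apply: cvgMr.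
  - apply: (@squeeze_cvgr _ _ _ _ (fun n => - (normal_peak s * (`|g m| + C + C * (4 * s ^+ 2)) * q (m + n%:R)))
      (fun n => normal_peak s * (`|g m| + C + C * (4 * s ^+ 2)) * q (m + n%:R))).
    + by apply: nearW => n; have := gp (m - n%:R); rewrite q_even ler_norml.
    + by rewrite -[X in _ --> X]oppr0; apply: cvgN; rewrite -[X in _ --> X](mulr0 (normal_peak s * (`|g m| + C + C * (4 * s ^+ 2)))); apply: cvgMr.
    + by rewrite -[X in _ --> X](mulr0 (normal_peak s * (`|g m| + C + C * (4 * s ^+ 2)))); apply: cvgMr.
move: h; rewrite RintB//; last exact: rintZr.
rewrite RintZr// => /eqP; rewrite subr_eq0 => /eqP ->; field => //.
Qed.

Lemma rint_normal_id : rint gam (fun x => x - m).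
Proof.
apply: (@rint_normal_quad _ 1 1) => //; first by apply: measurable_funB.
move=> x; rewrite -(ger0_norm (sqr_ge0 (x - m))) normrX; set a := `|_|.
have : 0 <= (a - 1) ^+ 2 by exact: sqr_ge0.
have : 0 <= a by rewrite normr_ge0.
nra.
Qed.

Lemma rint_normal_sq : rint gam (fun x => (x - m) ^+ 2).
Proof.
apply: (@rint_normal_quad _ 0 1) => //; first by apply: measurable_funX; apply: measurable_funB.
by move=> x; rewrite add0r mul1r ger0_norm ?sqr_ge0.
Qed.

Lemma normal_mean : \int[gam]_x (x - m) = 0.
Proof.
have E : \int[gam]_x ((x - m) * 1) = s ^+ 2 * \int[gam]_x (0 : R).
  apply: (@normal_ibp (fun=> 1) (fun=> 0) 0) => x.
  - exact: cvg_cst.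
  - by rewrite normr0.
rewrite Rint_cst mulr0 in E; rewrite -[RHS]E.
by apply: Rint_eq => x; rewrite mulr1.
Qed.

Lemma normal_second_moment : \int[gam]_x ((x - m) ^+ 2) = s ^+ 2.
Proof.
have E : \int[gam]_x ((x - m) * (x - m)) = s ^+ 2 * \int[gam]_x (1 : R).
  apply: (@normal_ibp (fun x => x - m) (fun=> 1) 1) => x.
  - by apply: is_derive_eq; rewrite subr0.
  - exact: cvg_cst.
  - by rewrite normr1.
rewrite Rint_cst mulr1 in E; rewrite -[RHS]E.
by apply: Rint_eq => x; rewrite expr2.
Qed.

End normal_law.

(** As a function of the frequency [xi], the expectation [c] solves [c' = - s ^+ 2 xi c] by Stein's
    identity, so [k], which is [c] times [expR (s ^+ 2 xi ^+ 2 / 2)], is constant; its values at 0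
    and 1 are compared. The phase [th] takes the place of the imaginary part of the characteristic
    function. *)
Lemma normal_cos {R : realType} (s th : R) : s != 0 ->
  \int[normal_prob 0 s]_x cos (x + th) = cos th * expR (- (s ^+ 2 / 2)).
Proof.
move=> s0; set gam := normal_prob 0 s.
pose c (xi : R) := \int[gam]_x cos (xi * x + th).
have mlin xi : measurable_fun setT (fun x : R => xi * x + th).
  by apply: measurable_funD => //; apply: measurable_funM.
have mc xi : measurable_fun setT (fun x : R => cos (xi * x + th)).
  by apply: measurableT_comp (mlin xi); apply: continuous_measurable; exact: continuous_cos.
have ms xi : measurable_fun setT (fun x : R => sin (xi * x + th)).
  by apply: measurableT_comp (mlin xi); apply: continuous_measurable; exact: continuous_sin.
have cos1 (y : R) : `|cos y| <= 1 by rewrite ler_norml cos_geN1 cos_le1.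
have sin1 (y : R) : `|sin y| <= 1 by rewrite ler_norml sin_geN1 sin_le1.
have rid : rint gam (fun x : R => `|x|).
  by have := rint_abs (rint_normal_id 0 s0); congr (rint _ _); apply/funext => x; rewrite subr0.
have dc xi : is_derive xi (1 : R) c (- (s ^+ 2 * xi) * c xi).
  have -> : - (s ^+ 2 * xi) * c xi = \int[gam]_x (- (x * sin (xi * x + th))).
    have i1 : \int[gam]_x ((x - 0) * - sin (xi * x + th)) =
        s ^+ 2 * \int[gam]_x (- xi * cos (xi * x + th)).
      apply: (@normal_ibp _ _ _ _ _ _ `|xi|) => //.
      - by move=> x; apply: is_derive_eq; rewrite /GRing.scale/=; ring.
      - move=> x; apply: cvgMr; apply: continuous_comp; last exact: continuous_cos.
        by apply: cvgD; [apply: cvgMr; exact: cvg_id|exact: cvg_cst].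
      - by move=> x; rewrite normrM normrN ler_piMr.
    rewrite RintZ in i1; last by apply: (@rint_bounded _ _ _ _ 1); [exact: mc|].
    rewrite -/(c xi) in i1.
    transitivity (s ^+ 2 * (- xi * c xi)); first by ring.
    by rewrite -i1; apply: Rint_eq => x; ring.
  apply: (is_derive_integral (P := normal_prob 0 s) (f := fun xi x => cos (xi * x + th))
    (f' := fun xi x => - (x * sin (xi * x + th))) (g := fun x : R => `|x|)) => //.
  - by move=> xi'; apply: (@rint_bounded _ _ _ _ 1); [exact: mc|].
  - by move=> xi' x; apply: is_derive_eq; rewrite /GRing.scale/=; ring.
  - by move=> xi' x _; rewrite normrN normrM ler_piMr.
pose k (xi : R) := c xi * expR (s ^+ 2 * xi ^+ 2 / 2).
have dk (xi : R) : is_derive xi (1 : R) k 0.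
  by apply: is_derive_eq; rewrite /GRing.scale/=; field.
have := is_derive_0_is_cst 1 0 dk.
rewrite /k /c expr0n/= mulr0 mul0r expR0 mulr1.
under [X in _ = X]Rint_eq do rewrite mul0r add0r.
rewrite Rint_cst => <-; rewrite expr1n mulr1 -mulrA -expRD subrr expR0 mulr1.
by apply: Rint_eq => x; rewrite mul1r.
Qed.

(** * Independence of uncorrelated Gaussian variables *)

Lemma cvg_to_eq {R : realType} {T : Type} {F : set_system T} (f : T -> R) (l l' : R) :
  l = l' -> f x @[x --> F] --> l -> f x @[x --> F] --> l'.
Proof. by move=> ->. Qed.

Lemma sinc_cvg {R : realType} (z : R) :
  (k.+1%:R * sin (z / k.+1%:R)) @[k --> \oo] --> z.
Proof.
have ds : is_derive (0 : R) 1 sin (cos 0) by exact: is_derive_sin.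
have [g [gE gc g0]] := (is_derive1_caratheodory sin 0 (cos 0)).1 ds.
have E k : k.+1%:R * sin (z / k.+1%:R) = g (z / k.+1%:R) * z.
  have := gE (z / k.+1%:R); rewrite sin0 !subr0 => ->.
  have k0 : k.+1%:R != 0 :> R by rewrite pnatr_eq0.
  by field.
under eq_fun do rewrite E.
apply: (@cvg_to_eq _ _ _ _ (g 0 * z)); first by rewrite g0 cos0 mul1r.
apply: cvgMl.
have c : (fun k : nat => z / k.+1%:R) @ \oo --> (0 : R).
  apply: (@cvg_to_eq _ _ _ _ (z * 0)); first by rewrite mulr0.
  apply: cvgMr; exact: cvg_harmonic.
exact: (cvg_comp _ _ c gc).
Qed.

(** A smooth approximation of the indicator of [y < 0]. The outer factor [n] decides the boundary
    case: without it the value at [y = 0] would be [expR (- 1)] instead of tending to 0. *)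
Lemma expN_exp_cvg {R : realType} (y : R) :
  expR (- (n%:R * expR (n%:R * y))) @[n --> \oo] --> ((y < 0)%R%:R : R).
Proof.
have [y0|y0] := ltP y 0.
  have c : (n%:R * expR (n%:R * y)) @[n --> \oo] --> (0 : R).
    apply/cvgrPdist_lt => e e0; near=> n.
    rewrite sub0r normrN ger0_norm ?mulr_ge0 ?expR_ge0//.
    have n0 : 2 / (y ^+ 2 * e) < n%:R by near: n; exact: nbhs_infty_gtr.
    have n1 : (1 <= n)%N by near: n; exists 1%N.
    have n2 : (1 : R) <= n%:R by rewrite ler1n.
    have y2 : 0 < y ^+ 2 by rewrite exprn_even_gt0//= lt_eqF.
    have -> : n%:R * y = - (n%:R * - y) by ring.
    rewrite expRN ltr_pdivrMr ?expR_gt0//.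
    have h : (n%:R * - y) ^+ 2 / 2 <= expR (n%:R * - y).
      have h0 : 0 <= n%:R * - y by rewrite mulr_ge0// oppr_ge0 ltW.
      have h1 : 1 + (n%:R * - y) ^+ 2 / 2 <= expR (n%:R * - y) := expR_ge1Dxn 1 h0.
      by lra.
    apply: lt_le_trans (ler_wpM2l (ltW e0) h).
    have -> : e * ((n%:R * - y) ^+ 2 / 2) = n%:R * (n%:R * (y ^+ 2 * e) / 2) by field.
    rewrite -[ltLHS]mulr1 ltr_pM2l; last lra.
    move: n0; rewrite ltr_pdivrMr; last by rewrite mulr_gt0.
    lra.
  apply: (@cvg_to_eq _ _ _ _ (expR (- 0))); first by rewrite oppr0 expR0.
  apply: continuous_cvg; first exact: continuous_expR.
  exact: cvgN.
apply/cvgrPdist_lt => e e0; near=> n.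
rewrite sub0r normrN ger0_norm ?expR_ge0// expRN.
have n0 : e^-1 < n%:R by near: n; exact: nbhs_infty_gtr.
rewrite invf_plt ?posrE ?expR_gt0//.
apply: (lt_le_trans n0); apply: le_trans (expR_ge1Dx _).
have h1 : 1 <= expR (n%:R * y) by rewrite -[leLHS]expR0 ler_expR mulr_ge0.
have : 0 <= n%:R :> R by [].
nra.
Unshelve. all: by end_near. Qed.

Section trigonometric_determination.
Context d (T : measurableType d) (R : realType) (P : probability T R).
Variables (zeta : T -> R) (n : nat) (Z : nat -> T -> R).
Hypothesis mzeta : measurable_fun setT zeta.
Hypothesis bzeta : forall w, `|zeta w| <= 2.
Hypothesis mZ : forall i, measurable_fun setT (Z i).

Definition lincomb (c : nat -> R) (w : T) : R := \sum_(i < n) c i * Z i w.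

Hypothesis ztrig : forall c th, \int[P]_w (zeta w * cos (lincomb c w + th)) = 0.

Definition mbdd (h : T -> R) :=
  measurable_fun setT h /\ exists C, forall w, `|h w| <= C.

(** All frequencies [c] and phases [th] belong to the definition, so that product-to-sum formulas do
    not leave the class. *)
Let Q (h : T -> R) := mbdd h /\
  forall c th, \int[P]_w (zeta w * h w * cos (lincomb c w + th)) = 0.

(** Multipliers of [Q]. Unlike [Q] they are visibly closed under products, so they form an algebra
    closed under bounded pointwise limits, inside which the indicators of rays are reached. *)
Let Mul (e : T -> R) := mbdd e /\ forall h, Q h -> Q (fun w => h w * e w).

Let mlincomb c : measurable_fun setT (lincomb c).
Proof. by apply: measurable_sum => i; apply: measurable_funM. Qed.

Lemma mcos (f : T -> R) : measurable_fun setT f -> measurable_fun setT (fun w => cos (f w)).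
Proof. by move=> mf; apply: measurableT_comp mf; apply: continuous_measurable; exact: continuous_cos. Qed.

Lemma cos_norm_le1 (x : R) : `|cos x| <= 1.
Proof. by rewrite ler_norml cos_geN1 cos_le1. Qed.

Lemma mbddM f g : mbdd f -> mbdd g -> mbdd (fun w => f w * g w).
Proof.
move=> [mf [C hC]] [mg [D hD]]; split; first exact: measurable_funM.
by exists (C * D) => w; rewrite normrM ler_pM.
Qed.

Lemma mbddD f g : mbdd f -> mbdd g -> mbdd (fun w => f w + g w).
Proof.
move=> [mf [C hC]] [mg [D hD]]; split; first exact: measurable_funD.
by exists (C + D) => w; apply: le_trans (ler_normD _ _) _; rewrite lerD.
Qed.

Lemma mbdd_cst r : mbdd (fun=> r).
Proof. by split => //; exists `|r|. Qed.

Lemma rint_mbdd f : mbdd f -> rint P f.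
Proof. by move=> [mf [C hC]]; exact: rint_bounded hC. Qed.

Let rintQ h c th : mbdd h -> rint P (fun w => zeta w * h w * cos (lincomb c w + th)).
Proof.
move=> bh; apply: rint_mbdd; apply: mbddM.
  by apply: mbddM => //; split => //; exists 2.
split; last by exists 1 => w; exact: cos_norm_le1.
by apply: mcos; apply: measurable_funD.
Qed.

Let QD h1 h2 : Q h1 -> Q h2 -> Q (fun w => h1 w + h2 w).
Proof.
move=> [b1 q1] [b2 q2]; split; first exact: mbddD.
move=> c th; rewrite -[RHS]addr0 -[X in _ = X + _](q1 c th) -[X in _ = _ + X](q2 c th).
by rewrite -RintD; [apply: Rint_eq => w; ring|exact: rintQ..].
Qed.

Let QZ r h : Q h -> Q (fun w => r * h w).
Proof.
move=> [b q]; split; first by apply: mbddM => //; exact: mbdd_cst.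
move=> c th; rewrite -[RHS](mulr0 r) -[X in _ = _ * X](q c th) -RintZ; last exact: rintQ.
by apply: Rint_eq => w; ring.
Qed.

Let Qlim (h_ : nat -> T -> R) h (C : R) : (forall k, Q (h_ k)) ->
  (forall w, h_ k w @[k --> \oo] --> h w) -> (forall k w, `|h_ k w| <= C) -> Q h.
Proof.
move=> qh ch bh.
have mh : measurable_fun setT h.
  by apply: (measurable_fun_cvg (h := h_)) => [k|w _]; [case: (qh k) => -[]|exact: ch].
have bh' w : `|h w| <= C.
  have c1 : `|h_ k w| @[k --> \oo] --> `|h w| by apply: cvg_norm; exact: ch.
  rewrite -(cvg_lim (@Rhausdorff R) c1); apply: limr_le; first by apply/cvg_ex; exists `|h w|.
  by apply: nearW => k.
have bdh : mbdd h by split => //; exists C.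
split => // c th.
have c1 : (\int[P]_w (zeta w * h_ k w * cos (lincomb c w + th))) @[k --> \oo] -->
    \int[P]_w (zeta w * h w * cos (lincomb c w + th)).
  apply: (Rint_dominated (mu := P) (g := fun=> 2 * C * 1)).
  - by move=> k; apply: rint_measurable; apply: rintQ; case: (qh k).
  - by apply: rint_measurable; exact: rintQ.
  - apply: aeW => w; apply: cvgMl; apply: cvgMr; exact: ch.
  - exact: rint_cst.
  - move=> k w; rewrite !normrM; apply: ler_pM => //; last exact: cos_norm_le1.
    by apply: ler_pM.
rewrite -(cvg_lim (@Rhausdorff R) c1).
under eq_fun do rewrite (qh _).2.
exact: lim_cst.
Qed.

Let MulD e1 e2 : Mul e1 -> Mul e2 -> Mul (fun w => e1 w + e2 w).
Proof.
move=> [b1 m1] [b2 m2]; split; first exact: mbddD.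
move=> h qh; have := QD (m1 h qh) (m2 h qh); congr Q.
by apply/funext => w; ring.
Qed.

Let MulZ r e : Mul e -> Mul (fun w => r * e w).
Proof.
move=> [b m]; split; first by apply: mbddM => //; exact: mbdd_cst.
by move=> h qh; have := QZ r (m h qh); congr Q; apply/funext => w; ring.
Qed.

Let MulM e1 e2 : Mul e1 -> Mul e2 -> Mul (fun w => e1 w * e2 w).
Proof.
move=> [b1 m1] [b2 m2]; split; first exact: mbddM.
by move=> h qh; have := m2 _ (m1 h qh); congr Q; apply/funext => w; ring.
Qed.

Let Mul_cst r : Mul (fun=> r).
Proof.
split; first exact: mbdd_cst.
by move=> h qh; have := QZ r qh; congr Q; apply/funext => w; ring.
Qed.

Let Mul_lim (e_ : nat -> T -> R) e (C : R) : (forall k, Mul (e_ k)) ->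
  (forall w, e_ k w @[k --> \oo] --> e w) -> (forall k w, `|e_ k w| <= C) -> Mul e.
Proof.
move=> qe ce be.
have me : measurable_fun setT e.
  by apply: (measurable_fun_cvg (h := e_)) => [k|w _]; [by case: (qe k) => -[]|exact: ce].
have be' w : `|e w| <= C.
  have c1 : `|e_ k w| @[k --> \oo] --> `|e w| by apply: cvg_norm; exact: ce.
  rewrite -(cvg_lim (@Rhausdorff R) c1); apply: limr_le; first by apply/cvg_ex; exists `|e w|.
  by apply: nearW => k.
split; first by split => //; exists C.
move=> h qh; have [[mh [D hD]] _] := qh.
apply: (@Qlim (fun k w => h w * e_ k w) _ (D * C)).
- by move=> k; exact: (qe k).2.
- by move=> w; apply: cvgMr; exact: ce.
- by move=> k w; rewrite normrM ler_pM.
Qed.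

Let Mul_exp e : Mul e -> Mul (fun w => expR (e w)).
Proof.
move=> me; have [[mea [C hC]] _] := me.
apply: (@Mul_lim (fun k w => \sum_(0 <= i < k) (i`!%:R)^-1 * e w ^+ i) _ (expR C)).
- move=> k; rewrite /index_iota; elim: (iota _ _) => [|i l ih].
    by under eq_fun do rewrite big_nil; exact: Mul_cst.
  under eq_fun do rewrite big_cons; apply: MulD => //; apply: MulZ.
  elim: i => [|i ihi]; first by under eq_fun do rewrite expr0; exact: Mul_cst.
  by under eq_fun do rewrite exprS; exact: MulM.
- move=> w; have := is_cvg_series_exp_coeff (e w); rewrite -/(expR (e w)).
  suff -> : series (exp_coeff (e w)) = (fun k => \sum_(0 <= i < k) i`!%:R^-1 * e w ^+ i) by [].
  apply/funext => k; apply: eq_bigr => i _.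
  by rewrite /exp_coeff/= mulrC.
- move=> k w; apply: le_trans (ler_norm_sum _ _ _) _.
  apply: le_trans (_ : expR `|e w| <= _); last by rewrite ler_expR.
  rewrite /expR; apply: le_trans (nondecreasing_cvgn_le _ (is_cvg_series_exp_coeff `|e w|) k).
    rewrite /series/= /exp_coeff/=; apply: ler_sum => i _.
    rewrite normrM normrX normfV. by rewrite (ger0_norm (ler0n _ _)) mulrC.
  apply/nondecreasing_seqP => j; rewrite /series/= big_nat_recr//= lerDl.
  by rewrite /exp_coeff/= divr_ge0// exprn_ge0.
Qed.

(** Product-to-sum: multiplying by this cosine averages two cosines whose frequency vectors are [c]
    with [b] or [- b] added in coordinate [j]. *)
Let Mul_cosZ (j : nat) (b th0 : R) : (j < n)%N -> Mul (fun w => cos (b * Z j w + th0)).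
Proof.
move=> jn; split.
  split; last by exists 1 => w; exact: cos_norm_le1.
  by apply: mcos; apply: measurable_funD => //; apply: measurable_funM.
move=> h [bh qh]; split.
  apply: mbddM => //; split; last by exists 1 => w; exact: cos_norm_le1.
  by apply: mcos; apply: measurable_funD => //; apply: measurable_funM.
move=> c th.
pose cc (r : R) i := c i + (i == j)%:R * r.
have lE r w : lincomb (cc r) w = lincomb c w + r * Z j w.
  rewrite /lincomb /cc.
  under eq_bigr do rewrite mulrDl.
  rewrite big_split/=; congr (_ + _).
  rewrite (bigD1 (Ordinal jn))//= eqxx mul1r big1 ?addr0// => i ij.
  have -> : (nat_of_ord i == j) = false by apply: contraNF ij => /eqP ij; apply/eqP/val_inj.
  by rewrite !mul0r.
have -> : 0 = 2^-1 * 0 + 2^-1 * 0 :> R by ring.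
rewrite -[X in _ = _ * X + _](qh (cc b) (th + th0)) -[X in _ = _ + _ * X](qh (cc (- b)) (th - th0)).
rewrite -!RintZ; [|exact: rintQ..].
rewrite -RintD; [|by apply: rintZ; exact: rintQ..].
apply: Rint_eq => w; rewrite !lE.
have -> : lincomb c w + b * Z j w + (th + th0) = (lincomb c w + th) + (b * Z j w + th0) by ring.
have -> : lincomb c w + - b * Z j w + (th - th0) = (lincomb c w + th) - (b * Z j w + th0) by ring.
move: (lincomb c w + th) (b * Z j w + th0) => A B.
by rewrite cosD cosB; field.
Qed.

(** Only bounded functions are multipliers, so [Z j] enters as the limit of [k sin (Z j / k)], where
    the sine is a cosine with phase [- pi / 2]. Two exponentials then build the approximation of
    [expN_exp_cvg]. *)
Let Mul_ray (j : nat) (a : R) : (j < n)%N -> Mul (fun w => (Z j w < a)%R%:R).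
Proof.
move=> jn.
have step (i : nat) : Mul (fun w => expR (- (i%:R * expR (i%:R * (Z j w - a))))).
  apply: (@Mul_lim (fun k w => expR (- (i%:R * expR (i%:R * (k.+1%:R * sin (Z j w / k.+1%:R) - a))))) _ 1).
  - move=> k; apply: Mul_exp.
    suff : Mul (fun w => - i%:R * expR (i%:R * (k.+1%:R * sin (Z j w / k.+1%:R) - a))).
      by congr Mul; apply/funext => w; ring.
    apply: MulZ; apply: Mul_exp; apply: MulZ.
    apply: (@MulD _ (fun=> - a)); last exact: Mul_cst.
    apply: MulZ.
    have := @Mul_cosZ j k.+1%:R^-1 (- (pi / 2)) jn; congr Mul.
    apply/funext => w; rewrite cosBpihalf mulrC.
    done.
  - move=> w; apply: continuous_cvg; first exact: continuous_expR.
    apply: cvgN; apply: cvgMr; apply: continuous_cvg; first exact: continuous_expR.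
    apply: cvgMr; apply: cvgB; last exact: cvg_cst.
    exact: sinc_cvg.
  - move=> k w; rewrite ger0_norm ?expR_ge0// -[leRHS]expR0 ler_expR oppr_le0 ?mulr_ge0 ?expR_ge0.
apply: (@Mul_lim (fun i w => expR (- (i%:R * expR (i%:R * (Z j w - a))))) _ 1).
- by [].
- by move=> w; rewrite -subr_lt0; exact: expN_exp_cvg.
- move=> k w; rewrite ger0_norm ?expR_ge0// -[leRHS]expR0 ler_expR oppr_le0 ?mulr_ge0 ?expR_ge0.
Qed.

Lemma trig_determines_rays (l : seq (nat * R)) : all (fun p => p.1 < n)%N l ->
  \int[P]_w (zeta w * (all (fun p => Z p.1 w < p.2)%R l)%:R) = 0.
Proof.
move=> ln.
have [_ /(_ (fun=> 1))] : Mul (fun w => (all (fun p => Z p.1 w < p.2)%R l)%:R).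
  elim: l ln => [_|[j a] l ih /= /andP[jn /ih{}ih]]; first exact: Mul_cst.
  have := MulM (Mul_ray a jn) ih; congr Mul; apply/funext => w.
  by rewrite -natrM mulnb.
case.
  split; first exact: mbdd_cst.
  by move=> c th; under Rint_eq do rewrite mulr1; exact: ztrig.
move=> _ /(_ (fun=> 0) 0) <-; apply: Rint_eq => w.
rewrite /lincomb big1; last by move=> i _; rewrite mul0r.
by rewrite addr0 cos0 mulr1 mul1r.
Qed.

End trigonometric_determination.

Section mfun_packing.
Context d d' (T : measurableType d) (T' : measurableType d') (f : T -> T').
Hypothesis mf : measurable_fun setT f.
Let mf_mixin := isMeasurableFun.Build _ _ _ _ _ mf.
Definition mfun_of : {mfun T >-> T'} := HB.pack f mf_mixin.
End mfun_packing.

Notation pushm := measure_function_pushforward__canonical__measure_function_Measure.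

Section trigonometric_independence.
Context d (T : measurableType d) (R : realType) (P : probability T R).
Variables (n : nat) (Z : nat -> T -> R) (W : T -> R).
Hypothesis mZ : forall i, measurable_fun setT (Z i).
Hypothesis mW : measurable_fun setT W.
Hypothesis hind : forall c xi th th',
  \int[P]_w (cos (xi * W w + th') * cos (lincomb n Z c w + th)) =
  \int[P]_w cos (xi * W w + th') * \int[P]_w cos (lincomb n Z c w + th).

Let mlc c : measurable_fun setT (lincomb n Z c).
Proof. by apply: measurable_sum => i; apply: measurable_funM. Qed.

Let bcos (f : T -> R) : measurable_fun setT f -> mbdd (fun w => cos (f w)).
Proof. by move=> mf; split; [exact: mcos|exists 1 => w; exact: cos_norm_le1]. Qed.

Let mray b : mbdd (fun w => (W w < b)%R%:R : R).
Proof.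
split; last by exists 1 => w; case: (_ < _)%R; rewrite ?normr1 ?normr0.
have := @measurable_indic _ T R setT (W @^-1` `]-oo, b[).
have mE : measurable (W @^-1` `]-oo, b[) by rewrite -[X in measurable X]setTI; exact: mW.
move/(_ mE); congr (measurable_fun _ _); apply/funext => w.
by rewrite indicE; congr (nat_of_bool _)%:R; apply/idP/idP; rewrite inE/= in_itv.
Qed.

(** The determination result for the one-element family [W], with [zeta] the centred cosine of the
    [Z i]: cosines of [W] are exchanged for rays. [trig_indep_rays] does the same on the side of the
    [Z i]. *)
Let ray_cos b c th :
  \int[P]_w ((W w < b)%R%:R * cos (lincomb n Z c w + th)) =
  \int[P]_w (W w < b)%R%:R * \int[P]_w cos (lincomb n Z c w + th).
Proof.
set Ec := \int[P]_w cos (lincomb n Z c w + th).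
have bc : mbdd (fun w => cos (lincomb n Z c w + th)) by apply: bcos; apply: measurable_funD.
have Ec1 : `|Ec| <= 1.
  by apply: Rint_abs_leC; [case: bc|move=> w; exact: cos_norm_le1].
pose zeta w := cos (lincomb n Z c w + th) - Ec.
have mz : measurable_fun setT zeta by apply: measurable_funB => //; case: bc.
have := @trig_determines_rays _ _ _ P zeta 1 (fun=> W) mz _ (fun=> mW) _ [:: (0%N, b)] isT.
move=> h.
have {}h : \int[P]_w (zeta w * (W w < b)%R%:R) = 0.
  rewrite -[RHS]h.
  - by apply: Rint_eq => w /=; rewrite andbT.
  - move=> w; rewrite /zeta; apply: le_trans (ler_normB _ _) _.
    have := cos_norm_le1 (lincomb n Z c w + th); lra.
  - move=> c' th'.
    have bW : mbdd (fun w => cos (c' 0%N * W w + th')).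
      by apply: bcos; apply: measurable_funD => //; apply: measurable_funM.
    transitivity (\int[P]_w (cos (c' 0%N * W w + th') * cos (lincomb n Z c w + th) - Ec * cos (c' 0%N * W w + th'))).
      by apply: Rint_eq => w; rewrite /zeta /lincomb big_ord1; ring.
    rewrite RintB; [|exact/rint_mbdd/mbddM|by apply: rintZ; exact: rint_mbdd].
    rewrite RintZ; last exact: rint_mbdd.
    by rewrite hind -/Ec; ring.
move: h; rewrite /zeta.
under Rint_eq do rewrite mulrBl.
rewrite RintB; [|by apply/rint_mbdd/mbddM; [exact: bc|exact: mray]|by apply: rintZ; exact: rint_mbdd].
rewrite RintZ; last exact: rint_mbdd.
move/eqP; rewrite subr_eq0 => /eqP; rewrite mulrC => <-.
by apply: Rint_eq => w; rewrite mulrC.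
Qed.

(** A pi-system generating the sigma-algebra of the first [n] variables; lists may repeat an index,
    so intersection is concatenation and the empty list gives the whole space. *)
Definition rays : set (set T) :=
  [set A | exists2 l : seq (nat * R), all (fun p => p.1 < n)%N l &
     A = [set w | all (fun p => Z p.1 w < p.2)%R l]].

Lemma rays_setI : setI_closed rays.
Proof.
move=> _ _ [l1 h1 ->] [l2 h2 ->]; exists (l1 ++ l2); first by rewrite all_cat h1.
by apply/seteqP; split => w /=; rewrite all_cat => /andP.
Qed.

Lemma rays_setT : rays setT.
Proof. by exists [::] => //; apply/seteqP; split. Qed.

Let mrayset j a : measurable [set w | (Z j w < a)%R].
Proof.
have -> : [set w | (Z j w < a)%R] = setT `&` Z j @^-1` `]-oo, a[.
  by rewrite setTI; apply/seteqP; split => w /=; rewrite in_itv.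
exact: mZ.
Qed.

Lemma rays_measurable : rays `<=` measurable.
Proof.
move=> _ [l _ ->]; elim: l => [|[j a] l ih].
  by rewrite (_ : [set _ | _] = setT)//; apply/seteqP; split.
rewrite (_ : [set w | _] = [set w | (Z j w < a)%R] `&`
   [set w | all (fun p => Z p.1 w < p.2)%R l]); first exact: measurableI.
by apply/seteqP; split => w /= /andP.
Qed.

Lemma Rint_indic (A : set T) : measurable A -> \int[P]_w (\1_A w) = fine (P A).
Proof. by move=> mA; rewrite /Rintegral integral_indic// setIT. Qed.

Lemma finePK (A : set T) : measurable A -> (fine (P A))%:E = P A.
Proof. by move=> mA; rewrite fineK// fin_num_measure. Qed.

Lemma trig_indep_rays A b : rays A ->
  P (A `&` W @^-1` `]-oo, b[) = (P A * P (W @^-1` `]-oo, b[))%E.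
Proof.
move=> rA; have mA := rays_measurable rA.
have mWb : measurable (W @^-1` `]-oo, b[) by rewrite -[X in measurable X]setTI; exact: mW.
case: rA => l hl AE.
have iA w : \1_A w = (all (fun p => Z p.1 w < p.2)%R l)%:R :> R.
  by rewrite indicE; congr (nat_of_bool _)%:R; apply/idP/idP; rewrite inE AE.
have iW w : \1_(W @^-1` `]-oo, b[) w = (W w < b)%R%:R :> R.
  by rewrite indicE; congr (nat_of_bool _)%:R; apply/idP/idP; rewrite inE/= in_itv.
have mI : measurable (A `&` W @^-1` `]-oo, b[) by exact: measurableI.
rewrite -(finePK mA) -(finePK mWb) -(finePK mI) -EFinM; congr EFin.
rewrite -!Rint_indic//.
set q := \int[P]_w \1_(W @^-1` `]-oo, b[) w.
have q1 : `|q| <= 1.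
  apply: Rint_abs_leC; first exact: measurable_indic.
  by move=> w; rewrite indicE; case: (_ \in _); rewrite ?normr1 ?normr0.
pose zeta w := (W w < b)%R%:R - q.
have mz : mbdd zeta by have := mbddD (mray b) (mbdd_cst T (- q)).
have := @trig_determines_rays _ _ _ P zeta n Z mz.1 _ mZ _ l hl.
move=> h.
have {}h : \int[P]_w (zeta w * \1_A w) = 0.
  rewrite -[RHS]h.
  - by apply: Rint_eq => w; rewrite iA.
  - move=> w; rewrite /zeta; apply: le_trans (ler_normB _ _) _.
    have : `|(W w < b)%R%:R| <= 1 :> R by case: (_ < _)%R; rewrite ?normr1 ?normr0.
    lra.
  - move=> c th; rewrite /zeta.
    have bc : mbdd (fun w => cos (lincomb n Z c w + th)) by apply: bcos; apply: measurable_funD.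
    under Rint_eq do rewrite mulrBl.
    rewrite RintB; [|exact/rint_mbdd/mbddM|by apply: rintZ; exact: rint_mbdd].
    rewrite RintZ; last exact: rint_mbdd.
    rewrite ray_cos -mulrBl -[X in (X - _) * _](@Rint_eq _ _ _ P (\1_(W @^-1` `]-oo, b[))).
      by rewrite subrr mul0r.
    by move=> w; rewrite iW.
have bA : mbdd (\1_A : T -> R).
  split; first exact: measurable_indic.
  by exists 1 => w; rewrite indicE; case: (_ \in _); rewrite ?normr1 ?normr0.
move: h; rewrite /zeta; under Rint_eq do rewrite mulrBl.
rewrite RintB; [|exact/rint_mbdd/mbddM|by apply: rintZ; exact: rint_mbdd].
rewrite RintZ; last exact: rint_mbdd.
move/eqP; rewrite subr_eq0 => /eqP; rewrite mulrC => <-.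
apply: Rint_eq => w; rewrite -iW !indicE -natrM mulnb in_setI andbC; congr _%:R.
Qed.

(** Uniqueness of measures twice: in [A] with a ray of [W] fixed, then in [B] with [A] fixed. Each
    time a restricted measure is compared with a multiple of the full one on a generating
    pi-system. *)
Lemma trig_indep A B : <<s rays >> A -> measurable B ->
  P (A `&` W @^-1` B) = (P A * P (W @^-1` B))%E.
Proof.
have mWB (C : set R) : measurable C -> measurable (W @^-1` C).
  by move=> mC; rewrite -[X in measurable X]setTI; exact: mW.
have step b A' : <<s rays >> A' -> P (A' `&` W @^-1` `]-oo, b[) = (P A' * P (W @^-1` `]-oo, b[))%E.
  have mb : measurable (W @^-1` `]-oo, b[) by exact: mWB.
  have q0 : 0 <= fine (P (W @^-1` `]-oo, b[)) by exact: fine_ge0.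
  move=> sA; have mA' := smallest_sub (@sigma_algebra_measurable _ T) rays_measurable sA.
  have cov : \bigcup_(k in [set: nat]) [set: T] = setT by apply: bigcup_const; exists 0%N.
  have := @g_sigma_algebra_measure_unique _ R T rays rays_measurable (fun=> setT)
    (fun=> rays_setT) cov (mrestr P mb) (mscale (NngNum q0) P) rays_setI.
  move=> hu.
  have -> : P (A' `&` W @^-1` `]-oo, b[) = ((fine (P (W @^-1` `]-oo, b[)))%:E * P A')%E.
    apply: hu => //.
    + move=> A0 rA0.
      change (P (A0 `&` W @^-1` `]-oo, b[) = (fine (P (W @^-1` `]-oo, b[)))%:E * P A0)%E.
      by rewrite trig_indep_rays// finePK// muleC.
    + by move=> _; rewrite ltey_eq fin_num_measure.
  by rewrite finePK// muleC.
move=> sA mB; have mA := smallest_sub (@sigma_algebra_measurable _ T) rays_measurable sA.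
have q0 : 0 <= fine (P A) by exact: fine_ge0.
have Gcover : \bigcup_(k in [set: nat]) `]-oo, k%:R[%classic = [set: R].
  rewrite -subTset => x _ /=; exists (Num.truncn `|x|).+1 => //=; rewrite in_itv/=.
  by apply: le_lt_trans (ler_norm x) _; rewrite truncnS_gt.
have GI : setI_closed (@RGenInftyO.G R).
  move=> _ _ [x ->] [y ->]; exists (Order.min x y).
  apply/seteqP; split => z /=; rewrite !in_itv/= lt_min; first by move=> [-> ->].
  by move=> /andP.
have := @measure_unique _ R R (@RGenInftyO.G R) (fun k => `]-oo, k%:R[%classic) (@RGenInftyO.measurableE R)
   GI _ Gcover (pushm (mrestr P mA) mW) (mscale (NngNum q0) (pushm P mW)).
move=> hu.
have -> : P (A `&` W @^-1` B) = ((fine (P A))%:E * P (W @^-1` B))%E.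
  rewrite setIC; apply: hu => //.
  - by move=> k; exists k%:R.
  - move=> _ [x ->].
    change (P (W @^-1` `]-oo, x[ `&` A) = (fine (P A))%:E * P (W @^-1` `]-oo, x[))%E.
    by rewrite setIC step// finePK.
  - by move=> k; rewrite ltey_eq fin_num_measure//; exact: mWB.
by rewrite finePK.
Qed.

End trigonometric_independence.

(** * Fubini's theorem for a variable independent of a sigma-algebra *)

Section decoupling.
Context d (T : measurableType d) (R : realType) (P : probability T R).
Variables (G : set (set T)) (W : T -> R) (nu : probability R R).
Hypothesis mG : G `<=` measurable.
Hypothesis mW : measurable_fun setT W.
Hypothesis hind : forall A B, <<s G >> A -> measurable B ->
  P (A `&` W @^-1` B) = (P A * nu B)%E.

(** The sample space with the coarse sigma-algebra: a function measurable on [TG * R] sees the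
    sample point only through [G]. This expresses conditioning without conditional expectations. *)
Let TG := g_sigma_algebraType G.

Let sGm A : <<s G >> A -> measurable A.
Proof. exact: (smallest_sub (@sigma_algebra_measurable _ T) mG). Qed.

Let mid : measurable_fun [set: T] (id : T -> TG).
Proof. by move=> _ A mA; rewrite setTI; exact: sGm. Qed.

Lemma measurable_coarsen d' (T' : measurableType d') (f : TG -> T') :
  measurable_fun [set: TG] f -> measurable_fun [set: T] (f : T -> T').
Proof. by move=> mf; exact: measurableT_comp mf mid. Qed.

Let pairW (w : T) : TG * R := (w, W w).

Let mpair : measurable_fun setT pairW.
Proof. exact: measurable_fun_pair mid mW. Qed.

Let PG : probability TG R := distribution P (mfun_of mid).

Let product_law (X : set (TG * R)) : measurable X ->
  (PG \x nu)%E X = pushm P mpair X.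
Proof.
apply: product_measure_unique => A B mA mB.
exact: hind.
Qed.

(* [f] is integrated with the first variable frozen; the hypothesis on [a] and [k] gives Fubini. *)
Lemma decoupling (f : TG * R -> R) (a : TG -> R) (k : R -> R) :
  measurable_fun setT f -> measurable_fun setT a ->
  rint P (a : T -> R) -> rint nu k -> (forall w x, `|f (w, x)| <= a w * k x) ->
  [/\ rint P (fun w => f (w, W w)), rint P (fun w => \int[nu]_x f (w, x) : R) &
  \int[P]_w f (w, W w) = \int[P]_w \int[nu]_x f (w, x)].
Proof.
move=> mf ma ia ik hf.
have mEf : measurable_fun setT (EFin \o f) by exact/measurable_EFinP.
have iaG : rint PG a.
  by apply: (@integrable_pushforward _ _ T TG R id mid P setT (EFin \o a)) => //; exact/measurable_EFinP.
have fi : (PG \x nu)%E.-integrable setT (EFin \o f).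
  apply/(integrable12ltyP PG nu mEf).
  have iak : (PG.-integrable setT (EFin \o (fun w => a w * \int[nu]_x k x))) by exact: rintZr.
  case/integrableP: iak => _; apply: le_lt_trans; apply: ge0_le_integral => //.
  - by move=> w _; apply: integral_ge0.
  - apply: (measurable_fun_fubini_tonelli_F (abse \o (EFin \o f))) => //.
    + exact: measurableT_comp.
    + by move=> x; exact: abse_ge0.
  - apply: measurableT_comp; first exact: abse_measurable.
    by apply/measurable_EFinP; exact: measurable_funM.
  - move=> w _; rewrite /=.
    have mfw : measurable_fun setT (fun x => f (w, x)).
      exact: measurableT_comp mf (pair1_measurable w).
    apply: le_trans (_ : (\int[nu]_x (a w * k x)%:E <= _)%E).
      apply: ge0_le_integral => //.
      + have mE : measurable_fun setT (EFin \o (fun x => f (w, x))) by exact/measurable_EFinP.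
        exact: (measurableT_comp (@abse_measurable R setT) mE).
      + by apply/measurable_EFinP; apply: measurable_funM => //; exact: rint_measurable ik.
      + by move=> x _; rewrite /= lee_fin.
    rewrite rint_EFin; last exact: rintZ.
    by rewrite RintZ// lee_fin ler_norm.
have ppi : (pushm P mpair).-integrable setT (EFin \o f).
  apply/integrableP; split => //; case/integrableP: fi => _; apply: le_lt_trans.
  by rewrite (eq_measure_integral (PG \x nu)%E)// => A mA _; rewrite -product_law.
have i1 : rint P (fun w => f (w, W w)).
  apply/integrableP; split.
    by apply/measurable_EFinP; exact: measurableT_comp mf mpair.
  case/integrableP: ppi => _.
  by rewrite ge0_integral_pushforward//; apply: measurableT_comp.
have E : (fun w => \int[nu]_x (f (w, x))%:E)%E = EFin \o (fun w => \int[nu]_x f (w, x)).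
  apply/funext => w; rewrite /= rint_EFin//.
  apply: (rint_le (g := fun x => a w * k x)) => //; last exact: rintZ.
  exact: measurableT_comp mf (pair1_measurable w).
have mI : measurable_fun [set: TG] (EFin \o (fun w => \int[nu]_x f (w, x))).
  by rewrite -E; apply: measurable_fubini_F fi.
have iI : PG.-integrable setT (EFin \o (fun w => \int[nu]_x f (w, x))).
  by rewrite -E; exact: integrable_fubini_F fi.
have i2 : rint P (fun w => \int[nu]_x f (w, x) : R).
  apply/integrableP; split; first exact: measurable_coarsen mI.
  case/integrableP: iI => _.
  by rewrite (@ge0_integral_pushforward _ _ T TG R id mid P setT)//; apply: measurableT_comp.
split => //.
rewrite /Rintegral -(@integral_pushforward _ _ T (TG * R)%type R pairW mpair P setT (EFin \o f))//.
rewrite (eq_measure_integral (PG \x nu)%E); last by move=> A mA _; rewrite -product_law.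
rewrite -(integral12_prod_meas1 fi) /fubini_F.
congr fine.
by rewrite /= E; apply: (@integral_pushforward _ _ T TG R id mid P setT).
Qed.

End decoupling.

Section gauss_measure.
Context {R : realType}.
Variables (m s : R).

Let mid : measurable_fun [set: measurableTypeR R] (id : measurableTypeR R -> R).
Proof. by move=> _ A mA; rewrite setTI. Qed.

(* [normal_prob] lives on [measurableTypeR R], whose display differs from that of [R]. *)
Definition gauss : probability R R := distribution (normal_prob m s) (mfun_of mid).

Lemma gaussE A : gauss A = normal_prob m s A.
Proof. by []. Qed.

Lemma rint_gauss (f : R -> R) : measurable_fun setT f ->
  rint (normal_prob m s) f -> rint gauss f.
Proof.
move=> mf fi.
by apply: (@integrable_pushforward _ _ (measurableTypeR R) R R id mid (normal_prob m s) setT (EFin \o f)) => //; exact/measurable_EFinP.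
Qed.

Lemma Rint_gauss (f : R -> R) : measurable_fun setT f ->
  rint (normal_prob m s) f -> \int[gauss]_x f x = \int[normal_prob m s]_x f x.
Proof.
move=> mf fi; congr fine.
apply: (@integral_pushforward _ _ (measurableTypeR R) R R id mid (normal_prob m s) setT (EFin \o f)) => //.
exact/measurable_EFinP.
Qed.

Hypothesis s0 : s != 0.

Lemma rint_gauss_id : rint gauss (fun x => x - m).
Proof. by apply: rint_gauss; [exact: measurable_funB|exact: rint_normal_id]. Qed.

Lemma rint_gauss_sq : rint gauss (fun x => (x - m) ^+ 2).
Proof.
by apply: rint_gauss; [apply: measurable_funX; exact: measurable_funB|exact: rint_normal_sq].
Qed.

Lemma gauss_mean : \int[gauss]_x (x - m) = 0.
Proof.
by rewrite Rint_gauss ?normal_mean//; [exact: measurable_funB|exact: rint_normal_id].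
Qed.

Lemma gauss_second_moment : \int[gauss]_x ((x - m) ^+ 2) = s ^+ 2.
Proof.
rewrite Rint_gauss ?normal_second_moment//; last exact: rint_normal_sq.
by apply: measurable_funX; exact: measurable_funB.
Qed.

Lemma gauss_ibp (g g' : R -> R) (C : R) :
  (forall x, is_derive x (1 : R) g (g' x)) -> continuous g' ->
  (forall x, `|g' x| <= C) ->
  rint gauss (fun x => (x - m) * g x) /\
  \int[gauss]_x ((x - m) * g x) = s ^+ 2 * \int[gauss]_x g' x.
Proof.
move=> hd cg' hC.
have C0 : 0 <= C by apply: le_trans (hC 0).
have mg := continuous_measurable (is_derive_continuous hd).
have mg' := continuous_measurable cg'.
have mxg : measurable_fun setT (fun x : R => (x - m) * g x).
  by apply: measurable_funM => //; exact: measurable_funB.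
have ii : rint (normal_prob m s) (fun x => (x - m) * g x).
  apply: (@rint_normal_quad _ _ _ s0 _ `|g m| (`|g m| + C)) => //; first exact: addr_ge0.
  move=> x; rewrite normrM.
  have gb : `|g x| <= `|g m| + C * `|x - m|.
    rewrite -[g x](subrK (g m)) addrC; apply: le_trans (ler_normD _ _) _.
    by rewrite lerD2l; apply: is_derive_MVT hd hC.
  apply: le_trans (ler_wpM2l (normr_ge0 _) gb) _.
  rewrite -(ger0_norm (sqr_ge0 (x - m))) normrX.
  set a := `|x - m|; have a0 : 0 <= a by rewrite normr_ge0.
  set b := `|g m|; have b0 : 0 <= b by rewrite normr_ge0.
  have : 0 <= b * (a - 1) ^+ 2 by rewrite mulr_ge0// sqr_ge0.
  have : 0 <= b * a ^+ 2 by rewrite mulr_ge0// sqr_ge0.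
  nra.
split; first exact: rint_gauss.
rewrite !Rint_gauss//; first exact: normal_ibp hC.
by apply: (@rint_bounded _ _ _ _ C).
Qed.

End gauss_measure.

Lemma gauss_cos {R : realType} (s th : R) : s != 0 ->
  \int[gauss 0 s]_x cos (x + th) = cos th * expR (- (s ^+ 2 / 2)).
Proof.
move=> s0.
have mc : measurable_fun [set: R] (fun x : R => cos (x + th)).
  by apply: mcos; exact: measurable_funD.
rewrite Rint_gauss ?normal_cos//.
by apply: (@rint_bounded _ _ _ _ 1) => // x; exact: cos_norm_le1.
Qed.

Section gaussian_variable.
Context d (T : measurableType d) (R : realType) (P : probability T R).

Lemma rint_law (X : T -> R) (nu : probability R R) (f : R -> R) :
  measurable_fun setT X -> (forall A, measurable A -> P (X @^-1` A) = nu A) ->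
  measurable_fun setT f -> rint nu f ->
  rint P (fun w => f (X w)) /\ \int[P]_w f (X w) = \int[nu]_x f x.
Proof.
move=> mX hX mf fi.
have mEf : measurable_fun setT (EFin \o f) by exact/measurable_EFinP.
have ipf : (pushm P mX).-integrable setT (EFin \o f).
  apply/integrableP; split => //; case/integrableP: fi => _; apply: le_lt_trans.
  by rewrite [leLHS](eq_measure_integral nu) => [|A mA _]; [exact: lexx|exact: hX].
have i1 : rint P (fun w => f (X w)).
  apply/integrableP; split; first by apply/measurable_EFinP; exact: measurableT_comp.
  case/integrableP: ipf => _.
  by rewrite (@ge0_integral_pushforward _ _ T R R X mX P setT)//; exact: measurableT_comp.
split => //; rewrite /Rintegral -(@integral_pushforward _ _ T R R X mX P setT (EFin \o f))//.
by congr fine; apply: eq_measure_integral => A mA _; exact: hX.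
Qed.

(** The parameter [s] in [is_gaussian] may be negative; the density depends on [s ^+ 2] alone, so
    the law can be stated through the variance. *)
Lemma gauss_sqrt (m s : R) A : gauss m s A = gauss m (Num.sqrt (s ^+ 2)) A.
Proof.
have [->|s0] := eqVneq s 0; first by rewrite expr0n/= sqrtr0.
have s1 : Num.sqrt (s ^+ 2) != 0 by rewrite sqrtr_sqr normr_eq0.
rewrite !gaussE /normal_prob; congr (integral _ _ _); apply/funext => x.
by rewrite (normal_pdfE m s0) (normal_pdfE m s1) /= /normal_peak /normal_fun sqr_sqrtr// sqr_ge0.
Qed.

Lemma rint_dirac (m : R) (f : R -> R) : measurable_fun setT f ->
  rint (\d_m : probability R R) f /\ \int[(\d_m : probability R R)]_x f x = f m.
Proof.
move=> mf; have mEf : measurable_fun setT (EFin \o f) by exact/measurable_EFinP.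
split.
  apply/integrableP; split => //; rewrite integral_dirac ?diracT ?mul1e//= ?ltry//.
  by apply/measurable_EFinP; exact: measurableT_comp.
by rewrite /Rintegral (@integral_dirac _ R m R setT measurableT _ mEf) diracT mul1e.
Qed.

(** Elimination of the existential parameters: for a centred variable the law and the expected
    cosines are expressed by the second moment. Dirac laws are computed separately, whence the
    positive variance in the last clause. *)
Lemma gaussian_moments (X : T -> R) : is_gaussian P X -> rint P X /\
  (\int[P]_w X w = 0 ->
   [/\ rint P (fun w => X w ^+ 2),
      forall th, \int[P]_w cos (X w + th) = cos th * expR (- (\int[P]_w (X w ^+ 2) / 2)) &
      0 < \int[P]_w (X w ^+ 2) -> forall A, measurable A ->
        P (X @^-1` A) = gauss 0 (Num.sqrt (\int[P]_w (X w ^+ 2))) A]).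
Proof.
move=> [mX [m [s law]]].
have mid : measurable_fun [set: R] (id : R -> R) by exact: measurable_id.
have msq : measurable_fun [set: R] (fun x : R => x ^+ 2) by exact: measurable_funX.
have mcs th : measurable_fun [set: R] (fun x : R => cos (x + th)).
  by apply: mcos; apply: measurable_funD.
have [s0|s0] := eqVneq s 0.
  have lawd A : measurable A -> P (X @^-1` A) = (\d_m : probability R R) A.
    by move=> mA; rewrite law// s0 eqxx.
  have D f : measurable_fun setT f -> rint P (fun w => f (X w)) /\ \int[P]_w f (X w) = f m.
    move=> mf; have [h1 h2] := rint_dirac m mf.
    by have [h3 ->] := rint_law mX lawd mf h1.
  have [h1 h2] := D _ mid; split => // m0.
  have {}m0 : m = 0 by rewrite -h2.
  have [h3 h4] := D _ msq; split => //.
  - move=> th; have [_ ->] := D _ (mcs th).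
    by rewrite h4 m0 add0r expr0n/= mul0r oppr0 expR0 mulr1.
  - by rewrite h4 m0 expr0n/= ltxx.
have lawn A : measurable A -> P (X @^-1` A) = gauss m s A.
  by move=> mA; rewrite law// (negbTE s0).
have [h1 h2] := rint_law (nu := gauss m s) mX lawn (measurable_funB mid (@measurable_cst _ _ _ _ _ m)) (rint_gauss_id m s0).
have X1 : rint P X.
  have := rintD h1 (rint_cst P m); congr (rint _ _); apply/funext => w /=.
  by rewrite subrK.
split => // EX0.
have m0 : m = 0.
  have : \int[P]_w (X w - m) = 0 by rewrite [LHS]h2 gauss_mean.
  rewrite RintB//; last exact: rint_cst.
  by rewrite EX0 Rint_cst sub0r => /eqP; rewrite oppr_eq0 => /eqP.
subst m.
have rsq : rint (gauss 0 s) (fun x : R => x ^+ 2).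
  by have := rint_gauss_sq 0 s0; congr (rint _ _); apply/funext => x; rewrite subr0.
have [h3 h4] := rint_law (nu := gauss 0 s) mX lawn msq rsq.
have V : \int[P]_w (X w ^+ 2) = s ^+ 2.
  rewrite h4 -(gauss_second_moment 0 s0); apply: Rint_eq => x; by rewrite subr0.
split => //.
- move=> th; have hb : rint (gauss 0 s) (fun x : R => cos (x + th)).
    by apply: (@rint_bounded _ _ _ _ 1) => // x; exact: cos_norm_le1.
  have [_ ->] := rint_law (nu := gauss 0 s) mX lawn (mcs th) hb.
  by rewrite V gauss_cos.
- move=> _ A mA.
  set aaa := 0%N.
  have e := gauss_sqrt 0 s A.
  rewrite V.
  have l := lawn A mA.
  rewrite l.
  exact: e.
Qed.

End gaussian_variable.

(** * The Gaussian space spanned by a fractional Brownian motion *)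

Section gaussian_space.
Context d (T : measurableType d) (R : realType) (P : probability T R).
Variables (H : R) (B : R -> T -> R).
Hypothesis hB : is_fbm P H B.

Definition gspan (X : T -> R) := exists (n : nat) (c t : 'I_n -> R),
  (forall i, 0 <= t i) /\ X = (fun w => \sum_(i < n) c i * B (t i) w).

Lemma gspan_B t : 0 <= t -> gspan (B t).
Proof.
move=> t0; exists 1%N, (fun=> 1), (fun=> t); split => //.
by apply/funext => w; rewrite big_ord1 mul1r.
Qed.

Lemma gspan0 : gspan (fun=> 0).
Proof.
by exists 0%N, (fun=> 0), (fun=> 0); split => //; apply/funext => w; rewrite big_ord0.
Qed.

Lemma gspanZ r X : gspan X -> gspan (fun w => r * X w).
Proof.
move=> [n [c [t [t0 ->]]]]; exists n, (fun i => r * c i), t; split => //.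
by apply/funext => w; rewrite mulr_sumr; apply: eq_bigr => i _; rewrite mulrA.
Qed.

Lemma gspanD X Y : gspan X -> gspan Y -> gspan (fun w => X w + Y w).
Proof.
move=> [n [c [t [t0 ->]]]] [n' [c' [t' [t0' ->]]]].
exists (n + n')%N, (fun i => match fintype.split i with inl j => c j | inr j => c' j end),
  (fun i => match fintype.split i with inl j => t j | inr j => t' j end); split.
  by move=> i; case: fintype.split.
apply/funext => w; rewrite big_split_ord/=; congr (_ + _); apply: eq_bigr => i _.
  by rewrite (unsplitK (inl i)).
by rewrite (unsplitK (inr i)).
Qed.

Lemma gspanB X Y : gspan X -> gspan Y -> gspan (fun w => X w - Y w).
Proof.
move=> hX hY; have := gspanD hX (gspanZ (-1) hY); congr gspan.
by apply/funext => w; rewrite mulN1r.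
Qed.

Lemma gspan_sum (n : nat) (F : nat -> T -> R) : (forall i, gspan (F i)) ->
  gspan (fun w => \sum_(i < n) F i w).
Proof.
move=> h; elim: n => [|n ih].
  by under eq_fun do rewrite big_ord0; exact: gspan0.
by under eq_fun do rewrite big_ord_recr/=; exact: gspanD.
Qed.

Lemma gspan_gaussian X : gspan X -> is_gaussian P X.
Proof.
case: hB => _ hg _ _ [n [c [t [t0 ->]]]]; exact: hg.
Qed.

Lemma gspan_measurable X : gspan X -> measurable_fun setT X.
Proof. by case/gspan_gaussian. Qed.

Lemma gspan_rint X : gspan X -> rint P X.
Proof. by move/gspan_gaussian/gaussian_moments => []. Qed.

Lemma fbm_mean t : 0 <= t -> \int[P]_w B t w = 0.
Proof.
by case: hB => _ _ hm _ t0; have := hm t t0; rewrite unlock /Rintegral => ->.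
Qed.

Lemma gspan_mean X : gspan X -> \int[P]_w X w = 0.
Proof.
case=> n [c [t [t0 ->]]]; rewrite Rint_sum; last first.
  by move=> i; apply: rintZ; apply: gspan_rint; exact: gspan_B.
rewrite big1// => i _; rewrite RintZ; last by apply: gspan_rint; exact: gspan_B.
by rewrite fbm_mean// mulr0.
Qed.

Lemma gspan_sq X : gspan X -> rint P (fun w => X w ^+ 2).
Proof.
by move=> hX; have [_ /(_ (gspan_mean hX))[]] := gaussian_moments (gspan_gaussian hX).
Qed.

Lemma gspan_cos X th : gspan X ->
  \int[P]_w cos (X w + th) = cos th * expR (- (\int[P]_w (X w ^+ 2) / 2)).
Proof.
by move=> hX; have [_ /(_ (gspan_mean hX))[]] := gaussian_moments (gspan_gaussian hX).
Qed.

Lemma gspan_law X : gspan X -> 0 < \int[P]_w (X w ^+ 2) -> forall A, measurable A ->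
  P (X @^-1` A) = gauss 0 (Num.sqrt (\int[P]_w (X w ^+ 2))) A.
Proof.
by move=> hX; have [_ /(_ (gspan_mean hX))[]] := gaussian_moments (gspan_gaussian hX).
Qed.

Lemma gspan_mul X Y : gspan X -> gspan Y -> rint P (fun w => X w * Y w).
Proof.
by move=> hX hY; apply: rint_mul; [exact: gspan_measurable|exact: gspan_measurable|
  exact: gspan_sq|exact: gspan_sq].
Qed.

Lemma fbm_cov s t : 0 <= s -> 0 <= t ->
  \int[P]_w (B s w * B t w) = fbm_covariance H s t.
Proof.
move=> s0 t0; have [_ _ hm hc] := hB; have := hc s t s0 t0.
rewrite covariance.unlock !hm//= expectation.unlock => h.
apply: EFin_inj; rewrite -[RHS]h -rint_EFin; last by apply: gspan_mul; exact: gspan_B.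
by congr (integral _ _ _); apply/funext => w; congr EFin; change (B s w * B t w = (B s w - 0) * (B t w - 0)); rewrite !subr0.
Qed.

Definition gcov (X Y : T -> R) : R := \int[P]_w (X w * Y w).

Lemma gcovDl X Y Z : gspan X -> gspan Y -> gspan Z ->
  gcov (fun w => X w + Y w) Z = gcov X Z + gcov Y Z.
Proof.
move=> hX hY hZ; rewrite -RintD; [|exact: gspan_mul..].
by apply: Rint_eq => w; rewrite mulrDl.
Qed.

Lemma gcovC X Y : gcov X Y = gcov Y X.
Proof. by apply: Rint_eq => w; rewrite mulrC. Qed.

Lemma gcovZl r X Z : gspan X -> gspan Z -> gcov (fun w => r * X w) Z = r * gcov X Z.
Proof.
move=> hX hZ; rewrite -RintZ; last exact: gspan_mul.
by apply: Rint_eq => w; rewrite mulrA.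
Qed.

Lemma gcovBl X Y Z : gspan X -> gspan Y -> gspan Z ->
  gcov (fun w => X w - Y w) Z = gcov X Z - gcov Y Z.
Proof.
move=> hX hY hZ; rewrite -RintB; [|exact: gspan_mul..].
by apply: Rint_eq => w; rewrite mulrBl.
Qed.

Lemma gcov_sq X : \int[P]_w (X w ^+ 2) = gcov X X.
Proof. by apply: Rint_eq => w; rewrite expr2. Qed.

Lemma gcov_add_orth X Y r : gspan X -> gspan Y -> gcov X Y = 0 ->
  \int[P]_w ((X w + r * Y w) ^+ 2) = gcov X X + r ^+ 2 * gcov Y Y.
Proof.
move=> hX hY h0.
transitivity (gcov (fun w => X w + r * Y w) (fun w => X w + r * Y w)).
  by rewrite -gcov_sq.
have hrY := gspanZ r hY; have hS := gspanD hX hrY.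
rewrite gcovDl// !(gcovC _ (fun w => X w + r * Y w)) !gcovDl// !(gcovC _ (fun w => r * Y w)).
by rewrite !gcovZl// (gcovC _ (fun w => r * Y w)) gcovZl// (gcovC Y X) h0; ring.
Qed.

Variables (n : nat) (Z : nat -> T -> R) (W : T -> R).
Hypothesis hZ : forall i, gspan (Z i).
Hypothesis hW : gspan W.
Hypothesis orth : forall i, (i < n)%N -> gcov (Z i) W = 0.
Hypothesis Wpos : 0 < gcov W W.

Lemma gspan_lincomb c : gspan (lincomb n Z c).
Proof. by rewrite /lincomb; apply: (@gspan_sum n (fun i w => c i * Z i w)) => i; exact: gspanZ. Qed.

Lemma gcov_lincomb c : gcov (lincomb n Z c) W = 0.
Proof.
transitivity (\sum_(i < n) \int[P]_w (c i * (Z i w * W w))).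
  rewrite -Rint_sum; last by move=> i; apply: rintZ; exact: gspan_mul.
  by apply: Rint_eq => w; rewrite /lincomb mulr_suml; apply: eq_bigr => i _; ring.
rewrite big1// => i _; rewrite RintZ; last exact: gspan_mul.
by rewrite [X in _ * X](orth (ltn_ord i)) mulr0.
Qed.

(** The expected product of cosines involves [L + xi W] and [L - xi W]; for uncorrelated [L] and [W]
    both have variance [Var L + xi ^+ 2 Var W], so the Gaussian factors split and [trig_indep]
    applies. *)
Lemma gspan_indep A C : <<s rays n Z >> A -> measurable C ->
  P (A `&` W @^-1` C) = (P A * gauss 0 (Num.sqrt (gcov W W)) C)%E.
Proof.
move=> sA mC.
have -> : gauss 0 (Num.sqrt (gcov W W)) C = P (W @^-1` C).
  by rewrite gspan_law// gcov_sq.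
apply: (@trig_indep _ _ _ P n Z W) => //.
- by move=> i; exact: gspan_measurable.
- exact: gspan_measurable.
- move=> c xi th th'; set L := lincomb n Z c.
  have hL : gspan L by exact: gspan_lincomb.
  have LW : gcov L W = 0 by exact: gcov_lincomb.
  have bc X t : gspan X -> rint P (fun w => cos (X w + t)).
    move=> hX; apply: rint_mbdd; split; last by exists 1 => w; exact: cos_norm_le1.
    by apply: mcos; apply: measurable_funD => //; exact: gspan_measurable.
  have hp r : gspan (fun w => L w + r * W w) by apply: gspanD => //; exact: gspanZ.
  transitivity (\int[P]_w (2^-1 * (cos ((L w + xi * W w) + (th + th')) + cos ((L w + - xi * W w) + (th - th'))))).
    apply: Rint_eq => w.
    have -> : L w + xi * W w + (th + th') = (L w + th) + (xi * W w + th') by ring.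
    have -> : L w + - xi * W w + (th - th') = (L w + th) - (xi * W w + th') by ring.
    by move: (L w + th) (xi * W w + th') => a b; rewrite cosD cosB; field.
  rewrite RintZ; last by apply: rintD; exact: bc.
  rewrite RintD; [|exact: bc..].
  rewrite !gspan_cos//; last exact: gspanZ.
  rewrite !gcov_add_orth// sqrrN gcov_sq.
  have -> : gcov (fun w => xi * W w) (fun w => xi * W w) = xi ^+ 2 * gcov W W.
    rewrite gcovZl//; last exact: gspanZ.
    by rewrite gcovC gcovZl//; ring.
  rewrite !gcov_sq.
  rewrite cosD cosB.
  have -> : - ((gcov L L + xi ^+ 2 * gcov W W) / 2) = - (xi ^+ 2 * gcov W W / 2) + - (gcov L L / 2) by field.
  by rewrite expRD; field.
Qed.

End gaussian_space.

(** * The heat semigroup *)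

Lemma measurable_rays d (T : measurableType d) (R : realType) (n : nat) (Z : nat -> T -> R) i :
  (i < n)%N -> measurable_fun [set: g_sigma_algebraType (rays n Z)] (Z i).
Proof.
move=> ni; apply: (measurability (@RGenInftyO.G R) (@RGenInftyO.measurableE R)).
move=> _ [_ [a ->] <-]; rewrite setTI; apply: sub_sigma_algebra.
exists [:: (i, a)]; first by rewrite /= ni.
by apply/seteqP; split => w /=; rewrite in_itv/= andbT.
Qed.

Section antiderivative.
Context {R : realType}.
Notation leb := (@lebesgue_measure R).

Lemma continuous_antiderivative (g : R -> R) : continuous g ->
  exists G : R -> R, forall x, is_derive x (1 : R) G (g x).
Proof.
move=> cg.
have ig a c : leb.-integrable `[a, c] (EFin \o g).
  by apply: continuous_compact_integrable; [exact: segment_compact|exact: continuous_subspaceT].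
(* A single base point would serve only the half-line to its right, hence integrals from every
   [- n]. For different [n] they differ by constants, and subtracting the value at 0 makes them
   agree. *)
pose I (n : nat) (x : R) := \int[leb]_(t in `[- n%:R, x]) g t.
have dI (n : nat) (x : R) : - n%:R < x -> is_derive x (1 : R) (I n) (g x).
  move=> nx; have xx : x < x + 1 by lra.
  have [h1 h2] := continuous_FTC1_closed (f := g) xx (ig _ _) nx (cg x).
  by apply: DeriveDef; [exact: h1|rewrite -derive1E; exact: h2].
pose N (x : R) : nat := (Num.truncn `|x|).+1.
have hN (x : R) : - (N x)%:R < x.
  rewrite ltrNl; apply: le_lt_trans (ler_norm _) _; rewrite normrN.
  by rewrite /N truncnS_gt.
pose G x := I (N x) x - I (N x) 0.
have step (n m : nat) x : (n <= m)%N -> (0 < n)%N -> - n%:R < x ->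
    I m x - I m 0 = I n x - I n 0.
  move=> nm n1 nx.
  have nmR : n%:R <= m%:R :> R by rewrite ler_nat.
  have n0 : - n%:R <= 0 :> R by rewrite oppr_le0.
  have dd (y : R) : - n%:R < y -> is_derive y (1 : R) (fun z => I m z - I n z) 0.
    move=> ny; have d1 := dI n y ny.
    have my : - m%:R < y by lra.
    have d2 := dI m y my.
    by apply: is_derive_eq; rewrite subrr.
  have cst (a c : R) : a <= c -> - n%:R < a -> I m c - I n c = I m a - I n a.
    move=> ac na; apply/eqP; rewrite -subr_eq0; apply/eqP.
    have hd : forall y, y \in `]a, c[ -> is_derive y (1 : R) (fun z => I m z - I n z) 0.
      by move=> y; rewrite in_itv/= => /andP[ay _]; apply: dd; lra.
    have hc : {within `[a, c], continuous (fun z => I m z - I n z)}.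
      apply: derivable_within_continuous => y; rewrite in_itv/= => /andP[ay _].
      by have := dd y (lt_le_trans na ay); case.
    by have [_ _] := MVT_segment ac hd hc; rewrite mul0r.
  have nn : - n%:R < 0 :> R by rewrite oppr_lt0 ltr0n.
  case: (leP 0 x) => [x0|/ltW x0].
    by have := cst 0 x x0 nn; lra.
  by have := cst x 0 x0 nx; lra.
exists G => x.
pose M := (N x).+1.
have Mx : - M%:R < x by apply: lt_trans (hN x); rewrite ltrN2 ltr_nat.
have E : \forall y \near x, I M y - I M 0 = G y.
  have := @nbhsx_ballx _ _ x 1 ltr01.
  apply: filterS => y; rewrite -ball_normE /= => xy; apply: step.
  - rewrite /N /M ltnS.
    suff : `|y| < (Num.truncn `|x|).+2%:R by rewrite -truncn_lt_nat//; lia.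
    have : `|y| <= `|x| + `|x - y|.
      by have := ler_normB x (x - y); rewrite opprB addrC subrK.
    have := truncnS_gt `|x|.
    have -> : (Num.truncn `|x|).+2%:R = (Num.truncn `|x|).+1%:R + 1 :> R by rewrite natr1.
    lra.
  - by [].
  - exact: hN.
have d1 := dI M x Mx.
have d2 : is_derive x (1 : R) (fun y => I M y - I M 0) (g x).
  by apply: is_derive_eq; rewrite subr0.
exact: near_eq_is_derive E d2.
Qed.

End antiderivative.

Lemma continuous_integral d (T : measurableType d) (R : realType) (P : probability T R)
    (f : R -> T -> R) (k : T -> R) :
  (forall y, rint P (f y)) -> (forall w, continuous (f ^~ w)) -> rint P k ->
  (forall y w, `|f y w| <= k w) -> continuous (fun y => \int[P]_w f y w).
Proof.
move=> fi fc ki fk a.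
have aI : a \in `]a - 1, a + 1[ by rewrite /= in_itv/=; apply/andP; split; lra.
have fi' x : `]a - 1, a + 1[%classic x -> rint P (f x) by [].
have fc' : {ae P, forall w, setT w -> {in `]a - 1, a + 1[%classic, continuous (f ^~ w)}}.
  by apply: aeW => w _ x _; exact: fc.
have fk' x : `]a - 1, a + 1[%classic x -> {ae P, forall w, setT w -> `|f x w| <= k w}.
  by move=> _; apply: aeW => w _; exact: fk.
apply: (continuity_under_integral measurableT fi' fc' ki fk').
by rewrite inE.
Qed.

Lemma is_derive_shift {R : realType} (G : R -> R) (z x dG : R) :
  is_derive (z + x) (1 : R) G dG -> is_derive x (1 : R) (fun y => G (z + y)) dG.
Proof.
move=> d; have h : is_derive x (1 : R) (fun y => z + y) 1.
  have := is_deriveD (is_derive_cst z x 1) (is_derive_id x (1 : R)).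
  by rewrite add0r.
by have := @is_derive1_comp _ G (fun y => z + y) x dG 1 d h; rewrite mulr1.
Qed.

Section heat_semigroup.
Context {R : realType}.
Implicit Types (g : R -> R) (s : R).

Definition cbdd (C : R) g := continuous g /\ forall x, `|g x| <= C.

Definition heat s g (y : R) : R := \int[gauss 0 (Num.sqrt s)]_x g (y + x).

(** The derivative of [heat s g] with the differentiation moved to the Gaussian density; the formula
    makes sense for [g] merely continuous and bounded. *)
Definition dheat s g (y : R) : R := \int[gauss 0 (Num.sqrt s)]_x (x / s * g (y + x)).

Let sq0 s : 0 < s -> Num.sqrt s != 0.
Proof. by move=> s0; rewrite gt_eqF// sqrtr_gt0. Qed.

Lemma gauss_id s : 0 < s -> rint (gauss 0 (Num.sqrt s)) (fun x => x).
Proof.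
by move=> s0; have := rint_gauss_id 0 (sq0 s0); congr (rint _ _); apply/funext => x; rewrite subr0.
Qed.

Lemma gauss_sq s : 0 < s -> rint (gauss 0 (Num.sqrt s)) (fun x => x ^+ 2) /\
  \int[gauss 0 (Num.sqrt s)]_x (x ^+ 2) = s.
Proof.
move=> s0; split.
  by have := rint_gauss_sq 0 (sq0 s0); congr (rint _ _); apply/funext => x; rewrite subr0.
rewrite -[RHS]sqr_sqrtr ?(ltW s0)// -(gauss_second_moment 0 (sq0 s0)).
by apply: Rint_eq => x; rewrite subr0.
Qed.

Lemma gauss_abs s : 0 < s -> \int[gauss 0 (Num.sqrt s)]_x `|x| <= Num.sqrt s.
Proof.
move=> s0; have [h1 h2] := gauss_sq s0; rewrite -[in leRHS]h2.
by apply: Rint_abs_sq.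
Qed.

Let shift_cont g y : continuous g -> continuous (fun x => g (y + x)).
Proof.
move=> cg x; apply: continuous_comp; last exact: cg.
by apply: cvgD; [exact: cvg_cst|exact: cvg_id].
Qed.

Let shift_cont' g x : continuous g -> continuous (fun y => g (y + x)).
Proof.
move=> cg y; apply: continuous_comp; last exact: cg.
by apply: cvgD; [exact: cvg_id|exact: cvg_cst].
Qed.

Lemma rint_heat C s g y : cbdd C g -> rint (gauss 0 (Num.sqrt s)) (fun x => g (y + x)).
Proof.
move=> [cg bg]; apply: (@rint_bounded _ _ _ _ C) => //.
by apply: continuous_measurable; exact: shift_cont.
Qed.

Lemma heat_cbdd C s g : cbdd C g -> cbdd C (heat s g).
Proof.
move=> hg; have [cg bg] := hg; split.
  apply: (continuous_integral (k := fun=> C)) => //.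
  - by move=> y; exact: rint_heat hg.
  - by move=> x; exact: shift_cont'.
  - exact: rint_cst.
move=> y; apply: Rint_abs_leC => //.
by apply: continuous_measurable; exact: shift_cont.
Qed.

Lemma heatD C1 C2 s g1 g2 y : cbdd C1 g1 -> cbdd C2 g2 ->
  heat s (fun x => g1 x + g2 x) y = heat s g1 y + heat s g2 y.
Proof. by move=> h1 h2; rewrite -RintD//; [exact: rint_heat h1|exact: rint_heat h2]. Qed.

Lemma heatZ C s r g y : cbdd C g -> heat s (fun x => r * g x) y = r * heat s g y.
Proof. by move=> h; rewrite -RintZ//; exact: rint_heat h. Qed.

Lemma cbddD C1 C2 g1 g2 : cbdd C1 g1 -> cbdd C2 g2 -> cbdd (C1 + C2) (fun x => g1 x + g2 x).
Proof.
move=> [c1 b1] [c2 b2]; split; first by move=> x; apply: cvgD; [exact: c1|exact: c2].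
by move=> x; apply: le_trans (ler_normD _ _) _; exact: lerD.
Qed.

Lemma cbddM C1 C2 g1 g2 : cbdd C1 g1 -> cbdd C2 g2 -> cbdd (C1 * C2) (fun x => g1 x * g2 x).
Proof.
move=> [c1 b1] [c2 b2]; split; first by move=> x; apply: cvgM; [exact: c1|exact: c2].
by move=> x; rewrite normrM; exact: ler_pM.
Qed.

Lemma cbdd_cst (r : R) : cbdd `|r| (fun=> r).
Proof. by split => // x; exact: cvg_cst. Qed.

Lemma cbddW C1 C2 g : C1 <= C2 -> cbdd C1 g -> cbdd C2 g.
Proof. by move=> C12 [cg bg]; split => // x; exact: le_trans (bg x) C12. Qed.

Lemma cbdd_comp C g (f : R -> R) : continuous f -> cbdd C g -> cbdd C (fun x => g (f x)).
Proof.
move=> cf [cg bg]; split => [x|x]; last exact: bg.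
by apply: (@continuous_comp _ _ _ f g); [exact: cf|exact: cg].
Qed.

Lemma heat_derive C1 C2 s g g' y : 
  (forall x, is_derive x (1 : R) g (g' x)) -> cbdd C1 g -> cbdd C2 g' ->
  is_derive y (1 : R) (heat s g) (heat s g' y).
Proof.
move=> dg hg hg'.
apply: (is_derive_integral (P := gauss 0 (Num.sqrt s)) (f := fun y x => g (y + x))
  (f' := fun y x => g' (y + x)) (g := fun=> C2)).
- by move=> z; exact: rint_heat hg.
- by move=> z x; under eq_fun do rewrite addrC; apply: is_derive_shift; rewrite addrC.
- exact: rint_cst.
- by move=> z x _; case: hg' => _; apply.
Qed.

Lemma rint_dheat C s g y : 0 < s -> cbdd C g ->
  rint (gauss 0 (Num.sqrt s)) (fun x => x / s * g (y + x)).
Proof.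
move=> s0 [cg bg]; apply: (rint_le (mu := gauss 0 (Num.sqrt s)) (g := fun x => C / s * `|x|)).
- apply: measurable_funM; first by apply: measurable_funM.
  by apply: continuous_measurable; exact: shift_cont.
- by apply: rintZ; apply: rint_abs; exact: gauss_id.
- move=> x; rewrite !normrM normfV (ger0_norm (ltW s0)).
  rewrite [X in _ <= X]mulrC mulrA [leRHS]mulrAC ler_wpM2l// mulr_ge0// invr_ge0 ltW//.
Qed.

(** With [G] an antiderivative of [g], Stein's identity writes [heat s g z] as the mean of
    [x / s * G (z + x)], and in this form the parameter can be differentiated under the integral. *)
Lemma heat_smooth C s g y : 0 < s -> cbdd C g ->
  is_derive y (1 : R) (heat s g) (dheat s g y).
Proof.
move=> s0 hg; have [cg bg] := hg.
have [G dG] := continuous_antiderivative cg.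
have dGs z x : is_derive x (1 : R) (fun x => G (z + x)) (g (z + x)).
  exact: is_derive_shift.
have E z : rint (gauss 0 (Num.sqrt s)) (fun x => x / s * G (z + x)) /\
    heat s g z = \int[gauss 0 (Num.sqrt s)]_x (x / s * G (z + x)).
  have [h1 h2] := gauss_ibp 0 (sq0 s0) (dGs z) (@shift_cont g z cg) (fun x => bg (z + x)).
  have E x : x / s * G (z + x) = s^-1 * ((x - 0) * G (z + x)) by rewrite subr0; ring.
  split; first by under eq_fun do rewrite E; exact: rintZ.
  under Rint_eq do rewrite E.
  rewrite RintZ// h2 sqr_sqrtr ?(ltW s0)// mulrA mulVf ?mul1r//.
  by rewrite gt_eqF.
have -> : heat s g = (fun z => \int[gauss 0 (Num.sqrt s)]_x (x / s * G (z + x))).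
  by apply/funext => z; case: (E z).
apply: (is_derive_integral (P := gauss 0 (Num.sqrt s)) (f := fun z x => x / s * G (z + x))
  (f' := fun z x => x / s * g (z + x)) (g := fun x => C / s * `|x|)).
- by move=> z; case: (E z).
- move=> z x; have d := dG (z + x).
  have d1 : is_derive z (1 : R) (fun z => G (z + x)) (g (z + x)).
    by under eq_fun do rewrite addrC; apply: is_derive_shift; rewrite addrC.
  by apply: is_derive_eq.
- by apply: rintZ; apply: rint_abs; exact: gauss_id.
- move=> z x _; rewrite !normrM normfV (ger0_norm (ltW s0)).
  rewrite [X in _ <= X]mulrC mulrA [leRHS]mulrAC ler_wpM2l// mulr_ge0// invr_ge0 ltW//.
Qed.

(** The mean of [|x|] is at most [sqrt s], so one derivative of a bounded function costs
    [1 / sqrt s], a singularity integrable at 0. *)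
Lemma dheat_cbdd C s g : 0 < s -> cbdd C g -> cbdd (C / Num.sqrt s) (dheat s g).
Proof.
move=> s0 hg; have [cg bg] := hg.
have C0 : 0 <= C by exact: le_trans (bg 0).
have bnd y x : `|x / s * g (y + x)| <= C / s * `|x|.
  rewrite !normrM normfV (ger0_norm (ltW s0)).
  rewrite [X in _ <= X]mulrC mulrA [leRHS]mulrAC ler_wpM2l// mulr_ge0// invr_ge0 ltW//.
have ik : rint (gauss 0 (Num.sqrt s)) (fun x => C / s * `|x|).
  by apply: rintZ; apply: rint_abs; exact: gauss_id.
split.
  apply: (continuous_integral (P := gauss 0 (Num.sqrt s)) (k := fun x => C / s * `|x|)) => //.
  - by move=> y; exact: rint_dheat hg.
  - by move=> x y; apply: cvgM; [exact: cvg_cst|exact: shift_cont'].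
move=> y; apply: le_trans (Rint_abs_le (rint_dheat y s0 hg) ik (bnd y)) _.
rewrite RintZ; last by apply: rint_abs; exact: gauss_id.
have -> : C / Num.sqrt s = C / s * Num.sqrt s.
  rewrite -[X in C / X * _](sqr_sqrtr (ltW s0)); field; exact: sq0.
by rewrite ler_wpM2l ?gauss_abs// divr_ge0// ltW.
Qed.

End heat_semigroup.

Section gspan_decoupling.
Context d (T : measurableType d) (R : realType) (P : probability T R).
Variables (H : R) (B : R -> T -> R).
Hypothesis hB : is_fbm P H B.
Variables (n : nat) (Z : nat -> T -> R) (W : T -> R).
Hypothesis hZ : forall i, gspan B (Z i).
Hypothesis hW : gspan B W.
Hypothesis orth : forall i, (i < n)%N -> gcov P (Z i) W = 0.
Hypothesis Wpos : 0 < gcov P W W.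

Lemma gspan_decoupling (f : g_sigma_algebraType (rays n Z) * R -> R) (A D : R) :
  measurable_fun setT f -> 0 <= A -> 0 <= D ->
  (forall w x, `|f (w, x)| <= A + D * x ^+ 2) ->
  [/\ rint P (fun w => f (w, W w)),
    rint P (fun w => \int[gauss 0 (Num.sqrt (gcov P W W))]_x f (w, x) : R) &
    \int[P]_w f (w, W w) = \int[P]_w \int[gauss 0 (Num.sqrt (gcov P W W))]_x f (w, x)].
Proof.
move=> mf A0 D0 hf.
have mr : rays n Z `<=` measurable.
  by apply: rays_measurable => i; exact: gspan_measurable hB _ (hZ i).
apply: (@decoupling _ _ _ P (rays n Z) W (gauss 0 (Num.sqrt (gcov P W W))) mr _ _ f
  (fun=> 1) (fun x => A + D * x ^+ 2)).
- exact: gspan_measurable hB _ hW.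
- by move=> E C sE mC; exact: (gspan_indep hB hZ hW orth Wpos).
- by [].
- by [].
- exact: rint_cst.
- by apply: rintD; [exact: rint_cst|apply: rintZ; exact: (gauss_sq Wpos).1].
- by move=> w x; rewrite mul1r.
Qed.

End gspan_decoupling.

Section brownian.
Context d (T : measurableType d) (R : realType) (P : probability T R).
Variable (B : R -> T -> R).
Hypothesis hB : is_fbm P 2^-1 B.

Lemma bm_cov s t : 0 <= s -> 0 <= t -> gcov P (B s) (B t) = Num.min s t.
Proof.
move=> s0 t0; rewrite /gcov (fbm_cov hB)// /fbm_covariance divff// !powRr1//.
case: (leP s t) => st.
  by rewrite ger0_norm ?subr_ge0//; field.
by rewrite ltr0_norm ?subr_lt0//; field.
Qed.

Lemma bm_incr r s : 0 <= r -> 0 <= s ->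
  [/\ gspan B (fun w => B (r + s) w - B r w),
    forall u, 0 <= u <= r -> gcov P (B u) (fun w => B (r + s) w - B r w) = 0 &
    gcov P (fun w => B (r + s) w - B r w) (fun w => B (r + s) w - B r w) = s].
Proof.
move=> r0 s0; have rs : 0 <= r + s by exact: addr_ge0.
have g1 := gspan_B B rs; have g2 := gspan_B B r0.
have g3 : gspan B (fun w => B (r + s) w - B r w) by exact: gspanB.
have orth u : 0 <= u <= r -> gcov P (B u) (fun w => B (r + s) w - B r w) = 0.
  move=> /andP[u0 ur]; rewrite gcovC (gcovBl hB)//; last exact: gspan_B.
  rewrite !bm_cov//; have -> : Num.min (r + s) u = u by apply/min_idPr; lra.
  by have -> : Num.min r u = u; [apply/min_idPr; lra|rewrite subrr].
split => //; rewrite (gcovBl hB)// (orth r) ?r0 ?lexx// subr0.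
rewrite gcovC (gcovBl hB)// !bm_cov// minxx.
by have -> : Num.min r (r + s) = r; [apply/min_idPl; lra|ring].
Qed.

Lemma heat_bm C (r y : R) (g : R -> R) : 0 < r -> cbdd C g ->
  heat r g y = \int[P]_w g (y + B r w).
Proof.
move=> r0 hg; have hr := gspan_B B (ltW r0).
have v : \int[P]_w (B r w ^+ 2) = r by rewrite gcov_sq bm_cov ?ltW// minxx.
have law A : measurable A -> P (B r @^-1` A) = gauss 0 (Num.sqrt r) A.
  by move=> mA; have := gspan_law hB hr; rewrite v => /(_ r0 A mA).
have := rint_law (nu := gauss 0 (Num.sqrt r)) (gspan_measurable hB hr) law _ (rint_heat r y hg).
case=> //; apply: continuous_measurable => x; apply: continuous_comp; last exact: hg.1.
by apply: cvgD; [exact: cvg_cst|exact: cvg_id].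
Qed.

(** Gaussian convolution is read off a Brownian motion: [B (r + s)] is [B r] plus an uncorrelated,
    hence independent, increment. This is how the Brownian motion enters the analytic estimates
    below. *)
Lemma heat_semigroup C (r s y : R) (g : R -> R) : 0 < r -> 0 < s -> cbdd C g ->
  heat (r + s) g y = heat r (heat s g) y.
Proof.
move=> r0 s0 hg; have [hW horth hv] := bm_incr (ltW r0) (ltW s0).
rewrite (heat_bm _ _ hg) ?addr_gt0// (heat_bm _ _ (heat_cbdd s hg))//.
pose W w := B (r + s) w - B r w.
pose f (p : g_sigma_algebraType (rays 1 (fun=> B r)) * R) := g (y + B r p.1 + p.2).
have mg : measurable_fun setT g by apply: continuous_measurable; exact: hg.1.
have mf : measurable_fun setT f.
  apply: measurableT_comp mg _; apply: measurable_funD; last exact: measurable_snd.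
  apply: measurable_funD => //; apply: measurableT_comp; last exact: measurable_fst.
  exact: (@measurable_rays _ _ _ 1 (fun=> B r) 0).
have C0 : 0 <= C by apply: le_trans (hg.2 0).
have [] := @gspan_decoupling _ _ _ _ _ _ hB 1 (fun=> B r) W _ hW _ _ f C 0 mf C0 (lexx 0) _.
- by move=> _; exact: gspan_B (ltW r0).
- by move=> i _; apply: horth; rewrite ltW//=.
- by rewrite hv.
- by move=> w x; rewrite mul0r addr0; exact: hg.2.
move=> _ _; rewrite hv => h.
transitivity (\int[P]_w f (w, W w)).
  by apply: Rint_eq => w; rewrite /f /W/=; congr g; ring.
exact: h.
Qed.

(** Half of the time is spent on each of two derivatives, each costing [1 / sqrt (s / 2)]; together
    they give [2 / s]. *)
Lemma dheat_lip C (s : R) (g : R -> R) x y : 0 < s -> cbdd C g ->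
  `|dheat s g x - dheat s g y| <= 2 * C / s * `|x - y|.
Proof.
move=> s0 hg; have s20 : 0 < s / 2 by rewrite divr_gt0.
set h := heat (s / 2) g.
have hh : cbdd C h by exact: heat_cbdd.
have dh z : is_derive z (1 : R) h (dheat (s / 2) g z) by exact: heat_smooth hg.
have hdh := dheat_cbdd s20 hg.
have E z : dheat s g z = heat (s / 2) (dheat (s / 2) g) z.
  have d1 : is_derive z (1 : R) (heat s g) (dheat s g z) := heat_smooth z s0 hg.
  have d2 := heat_derive (s / 2) z dh hh hdh.
  have e : heat (s / 2) h = heat s g.
    by apply/funext => u; rewrite -(heat_semigroup _ s20 s20 hg) -splitr.
  rewrite e in d2; case: d1 => _ <-; by case: d2.
rewrite !E.
apply: (@is_derive_MVT _ _ (dheat (s / 2) (dheat (s / 2) g))).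
  by move=> z; exact: heat_smooth hdh.
move=> z; have [_ b] := dheat_cbdd s20 hdh.
apply: le_trans (b z) _.
have -> // : C / Num.sqrt (s / 2) / Num.sqrt (s / 2) = 2 * C / s.
rewrite -mulrA -invfM -expr2 sqr_sqrtr ?ltW//; field; lra.
Qed.

End brownian.

(** * Value functions of the Brownian Euler scheme *)

Section singular_sums.
Context {R : realType}.
Variable h : R.
Hypothesis h0 : 0 < h.

Let step (i : nat) : h / Num.sqrt (i.+1%:R * h) <= 2 * (Num.sqrt (i.+1%:R * h) - Num.sqrt (i%:R * h)).
Proof.
set x := Num.sqrt (i.+1%:R * h); set y := Num.sqrt (i%:R * h).
have x0 : 0 < x by rewrite sqrtr_gt0 mulr_gt0.
have y0 : 0 <= y by exact: sqrtr_ge0.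
have x2 : x ^+ 2 = i.+1%:R * h by rewrite sqr_sqrtr// mulr_ge0// ltW.
have y2 : y ^+ 2 = i%:R * h by rewrite sqr_sqrtr// mulr_ge0// ltW.
rewrite ler_pdivrMr//.
have e : h = x ^+ 2 - y ^+ 2 by rewrite x2 y2 -natr1; ring.
rewrite [leLHS]e; have : 0 <= (x - y) ^+ 2 by exact: sqr_ge0.
nra.
Qed.

Lemma singular_sum (m : nat) :
  \sum_(i < m) h / Num.sqrt (i.+1%:R * h) <= 2 * Num.sqrt (m%:R * h).
Proof.
elim: m => [|m ih]; first by rewrite big_ord0 mul0r sqrtr0 mulr0.
by rewrite big_ord_recr/=; have := step m; lra.
Qed.

(** Only times up to [r ^+ 2] count, so the comparison integral stops there; the induction needs the
    sharper bound by the minimum of [sqrt (m h)] and [r]. *)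
Lemma singular_sum_near (m : nat) (r : R) : 0 < r ->
  \sum_(i < m) (if i.+1%:R * h <= r ^+ 2 then h / Num.sqrt (i.+1%:R * h) else 0) <= 2 * r.
Proof.
move=> r0.
have mono (i : nat) : Num.sqrt (i%:R * h) <= Num.sqrt (i.+1%:R * h).
  by rewrite ler_wsqrtr// ler_wpM2r ?ltW// ltr_nat.
suff : \sum_(i < m) (if i.+1%:R * h <= r ^+ 2 then h / Num.sqrt (i.+1%:R * h) else 0)
    <= 2 * Num.min (Num.sqrt (m%:R * h)) r.
  by move/le_trans; apply; rewrite ler_wpM2l// ge_min lexx orbT.
elim: m => [|m ih].
  rewrite big_ord0 mul0r sqrtr0 mulr_ge0// le_min lexx ltW//.
rewrite big_ord_recr/=; case: ifPn => [hm|_].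
  have sr : Num.sqrt (m.+1%:R * h) <= r.
    by rewrite -[leRHS](ger0_norm (ltW r0)) -sqrtr_sqr ler_wsqrtr.
  have e1 : Num.min (Num.sqrt (m.+1%:R * h)) r = Num.sqrt (m.+1%:R * h) by apply/min_idPl.
  have e2 : Num.min (Num.sqrt (m%:R * h)) r = Num.sqrt (m%:R * h).
    by apply/min_idPl; exact: le_trans (mono m) sr.
  by move: ih; rewrite e1 e2; have := step m; lra.
rewrite addr0; apply: le_trans ih _; rewrite ler_wpM2l// le_min !ge_min lexx orbT andbT.
by rewrite mono.
Qed.

Lemma geometric_sum (m : nat) (lam : R) : 0 < lam ->
  \sum_(i < m) h * (1 + lam * h) ^- i.+1 <= lam^-1.
Proof.
move=> l0; set q := 1 + lam * h.
have lh : 0 < lam * h by exact: mulr_gt0.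
have q0 : 0 < q by rewrite /q; lra.
suff -> : \sum_(i < m) h * q ^- i.+1 = (1 - q ^- m) / lam.
  rewrite ler_pdivrMr// mulVf ?gt_eqF// gerBl invr_ge0 exprn_ge0// ltW//.
elim: m => [|m ih]; first by rewrite big_ord0 expr0 invr1 subrr mul0r.
rewrite big_ord_recr/= ih.
have qm : q ^+ m != 0 by rewrite expf_neq0// gt_eqF.
have ql : q != 0 by rewrite gt_eqF.
have -> : h = (q - 1) / lam by rewrite /q; field; rewrite gt_eqF.
rewrite exprS; field.
by rewrite qm ql gt_eqF.
Qed.

(** Split at time [r ^+ 2]: before it the weight is dropped and the singular part has mass [2 r];
    after it the kernel is at most [1 / r] and the weights form a geometric series of mass
    [1 / lam]. *)
Lemma weighted_singular_sum (m : nat) (r lam : R) : 0 < r -> 0 < lam ->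
  \sum_(i < m) h / Num.sqrt (i.+1%:R * h) * (1 + lam * h) ^- i.+1 <= 2 * r + (r * lam)^-1.
Proof.
move=> r0 l0; have lh : 0 < lam * h by exact: mulr_gt0.
have q1 (i : nat) : 0 <= (1 + lam * h) ^- i <= 1.
  have q1 : 1 <= (1 + lam * h) ^+ i by apply: exprn_ege1; lra.
  have q2 : 0 < (1 + lam * h) ^+ i by lra.
  by rewrite invr_ge0 (ltW q2) /= invf_le1.
apply: le_trans (_ : \sum_(i < m) ((if i.+1%:R * h <= r ^+ 2 then h / Num.sqrt (i.+1%:R * h) else 0)
   + r^-1 * (h * (1 + lam * h) ^- i.+1)) <= _).
  apply: ler_sum => i _; have /andP[qa qb] := q1 i.+1.
  have x0 : 0 < Num.sqrt (i.+1%:R * h) by rewrite sqrtr_gt0 mulr_gt0.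
  case: ifPn => hi.
    have : h / Num.sqrt (i.+1%:R * h) * (1 + lam * h) ^- i.+1 <= h / Num.sqrt (i.+1%:R * h).
      by rewrite ler_piMr// divr_ge0// ltW.
    have : 0 <= r^-1 * (h * (1 + lam * h) ^- i.+1).
      by rewrite mulr_ge0 ?invr_ge0 ?(ltW r0)// mulr_ge0 ?(ltW h0).
    lra.
  rewrite add0r mulrAC mulrA; rewrite [r^-1 * _]mulrC -mulrA -[leRHS]mulrA.
  rewrite ler_wpM2l ?(ltW h0)// mulrC ler_wpM2r//.
  rewrite lef_pV2 ?posrE//.
  have : r ^+ 2 < i.+1%:R * h by rewrite ltNge.
  move=> /ltW/ler_wsqrtr; rewrite sqrtr_sqr ger0_norm// ltW//.
rewrite big_split/=; apply: lerD; first exact: singular_sum_near.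
rewrite -mulr_sumr invfM ler_wpM2l ?invr_ge0 ?(ltW r0)//.
exact: geometric_sum.
Qed.

End singular_sums.

Section backward_recursion.
Context d (T : measurableType d) (R : realType) (P : probability T R).
Variable (B : R -> T -> R).
Hypothesis hB : is_fbm P 2^-1 B.
Variables (b b' f f' f'' : R -> R) (b0 L F0 F1 F2 : R).
Hypotheses (db : forall x, is_derive x (1 : R) b (b' x)) (hb : cbdd b0 b) (hb' : cbdd L b').
Hypotheses (df : forall x, is_derive x (1 : R) f (f' x)) (df' : forall x, is_derive x (1 : R) f' (f'' x)).
Hypotheses (hf : cbdd F0 f) (hf' : cbdd F1 f') (hf'' : cbdd F2 f'').
Variable h : R.
Hypothesis h0 : 0 < h.

Let shift (y : R) := y + h * b y.

Let L0 : 0 <= L.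
Proof. by case: hb' => _ /(_ 0); apply: le_trans. Qed.

Let b00 : 0 <= b0.
Proof. by case: hb => _ /(_ 0); apply: le_trans. Qed.

Let F10 : 0 <= F1.
Proof. by case: hf' => _ /(_ 0); apply: le_trans. Qed.

Let F20 : 0 <= F2.
Proof. by case: hf'' => _ /(_ 0); apply: le_trans. Qed.

Let cshift : continuous shift.
Proof.
move=> x; apply: cvgD; first exact: cvg_id.
by apply: cvgM; [exact: cvg_cst|exact: hb.1].
Qed.

(* [wval m] is the expected value of [f] after [m.+1] Brownian Euler steps,
   the first of which has its drift already applied. *)
Fixpoint wval (m : nat) : R -> R :=
  if m is k.+1 then heat h (fun y => wval k (shift y)) else heat h f.

Fixpoint dwval (m : nat) : R -> R :=
  if m is k.+1 then heat h (fun y => dwval k (shift y) * (1 + h * b' y)) else heat h f'.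

Definition M1 (m : nat) := (1 + h * L) ^+ m * F1.

Lemma wval_cbdd m : cbdd F0 (wval m).
Proof.
by elim: m => [|m ih] /=; apply: heat_cbdd => //; exact: cbdd_comp ih.
Qed.

Lemma cbdd_jac : cbdd (1 + h * L) (fun y => 1 + h * b' y).
Proof.
split.
  move=> x; apply: cvgD; first exact: cvg_cst.
  by apply: cvgM; [exact: cvg_cst|exact: hb'.1].
move=> x; apply: le_trans (ler_normD _ _) _; rewrite normr1 lerD2l normrM (ger0_norm (ltW h0)).
apply: ler_wpM2l; [exact: ltW|exact: hb'.2].
Qed.

Lemma dwval_cbdd m : cbdd (M1 m) (dwval m).
Proof.
elim: m => [|m ih] /=; first by rewrite /M1 expr0 mul1r; exact: heat_cbdd.
apply: heat_cbdd; rewrite /M1 exprSr mulrAC; apply: cbddM => //; last exact: cbdd_jac.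
exact: cbdd_comp ih.
Qed.

Lemma wval_derive m x : is_derive x (1 : R) (wval m) (dwval m x).
Proof.
elim: m x => [|m ih] x /=; first exact: heat_derive hf hf'.
apply: (@heat_derive _ F0 (M1 m * (1 + h * L))).
- exact: cbdd_comp (wval_cbdd m).
- by apply: cbddM; [exact: cbdd_comp (dwval_cbdd m)|exact: cbdd_jac].
Qed.

(* [dwval] obeys the heat recursion of [wval] up to the source [h * gsrc], of size [h * O(1)]. *)
Definition gsrc (m : nat) (y : R) : R :=
  h^-1 * (dwval m (shift y) - dwval m y) + b' y * dwval m (shift y).

Lemma gsrcE m y : dwval m (shift y) * (1 + h * b' y) = dwval m y + h * gsrc m y.
Proof. by rewrite /gsrc; field; rewrite gt_eqF. Qed.

(** Only qualitative, since the bound grows like [1 / h]: it provides integrability until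
    [gsrc_cbdd] gives a bound uniform in the mesh. *)
Lemma gsrc_cbdd0 m : cbdd (`|h^-1| * (M1 m + M1 m) + L * M1 m) (gsrc m).
Proof.
apply: cbddD; last by apply: cbddM => //; exact: cbdd_comp (dwval_cbdd m).
apply: cbddM; first exact: cbdd_cst.
have := cbddD (cbdd_comp cshift (dwval_cbdd m)) (cbddM (cbdd_cst (-1)) (dwval_cbdd m)).
rewrite normrN normr1 mul1r; congr cbdd.
by apply/funext => x; rewrite mulN1r.
Qed.

Lemma sum_cbdd (k : nat) (C : nat -> R) (g : nat -> R -> R) : (forall j, cbdd (C j) (g j)) ->
  cbdd (\sum_(j < k) C j) (fun x => \sum_(j < k) g j x).
Proof.
move=> hg; elim: k => [|k ih].
  rewrite big_ord0; under eq_fun do rewrite big_ord0.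
  by apply: cbddW (cbdd_cst 0); rewrite normr0.
have -> : (fun x => \sum_(j < k.+1) g j x) = (fun x => \sum_(j < k) g j x + g k x).
  by apply/funext => x; rewrite big_ord_recr.
by rewrite big_ord_recr/=; exact: cbddD.
Qed.

Lemma heat_sum (k : nat) (C : nat -> R) (g : nat -> R -> R) s z : (forall j, cbdd (C j) (g j)) ->
  heat s (fun x => \sum_(j < k) g j x) z = \sum_(j < k) heat s (g j) z.
Proof.
move=> hg; elim: k => [|k ih].
  by rewrite big_ord0 /heat; under Rint_eq do rewrite big_ord0; rewrite Rint_cst.
rewrite big_ord_recr/= -ih -(heatD s z (sum_cbdd k hg) (hg k)).
by congr heat; apply/funext => x; rewrite big_ord_recr.
Qed.

(** Variation of constants. Each step applies [heat h] to the previous derivative plus a source, and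
    the semigroup property merges the steps; the source created at level [j] is smoothed for the
    time [(m - j) h], which is positive. *)
Lemma duhamel m y : dwval m y = heat (m.+1%:R * h) f' y +
  h * \sum_(j < m) heat ((m - j)%:R * h) (gsrc j) y.
Proof.
elim: m y => [|m ih] y; first by rewrite big_ord0 mulr0 addr0 mul1r.
have hs j : cbdd (`|h^-1| * (M1 j + M1 j) + L * M1 j) (heat ((m - j)%:R * h) (gsrc j)).
  exact/heat_cbdd/gsrc_cbdd0.
transitivity (heat h (fun x => dwval m x + h * gsrc m x) y).
  by rewrite /=; congr heat; apply/funext => x; exact: gsrcE.
rewrite (heatD h y (dwval_cbdd m) (cbddM (cbdd_cst h) (gsrc_cbdd0 m))).
rewrite (heatZ h h y (gsrc_cbdd0 m)).
have -> : dwval m = fun x => heat (m.+1%:R * h) f' x + h * \sum_(j < m) heat ((m - j)%:R * h) (gsrc j) x.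
  by apply/funext => x; exact: ih.
rewrite (heatD h y (heat_cbdd _ hf') (cbddM (cbdd_cst h) (sum_cbdd m hs))).
rewrite (heatZ h h y (sum_cbdd m hs)) (heat_sum m h y hs).
have mjp (j : 'I_m) : 0 < (m - j)%:R * h by rewrite mulr_gt0// ltr0n subn_gt0.
have eh (j : 'I_m) : h + (m - j)%:R * h = (m.+1 - j)%:R * h.
  have jm := ltn_ord j.
  by rewrite subSn 1?ltnW// -[(_ - _).+1%:R]natr1; ring.
have s0 : 0 < m.+1%:R * h by rewrite mulr_gt0.
have e1 : h + m.+1%:R * h = m.+2%:R * h by rewrite -[m.+2%:R]natr1; ring.
have sg1 := heat_semigroup hB y h0 s0 hf'; rewrite e1 in sg1.
transitivity (heat (m.+2%:R * h) f' y + h * \sum_(j < m) heat ((m.+1 - j)%:R * h) (gsrc j) y +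
  h * heat h (gsrc m) y); last first.
  by rewrite -addrA -mulrDr big_ord_recr/= subSnn mul1r.
have gen (a c e a' c' : R) : a = a' -> c = c' -> a + h * c + e = a' + h * c' + e by move=> -> ->.
apply: gen; first exact: esym sg1.
apply: eq_bigr => j _.
have sg2 := heat_semigroup hB y h0 (mjp j) (gsrc_cbdd0 j); rewrite eh in sg2.
exact: esym sg2.
Qed.

(** The Duhamel formula differentiated term by term: the derivative falls on [f'] and on the heat
    kernels, so no second derivative of the drift appears. *)
Definition d2wval m y := heat (m.+1%:R * h) f'' y +
  h * \sum_(j < m) dheat ((m - j)%:R * h) (gsrc j) y.

Let mj_gt0 (m : nat) (j : 'I_m) : 0 < (m - j)%:R * h.
Proof. by rewrite mulr_gt0// ltr0n subn_gt0. Qed.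

Lemma dwval_derive m y : is_derive y (1 : R) (dwval m) (d2wval m y).
Proof.
have -> : dwval m = fun x => heat (m.+1%:R * h) f' x + h * \sum_(j < m) heat ((m - j)%:R * h) (gsrc j) x.
  by apply/funext => x; exact: duhamel.
have d1 : is_derive y (1 : R) (heat (m.+1%:R * h) f') (heat (m.+1%:R * h) f'' y).
  exact: heat_derive hf' hf''.
have d2 (j : 'I_m) : is_derive y (1 : R) (heat ((m - j)%:R * h) (gsrc j)) (dheat ((m - j)%:R * h) (gsrc j) y).
  by apply: heat_smooth (gsrc_cbdd0 j); exact: mj_gt0.
have d3 := is_derive_sum d2.
have e : (fun x => \sum_(j < m) heat ((m - j)%:R * h) (gsrc j) x) = \sum_(j < m) heat ((m - j)%:R * h) (gsrc j).
  by apply/funext => x; rewrite fct_sumE.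
have d4 : is_derive y (1 : R) (fun x => \sum_(j < m) heat ((m - j)%:R * h) (gsrc j) x)
    (\sum_(j < m) dheat ((m - j)%:R * h) (gsrc j) y) by rewrite e.
exact: is_deriveD d1 (is_deriveZ h d4).
Qed.

Lemma d2wval_continuous m : continuous (d2wval m).
Proof.
move=> x; apply: cvgD; first by have [c _] := heat_cbdd (m.+1%:R * h) hf''; exact: c.
apply: cvgM; first exact: cvg_cst.
apply: cvg_big => //; first exact: add_continuous.
move=> j _; have [c _] := dheat_cbdd (mj_gt0 j) (gsrc_cbdd0 j); exact: c.
Qed.

(** The difference quotient in [gsrc] spans a distance at most [h b0], so it is at most [b0] times
    the size of [w'']. The source is thus bounded by the quantity it helps to estimate, a loop
    closed by Gronwall in [d2wval_bound]. *)
Lemma gsrc_cbdd K m : (forall y, `|d2wval m y| <= K) -> cbdd (K * b0 + L * M1 m) (gsrc m).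
Proof.
move=> hK; have [c _] := gsrc_cbdd0 m; split => // y.
apply: le_trans (ler_normD _ _) _; apply: lerD; last first.
  by rewrite normrM; apply: ler_pM => //; [exact: hb'.2|exact: (dwval_cbdd m).2].
have K0 : 0 <= K by apply: le_trans (hK 0).
have := is_derive_MVT y (shift y) (dwval_derive m) hK.
rewrite /shift addrAC subrr add0r => h1.
rewrite normrM ger0_norm ?invr_ge0 ?(ltW h0)// mulrC ler_pdivrMr//.
apply: le_trans h1 _; rewrite -mulrA ler_wpM2l// normrM ger0_norm ?(ltW h0)// mulrC.
by apply: ler_wpM2r; [exact: ltW|exact: hb.2].
Qed.

Definition sup1 (t : R) : R := expR (L * t) * F1.

Lemma M1_le (m : nat) (t : R) : m%:R * h <= t -> M1 m <= sup1 t.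
Proof.
move=> mt; rewrite /M1 /sup1 ler_wpM2r//.
apply: le_trans (_ : expR (h * L) ^+ m <= _).
  apply: lerXn2r; rewrite ?nnegrE ?expR_ge0 ?addr_ge0 ?mulr_ge0 ?(ltW h0)//.
  exact: expR_ge1Dx.
rewrite -expRM_natl ler_expR -mulr_natl.
by have := ler_wpM2l L0 mt; lra.
Qed.

(* Gronwall for the kernel [1 / sqrt s]: with the weight [(1 + lam h)^m] and
   this [lam], the kernel has mass at most [(2 b0)^-1]. *)
Definition sup2 (t : R) : R :=
  2 * (F2 + 2 * L * sup1 t * Num.sqrt t) * expR (32 * (b0 + 1) ^+ 2 * t).

(** Strong induction with the ansatz [A (1 + lam h) ^ m]. Earlier levels feed back through
    [gsrc_cbdd]; the choice of [lam] makes this at most half of the ansatz, and [F2] together with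
    the source [L sup1] accounts for the other half, [A / 2]. *)
Lemma d2wval_bound (m : nat) (t y : R) : m%:R * h <= t -> `|d2wval m y| <= sup2 t.
Proof.
set lam : R := 32 * (b0 + 1) ^+ 2; set A := 2 * (F2 + 2 * L * sup1 t * Num.sqrt t).
move=> mt; have B0 : 0 <= b0 := b00.
have t0 : 0 <= t by apply: le_trans mt; rewrite mulr_ge0 ?(ltW h0).
have S1 : 0 <= sup1 t by rewrite mulr_ge0// expR_ge0.
have A0 : 0 <= A by rewrite /A mulr_ge0// addr_ge0// mulr_ge0 ?sqrtr_ge0// mulr_ge0// mulr_ge0.
have lam0 : 0 < lam by rewrite /lam mulr_gt0// exprn_gt0//; lra.
have q0 : 0 < 1 + lam * h by rewrite addr_gt0// mulr_gt0.
suff key : forall y, `|d2wval m y| <= A * (1 + lam * h) ^+ m.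
  apply: le_trans (key y) _; rewrite /sup2 -/A -/lam ler_wpM2l//.
  apply: le_trans (_ : expR (lam * h) ^+ m <= _).
    apply: lerXn2r; rewrite ?nnegrE ?expR_ge0 ?(ltW q0)//; exact: expR_ge1Dx.
  rewrite -expRM_natl ler_expR -mulr_natl.
  by have := ler_wpM2l (ltW lam0) mt; lra.
elim/ltn_ind: m mt => m ih mt z.
have hg (j : 'I_m) : cbdd (A * (1 + lam * h) ^+ j * b0 + L * sup1 t) (gsrc j).
  have jt : j%:R * h <= t.
    by apply: le_trans mt; rewrite ler_wpM2r ?(ltW h0)// ler_nat ltnW.
  apply: cbddW (gsrc_cbdd (ih _ (ltn_ord j) jt)).
  by rewrite lerD2l ler_wpM2l// M1_le.
apply: le_trans (ler_normD _ _) _.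
have e1 : `|heat (m.+1%:R * h) f'' z| <= F2 by exact: (heat_cbdd _ hf'').2.
have e2 : `|h * \sum_(j < m) dheat ((m - j)%:R * h) (gsrc j) z| <=
   \sum_(j < m) (h / Num.sqrt ((m - j)%:R * h)) * (A * (1 + lam * h) ^+ j * b0 + L * sup1 t).
  rewrite normrM ger0_norm ?(ltW h0)//.
  apply: le_trans (ler_wpM2l (ltW h0) (ler_norm_sum _ _ _)) _.
  rewrite mulr_sumr; apply: ler_sum => j _.
  rewrite [leRHS]mulrAC -[leRHS]mulrA ler_wpM2l ?(ltW h0)//.
  by have [_] := dheat_cbdd (mj_gt0 j) (hg j); apply.
have e3 : \sum_(j < m) (h / Num.sqrt ((m - j)%:R * h)) * (A * (1 + lam * h) ^+ j * b0 + L * sup1 t) =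
   A * (1 + lam * h) ^+ m * b0 * \sum_(i < m) (h / Num.sqrt (i.+1%:R * h) * (1 + lam * h) ^- i.+1) +
   L * sup1 t * \sum_(i < m) (h / Num.sqrt (i.+1%:R * h)).
  rewrite (reindex_inj rev_ord_inj)/= !mulr_sumr -big_split/=.
  apply: eq_bigr => i _; have im := ltn_ord i.
  rewrite subKn// mulrDr; congr (_ + _); last by rewrite mulrC.
  have -> : (1 + lam * h) ^+ m = (1 + lam * h) ^+ (m - i.+1) * (1 + lam * h) ^+ i.+1.
    by rewrite -exprD subnK.
  have qi : (1 + lam * h) ^+ i.+1 != 0 by rewrite expf_neq0// gt_eqF.
  field; rewrite qi/= gt_eqF// sqrtr_gt0 mulr_gt0//.
(* With this radius [2 r] and [1 / (r lam)] both equal [1 / (4 (b0 + 1))]; the summand 1 guards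
   against [b0 = 0]. *)
set r : R := (8 * (b0 + 1))^-1.
have b1 : 0 < b0 + 1 by lra.
have r0 : 0 < r by rewrite /r invr_gt0; lra.
have k1 : \sum_(i < m) (h / Num.sqrt (i.+1%:R * h) * (1 + lam * h) ^- i.+1) <= (2 * (b0 + 1))^-1.
  apply: le_trans (weighted_singular_sum h0 m r0 lam0) _.
  rewrite /r /lam le_eqVlt; apply/orP; left; apply/eqP; field; lra.
have k2 : \sum_(i < m) (h / Num.sqrt (i.+1%:R * h)) <= 2 * Num.sqrt t.
  apply: le_trans (singular_sum h0 m) _; rewrite ler_wpM2l// ler_wsqrtr//.
have q1 : 1 <= (1 + lam * h) ^+ m by apply: exprn_ege1; rewrite lerDl mulr_ge0 ?(ltW lam0) ?(ltW h0).
set Q := (1 + lam * h) ^+ m in q1 e3 *.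
have AQ : 0 <= A * Q by rewrite mulr_ge0//; lra.
have i1 : A * Q * b0 * \sum_(i < m) (h / Num.sqrt (i.+1%:R * h) * (1 + lam * h) ^- i.+1) <= A * Q / 2.
  apply: le_trans (ler_wpM2l (mulr_ge0 AQ b00) k1) _.
  rewrite -mulrA ler_wpM2l// ler_pdivrMr; last lra.
  by lra.
have i2 : L * sup1 t * \sum_(i < m) (h / Num.sqrt (i.+1%:R * h)) <= L * sup1 t * (2 * Num.sqrt t).
  by rewrite ler_wpM2l// mulr_ge0.
have i3 : A <= A * Q by rewrite ler_peMr.
have i4 : F2 + L * sup1 t * (2 * Num.sqrt t) = A / 2 by rewrite /A; field.
move: e2; rewrite e3; lra.
Qed.

(** Sources smoothed for a time at most [r ^+ 2] are bounded by their size, which leaves the offset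
    [4 r]; older ones are Lipschitz with constant [2 / r ^+ 2] by [dheat_lip]. The kernel [1 / s] is
    not integrable at 0, so a Lipschitz bound on all sources would not be uniform in the mesh. *)
Lemma d2wval_modulus (m : nat) (t r x y : R) : m%:R * h <= t -> 0 < r ->
  `|d2wval m x - d2wval m y| <= F2 / Num.sqrt (m.+1%:R * h) * `|x - y| +
    (sup2 t * b0 + L * sup1 t) * (4 * r + 2 * t / r ^+ 2 * `|x - y|).
Proof.
move=> mt r0; set G := sup2 t * b0 + L * sup1 t.
have hg (j : 'I_m) : cbdd G (gsrc j).
  have jt : j%:R * h <= t.
    by apply: le_trans mt; rewrite ler_wpM2r ?(ltW h0)// ler_nat ltnW.
  apply: cbddW (gsrc_cbdd (fun y => d2wval_bound y jt)).
  by rewrite lerD2l ler_wpM2l// M1_le.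
have t0 : 0 <= t by apply: le_trans mt; rewrite mulr_ge0 ?(ltW h0).
have G0 : 0 <= G.
  have S1 : 0 <= sup1 t by rewrite mulr_ge0// expR_ge0.
  by rewrite addr_ge0// mulr_ge0// !mulr_ge0 ?expR_ge0// addr_ge0// !mulr_ge0 ?sqrtr_ge0.
have -> : d2wval m x - d2wval m y = (heat (m.+1%:R * h) f'' x - heat (m.+1%:R * h) f'' y) +
    \sum_(j < m) (h * (dheat ((m - j)%:R * h) (gsrc j) x - dheat ((m - j)%:R * h) (gsrc j) y)).
  by rewrite /d2wval -mulr_sumr sumrB; ring.
apply: le_trans (ler_normD _ _) _; apply: lerD.
  have m0 : 0 < m.+1%:R * h by rewrite mulr_gt0.
  apply: (is_derive_MVT (df := dheat (m.+1%:R * h) f'')).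
    by move=> z; exact: heat_smooth hf''.
  by move=> z; have [_] := dheat_cbdd m0 hf''; apply.
apply: le_trans (ler_norm_sum _ _ _) _.
rewrite (reindex_inj rev_ord_inj)/=.
apply: le_trans (_ : \sum_(i < m) (2 * G * (if i.+1%:R * h <= r ^+ 2 then h / Num.sqrt (i.+1%:R * h) else 0)
   + 2 * G / r ^+ 2 * `|x - y| * h) <= _).
  apply: ler_sum => i _; have im := ltn_ord i; rewrite subKn//.
  have s0 : 0 < i.+1%:R * h by rewrite mulr_gt0.
  have hgi := hg (rev_ord i).
  rewrite normrM ger0_norm ?(ltW h0)//.
  have r2 : 0 < r ^+ 2 by rewrite exprn_gt0.
  case: ifPn => hi.
    have [_ bd] := dheat_cbdd s0 hgi.
    have : `|dheat (i.+1%:R * h) (gsrc (m - i.+1)) x - dheat (i.+1%:R * h) (gsrc (m - i.+1)) y| <= G / Num.sqrt (i.+1%:R * h) + G / Num.sqrt (i.+1%:R * h).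
      by apply: le_trans (ler_normB _ _) _; exact: lerD.
    move=> /(ler_wpM2l (ltW h0)) h1; apply: le_trans h1 _.
    have : 0 <= 2 * G / r ^+ 2 * `|x - y| * h by rewrite !mulr_ge0 ?invr_ge0 ?(ltW r2) ?(ltW h0).
    lra.
  rewrite mulr0 add0r mulrC ler_wpM2r ?(ltW h0)//.
  apply: le_trans (dheat_lip hB x y s0 hgi) _; rewrite ler_wpM2r//.
  rewrite ler_wpM2l ?mulr_ge0// lef_pV2 ?posrE//.
  by rewrite ltW// ltNge.
rewrite big_split/= -mulr_sumr sumr_const card_ord.
have n1 := singular_sum_near h0 m r0.
have n2 := ler_wpM2l (mulr_ge0 (ler0n R 2) G0) n1.
have : (2 * G / r ^+ 2 * `|x - y| * h) *+ m = 2 * G / r ^+ 2 * `|x - y| * (m%:R * h).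
  by rewrite -mulr_natr; ring.
move=> ->.
have : 2 * G / r ^+ 2 * `|x - y| * (m%:R * h) <= 2 * G / r ^+ 2 * `|x - y| * t.
  by rewrite ler_wpM2l// !mulr_ge0 ?invr_ge0// exprn_ge0// ltW.
lra.
Qed.

End backward_recursion.

(** * Gaussian integration by parts along the Euler scheme *)

Section euler_functional.
Context {R : realType}.
Variables (b b' : R -> R) (b0 L : R).
Hypotheses (db : forall x, is_derive x (1 : R) b (b' x)) (hb : cbdd b0 b) (hb' : cbdd L b').
Variables (h y0 : R).
Hypothesis h0 : 0 < h.

Definition drifted (y : R) : R := y + h * b y.

Fixpoint euler (z : nat -> R) (k : nat) : R :=
  if k is j.+1 then drifted (euler z j) + z j else y0.

(* Derivative of [euler] at [z] in the direction [c]. *)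
Fixpoint tangent (z c : nat -> R) (k : nat) : R :=
  if k is j.+1 then tangent z c j * (1 + h * b' (euler z j)) + c j else 0.

Let L0 : 0 <= L.
Proof. by case: hb' => _ /(_ 0); apply: le_trans. Qed.

Lemma drifted_derive x : is_derive x (1 : R) drifted (1 + h * b' x).
Proof. by apply: is_derive_eq; rewrite /GRing.scale/= ?mulr0 ?add0r ?addr0. Qed.

Lemma euler_derive (z c : nat -> R) k x :
  is_derive x (1 : R) (fun x => euler (fun j => z j + c j * x) k)
    (tangent (fun j => z j + c j * x) c k).
Proof.
elim: k => [|k ih] /=; first exact: is_derive_cst.
have d1 := is_derive1_comp (drifted_derive _) ih.
have d2 : is_derive x (1 : R) (fun x => z k + c k * x) (c k).
  have := is_deriveD (is_derive_cst (z k) x 1) (is_deriveZ (c k) (is_derive_id x (1 : R))).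
  by rewrite add0r; congr is_derive; rewrite /GRing.scale/= mulr1.
by have := is_deriveD d1 d2; rewrite mulrC.
Qed.

Lemma tangent_bound (z c : nat -> R) k :
  `|tangent z c k| <= (1 + h * L) ^+ k * \sum_(j < k) `|c j|.
Proof.
have hL : 0 <= h * L by rewrite mulr_ge0// ltW.
elim: k => [|k ih] /=; first by rewrite normr0 expr0 big_ord0 mulr0.
apply: le_trans (ler_normD _ _) _; rewrite big_ord_recr/= [leRHS]mulrDr; apply: lerD.
  rewrite normrM exprSr mulrAC; apply: ler_pM => //.
  exact: (cbdd_jac hb' h0).2.
by rewrite ler_peMl//; apply: exprn_ege1; rewrite lerDl.
Qed.

Lemma tangentZ (z c : nat -> R) r k : tangent z (fun j => r * c j) k = r * tangent z c k.
Proof.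
by elim: k => [|k ih] /=; [rewrite mulr0|rewrite ih; ring].
Qed.

Lemma tangent_continuous (z c : nat -> R) k : continuous (fun x => tangent (fun j => z j + c j * x) c k).
Proof.
elim: k => [|k ih] x /=; first exact: cvg_cst.
apply: cvgD; last exact: cvg_cst.
apply: cvgM; first exact: ih.
apply: cvgD; first exact: cvg_cst.
apply: cvgM; first exact: cvg_cst.
have ce : continuous (fun x => euler (fun j => z j + c j * x) k).
  exact: (is_derive_continuous (euler_derive z c k)).
by apply: (@continuous_comp _ _ _ (fun x => euler (fun j => z j + c j * x) k) b'); [exact: ce|exact: hb'.1].
Qed.

(** A perturbation injected at step [j] passes through at most [k - j] Jacobians, each within [h L]
    of 1. Hence the leading term in the integration by parts is the plain sum of covariances. *)
Lemma tangent_sum (z c : nat -> R) k : (forall j, 0 <= c j) ->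
  `|tangent z c k - \sum_(j < k) c j| <=
    (1 + h * L) ^+ k * (h * L * \sum_(j < k) (k - j)%:R * c j).
Proof.
have hL : 0 <= h * L by rewrite mulr_ge0// ltW.
move=> c0; elim: k => [|k ih] /=.
  by rewrite !big_ord0 subr0 normr0 !mulr0.
rewrite big_ord_recr/=.
set S := \sum_(j < k) c j; set t := tangent z c k; set be := b' _.
have S0 : 0 <= S by apply: sumr_ge0.
have -> : t * (1 + h * be) + c k - (S + c k) = (t - S) * (1 + h * be) + S * (h * be) by ring.
have e : \sum_(j < k.+1) (k.+1 - j)%:R * c j = \sum_(j < k) (k - j)%:R * c j + S + c k.
  rewrite big_ord_recr/= subSnn mul1r -big_split/=; congr (_ + _).
  apply: eq_bigr => j _; rewrite subSn 1?ltnW// -natr1; ring.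
rewrite e; apply: le_trans (ler_normD _ _) _.
have bb : `|1 + h * be| <= 1 + h * L by exact: (cbdd_jac hb' h0).2.
have bb2 : `|h * be| <= h * L.
  by rewrite normrM (ger0_norm (ltW h0)) ler_wpM2l ?(ltW h0)//; exact: hb'.2.
have q1 : 1 <= (1 + h * L) ^+ k.+1 by apply: exprn_ege1; rewrite lerDl.
have i1 : `|(t - S) * (1 + h * be)| <= (1 + h * L) ^+ k.+1 * (h * L * \sum_(j < k) (k - j)%:R * c j).
  by rewrite normrM exprSr mulrAC; apply: ler_pM.
have i2 : `|S * (h * be)| <= (1 + h * L) ^+ k.+1 * (h * L * S).
  rewrite normrM (ger0_norm S0); apply: le_trans (_ : h * L * S <= _).
    by rewrite mulrC ler_wpM2r.
  by rewrite ler_peMl// mulr_ge0.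
have i3 : 0 <= (1 + h * L) ^+ k.+1 * (h * L * c k).
  by apply: mulr_ge0; [lra|apply: mulr_ge0].
lra.
Qed.

Lemma jacobian_sum (z c : nat -> R) k (al : R) : (forall j, 0 <= c j) -> `|al| <= L ->
  `|tangent z c k * (1 + h * al) - \sum_(j < k) c j| <=
    (1 + h * L) ^+ k.+1 * (h * L * (2 * \sum_(j < k) (k - j)%:R * c j)).
Proof.
have hL : 0 <= h * L by rewrite mulr_ge0// ltW.
move=> c0 hal; have i0 := tangent_sum z k c0.
set S := \sum_(j < k) c j in i0 *; set t := tangent z c k in i0 *.
set V := \sum_(j < k) (k - j)%:R * c j in i0 *.
have SV : S <= V.
  apply: ler_sum => j _; rewrite ler_peMl// ler1n subn_gt0//.
have S0 : 0 <= S by apply: sumr_ge0.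
have -> : t * (1 + h * al) - S = (t - S) * (1 + h * al) + S * (h * al) by ring.
apply: le_trans (ler_normD _ _) _.
have bb2 : `|h * al| <= h * L.
  by rewrite normrM (ger0_norm (ltW h0)) ler_wpM2l ?(ltW h0).
have bb : `|1 + h * al| <= 1 + h * L.
  by apply: le_trans (ler_normD _ _) _; rewrite normr1 lerD2l.
have q1 : 1 <= (1 + h * L) ^+ k.+1 by apply: exprn_ege1; rewrite lerDl.
have i1 : `|(t - S) * (1 + h * al)| <= (1 + h * L) ^+ k.+1 * (h * L * V).
  by rewrite normrM exprSr mulrAC; apply: ler_pM.
have i2 : `|S * (h * al)| <= (1 + h * L) ^+ k.+1 * (h * L * V).
  rewrite normrM (ger0_norm S0); apply: le_trans (_ : h * L * V <= _).
    by rewrite mulrC; apply: ler_pM.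
  by rewrite ler_peMl// mulr_ge0//; apply: le_trans SV.
lra.
Qed.

Lemma measurable_euler d (T : measurableType d) (Z : nat -> T -> R) k :
  (forall j, (j < k)%N -> measurable_fun setT (Z j)) ->
  measurable_fun setT (fun w => euler (Z ^~ w) k).
Proof.
have mb : measurable_fun setT b by apply: continuous_measurable; exact: hb.1.
elim: k => [|k ih] mZ /=; first exact: measurable_cst.
have me : measurable_fun setT (fun w => euler (Z ^~ w) k) by apply: ih => j jk; apply: mZ; rewrite ltnW.
apply: measurable_funD; last exact: mZ.
apply: measurable_funD => //; apply: measurable_funM => //.
exact: measurableT_comp mb me.
Qed.

Lemma measurable_tangent d (T : measurableType d) (Z : nat -> T -> R) (c : nat -> R) k :
  (forall j, (j < k)%N -> measurable_fun setT (Z j)) ->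
  measurable_fun setT (fun w => tangent (Z ^~ w) c k).
Proof.
have mb : measurable_fun setT b' by apply: continuous_measurable; exact: hb'.1.
elim: k => [|k ih] mZ /=; first exact: measurable_cst.
have mZ' j : (j < k)%N -> measurable_fun setT (Z j) by move=> jk; apply: mZ; rewrite ltnW.
have me := measurable_euler mZ'.
apply: measurable_funD => //; apply: measurable_funM; first exact: ih.
apply: measurable_funD => //; apply: measurable_funM => //.
exact: measurableT_comp mb me.
Qed.

End euler_functional.

Section euler_gaussian.
Context d (T : measurableType d) (R : realType) (P : probability T R).
Variables (H : R) (B : R -> T -> R).
Hypothesis hB : is_fbm P H B.
Variables (b b' : R -> R) (b0 L : R).
Hypotheses (db : forall x, is_derive x (1 : R) b (b' x)) (hb : cbdd b0 b) (hb' : cbdd L b').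
Variables (h y0 : R).
Hypothesis h0 : 0 < h.
Variables (Z : nat -> T -> R) (k : nat) (W : T -> R).
Hypothesis hZ : forall i, gspan B (Z i).
Hypothesis hW : gspan B W.
Hypothesis Wpos : 0 < gcov P W W.

Let E w := euler b h y0 (Z ^~ w) k.

Let p w := drifted b h (E w).

Lemma measurable_eulerZ : measurable_fun setT (fun w => euler b h y0 (Z ^~ w) k).
Proof. by apply: (measurable_euler hb h y0 (Z := Z)) => j _; exact (gspan_measurable hB (hZ j)). Qed.

Lemma measurable_drifted : measurable_fun setT (drifted b h).
Proof.
by apply: continuous_measurable; exact: (is_derive_continuous (drifted_derive db h)).
Qed.

Lemma measurable_p : measurable_fun setT p.
Proof. exact: measurableT_comp measurable_drifted measurable_eulerZ. Qed.

(** With the past increments frozen, averaging over the independent Gaussian [W] is the heat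
    operator at time [Var W]. *)
Lemma euler_independent_step (C : R) (g : R -> R) :
  (forall j, (j < k)%N -> gcov P (Z j) W = 0) -> cbdd C g ->
  \int[P]_w g (p w + W w) = \int[P]_w heat (gcov P W W) g (p w).
Proof.
move=> orth hg; have C0 : 0 <= C by apply: le_trans (hg.2 0).
pose f (q : g_sigma_algebraType (rays k Z) * R) := g (drifted b h (euler b h y0 (Z ^~ q.1) k) + q.2).
have mf : measurable_fun setT f.
  apply: (@measurableT_comp _ _ _ _ _ _ g); first by apply: continuous_measurable; exact: hg.1.
  apply: measurable_funD; last exact: measurable_snd.
  apply: (measurableT_comp measurable_drifted).
  apply: (measurable_euler hb h y0 (Z := fun j (q : g_sigma_algebraType (rays k Z) * R) => Z j q.1)).
  by move=> j jk; apply: measurableT_comp; [exact: measurable_rays|exact: measurable_fst].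
have [] := gspan_decoupling hB hZ hW orth Wpos mf C0 (lexx 0).
  by move=> w x; rewrite mul0r addr0; exact: hg.2.
by move=> _ _.
Qed.

(** Each [Z j] is split into [c j * W], its regression on [W], and a remainder [Z' j] uncorrelated
    with [W], hence independent of it. With the [Z' j] frozen, the scheme is a function of one real
    Gaussian with derivative given by [tangent] in the direction [c]; Stein's identity applies, and
    [v * c j] restores the covariance. *)
Lemma euler_ibp (C0 C : R) (g g' : R -> R) :
  (forall x, is_derive x (1 : R) g (g' x)) -> cbdd C0 g -> cbdd C g' ->
  \int[P]_w (g (p w) * W w) =
  \int[P]_w (g' (p w) * (tangent b b' h y0 (Z ^~ w) (fun j => gcov P (Z j) W) k * (1 + h * b' (E w)))).
Proof.
move=> dg hg hg'; set v := gcov P W W.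
pose c j := gcov P (Z j) W / v.
pose Z' j w := Z j w - c j * W w.
have hZ' j : gspan B (Z' j) by apply: gspanB => //; exact: gspanZ.
have orth j : (j < k)%N -> gcov P (Z' j) W = 0.
  move=> _; rewrite /Z' (gcovBl hB)//; last exact: gspanZ.
  by rewrite (gcovZl hB)// /c -/v; field; rewrite gt_eqF.
have C00 : 0 <= C0 by apply: le_trans (hg.2 0).
have Cp : 0 <= C by apply: le_trans (hg'.2 0).
have v0 : 0 < v by [].
(* The increments with the value of [W] replaced by a free variable; [x = W w] returns the original
   [Z]. *)
pose z w x j := Z' j w + c j * x.
pose F w x := g (drifted b h (euler b h y0 (z w x) k)).
pose F' w x := g' (drifted b h (euler b h y0 (z w x) k)) *
   (tangent b b' h y0 (z w x) c k * (1 + h * b' (euler b h y0 (z w x) k))).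
pose K := C * ((1 + h * L) ^+ k * (\sum_(j < k) `|c j|) * (1 + h * L)).
have F'b w x : `|F' w x| <= K.
  rewrite /F' /K normrM normrM; apply: ler_pM => //; first exact: hg'.2.
  by apply: ler_pM => //; [exact: (tangent_bound b hb' y0 h0)|exact: (cbdd_jac hb' h0).2].
have K0 : 0 <= K by exact: le_trans (F'b point 0).
have dF w x : is_derive x (1 : R) (F w) (F' w x).
  have d1 := euler_derive db h y0 (Z' ^~ w) c k x.
  have d2 := is_derive1_comp (drifted_derive db h _) d1.
  have := is_derive1_comp (dg _) d2.
  by rewrite /F' (mulrC (tangent _ _ _ _ _ _ _)).
have cF' w : continuous (F' w).
  have ce : continuous (fun x => euler b h y0 (z w x) k).
    exact: (is_derive_continuous (euler_derive db h y0 (Z' ^~ w) c k)).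
  have cd : continuous (drifted b h) by exact: (is_derive_continuous (drifted_derive db h)).
  move=> x; apply: cvgM.
    apply: (@continuous_comp _ _ _ (fun x => drifted b h (euler b h y0 (z w x) k)) g'); last exact: hg'.1.
    by apply: (@continuous_comp _ _ _ (fun x => euler b h y0 (z w x) k) (drifted b h)); [exact: ce|exact: cd].
  apply: cvgM; first exact: (tangent_continuous db hb').
  apply: cvgD; first exact: cvg_cst.
  apply: cvgM; first exact: cvg_cst.
  by apply: (@continuous_comp _ _ _ (fun x => euler b h y0 (z w x) k) b'); [exact: ce|exact: hb'.1].
pose TG := g_sigma_algebraType (rays k Z').
have mz j : (j < k)%N -> measurable_fun setT (fun q : TG * R => z q.1 q.2 j).
  move=> jk; apply: measurable_funD.
    by apply: measurableT_comp; [exact: measurable_rays|exact: measurable_fst].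
  by apply: measurable_funM => //; exact: measurable_snd.
have me : measurable_fun setT (fun q : TG * R => euler b h y0 (z q.1 q.2) k).
  exact: (measurable_euler hb h y0 (Z := fun j (q : TG * R) => z q.1 q.2 j)).
have mg : measurable_fun setT g by apply: continuous_measurable; exact: hg.1.
have mg' : measurable_fun setT g' by apply: continuous_measurable; exact: hg'.1.
have mb' : measurable_fun setT b' by apply: continuous_measurable; exact: hb'.1.
have mF : measurable_fun setT (fun q : TG * R => F q.1 q.2).
  exact: (measurableT_comp mg (measurableT_comp measurable_drifted me)).
have mF' : measurable_fun setT (fun q : TG * R => F' q.1 q.2).
  apply: measurable_funM; first exact: (measurableT_comp mg' (measurableT_comp measurable_drifted me)).
  apply: measurable_funM; first exact: (measurable_tangent hb hb' h y0 (Z := fun j (q : TG * R) => z q.1 q.2 j)).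
  by apply: measurable_funD => //; apply: measurable_funM => //; exact: measurableT_comp mb' me.
have [] := @gspan_decoupling _ _ _ _ _ _ hB k Z' W hZ' hW orth Wpos (fun q : TG * R => q.2 * F q.1 q.2) C0 C0 _ C00 C00.
- by apply: measurable_funM => //; exact: measurable_snd.
- move=> w x; rewrite normrM mulrC.
  apply: le_trans (ler_wpM2r (normr_ge0 _) (hg.2 _)) _.
  have e : `|x| ^+ 2 = x ^+ 2 by rewrite -normrX ger0_norm// sqr_ge0.
  have i : 0 <= 1 + `|x| ^+ 2 - `|x| by have := sqr_ge0 (`|x| - 1); have := normr_ge0 x; nra.
  by rewrite -e; have := mulr_ge0 C00 i; lra.
move=> _ _ h1.
have [] := @gspan_decoupling _ _ _ _ _ _ hB k Z' W hZ' hW orth Wpos (fun q : TG * R => F' q.1 q.2) K 0 mF' K0 (lexx 0).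
  by move=> w x; rewrite mul0r addr0.
move=> iF' iF'' h2.
have zW w j : z w (W w) j = Z j w by rewrite /z /Z' subrK.
have zWf w : z w (W w) = Z ^~ w by apply/funext => j; exact: zW.
transitivity (\int[P]_w (W w * F w (W w))).
  by apply: Rint_eq => w; rewrite /F zWf mulrC.
rewrite [LHS]h1.
transitivity (\int[P]_w (v * \int[gauss 0 (Num.sqrt v)]_x F' w x)).
  apply: Rint_eq => w.
  have sv : Num.sqrt v != 0 by rewrite gt_eqF// sqrtr_gt0.
  have [_] := gauss_ibp 0 sv (dF w) (cF' w) (F'b w).
  rewrite sqr_sqrtr ?(ltW v0)// => <-.
  by apply: Rint_eq => x; rewrite subr0.
transitivity (v * \int[P]_w F' w (W w)).
  by rewrite h2 RintZ//; exact: iF''.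
rewrite -RintZ; last exact: iF'.
apply: Rint_eq => w; rewrite /F' zWf.
have -> : tangent b b' h y0 (Z ^~ w) (fun j => gcov P (Z j) W) k = v * tangent b b' h y0 (Z ^~ w) c k.
  rewrite -tangentZ; congr tangent; apply/funext => j.
  by rewrite /c; field; rewrite gt_eqF.
by rewrite -/(E w) /p; ring.
Qed.

End euler_gaussian.

(** * Local expansion of one Euler step *)

Section one_step.
Context {R : realType}.

Lemma is_derive_MVT_near (f df : R -> R) (C a b : R) :
  (forall x, is_derive x (1 : R) f (df x)) ->
  (forall x, `|x - a| <= `|b - a| -> `|df x| <= C) -> `|f b - f a| <= C * `|b - a|.
Proof.
move=> hf hC.
have cf : continuous f by exact: is_derive_continuous hf.
case: (leP a b) => [ab|/ltW ba].
  have [|c] := @MVT_segment _ f df a b ab; first exact: continuous_subspaceT.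
  rewrite in_itv/= => /andP[ac cb] ->; rewrite normrM ler_wpM2r//.
  by apply: hC; rewrite !ger0_norm; lra.
have [|c] := @MVT_segment _ f df b a ba; first exact: continuous_subspaceT.
rewrite in_itv/= => /andP[bc ca] e; rewrite distrC e (distrC b a) normrM ler_wpM2r//.
by apply: hC; rewrite !ler0_norm; lra.
Qed.

Variables (h : R) (w w' w'' : R -> R) (C0 S1 S2 mu0 mu1 : R).
Hypothesis h0 : 0 < h.
Hypotheses (dw : forall x, is_derive x (1 : R) w (w' x)) (dw' : forall x, is_derive x (1 : R) w' (w'' x)).
Hypotheses (hw : cbdd C0 w) (hw' : cbdd S1 w') (hw'' : cbdd S2 w'').
Hypothesis mod2 : forall x y, `|w'' x - w'' y| <= mu0 + mu1 * `|x - y|.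
Hypothesis mu1_ge0 : 0 <= mu1.

Lemma taylor2 q x : `|w (q + x) - w q - w' q * x| <= S2 * x ^+ 2.
Proof.
have dg y : is_derive y (1 : R) (fun y => w (q + y) - w' q * y) (w' (q + y) - w' q).
  have d1 := is_derive_shift (dw (q + y)).
  have d2 := is_deriveZ (w' q) (is_derive_id y (1 : R)).
  by have := is_deriveB d1 d2; rewrite /GRing.scale/= mulr1.
have S20 : 0 <= S2 by apply: le_trans (hw''.2 0).
have := @is_derive_MVT_near _ _ (S2 * `|x|) 0 x dg.
rewrite mulr0 addr0 !subr0 -mulrA -expr2 -normrX (ger0_norm (sqr_ge0 x)).
have -> : w (q + x) - w' q * x - w q = w (q + x) - w q - w' q * x by ring.
apply=> y; rewrite subr0 => yx.
apply: le_trans (is_derive_MVT q (q + y) dw' hw''.2) _.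
by rewrite addrAC subrr add0r ler_wpM2l.
Qed.

(** Interpolation in the noise amplitude [rho]: by Stein's identity the derivative of [psi] is
    [rho h] times the mean of [w'' (q + rho x) - w'' q], so the modulus of [w''] replaces a third
    derivative. *)
Lemma heat_expansion q : `|heat h w q - w q - h / 2 * w'' q| <= h * (mu0 + mu1 * Num.sqrt h).
Proof.
have sh : Num.sqrt h != 0 by rewrite gt_eqF// sqrtr_gt0.
set g := gauss 0 (Num.sqrt h).
have cl (rho : R) : continuous (fun x : R => q + rho * x).
  by move=> x; apply: cvgD; [exact: cvg_cst|apply: cvgM; [exact: cvg_cst|exact: cvg_id]].
have cc (f : R -> R) (rho : R) : continuous f -> continuous (fun x => f (q + rho * x)).
  by move=> cf x; apply: (@continuous_comp _ _ _ (fun x => q + rho * x) f); [exact: cl|exact: cf].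
have bw (f : R -> R) C rho : cbdd C f -> rint g (fun x => f (q + rho * x)).
  move=> [cf bf]; apply: (@rint_bounded _ _ _ _ C) => //; apply: continuous_measurable; exact: cc.
have ig : rint g (fun x => x) by exact: gauss_id.
have ia : rint g (fun x => `|x|) by exact: rint_abs.
have dl (x y : R) : is_derive y (1 : R) (fun rho => q + rho * x) x.
  have := is_deriveD (is_derive_cst q y 1) (is_deriveZ x (is_derive_id y (1 : R))).
  rewrite add0r /GRing.scale/= mulr1; congr is_derive.
  by apply/funext => z/=; rewrite [z * _]mulrC.
have dpsi (rho : R) : is_derive rho (1 : R) (fun rho => \int[g]_x w (q + rho * x)) (\int[g]_x (x * w' (q + rho * x))).
  apply: (is_derive_integral (P := g) (f := fun rho x => w (q + rho * x))
     (f' := fun rho x => x * w' (q + rho * x)) (g := fun x => S1 * `|x|)).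
  - by move=> r; exact: bw hw.
  - by move=> r x; have := is_derive1_comp (dw _) (dl x r); rewrite mulrC.
  - exact: rintZ.
  - move=> r x _; rewrite normrM mulrC ler_wpM2r//; exact: hw'.2.
have ibp (rho : R) : \int[g]_x (x * w' (q + rho * x)) = rho * h * \int[g]_x w'' (q + rho * x).
  have dx (x : R) : is_derive x (1 : R) (fun x => w' (q + rho * x)) (rho * w'' (q + rho * x)).
    have d1 := is_deriveD (is_derive_cst q x 1) (is_deriveZ rho (is_derive_id x (1 : R))).
    rewrite add0r /GRing.scale/= mulr1 in d1.
    by have := is_derive1_comp (dw' _) d1; rewrite mulrC.
  have c2 : continuous (fun x => rho * w'' (q + rho * x)).
    by move=> x; apply: cvgM; [exact: cvg_cst|exact: (cc _ _ hw''.1)].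
  have b2 x : `|rho * w'' (q + rho * x)| <= `|rho| * S2 by rewrite normrM ler_wpM2l//; exact: hw''.2.
  have [_] := gauss_ibp 0 sh dx c2 b2.
  under Rint_eq do rewrite subr0.
  move=> ->.
  rewrite sqr_sqrtr ?(ltW h0)// RintZ; last exact: bw hw''.
  by ring.
pose psi rho := \int[g]_x w (q + rho * x) - h / 2 * w'' q * rho ^+ 2.
have dp (rho : R) : is_derive rho (1 : R) psi (rho * h * \int[g]_x (w'' (q + rho * x) - w'' q)).
  have d2 : is_derive rho (1 : R) (fun r => h / 2 * w'' q * r ^+ 2) (h * w'' q * rho).
    have -> : (fun r : R => h / 2 * w'' q * r ^+ 2) = (fun r => (h / 2 * w'' q) *: (r * r)).
      by apply/funext => r; rewrite expr2.
    have d := is_deriveZ (h / 2 * w'' q) (is_deriveM (is_derive_id rho (1 : R)) (is_derive_id rho (1 : R))).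
    by apply: (is_derive_eq d); rewrite /GRing.scale/= mulr1; field.
  have := is_deriveB (dpsi rho) d2; congr is_derive.
  rewrite ibp RintB; [|exact: bw hw''|exact: rint_cst].
  by rewrite Rint_cst; ring.
have mu00 : 0 <= mu0 by have := mod2 0 0; rewrite !subrr normr0 mulr0 addr0.
have := @is_derive_MVT_near _ _ (h * (mu0 + mu1 * Num.sqrt h)) 0 1 dp.
have -> : psi 1 - psi 0 = heat h w q - w q - h / 2 * w'' q.
  rewrite /psi expr1n expr0n/= mulr0 subr0 mulr1.
  under [X in _ - X]Rint_eq do rewrite mul0r addr0.
  rewrite Rint_cst /heat; under [X in X - _ - _ = _]Rint_eq do rewrite mul1r.
  by rewrite -/g; ring.
rewrite !subr0 normr1 mulr1; apply=> rho; rewrite subr0 => r1.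
rewrite normrM normrM (ger0_norm (ltW h0)).
have B1 : `|\int[g]_x (w'' (q + rho * x) - w'' q)| <= mu0 + mu1 * Num.sqrt h.
  have iq : rint g (fun x => mu0 + mu1 * `|x|) by apply: rintD; [exact: rint_cst|exact: rintZ].
  apply: (@le_trans _ _ (\int[g]_x (mu0 + mu1 * `|x|))).
    apply: Rint_abs_le => //.
      by apply: rintB; [exact: bw hw''|exact: rint_cst].
    move=> x; apply: le_trans (mod2 _ _) _; rewrite lerD2l ler_wpM2l//.
    by rewrite addrAC subrr add0r normrM ler_piMl.
  rewrite RintD; [|exact: rint_cst|exact: rintZ].
  rewrite Rint_cst RintZ// lerD2l ler_wpM2l//; exact: gauss_abs.
have I0 := normr_ge0 (\int[g]_x (w'' (q + rho * x) - w'' q)).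
have rh : `|rho| * h <= h by rewrite ler_piMl// ltW.
apply: ler_pM => //; rewrite mulr_ge0// ltW//.
Qed.

End one_step.

Section weak_step.
Context d (T : measurableType d) (R : realType) (P : probability T R).
Variables (H : R) (B : R -> T -> R).
Hypothesis hB : is_fbm P H B.
Variables (b b' : R -> R) (b0 L : R).
Hypotheses (db : forall x, is_derive x (1 : R) b (b' x)) (hb : cbdd b0 b) (hb' : cbdd L b').
Variables (h y0 : R).
Hypothesis h0 : 0 < h.
Variables (Z : nat -> T -> R) (k : nat) (W : T -> R).
Hypothesis hZ : forall i, gspan B (Z i).
Hypothesis hW : gspan B W.
Hypothesis Wpos : 0 < gcov P W W.
Hypothesis cov_ge0 : forall j, 0 <= gcov P (Z j) W.
Variables (w w' w'' : R -> R) (C0 S1 S2 mu0 mu1 : R).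
Hypotheses (dw : forall x, is_derive x (1 : R) w (w' x)) (dw' : forall x, is_derive x (1 : R) w' (w'' x)).
Hypotheses (hw : cbdd C0 w) (hw' : cbdd S1 w') (hw'' : cbdd S2 w'').
Hypothesis mod2 : forall x y, `|w'' x - w'' y| <= mu0 + mu1 * `|x - y|.
Hypothesis mu1_ge0 : 0 <= mu1.

Let E o := euler b h y0 (Z ^~ o) k.
Let p o := drifted b h (E o).
Let v := gcov P W W.
Let kap := \sum_(j < k) gcov P (Z j) W.
Let J := (1 + h * L) ^+ k.+1 * (h * L * (2 * \sum_(j < k) (k - j)%:R * gcov P (Z j) W)).

(** Both sides are expanded around [q = drifted p]. The term quadratic in [W] is only bounded, by
    [S2 v]; in the application [v = h ^ (2 H)] is small against [h]. The linear term [w' (p) W] does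
    not average out, since [W] is correlated with the past: [euler_ibp] turns it into [w'' (p) A]
    with [A] equal to [kap] up to [J], and this is compared with the Brownian [h / 2 * w'' (p)]. *)
Lemma weak_step :
  `|\int[P]_o w (drifted b h (p o + W o)) - \int[P]_o heat h (fun y => w (drifted b h y)) (p o)|
  <= S1 * h * L * (Num.sqrt v + Num.sqrt h) + S2 * (v + h * b0 * Num.sqrt v) +
     S2 * (`|kap - h / 2| + J) + h * (mu0 + mu1 * Num.sqrt h) + h / 2 * (mu0 + mu1 * (h * b0)).
Proof.
have h00 := ltW h0.
have L0 : 0 <= L by apply: le_trans (hb'.2 0).
have b00 : 0 <= b0 by apply: le_trans (hb.2 0).
have S10 : 0 <= S1 by apply: le_trans (hw'.2 0).
have S20 : 0 <= S2 by apply: le_trans (hw''.2 0).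
have mE : measurable_fun setT E := measurable_eulerZ hB hb h y0 k hZ.
have mp : measurable_fun setT p := measurable_p hB db hb h y0 k hZ.
have mW : measurable_fun setT W := gspan_measurable hB hW.
have iW := gspan_rint hB hW.
have iW2 := gspan_sq hB hW.
have mc (f : R -> R) (X : T -> R) : continuous f -> measurable_fun setT X -> measurable_fun setT (fun o => f (X o)).
  by move=> cf mX; exact: measurableT_comp (continuous_measurable cf) mX.
have cd : continuous (drifted b h) := is_derive_continuous (drifted_derive db h).
pose g y := w (drifted b h y).
have hg : cbdd C0 g by exact: cbdd_comp.
pose q o := drifted b h (p o).
have mq : measurable_fun setT q by exact: mc.
set A := fun o => tangent b b' h y0 (Z ^~ o) (fun j => gcov P (Z j) W) k * (1 + h * b' (E o)).
have mA : measurable_fun setT A.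
  apply: measurable_funM.
    apply: (measurable_tangent hb hb' h y0 (Z := Z)) => j _; exact (gspan_measurable hB (hZ j)).
  by apply: measurable_funD => //; apply: measurable_funM => //; exact: mc hb'.1 mE.
have Ab o : `|A o - h / 2| <= `|kap - h / 2| + J.
  have -> : A o - h / 2 = (kap - h / 2) + (A o - kap) by ring.
  apply: le_trans (ler_normD _ _) _; rewrite lerD2l.
  by apply: (jacobian_sum b hb' y0 h0) => //; exact: hb'.2.
have IBP : \int[P]_o (w' (p o) * W o) = \int[P]_o (w'' (p o) * A o).
  exact: (euler_ibp hB db hb hb' y0 h0 k hZ hW Wpos dw' hw' hw'').
have mw'p : measurable_fun setT (fun o => w' (p o)) by exact: mc hw'.1 mp.
have mw''p : measurable_fun setT (fun o => w'' (p o)) by exact: mc hw''.1 mp.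
have iX1 : rint P (fun o => g (p o + W o)).
  apply: (@rint_bounded _ _ _ _ C0); last by move=> o; exact: hg.2.
  by apply: mc hg.1 _; exact: measurable_funD.
have hhg := heat_cbdd h hg.
have iX2 : rint P (fun o => heat h g (p o)).
  apply: (@rint_bounded _ _ _ _ C0); last by move=> o; exact: hhg.2.
  exact: mc hhg.1 mp.
have iX3 : rint P (fun o => w' (p o) * W o).
  apply: (rint_le (g := fun o => S1 * `|W o|)); first exact: measurable_funM.
    by apply: rintZ; exact: rint_abs.
  by move=> o; rewrite normrM ler_wpM2r//; exact: hw'.2.
have iX4 : rint P (fun o => h / 2 * w'' (p o)).
  apply: rintZ; apply: (@rint_bounded _ _ _ _ S2) => //; move=> o; exact: hw''.2.
have iX5 : rint P (fun o => w'' (p o) * (A o - h / 2)).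
  apply: (@rint_bounded _ _ _ _ (S2 * (`|kap - h / 2| + J))).
    by apply: measurable_funM => //; exact: measurable_funB.
  by move=> o; rewrite normrM; apply: ler_pM => //; exact: hw''.2.
have I45 : \int[P]_o (w'' (p o) * A o) = \int[P]_o (h / 2 * w'' (p o)) + \int[P]_o (w'' (p o) * (A o - h / 2)).
  by rewrite -RintD//; apply: Rint_eq => o; ring.
have B5 : `|\int[P]_o (w'' (p o) * (A o - h / 2))| <= S2 * (`|kap - h / 2| + J).
  apply: Rint_abs_leC; first exact: rint_measurable iX5.
  by move=> o; rewrite normrM; apply: ler_pM => //; exact: hw''.2.
pose e0 := h * (mu0 + mu1 * Num.sqrt h) + h / 2 * (mu0 + mu1 * (h * b0)) + S1 * h * L * Num.sqrt h.
pose Q o := (S1 * h * L + S2 * h * b0) * `|W o| + (S2 * W o ^+ 2 + e0).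
have iQ1 : rint P (fun o => (S1 * h * L + S2 * h * b0) * `|W o|) by apply: rintZ; exact: rint_abs.
have iQ2 : rint P (fun o => S2 * W o ^+ 2) by exact: rintZ.
have iQ3 : rint P (fun o => S2 * W o ^+ 2 + e0) by apply: rintD => //; exact: rint_cst.
have iQ : rint P Q by exact: rintD.
have lipw y z : `|w y - w z| <= S1 * `|y - z|.
  by apply: (is_derive_MVT z y dw); exact: hw'.2.
have lipb y z : `|b y - b z| <= L * `|y - z|.
  by apply: (is_derive_MVT z y db); exact: hb'.2.
have lipd x y : `|w (drifted b h (x + y)) - w (drifted b h x + y)| <= S1 * h * L * `|y|.
  apply: le_trans (lipw _ _) _.
  have -> : drifted b h (x + y) - (drifted b h x + y) = h * (b (x + y) - b x) by rewrite /drifted; ring.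
  rewrite normrM (ger0_norm h00) -!mulrA ler_wpM2l// ler_wpM2l//.
  by apply: le_trans (lipb _ _) _; rewrite addrAC subrr add0r.
have qp o : `|q o - p o| <= h * b0.
  rewrite /q {1}/drifted addrAC subrr add0r normrM (ger0_norm h00) ler_wpM2l//; exact: hb.2.
have key o : `|(g (p o + W o) - heat h g (p o)) - (w' (p o) * W o - h / 2 * w'' (p o))| <= Q o.
  have t1 := lipd (p o) (W o); rewrite -/(q o) in t1.
  have t2 := taylor2 dw dw' hw'' (q o) (W o).
  have t3 : `|(w' (q o) - w' (p o)) * W o| <= S2 * h * b0 * `|W o|.
    rewrite normrM ler_wpM2r// -mulrA; apply: le_trans (is_derive_MVT _ _ dw' hw''.2) _.
    by rewrite ler_wpM2l.
  have t4 : `|h / 2 * (w'' (p o) - w'' (q o))| <= h / 2 * (mu0 + mu1 * (h * b0)).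
    rewrite normrM ger0_norm; last by rewrite divr_ge0.
    rewrite ler_wpM2l ?divr_ge0//; apply: le_trans (mod2 _ _) _.
    by rewrite lerD2l ler_wpM2l// distrC.
  have t5 := heat_expansion h0 dw dw' hw hw' hw'' mod2 mu1_ge0 (q o).
  have t6 : `|heat h w (q o) - heat h g (p o)| <= S1 * h * L * Num.sqrt h.
    rewrite distrC /heat -RintB; [|exact: rint_heat hg|exact: rint_heat hw].
    have ia : rint (gauss 0 (Num.sqrt h)) (fun x : R => `|x|) by apply: rint_abs; exact: gauss_id.
    apply: (@le_trans _ _ (\int[gauss 0 (Num.sqrt h)]_x (S1 * h * L * `|x|))).
      apply: Rint_abs_le; [|exact: rintZ|by move=> x; exact: lipd].
      by apply: rintB; [exact: rint_heat hg|exact: rint_heat hw].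
    by rewrite RintZ// ler_wpM2l ?mulr_ge0//; exact: gauss_abs.
  have -> : (g (p o + W o) - heat h g (p o)) - (w' (p o) * W o - h / 2 * w'' (p o)) =
    (w (drifted b h (p o + W o)) - w (q o + W o)) + (w (q o + W o) - w (q o) - w' (q o) * W o) +
    (w' (q o) - w' (p o)) * W o + h / 2 * (w'' (p o) - w'' (q o)) -
    (heat h w (q o) - w (q o) - h / 2 * w'' (q o)) + (heat h w (q o) - heat h g (p o)).
    by rewrite /g; ring.
  rewrite /Q /e0; move: t1 t2 t3 t4 t5 t6; rewrite !ler_norml.
  do 6 (move=> /andP[? ?]); apply/andP; split; lra.
have EW : \int[P]_o `|W o| <= Num.sqrt v.
  by rewrite /v -gcov_sq; apply: Rint_abs_sq.
have EQ : \int[P]_o Q o <= (S1 * h * L + S2 * h * b0) * Num.sqrt v + (S2 * v + e0).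
  rewrite /Q RintD// RintZ//; last exact: rint_abs.
  rewrite RintD//; last exact: rint_cst.
  rewrite RintZ// Rint_cst gcov_sq lerD2r ler_wpM2l//.
  by rewrite addr_ge0// !mulr_ge0.
have iD : rint P (fun o => (g (p o + W o) - heat h g (p o)) - (w' (p o) * W o - h / 2 * w'' (p o))).
  by apply: rintB; exact: rintB.
have := le_trans (Rint_abs_le iD iQ key) EQ.
rewrite RintB; [|exact: rintB..]; rewrite !RintB// IBP I45.
rewrite -[\int[P]_o w _]/(\int[P]_o g (p o + W o)).
move: B5; rewrite /e0; set I5 := \int[P]_o (w'' (p o) * _); set I4 := \int[P]_o (h / 2 * _).
set X1 := \int[P]_o g _; set X2 := \int[P]_o heat _ _ _.
rewrite !ler_norml => /andP[? ?] /andP[? ?]; apply/andP; split; lra.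
Qed.

End weak_step.

(** * Covariances of fractional Brownian increments *)

Section power_increments.
Context {R : realType}.

Lemma ln_le_sub1 (x : R) : 0 < x -> ln x <= x - 1.
Proof. by move=> x0; have := expR_ge1Dx (ln x); rewrite lnK//; lra. Qed.

(** This is [1 - expR (- u) <= u] with [u = q ln (y / x)]. All factors [2 H - 1] in the rate
    originate from the [q] gained here. *)
Lemma powR_sub_le (q x y : R) : 0 < x -> 0 < y -> y `^ q - x `^ q <= q * ln (y / x) * y `^ q.
Proof.
move=> x0 y0.
have -> : x `^ q = y `^ q * expR (- (q * ln (y / x))).
  rewrite /powR !gt_eqF// -expRD; congr expR; rewrite ln_div//; ring.
have := expR_ge1Dx (- (q * ln (y / x))); have := powR_gt0 q y0; nra.
Qed.

Lemma powR_le (p x y : R) : 0 <= p -> 0 <= x -> x <= y -> x `^ p <= y `^ p.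
Proof.
by move=> p0 x0 xy; apply: ge0_ler_powR; rewrite ?nnegrE//; exact: le_trans xy.
Qed.

Variable q : R.
Hypotheses (q0 : 0 <= q) (q1 : q <= 1).

Lemma powR_le1D (x : R) : 0 <= x -> x `^ q <= 1 + x.
Proof.
move=> x0; case: (leP x 1) => x1.
  by have := powR_le q0 x0 x1; rewrite powR1; lra.
apply: (@le_trans _ _ (x `^ 1)); first by rewrite ler_powR// ltW.
by rewrite powRr1//; lra.
Qed.

Lemma powR_incr (x y : R) : 0 < x -> x <= y -> 0 <= x * (y `^ q - x `^ q) <= q * (y - x) * (1 + y).
Proof.
move=> x0 xy; have y0 : 0 < y by lra.
apply/andP; split.
  by rewrite mulr_ge0 ?(ltW x0)// subr_ge0; apply: powR_le => //; exact: ltW.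
have := powR_sub_le q x0 y0.
have l1 : ln (y / x) <= (y - x) / x.
  have := ln_le_sub1 (divr_gt0 y0 x0); have -> // : y / x - 1 = (y - x) / x.
  by field; rewrite gt_eqF.
have yq : 0 <= y `^ q <= 1 + y by rewrite powR_ge0 powR_le1D// ltW.
move=> /(ler_wpM2l (ltW x0)) h1; apply: le_trans h1 _.
case/andP: yq => yq0 yq1.
apply: (@le_trans _ _ (x * (q * ((y - x) / x) * y `^ q))).
  by rewrite ler_wpM2l ?(ltW x0)// ler_wpM2r// ler_wpM2l.
have -> : x * (q * ((y - x) / x) * y `^ q) = q * (y - x) * y `^ q by field; rewrite gt_eqF.
by rewrite ler_wpM2l// mulr_ge0//; lra.
Qed.

(** For large [x] the logarithm in [powR_sub_le] is bounded by [x]; near 0 it is exchanged for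
    [1 / sqrt x], whose grid sums are controlled by [singular_sum]. *)
Lemma powR_dist1 (x : R) : 0 < x -> `|x `^ q - 1| <= q * (x ^+ 2 + 2 / Num.sqrt x).
Proof.
move=> x0; have s0 : 0 < Num.sqrt x by rewrite sqrtr_gt0.
have i0 : 0 <= 2 / Num.sqrt x by rewrite divr_ge0 ?ltW.
have x2 : 0 <= x ^+ 2 by exact: sqr_ge0.
case: (leP 1 x) => x1.
  have xq : 1 <= x `^ q <= x.
    apply/andP; split.
      by have := powR_le q0 ler01 x1; rewrite powR1.
    by rewrite -[leRHS](powRr1 (ltW x0)) ler_powR.
  case/andP: xq => xq1 xq2.
  rewrite ger0_norm ?subr_ge0//.
  have := powR_sub_le q ltr01 x0; rewrite powR1 divr1 => h; apply: le_trans h _.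
  have l1 := ln_le_sub1 x0; have l0 : 0 <= ln x by exact: ln_ge0.
  rewrite -mulrA ler_wpM2l//; apply: (@le_trans _ _ (x * x)); last by rewrite -expr2; lra.
  by apply: ler_pM => //; lra.
have xq : x `^ q <= 1.
  by have := powR_le q0 (ltW x0) (ltW x1); rewrite powR1.
rewrite ler0_norm ?subr_le0// opprB.
have := powR_sub_le q x0 ltr01; rewrite powR1 mulr1 => h; apply: le_trans h _.
rewrite ler_wpM2l//.
(* [ln (1 / x) = 2 ln (1 / sqrt x)]; a direct bound of [ln (1 / x)] by [1 / x] would have unbounded
   grid sums. *)
have -> : 1 / x = (Num.sqrt x)^-1 ^+ 2 by rewrite exprVn sqr_sqrtr ?ltW// div1r.
rewrite lnXn ?invr_gt0// mulr2n.
have := ln_le_sub1 (_ : 0 < (Num.sqrt x)^-1); rewrite invr_gt0 => /(_ s0).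
move: i0; lra.
Qed.

End power_increments.

Lemma powR_midconvex {R : realType} (p x y : R) : 1 <= p -> 0 <= x -> 0 <= y ->
  2 * ((x + y) / 2) `^ p <= x `^ p + y `^ p.
Proof.
move=> p1 x0 y0.
have h : (2^-1 * x + (1 - 2^-1) * y) `^ p <= 2^-1 * x `^ p + (1 - 2^-1) * y `^ p.
  by apply: (convex_powR p1 (Itv01 _ _)) => //=;
    rewrite ?inE/= ?in_itv/= ?x0 ?y0// ?invr_ge0// invf_le1 ?ler1n.
have e : 2^-1 * x + (1 - 2^-1) * y = (x + y) / 2 by field.
by rewrite e in h; lra.
Qed.

Section grid_covariance.
Context {R : realType}.
Variables (H h : R).
Hypotheses (H1 : 2^-1 <= H) (H2 : H < 1) (h0 : 0 < h).

Let q := 2 * H - 1.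
Let gp (l : nat) : R := (l%:R * h) `^ (2 * H).
Let up (l : nat) : R := (l%:R * h) `^ q.
(** For [l >= 1], the covariance of two increments [l] steps apart: half of a second difference of
    [u ^ (2 H)], nonnegative by convexity. *)
Let kap (l : nat) : R := 2^-1 * (gp l.+1 - 2 * gp l + gp l.-1).

Lemma grid_kap_ge0 l : (0 < l)%N -> 0 <= kap l.
Proof.
case: l => // l _; rewrite /kap /gp/= mulr_ge0//.
have p1 : 1 <= 2 * H by move: H1; lra.
have := powR_midconvex p1 (x := l.+2%:R * h) (y := l%:R * h).
have -> : (l.+2%:R * h + l%:R * h) / 2 = l.+1%:R * h.
  by rewrite -[l.+2%:R]natr1 -[l.+1%:R]natr1; field.
move=> hh; have := hh _ _; rewrite !mulr_ge0 ?(ltW h0)// => /(_ isT isT); lra.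
Qed.

Let gp0 : gp 0 = 0.
Proof. by rewrite /gp mul0r powR0//; move: H1 => ?; apply/eqP; lra. Qed.

Let gpE l : gp l = l%:R * h * up l.
Proof.
case: l => [|l]; first by rewrite gp0 mul0r mul0r.
have l0 : 0 < l.+1%:R * h by rewrite mulr_gt0.
rewrite /gp /up -{2}[_ * h](powRr1 (ltW l0)) -powRD ?(gt_eqF l0) ?implybT//.
by congr (_ `^ _); rewrite /q; ring.
Qed.

(** Second differences telescope to a first difference, so the total covariance of an increment with
    its whole past is explicit; [gp 1] is the variance of one increment. *)
Lemma grid_kap_sum k : \sum_(j < k) kap (k - j) = 2^-1 * (gp k.+1 - gp k - gp 1).
Proof.
rewrite (reindex_inj rev_ord_inj)/=.
under eq_bigr => j _ do rewrite subKn ?ltn_ord//.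
elim: k => [|k ih]; first by rewrite big_ord0 gp0; ring.
by rewrite big_ord_recr/= ih /kap/=; ring.
Qed.

Lemma grid_kap_weighted k : \sum_(j < k) (k - j)%:R * kap (k - j) = 2^-1 * (k%:R * (gp k.+1 - gp k) - gp k).
Proof.
rewrite (reindex_inj rev_ord_inj)/=.
under eq_bigr => j _ do rewrite subKn ?ltn_ord//.
elim: k => [|k ih]; first by rewrite big_ord0 gp0; ring.
by rewrite big_ord_recr/= ih /kap/= -natr1; ring.
Qed.

Let q0 : 0 <= q. Proof. by rewrite /q; move: H1; lra. Qed.
Let q1 : q <= 1. Proof. by rewrite /q; move: H2; lra. Qed.

Let up_incr k : 0 <= k%:R * h * (up k.+1 - up k) <= q * h * (1 + k.+1%:R * h).
Proof.
case: k => [|k].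
  by rewrite mul0r mul0r lexx/= mulr_ge0 ?mulr_ge0 ?(ltW h0)// addr_ge0// mulr_ge0// ltW.
have k0 : 0 < k.+1%:R * h by rewrite mulr_gt0.
have kk : k.+1%:R * h <= k.+2%:R * h by rewrite ler_wpM2r ?(ltW h0)// ler_nat.
have := powR_incr q0 q1 k0 kk.
by have -> : k.+2%:R * h - k.+1%:R * h = h by rewrite -[k.+2%:R]natr1; ring.
Qed.

(** The weighted sum is half of [k + 1] times [t_k (t_(k+1) ^ q - t_k ^ q)], to which [powR_incr]
    gives a factor [q h]: the correction by the tangent flow is again of order [2 H - 1]. *)
Lemma grid_kap_weighted_le k (t : R) : k.+1%:R * h <= t ->
  \sum_(j < k) (k - j)%:R * kap (k - j) <= q * (t * (1 + t)).
Proof.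
move=> kt; rewrite grid_kap_weighted !gpE.
have /andP[a1 a2] := up_incr k.
have k0 : 0 <= k.+1%:R * h by rewrite mulr_ge0 ?(ltW h0).
have e : k%:R * (k.+1%:R * h * up k.+1 - k%:R * h * up k) - k%:R * h * up k =
   k.+1%:R * (k%:R * h * (up k.+1 - up k)) by rewrite -natr1; ring.
rewrite e; apply: (@le_trans _ _ (k.+1%:R * (k%:R * h * (up k.+1 - up k)))).
  have := mulr_ge0 (ler0n R k.+1) a1; lra.
apply: (@le_trans _ _ (k.+1%:R * (q * h * (1 + k.+1%:R * h)))); first by rewrite ler_wpM2l.
have -> : k.+1%:R * (q * h * (1 + k.+1%:R * h)) = q * (k.+1%:R * h * (1 + k.+1%:R * h)) by ring.
by rewrite ler_wpM2l//; apply: ler_pM => //; lra.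
Qed.

(** Writing [gp] as [t * t ^ q], the discrete product rule splits the summand into
    [h (t_(k+1) ^ q - 1)] and [t_k (t_(k+1) ^ q - t_k ^ q)], both of order [q]. *)
Lemma grid_variance_sum n (t : R) : n%:R * h <= t ->
  \sum_(k < n) `|gp k.+1 - gp k - h| <= q * (t * t ^+ 2 + 4 * Num.sqrt t + t * (1 + t)).
Proof.
move=> nt; have t0 : 0 <= t by apply: le_trans nt; rewrite mulr_ge0 ?(ltW h0).
apply: (@le_trans _ _ (\sum_(k < n) (q * 2 * (h / Num.sqrt (k.+1%:R * h)) + q * h * (t ^+ 2 + (1 + t))))).
  apply: ler_sum => k _; have kn := ltn_ord k.
  have kt : k.+1%:R * h <= t by apply: le_trans nt; rewrite ler_wpM2r ?(ltW h0)// ler_nat.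
  have k0 : 0 < k.+1%:R * h by rewrite mulr_gt0.
  have -> : gp k.+1 - gp k - h = h * (up k.+1 - 1) + k%:R * h * (up k.+1 - up k).
    by rewrite !gpE -natr1; ring.
  have /andP[a1 a2] := up_incr k.
  apply: le_trans (ler_normD _ _) _; rewrite normrM (ger0_norm a1) (ger0_norm (ltW h0)).
  have := powR_dist1 q0 q1 k0; rewrite -/(up k.+1) => /(ler_wpM2l (ltW h0)) a3.
  have a4 : (k.+1%:R * h) ^+ 2 <= t ^+ 2 by rewrite lerXn2r// nnegrE ltW.
  have a5 : q * h * (1 + k.+1%:R * h) <= q * h * (1 + t) by rewrite ler_wpM2l ?mulr_ge0 ?(ltW h0)//; lra.
  have a6 : q * h * (k.+1%:R * h) ^+ 2 <= q * h * t ^+ 2 by rewrite ler_wpM2l ?mulr_ge0 ?(ltW h0).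
  lra.
rewrite big_split/= -mulr_sumr sumr_const card_ord -mulr_natl.
have s1 := singular_sum h0 n.
have s2 : Num.sqrt (n%:R * h) <= Num.sqrt t by rewrite ler_wsqrtr.
have s3 : q * 2 * (\sum_(k < n) h / Num.sqrt (k.+1%:R * h)) <= q * 2 * (2 * Num.sqrt t).
  by rewrite ler_wpM2l ?mulr_ge0//; lra.
have s4 : n%:R * (q * h * (t ^+ 2 + (1 + t))) <= q * (t * (t ^+ 2 + (1 + t))).
  have -> : n%:R * (q * h * (t ^+ 2 + (1 + t))) = q * (n%:R * h * (t ^+ 2 + (1 + t))) by ring.
  by rewrite ler_wpM2l// ler_wpM2r// addr_ge0 ?sqr_ge0//; lra.
lra.
Qed.

Lemma grid_step_le : gp 1 = h * h `^ q.
Proof. by rewrite gpE mul1r /up mul1r. Qed.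

End grid_covariance.

Section fbm_increments.
Context d (T : measurableType d) (R : realType) (P : probability T R).
Variables (H : R) (B : R -> T -> R).
Hypothesis hB : is_fbm P H B.
Hypotheses (H1 : 2^-1 <= H) (H2 : H < 1).
Variable h : R.
Hypothesis h0 : 0 < h.

Definition bincr (j : nat) (o : T) : R := B (j.+1%:R * h) o - B (j%:R * h) o.

Let t0 (j : nat) : 0 <= j%:R * h. Proof. by rewrite mulr_ge0// ltW. Qed.

Lemma gspan_bincr j : gspan B (bincr j).
Proof. by apply: gspanB; exact: gspan_B. Qed.

Let fbm_gcov (i j : nat) : gcov P (B (i%:R * h)) (B (j%:R * h)) = fbm_covariance H (i%:R * h) (j%:R * h).
Proof. exact: fbm_cov. Qed.

Lemma bincr_cov i l : gcov P (bincr i) (bincr (i + l.+1)) =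
  2^-1 * ((l.+2%:R * h) `^ (2 * H) - 2 * (l.+1%:R * h) `^ (2 * H) + (l%:R * h) `^ (2 * H)).
Proof.
have gB j := gspan_B B (t0 j); have gI := gspan_bincr.
rewrite /bincr (gcovBl hB)//; last exact: gI.
rewrite !(gcovC P (B _)) !(gcovBl hB)// !fbm_gcov /fbm_covariance.
have e (a c m : nat) : a = (c + m)%N -> `|c%:R * h - a%:R * h| = m%:R * h.
  by move=> ->; rewrite distrC natrD mulrDl addrAC subrr add0r ger0_norm.
rewrite (e (i + l.+1).+1 i.+1 l.+1)%N; last by lia.
rewrite (e (i + l.+1) i.+1 l)%N; last by lia.
rewrite (e (i + l.+1).+1 i l.+2)%N; last by lia.
rewrite (e (i + l.+1) i l.+1)%N; last by lia.
by field.
Qed.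

Lemma bincr_cov_ge i j : (i < j)%N -> gcov P (bincr i) (bincr j) =
  2^-1 * (((j - i).+1%:R * h) `^ (2 * H) - 2 * ((j - i)%:R * h) `^ (2 * H) + ((j - i).-1%:R * h) `^ (2 * H)).
Proof. 
move=> ij; have := bincr_cov i (j - i).-1.
have -> : (j - i).-1.+1 = (j - i)%N by lia.
by have -> : (i + (j - i))%N = j by lia.
Qed.

Lemma bincr_var i : gcov P (bincr i) (bincr i) = h `^ (2 * H).
Proof.
have gB j := gspan_B B (t0 j); have gI := gspan_bincr.
rewrite {1}/bincr (gcovBl hB)//.
rewrite !(gcovC P (B _)) /bincr !(gcovBl hB)// !fbm_gcov /fbm_covariance.
rewrite !subrr normr0 powR0; last by move: H1 => ?; apply/eqP; lra.
rewrite ?(distrC (i%:R * h)).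
have -> : i.+1%:R * h - i%:R * h = h by rewrite -natr1; ring.
by rewrite (ger0_norm (ltW h0)); field.
Qed.

(** Increments are positively correlated for [H >= 1/2]; [jacobian_sum] requires a direction with
    nonnegative entries. *)
Lemma bincr_cov_ge0 i j : 0 <= gcov P (bincr i) (bincr j).
Proof.
case: (ltngtP i j) => [ij|ij|->].
- by rewrite bincr_cov_ge//; apply: grid_kap_ge0 => //; lia.
- by rewrite gcovC bincr_cov_ge//; apply: grid_kap_ge0 => //; lia.
- by rewrite bincr_var powR_ge0.
Qed.

End fbm_increments.

(** * Weak error of the Euler scheme *)

Section weak_error.
Context d (T : measurableType d) (R : realType) (P : probability T R).
Variables (H : R) (B B2 : R -> T -> R).
Hypotheses (hB : is_fbm P H B) (hB2 : is_fbm P 2^-1 B2).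
Hypotheses (H1 : 2^-1 <= H) (H2 : H < 1).
Variables (b b' f f' f'' : R -> R) (b0 L F0 F1 F2 : R).
Hypotheses (db : forall x, is_derive x (1 : R) b (b' x)) (hb : cbdd b0 b) (hb' : cbdd L b').
Hypotheses (df : forall x, is_derive x (1 : R) f (f' x)) (df' : forall x, is_derive x (1 : R) f' (f'' x)).
Hypotheses (hf : cbdd F0 f) (hf' : cbdd F1 f') (hf'' : cbdd F2 f'').
Variables (y0 t Tm : R).
Hypotheses (t0 : 0 < t) (tT : t <= Tm).
Variable N : nat.

Let h := t / N.+1%:R.
Let Z := bincr B h.
Let E o k := euler b h y0 (Z ^~ o) k.
Let p o k := drifted b h (E o k).

Let h0 : 0 < h. Proof. by rewrite divr_gt0. Qed.

Let var_gt0 k : 0 < gcov P (Z k) (Z k).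
Proof. by rewrite (bincr_var hB H1 h0) powR_gt0. Qed.

Let gZ i : gspan B (Z i). Proof. exact: gspan_bincr. Qed.

Let mE k : measurable_fun setT (E ^~ k).
Proof. exact (measurable_eulerZ hB hb h y0 k gZ). Qed.

Let mp k : measurable_fun setT (p ^~ k).
Proof. exact (measurable_p hB db hb h y0 k gZ). Qed.

(** For [H = 1/2] the increments are uncorrelated with variance [h], so the backward recursion is
    exact. The Brownian side becomes a deterministic number, and the joint law of the two noises
    never enters. *)
Lemma euler_brownian : H = 2^-1 ->
  \int[P]_o f (E o N.+1) = wval b f h N (drifted b h y0).
Proof.
move=> HE.
have var1 k : gcov P (Z k) (Z k) = h.
  by rewrite (bincr_var hB H1 h0) HE mulfV// powRr1// ltW.
have orth k j : (j < k)%N -> gcov P (Z j) (Z k) = 0.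
  have m0 (m : nat) : 0 <= m%:R * h by rewrite mulr_ge0// ltW.
  move=> jk; rewrite (bincr_cov_ge hB H1 H2 h0 jk) HE mulfV// !powRr1 ?m0//.
  have : (0 < k - j)%N by lia.
  case: (k - j)%N => // m _ /=.
  have -> : m.+2%:R = m%:R + 2 :> R by rewrite -natrD addn2.
  have -> : m.+1%:R = m%:R + 1 :> R by rewrite natr1.
  by field.
have stp k (C : R) (g : R -> R) : cbdd C g ->
    \int[P]_o g (E o k.+1) = \int[P]_o heat h g (p o k).
  move=> hg; have := euler_independent_step hB db hb h y0 gZ (gZ k) (var_gt0 k) (@orth k) hg.
  by rewrite var1.
rewrite (stp _ _ _ hf).
suff a k : (k <= N)%N -> \int[P]_o wval b f h (N - k) (p o k) = wval b f h N (drifted b h y0).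
  by have := a N (leqnn N); rewrite subnn.
elim: k => [|k ih] kN; first by rewrite subn0 -[RHS](Rint_cst P).
apply: (eq_trans _ (ih (ltnW kN))); rewrite -(subnSK kN).
have hg : cbdd F0 (fun y => wval b f h (N - k.+1) (drifted b h y)).
  apply: (@cbdd_comp _ F0 (wval b f h (N - k.+1)) (drifted b h)); last exact: (wval_cbdd hb hf).
  exact: is_derive_continuous (drifted_derive db h).
exact: stp hg.
Qed.

Let q := 2 * H - 1.
Let v := h `^ (2 * H).
(** One quantity dominating every mesh-dependent error. It tends to 0 with the mesh for [H > 1/2]
    only, because of [h ^ q = v / h]. *)
Let rho := Num.sqrt v + Num.sqrt h + h `^ q + h.
Let S1 := sup1 L F1 Tm.
Let S2 := sup2 b0 L F1 F2 Tm.
Let G := S2 * b0 + L * S1.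

(** The part that survives the limit: the first summand comes from [grid_variance_sum], the second
    from the tangent-flow correction through [grid_kap_weighted_le]. *)
Definition weak_const : R := S2 * (2^-1 * (Tm * Tm ^+ 2 + 4 * Num.sqrt Tm + Tm * (1 + Tm)) +
  Tm * (expR (L * Tm) * (L * (2 * (Tm * (1 + Tm)))))).

(** The coefficient of [rho]. It may blow up like [r ^- 2] as [r] tends to 0, which dictates the
    order of the limits. *)
Definition weak_rest (r : R) : R :=
  F1 + Tm * (S1 * L + 2 * S2 + S2 * b0 + (1 + b0) * (G * (2 * Tm / r ^+ 2))) +
  (1 + b0) * (F2 * (2 * Num.sqrt Tm)).

Let kh (k : nat) : (k <= N.+1)%N -> k%:R * h <= Tm.
Proof.
move=> kN; apply: le_trans tT; rewrite /h mulrCA ler_piMr ?(ltW t0)//.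
by rewrite ler_pdivrMr// mul1r ler_nat.
Qed.

Let L0 : 0 <= L. Proof. by apply: le_trans (hb'.2 0). Qed.
Let b00 : 0 <= b0. Proof. by apply: le_trans (hb.2 0). Qed.
Let F10 : 0 <= F1. Proof. by apply: le_trans (hf'.2 0). Qed.
Let F20 : 0 <= F2. Proof. by apply: le_trans (hf''.2 0). Qed.
Let S10 : 0 <= S1. Proof. by rewrite mulr_ge0// expR_ge0. Qed.
Let Tm0 : 0 <= Tm. Proof. by apply: le_trans (ltW t0) tT. Qed.
Let S20 : 0 <= S2.
Proof. by rewrite !mulr_ge0 ?expR_ge0// addr_ge0// !mulr_ge0 ?sqrtr_ge0. Qed.
Let G0 : 0 <= G. Proof. by rewrite addr_ge0// mulr_ge0. Qed.
Let v0 : 0 <= v. Proof. exact: powR_ge0. Qed.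

Let gp (l : nat) : R := (l%:R * h) `^ (2 * H).

(** [weak_step] for the [k]-th increment with [w = wval (N - k.+1)]. The offset [4 G r] of the
    modulus is charged with weights [h] and [h / 2], whence [6 G r]. The term with [F2] is singular
    near the last step and is kept apart, as only its sum over [k] is controlled. *)
Lemma weak_error_step (r : R) k : 0 < r -> (k < N)%N ->
  `|\int[P]_o wval b f h (N - k.+1) (p o k.+1) - \int[P]_o wval b f h (N - k) (p o k)| <=
   S2 / 2 * `|gp k.+1 - gp k - h| +
   h * (S2 * (expR (L * Tm) * (L * (2 * (q * (Tm * (1 + Tm)))))) + 6 * G * r +
       (S1 * L + 2 * S2 + S2 * b0 + (1 + b0) * (G * (2 * Tm / r ^+ 2))) * rho) +
   (1 + b0) * rho * (F2 * (h / Num.sqrt ((N - k.+1).+1%:R * h))).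
Proof.
move=> r0 kN; rewrite -(subnSK kN); set m := (N - k.+1)%N.
have mT : m%:R * h <= Tm by apply: kh; apply: leq_trans (leq_subr _ _) _.
set s := Num.sqrt (m.+1%:R * h).
have s0 : 0 < s by rewrite sqrtr_gt0 mulr_gt0.
set mu0 := G * (4 * r); set mu1 := F2 / s + G * (2 * Tm / r ^+ 2).
have mu10 : 0 <= mu1.
  rewrite addr_ge0 ?divr_ge0 ?(ltW s0)// mulr_ge0// divr_ge0 ?exprn_ge0 ?(ltW r0)//.
  by rewrite mulr_ge0.
have mod2 x y : `|d2wval b b' f' f'' h m x - d2wval b b' f' f'' h m y| <= mu0 + mu1 * `|x - y|.
  have := d2wval_modulus hB2 hb hb' df' hf' hf'' h0 x y mT r0.
  by rewrite -/S1 -/S2 -/G -/s /mu0 /mu1; lra.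
have c2 : cbdd S2 (d2wval b b' f' f'' h m).
  split; first exact: (d2wval_continuous hb hb' hf' hf'' h0).
  by move=> y; exact: (d2wval_bound hB2 hb hb' df' hf' hf'' h0 y mT).
have c1 : cbdd S1 (dwval b b' f' h m).
  by apply: cbddW (dwval_cbdd hb hb' hf' h0 m); exact: (M1_le hb' hf' h0 mT).
have := weak_step hB db hb hb' y0 h0 k gZ (gZ k) (var_gt0 k)
  (fun j => bincr_cov_ge0 hB H1 H2 h0 j k) (wval_derive db hb hb' df hf hf' h0 m)
  (dwval_derive hB2 hb hb' df' hf' hf'' h0 m) (wval_cbdd hb hf h m) c1 c2 mod2 mu10.
rewrite (bincr_var hB H1 h0) -/v.
move=> hs; apply: le_trans hs _.
have covE (j : 'I_k) : gcov P (Z j) (Z k) = 2^-1 * (gp (k - j).+1 - 2 * gp (k - j) + gp (k - j).-1).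
  exact: (bincr_cov_ge hB H1 H2 h0 (ltn_ord j)).
have kapE : \sum_(j < k) gcov P (Z j) (Z k) = 2^-1 * (gp k.+1 - gp k - v).
  under eq_bigr => j _ do rewrite covE.
  by rewrite (grid_kap_sum h H1) mul1r.
have wkE : \sum_(j < k) (k - j)%:R * gcov P (Z j) (Z k) <= q * (Tm * (1 + Tm)).
  under eq_bigr => j _ do rewrite covE.
  by apply: (grid_kap_weighted_le H1 H2 h0); apply: kh; exact: ltnW.
have qTm : 0 <= q * (Tm * (1 + Tm)).
  by apply: mulr_ge0; [rewrite /q; move: H1; lra|rewrite mulr_ge0 ?addr_ge0].
rewrite kapE; set J := (1 + h * L) ^+ k.+1 * _.
have hJ : J <= expR (L * Tm) * (h * L * (2 * (q * (Tm * (1 + Tm))))).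
  have hL : 0 <= h * L by rewrite mulr_ge0// ltW.
  rewrite /J; apply: ler_pM.
  - by rewrite exprn_ge0// addr_ge0.
  - rewrite mulr_ge0// mulr_ge0//; apply: sumr_ge0 => j _.
    by rewrite mulr_ge0// (bincr_cov_ge0 hB H1 H2 h0).
  - have c : cbdd 1 (cst 1 : R -> R) by split => x; [exact: cvg_cst|rewrite normr1].
    have mm : k.+1%:R * h <= Tm by apply: kh; exact: ltnW.
    by have := M1_le hb' c h0 mm; rewrite /M1 /sup1 !mulr1.
  - by rewrite ler_wpM2l// ler_wpM2l.
have hk : `|2^-1 * (gp k.+1 - gp k - v) - h / 2| <= 2^-1 * `|gp k.+1 - gp k - h| + 2^-1 * v.
  have -> : 2^-1 * (gp k.+1 - gp k - v) - h / 2 = 2^-1 * (gp k.+1 - gp k - h) - 2^-1 * v by field.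
  by apply: le_trans (ler_normB _ _) _; rewrite !normrM (ger0_norm v0) gtr0_norm// invr_gt0.
have vE : v = h * h `^ q by have := grid_step_le H1 h0; rewrite mul1r.
have hq0 : 0 <= h `^ q by exact: powR_ge0.
have sv0 := sqrtr_ge0 v; have sh0 := sqrtr_ge0 h; have h00 := ltW h0.
have r1 : Num.sqrt v + Num.sqrt h <= rho by rewrite /rho; lra.
have r2 : h `^ q <= rho by rewrite /rho; lra.
have r3 : Num.sqrt v <= rho by rewrite /rho; lra.
have rho0 : 0 <= rho by lra.
have r4 : Num.sqrt h + h * b0 <= (1 + b0) * rho.
  have : Num.sqrt h <= rho by rewrite /rho; lra.
  have : b0 * h <= b0 * rho by rewrite ler_wpM2l// /rho; lra.
  by lra.
have e1 := ler_wpM2l (mulr_ge0 (mulr_ge0 S10 h00) L0) r1.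
have e2 := ler_wpM2l (mulr_ge0 (mulr_ge0 S20 h00) b00) r3.
have e3 := ler_wpM2l (mulr_ge0 S20 h00) r2.
have e4 := ler_wpM2l (mulr_ge0 h00 mu10) r4.
have e5 := ler_wpM2l S20 hk.
have e6 := ler_wpM2l S20 hJ.
have e7 : h * mu1 = F2 * (h / s) + h * (G * (2 * Tm / r ^+ 2)) by rewrite /mu1; ring.
have e8 : h * mu1 * ((1 + b0) * rho) = (1 + b0) * rho * (F2 * (h / s)) + h * ((1 + b0) * (G * (2 * Tm / r ^+ 2)) * rho).
  by rewrite e7; ring.
have e9 : S2 * v = S2 * h * h `^ q by rewrite vE; ring.
have e10 : 0 <= h * mu1 * (h * b0) by do ?[done|apply: mulr_ge0].
have e11 : 0 <= S2 * h * rho by do ?[done|apply: mulr_ge0].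
rewrite /mu0; move: e1 e2 e3 e4 e5 e6 e8 e9 e10 e11; lra.
Qed.

Lemma weak_error (r : R) : 0 < r ->
  `|\int[P]_o f (E o N.+1) - wval b f h N (drifted b h y0)| <=
    q * weak_const + Tm * (6 * G * r) + weak_rest r * rho.
Proof.
move=> r0; pose a k := \int[P]_o wval b f h (N - k) (p o k).
have a0 : a 0%N = wval b f h N (drifted b h y0).
  by rewrite /a subn0 -[RHS](Rint_cst P).
have aN : a N - a 0%N = \sum_(k < N) (a k.+1 - a k).
  by rewrite -(big_mkord xpredT (fun k => a k.+1 - a k)) telescope_sumr.
have h00 := ltW h0; have q0 : 0 <= q by rewrite /q; move: H1; lra.
have rho0 : 0 <= rho by rewrite !addr_ge0// ?sqrtr_ge0 ?powR_ge0.
(* There are [N.+1] steps and the telescoping sum exchanges [N] of them. For the last one the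
   Lipschitz bound on [f] is enough, since a single step costs an amount vanishing with the mesh. *)
have last : `|\int[P]_o f (E o N.+1) - a N| <= F1 * rho.
  have lipf y z : `|f y - f z| <= F1 * `|y - z|.
    by apply: (is_derive_MVT z y df); exact: hf'.2.
  have mf : measurable_fun setT f by apply: continuous_measurable; exact: hf.1.
  have i1 : rint P (fun o => f (E o N.+1)).
    by apply: (@rint_bounded _ _ _ _ F0) => //; [exact: measurableT_comp mf (mE _)|move=> o; exact: hf.2].
  have hhf := heat_cbdd h hf.
  have i2 : rint P (fun o => wval b f h (N - N) (p o N)).
    rewrite subnn/=; apply: (@rint_bounded _ _ _ _ F0) => //; last by move=> o; exact: hhf.2.
    by apply: measurableT_comp (mp _); apply: continuous_measurable; exact: hhf.1.
  have iZ := gspan_rint hB (gZ N).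
  have i3 : rint P (fun o => F1 * `|Z N o|) by apply: rintZ; exact: rint_abs.
  have i4 : rint P (fun o => F1 * `|Z N o| + F1 * Num.sqrt h) by apply: rintD => //; exact: rint_cst.
  rewrite /a -RintB//; apply: (@le_trans _ _ (\int[P]_o (F1 * `|Z N o| + F1 * Num.sqrt h))).
    apply: Rint_abs_le => //; first exact: rintB.
    move=> o; rewrite subnn/=; rewrite -/(E o N) -/(p o N).
    have -> : f (p o N + Z N o) - heat h f (p o N) =
      (f (p o N + Z N o) - f (p o N)) - (heat h f (p o N) - f (p o N)) by ring.
    apply: le_trans (ler_normB _ _) _; apply: lerD.
      by apply: le_trans (lipf _ _) _; rewrite addrAC subrr add0r.
    rewrite -[f (p o N)](Rint_cst (gauss 0 (Num.sqrt h))) /heat.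
    have ig : rint (gauss 0 (Num.sqrt h)) (fun x : R => `|x|) by apply: rint_abs; exact: gauss_id.
    rewrite -RintB; [|exact: rint_heat hf|exact: rint_cst].
    apply: (@le_trans _ _ (\int[gauss 0 (Num.sqrt h)]_x (F1 * `|x|))).
      apply: Rint_abs_le; [|exact: rintZ|].
        by apply: rintB; [exact: rint_heat hf|exact: rint_cst].
      by move=> x; apply: le_trans (lipf _ _) _; rewrite addrAC subrr add0r.
    by rewrite RintZ// ler_wpM2l//; exact: gauss_abs.
  rewrite RintD//; last exact: rint_cst.
  rewrite RintZ; last exact: rint_abs.
  rewrite Rint_cst -mulrDr ler_wpM2l//.
  have : \int[P]_o `|Z N o| <= Num.sqrt v.
    rewrite /v -(bincr_var hB H1 h0 N) -gcov_sq; apply: Rint_abs_sq; last exact: gspan_sq hB _ (gZ N).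
    exact: rint_measurable iZ.
  by rewrite /rho; have := powR_ge0 h q; lra.
rewrite -a0.
have -> : \int[P]_o f (E o N.+1) - a 0%N = (\int[P]_o f (E o N.+1) - a N) + (a N - a 0%N) by ring.
apply: le_trans (ler_normD _ _) _.
have NT : N%:R * h <= Tm by apply: kh.
pose c1 := S2 * (expR (L * Tm) * (L * (2 * (q * (Tm * (1 + Tm)))))) + 6 * G * r +
       (S1 * L + 2 * S2 + S2 * b0 + (1 + b0) * (G * (2 * Tm / r ^+ 2))) * rho.
have c10 : 0 <= c1.
  have d1 : 0 <= Tm * (1 + Tm) by rewrite mulr_ge0// addr_ge0.
  have d2 : 0 <= (1 + b0) * (G * (2 * Tm / r ^+ 2)).
    have r2 : 0 <= r ^+ 2 by rewrite exprn_ge0// ltW.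
    by do ?[done|rewrite invr_ge0|apply: addr_ge0|apply: mulr_ge0].
  have d3 : 0 <= 6 * G * r by rewrite !mulr_ge0// ltW.
  by rewrite /c1; do ?[done|exact: expR_ge0|apply: addr_ge0|apply: mulr_ge0].
have sum : `|a N - a 0%N| <= S2 / 2 * (q * (Tm * Tm ^+ 2 + 4 * Num.sqrt Tm + Tm * (1 + Tm))) +
   Tm * c1 + (1 + b0) * rho * (F2 * (2 * Num.sqrt Tm)).
  rewrite aN; apply: le_trans (ler_norm_sum _ _ _) _.
  apply: le_trans (ler_sum _ (fun (k : 'I_N) _ => weak_error_step r0 (ltn_ord k))) _.
  rewrite -/c1.
  have -> : \sum_(k < N) (S2 / 2 * `|gp k.+1 - gp k - h| + h * c1 +
      (1 + b0) * rho * (F2 * (h / Num.sqrt ((N - k.+1).+1%:R * h)))) =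
    S2 / 2 * (\sum_(k < N) `|gp k.+1 - gp k - h|) + N%:R * (h * c1) +
      (1 + b0) * rho * (F2 * (\sum_(k < N) h / Num.sqrt ((N - k.+1).+1%:R * h))).
    rewrite !big_split/= sumr_const card_ord -[(h * c1) *+ N]mulr_natl.
    by rewrite [F2 * _]mulr_sumr !mulr_sumr.
  have s1 := grid_variance_sum H1 H2 h0 NT.
  have s2 : \sum_(k < N) h / Num.sqrt ((N - k.+1).+1%:R * h) <= 2 * Num.sqrt Tm.
    apply: le_trans (_ : \sum_(i < N) h / Num.sqrt (i.+1%:R * h) <= _).
      by rewrite [leRHS](reindex_inj rev_ord_inj).
    apply: le_trans (singular_sum h0 N) _.
    by rewrite ler_wpM2l// ler_wsqrtr.
  have e1 := ler_wpM2l (divr_ge0 S20 (ler0n R 2)) s1.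
  have e2 := ler_wpM2l (mulr_ge0 (mulr_ge0 (addr_ge0 ler01 b00) rho0) F20) s2.
  have e3 := ler_wpM2r c10 NT.
  move: e1 e2 e3; rewrite -/q; lra.
move: last sum; rewrite /c1 /weak_rest /weak_const; lra.
Qed.

End weak_error.

(** * Equations with additive noise *)

Section clipped_paths.
Context {R : realType}.
Notation leb := (@lebesgue_measure R).

Lemma uniform_modulus (f : R -> R) (a b e : R) : continuous f -> 0 < e ->
  exists2 delta : R, 0 < delta &
    forall x y, a <= x <= b -> `|x - y| < delta -> `|f x - f y| < e.
Proof.
move=> cf e0; have := @segment_compact R a b; rewrite compact_near_coveringP.
move=> /(_ R (0^'+) (fun delta x => forall y, `|x - y| < delta -> `|f x - f y| < e)).
case.
  move=> x _; have e20 : 0 < e / 2 by rewrite divr_gt0.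
  have /cvgrPdist_lt /(_ _ e20) := cf x; rewrite near_simpl /prop_near1 => /nbhs_ballP[r /= r0 hr].
  have r20 : 0 < r / 2 by rewrite divr_gt0.
  exists (ball x (r / 2), [set delta | 0 < delta < r / 2]) => /=.
    split; first exact: nbhsx_ballx.
    by near=> delta; apply/andP; split; near: delta; [exact: nbhs_right_gt|exact: nbhs_right_lt].
  move=> [z delta] [/= xz /andP[_ dr]] y zy.
  have h1 := hr z; have h2 := hr y.
  rewrite -ball_normE /= in xz h1 h2.
  have : `|f x - f z| < e / 2 by apply: h1; lra.
  have : `|f x - f y| < e / 2.
    apply: h2; have -> : x - y = (x - z) + (z - y) by ring.
    by apply: le_lt_trans (ler_normD _ _) _; lra.
  have -> : f z - f y = (f x - f y) - (f x - f z) by ring.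
  by have := ler_normB (f x - f y) (f x - f z); lra.
move=> delta /= d0 hd; exists (delta / 2); first by rewrite divr_gt0.
move=> x y xab; apply: (hd (delta / 2)) => //=.
- by rewrite sub0r normrN gtr0_norm; lra.
- by rewrite divr_gt0.
Unshelve. all: by end_near.
Qed.

(** Paths are continuous only within [[0, +oo[]; clipping the time at 0 yields a function continuous
    on the whole line that agrees with the path at all relevant times. *)
Lemma clip_continuous (X : R -> R) : {within `[0, +oo[, continuous X} ->
  continuous (fun s : R => X (Num.max 0 s)).
Proof.
move=> /subspace_continuousP cX s.
have A0 : `[0, +oo[%classic (Num.max 0 s) by rewrite /= in_itv/= andbT le_max lexx.
apply: cvg_comp (cX _ A0).
move=> U /= hU; rewrite /nbhs/= in hU *.
have cm : Num.max 0 x @[x --> s] --> Num.max 0 s.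
  by apply: (@continuous_max _ _ (cst 0) id); [exact: cvg_cst|exact: cvg_id].
change (nbhs s (fun x => U (Num.max 0 x))).
have h : nbhs s (fun x : R => `[0, +oo[%classic (Num.max 0 x) -> U (Num.max 0 x)) := cm _ hU.
apply: filterS h => x /=; apply.
by rewrite in_itv/= andbT le_max lexx.
Qed.

Lemma path_antiderivative (g : R -> R) : {within `[0, +oo[, continuous g} ->
  exists2 G : R -> R, forall x, is_derive x (1 : R) G (g (Num.max 0 x)) &
    forall t, 0 <= t -> \int[leb]_(s in `[0, t]) g s = G t - G 0.
Proof.
move=> /clip_continuous cg; have [G dG] := continuous_antiderivative cg.
exists G => // t; rewrite le_eqVlt => /predU1P[<-|t0].
  by rewrite subrr set_itv1 Rintegral_set1.
rewrite -(Rintegral_FTC t0 dG cg); apply: eq_Rintegral => s.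
by rewrite inE/= in_itv/= => /andP[s0 _]; rewrite max_r.
Qed.

Lemma is_derive_increment_modulus (G g : R -> R) (t e : R) :
  (forall x, is_derive x (1 : R) G (g x)) -> continuous g -> 0 < e ->
  exists2 delta : R, 0 < delta & forall s u, 0 <= s -> s <= u -> u <= t -> u - s < delta ->
    `|G u - G s - g s * (u - s)| <= e * (u - s).
Proof.
move=> dG cg e0; have [delta d0 hd] := uniform_modulus 0 t cg e0.
exists delta => // s u s0 su ut usd.
have dK x : is_derive x (1 : R) (fun x => G x - g s * x) (g x - g s).
  have := is_deriveB (dG x) (is_deriveZ (g s) (is_derive_id x (1 : R))).
  by rewrite /GRing.scale/= mulr1.
have := @is_derive_MVT_near _ _ _ e s u dK.
have -> : G u - g s * u - (G s - g s * s) = G u - G s - g s * (u - s) by ring.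
rewrite (ger0_norm (_ : 0 <= u - s)); last lra.
apply=> x xs; rewrite distrC; apply: ltW; apply: hd.
  by rewrite s0 /=; lra.
by rewrite distrC; lra.
Qed.

End clipped_paths.

(** * Pathwise convergence of the Euler scheme *)

Section euler_convergence.
Context {R : realType}.
Variables (b : R -> R) (L : R).
Hypothesis lipb : forall x y, `|b x - b y| <= L * `|x - y|.
Variables (Y be : R -> R) (y0 t : R).
Hypotheses (t0 : 0 < t) (Y0 : Y 0 = y0).
Hypothesis hY : forall e, 0 < e -> exists2 delta : R, 0 < delta &
  forall s u, 0 <= s -> s <= u -> u <= t -> u - s < delta ->
    `|Y u - Y s - (be u - be s) - b (Y s) * (u - s)| <= e * (u - s).

(** Solution and scheme share the noise increments, which cancel in the difference. Local errors
    [h e'] accumulate by the discrete Gronwall inequality to at most [t expR (L t) e'], and [e'] is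
    chosen accordingly. *)
Lemma euler_cvg :
  euler b (t / n.+1%:R) y0 (fun j => be (j.+1%:R * (t / n.+1%:R)) - be (j%:R * (t / n.+1%:R))) n.+1
    @[n --> \oo] --> Y t.
Proof.
have L0 : 0 <= L by have := le_trans (normr_ge0 _) (lipb 0 1); rewrite sub0r normrN normr1 mulr1.
apply/cvgrPdist_le => e e0; have q0 : 0 < t * expR (L * t) by rewrite mulr_gt0// expR_gt0.
have [delta d0 hd] := hY (divr_gt0 e0 q0).
near=> n; set h := t / n.+1%:R.
have h0 : 0 < h by rewrite divr_gt0.
have hdelta : h < delta.
  rewrite /h ltr_pdivrMr// mulrC -ltr_pdivrMr//.
  apply: lt_trans (truncnS_gt _) _; rewrite ltr_nat ltnS.
  by near: n; exact: nbhs_infty_ge.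
set E := euler b h y0 _.
have hL : 0 <= h * L by rewrite mulr_ge0// ltW.
set e' := e / (t * expR (L * t)); have e'0 : 0 < e' by rewrite divr_gt0.
have key k : (k <= n.+1)%N -> `|Y (k%:R * h) - E k| <= (1 + h * L) ^+ k * (k%:R * (h * e')).
  elim: k => [|k ih] kn; first by rewrite mul0r Y0 subrr normr0 expr0 mul1r mul0r.
  have kh0 : 0 <= k%:R * h by rewrite mulr_ge0// ltW.
  have kk : k.+1%:R * h = k%:R * h + h by rewrite -natr1 mulrDl mul1r.
  have kt : k.+1%:R * h <= t.
    by rewrite /h mulrCA ler_piMr ?(ltW t0)// ler_pdivrMr// mul1r ler_nat.
  have s1 : k%:R * h <= k.+1%:R * h by rewrite kk; lra.
  have s2 : k.+1%:R * h - k%:R * h < delta by rewrite kk; lra.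
  have := hd _ _ kh0 s1 kt s2; rewrite -/e'.
  have -> : k.+1%:R * h - k%:R * h = h by rewrite kk; ring.
  have {}ih := ih (ltnW kn).
  rewrite [E k.+1]/= -/E /drifted -/h.
  set y' := Y (k.+1%:R * h); set y := Y (k%:R * h) in ih *; set db := be _ - be _; set x := E k in ih *.
  move=> h1.
  have -> : y' - (x + h * b x + db) = (y' - y - db - b y * h) + (y - x) + h * (b y - b x) by ring.
  apply: le_trans (ler_normD _ _) _; apply: le_trans (lerD (ler_normD _ _) (lexx _)) _.
  have h2 : `|h * (b y - b x)| <= h * L * `|y - x|.
    by rewrite normrM (ger0_norm (ltW h0)) -mulrA ler_wpM2l// ltW.
  have q1 : 1 <= (1 + h * L) ^+ k.+1 by apply: exprn_ege1; rewrite lerDl.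
  have h3 : (1 + h * L) * `|y - x| <= (1 + h * L) ^+ k.+1 * (k%:R * (h * e')).
    by rewrite exprS -mulrA ler_wpM2l// addr_ge0.
  have h4 : e' * h <= (1 + h * L) ^+ k.+1 * (h * e') by rewrite mulrC ler_peMl// mulr_ge0// ltW.
  rewrite -[k.+1%:R]natr1; lra.
have := key n.+1 (leqnn _).
have nh : n.+1%:R * h = t by rewrite /h mulrCA mulfV ?mulr1// pnatr_eq0.
rewrite nh => h1; apply: le_trans h1 _; rewrite [n.+1%:R * _]mulrA nh.
have q1 : (1 + h * L) ^+ n.+1 <= expR (L * t).
  apply: le_trans (_ : expR (h * L) ^+ n.+1 <= _).
    apply: lerXn2r; rewrite ?nnegrE ?expR_ge0 ?addr_ge0//; exact: expR_ge1Dx.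
  by rewrite -expRM_natl mulrA nh mulrC.
apply: le_trans (ler_wpM2r _ q1) _; first by rewrite mulr_ge0// ltW.
rewrite /e' le_eqVlt; apply/orP; left; apply/eqP; field.
by rewrite !gt_eqF// expR_gt0.
Unshelve. all: by end_near.
Qed.

End euler_convergence.

Section grid_limit.
Context {R : realType}.

Lemma step_cvg_right (t : R) : 0 < t -> t / n.+1%:R @[n --> \oo] --> 0^'+.
Proof.
move=> t0 U [e /= e0 hU].
exists (Num.truncn (t / e)) => // n /= hn; apply: hU; last by rewrite divr_gt0.
rewrite /= sub0r normrN gtr0_norm ?divr_gt0// ltr_pdivrMr// mulrC -ltr_pdivrMr//.
by apply: lt_le_trans (truncnS_gt _) _; rewrite ler_nat.
Qed.

Lemma powR_step_cvg0 (t p : R) : 0 < t -> 0 < p -> (t / n.+1%:R) `^ p @[n --> \oo] --> 0.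
Proof. by move=> t0 p0; exact: cvg_comp (step_cvg_right t0) (powR_cvg0 p0). Qed.

Lemma sqrt_comp_cvg0 (u : nat -> R) : u n @[n --> \oo] --> 0 -> Num.sqrt (u n) @[n --> \oo] --> 0.
Proof.
by move=> hu; rewrite -(sqrtr0 R); exact: (cvg_comp _ _ hu (@sqrt_continuous R 0)).
Qed.

Lemma weak_error_rate_cvg0 (H t : R) : 2^-1 < H -> 0 < t ->
  Num.sqrt ((t / n.+1%:R) `^ (2 * H)) + Num.sqrt (t / n.+1%:R) +
  (t / n.+1%:R) `^ (2 * H - 1) + t / n.+1%:R @[n --> \oo] --> 0.
Proof.
move=> H1 t0; have t1 : t / n.+1%:R @[n --> \oo] --> 0.
  by apply: cvg_trans (step_cvg_right t0) _; exact: cvg_within.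
have := cvgD (cvgD (cvgD (sqrt_comp_cvg0 (@powR_step_cvg0 t (2 * H) t0 _)) (sqrt_comp_cvg0 t1))
  (@powR_step_cvg0 t (2 * H - 1) t0 _)) t1.
by rewrite !addr0; apply; lra.
Qed.

End grid_limit.

Section additive_noise.
Context d (T : measurableType d) (R : realType) (P : probability T R).

(** The noise enters as [B t - B 0], the form both chain rules produce path by path; the covariance
    makes [B 0] vanish only almost surely. *)
Definition additive_solution (b : R -> R) (y0 : R) (B Y : R -> T -> R) : Prop :=
  {ae P, forall w, {within `[0, +oo[, continuous (Y ^~ w)} /\
    forall t, 0 <= t -> Y t w = y0 + drift_integral b Y t w + (B t w - B 0 w)}.

Variables (b b' : R -> R) (b0 L : R).
Hypotheses (db : forall x, is_derive x (1 : R) b (b' x)) (hb : cbdd b0 b) (hb' : cbdd L b').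

Lemma euler_expectation_cvg (H : R) (B Y : R -> T -> R) (y0 t F0 : R) (f : R -> R) :
  is_fbm P H B -> additive_solution b y0 B Y -> measurable_fun setT (Y t) -> 0 < t -> cbdd F0 f ->
  \int[P]_o f (euler b (t / n.+1%:R) y0 (bincr B (t / n.+1%:R) ^~ o) n.+1) @[n --> \oo]
    --> \int[P]_o f (Y t o).
Proof.
move=> hB hY mY t0 hf; have mf := continuous_measurable hf.1.
apply: (@Rint_dominated _ _ _ _ _ _ (fun=> F0)).
- move=> n; apply: measurableT_comp mf _.
  have h0 : 0 < t / n.+1%:R :> R by rewrite divr_gt0.
  by exact (measurable_eulerZ hB hb _ y0 n.+1 (gspan_bincr B h0)).
- exact: measurableT_comp mf mY.
- apply: filterS hY => w [cY eY].
  have cb : continuous b := is_derive_continuous db.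
  have cbY : {within `[0, +oo[, continuous (fun s => b (Y s w))}.
    by move=> x; apply: continuous_comp; [exact: cY|exact: cb].
  have [G dG IG] := path_antiderivative cbY.
  have YE u : 0 <= u -> Y u w = y0 + (G u - G 0) + (B u w - B 0 w).
    by move=> u0; rewrite eY// /drift_integral IG.
  have Y0 : Y 0 w = y0 by rewrite YE// !subrr !addr0.
  apply: (@continuous_cvg _ _ _ _ _ _ f); first exact: hf.1.
  apply: (@euler_cvg _ b L _ (Y ^~ w) (B ^~ w) y0 t t0 Y0).
    by move=> x y; apply: (is_derive_MVT y x db); exact: hb'.2.
  move=> e e0; have [delta d0 hd] := is_derive_increment_modulus t dG (clip_continuous cbY) e0.
  exists delta => // s u s0 su ut usd; have := hd s u s0 su ut usd.
  have -> : Y u w - Y s w - (B u w - B s w) = G u - G s.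
    by rewrite (YE s)// (YE u); [ring|exact: le_trans su].
  by rewrite max_r.
- exact: rint_cst.
- by move=> n w; exact: hf.2.
Qed.

Variables (f f' f'' : R -> R) (F0 F1 F2 : R).
Hypotheses (df : forall x, is_derive x (1 : R) f (f' x)) (df' : forall x, is_derive x (1 : R) f' (f'' x)).
Hypotheses (hf : cbdd F0 f) (hf' : cbdd F1 f') (hf'' : cbdd F2 f'').

Theorem additive_weak_rate (H : R) (B B2 Y Y2 : R -> T -> R) (y0 t Tm : R) :
  is_fbm P H B -> is_fbm P 2^-1 B2 -> 2^-1 < H -> H < 1 ->
  additive_solution b y0 B Y -> additive_solution b y0 B2 Y2 ->
  measurable_fun setT (Y t) -> measurable_fun setT (Y2 t) -> 0 < t -> t <= Tm ->
  `|\int[P]_o f (Y t o) - \int[P]_o f (Y2 t o)| <= (2 * H - 1) * weak_const b0 L F1 F2 Tm.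
Proof.
move=> hB hB2 H1 H2 hY hY2 mY mY2 t0 tT.
have c1 := euler_expectation_cvg hB hY mY t0 hf.
have c2 := euler_expectation_cvg hB2 hY2 mY2 t0 hf.
have c3 := cvg_norm (cvgB c1 c2).
have L0 : 0 <= L by apply: le_trans (hb'.2 0).
have b00 : 0 <= b0 by apply: le_trans (hb.2 0).
have F10 : 0 <= F1 by apply: le_trans (hf'.2 0).
have F20 : 0 <= F2 by apply: le_trans (hf''.2 0).
have Tm0 : 0 < Tm by exact: lt_le_trans tT.
set G := sup2 b0 L F1 F2 Tm * b0 + L * sup1 L F1 Tm.
have G0 : 0 <= G.
  have S1 : 0 <= sup1 L F1 Tm by rewrite mulr_ge0// expR_ge0.
  by rewrite addr_ge0// mulr_ge0// !mulr_ge0 ?expR_ge0// addr_ge0// !mulr_ge0 ?sqrtr_ge0.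
(* [key] is the limit of [weak_error] in the mesh for fixed [r], where [weak_rest r] is multiplied
   by a quantity tending to 0; only then does [r] tend to 0. *)
suff key (r : R) : 0 < r -> `|\int[P]_o f (Y t o) - \int[P]_o f (Y2 t o)| <=
    (2 * H - 1) * weak_const b0 L F1 F2 Tm + Tm * (6 * G * r).
  apply/ler_addgt0Pr => e e0; pose r := e / (Tm * 6 * (G + 1)).
  have G1 : 0 < G + 1 by lra.
  have r0 : 0 < r by rewrite divr_gt0// !mulr_gt0.
  apply: le_trans (key r r0) _; rewrite lerD2l.
  have -> : e = Tm * (6 * (G + 1) * r) by rewrite /r; field; rewrite !gt_eqF.
  by rewrite ler_wpM2l ?(ltW Tm0)// ler_wpM2r ?(ltW r0)// ler_wpM2l//; lra.
move=> r0.
have c4 := cvgD (cvg_cst ((2 * H - 1) * weak_const b0 L F1 F2 Tm + Tm * (6 * G * r)))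
  (cvgM (cvg_cst (weak_rest b0 L F1 F2 Tm r)) (weak_error_rate_cvg0 H1 t0)).
rewrite mulr0 addr0 in c4.
apply: (ler_cvg_to (c3 _ _) (c4 _ _ _ _)); near=> n.
have h21 : 2^-1 < 1 :> R by lra.
have := weak_error hB hB2 (ltW H1) H2 db hb hb' df df' hf hf' hf'' y0 t0 tT n r0.
by rewrite -(euler_brownian hB2 (lexx _) h21 db hb hf y0 t0 tT n erefl).
Unshelve. all: by end_near.
Qed.

End additive_noise.

(** * The chain rule for Young equations *)

Section uniform_grids.
Context {R : realType}.

Definition grid (h : R) (n : nat) : seq R := [seq i.+1%:R * h | i <- iota 0 n].

Lemma size_grid h n : size (grid h n) = n.
Proof. by rewrite size_map size_iota. Qed.

Lemma ppoint_grid (h t : R) n i : (i <= n)%N -> ppoint 0 t (grid h n) i = i%:R * h.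
Proof.
case: i => [|i] ni; first by rewrite mul0r.
by rewrite /ppoint /= (nth_map 0%N) ?size_iota// nth_iota.
Qed.

Lemma grid_itv_partition (h t : R) n : 0 < h -> n%:R * h = t -> itv_partition 0 t (grid h n).
Proof.
move=> h0 nh; split.
  apply/(pathP 0) => i; rewrite size_grid => ni.
  have e j : (j <= n)%N -> nth 0 (0 :: grid h n) j = j%:R * h.
    case: j => [|j] nj; first by rewrite mul0r.
    by rewrite /= (nth_map 0%N) ?size_iota// nth_iota.
  rewrite e 1?ltnW// -[nth _ _ _]/(nth 0 (0 :: grid h n) i.+1) e//.
  by rewrite ltr_pM2r// ltr_nat.
rewrite -nh; case: n {nh} => [|n]; first by rewrite /= mul0r.
by rewrite (last_nth 0) size_grid /= (nth_map 0%N) ?size_iota// nth_iota.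
Qed.

Lemma grid_mesh_lt (h t delta : R) n : h < delta -> mesh_lt 0 t (grid h n) delta.
Proof.
move=> hd i; rewrite size_grid => ni.
by rewrite (ppoint_grid h t ni) (ppoint_grid h t (ltnW ni)) -natr1 mulrDl mul1r addrAC subrr add0r.
Qed.

Definition gsum (f g : R -> R) (h : R) (n : nat) : R :=
  \sum_(j < n) f (j%:R * h) * (g (j.+1%:R * h) - g (j%:R * h)).

Lemma stieltjes_gsum (f g : R -> R) (t I e : R) : is_stieltjes_integral f g 0 t I -> 0 < e ->
  exists2 delta : R, 0 < delta & forall h n, 0 < h -> h < delta -> n%:R * h = t ->
    `|gsum f g h n - I| < e.
Proof.
move=> hI e0; have [delta d0 hd] := hI e e0; exists delta => // h n h0 hdelta nh.
have := hd (grid h n) (ppoint 0 t (grid h n)) (grid_itv_partition h0 nh) (@grid_mesh_lt h t delta n hdelta).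
rewrite size_grid big_mkord.
have -> : \sum_(i < n) f (ppoint 0 t (grid h n) i) * increment 0 t (grid h n) g i = gsum f g h n.
  apply: eq_bigr => i _; rewrite /increment !ppoint_grid// 1?ltnW//.
apply=> i ni; rewrite !ppoint_grid// 1?ltnW//.
by rewrite lexx /= ler_wpM2r ?(ltW h0)// ler_nat.
Qed.

(* Riemann sum over [2 ^ p] equal subintervals of [u, u + h]. *)
Fixpoint dyadic_sum (f g : R -> R) (p : nat) (u h : R) : R :=
  if p is k.+1 then dyadic_sum f g k u (h / 2) + dyadic_sum f g k (u + h / 2) (h / 2)
  else f u * (g (u + h) - g u).

Lemma dyadic_sumE f g p u h : let r := h / (2 ^ p)%:R in
  dyadic_sum f g p u h = \sum_(j < 2 ^ p) f (u + j%:R * r) * (g (u + j.+1%:R * r) - g (u + j%:R * r)).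
Proof.
elim: p u h => [|p ih] u h /=.
  by rewrite big_ord1 mul0r addr0 divr1 mul1r.
rewrite !ih.
have -> : h / 2 / (2 ^ p)%:R = h / (2 ^ p.+1)%:R by rewrite expnS natrM invfM mulrA.
set r := h / (2 ^ p.+1)%:R.
have r2 : (2 ^ p)%:R * r = h / 2.
  by rewrite /r expnS natrM; field; rewrite pnatr_eq0 -lt0n expn_gt0.
have halves (F : nat -> R) : \sum_(j < 2 ^ p.+1) F j = \sum_(j < 2 ^ p) F j + \sum_(j < 2 ^ p) F (2 ^ p + j)%N.
  by rewrite expnS mul2n -addnn big_split_ord.
rewrite (halves (fun j => f (u + j%:R * r) * (g (u + j.+1%:R * r) - g (u + j%:R * r)))); congr (_ + _).
by apply: eq_bigr => j _; rewrite -addnS !natrD !mulrDl r2 !addrA.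
Qed.

Lemma gsum_dyadic f g p l h : let r := h / (2 ^ p)%:R in
  gsum f g r (l.+1 * 2 ^ p) = gsum f g r (l * 2 ^ p) + dyadic_sum f g p (l%:R * h) h.
Proof.
move=> r; rewrite /gsum mulSnr big_split_ord/= dyadic_sumE -/r; congr (_ + _).
have r2 : (l * 2 ^ p)%:R * r = l%:R * h.
  by rewrite /r natrM; field; rewrite pnatr_eq0 -lt0n expn_gt0.
by apply: eq_bigr => j _; rewrite -addnS !natrD !mulrDl r2.
Qed.

End uniform_grids.

(** * The Young-Loeve estimate by bisection *)

Section young_loeve.
Context {R : realType}.
Variables (f g : R -> R) (T K1 K2 al be : R).
Hypotheses (al0 : 0 < al) (be0 : 0 < be) (ab1 : 1 < al + be).
Hypotheses (K10 : 0 <= K1) (K20 : 0 <= K2).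
Hypothesis hf : forall x y, 0 <= x <= T -> 0 <= y <= T -> `|f x - f y| <= K1 * `|x - y| `^ al.
Hypothesis hg : forall x y, 0 <= x <= T -> 0 <= y <= T -> `|g x - g y| <= K2 * `|x - y| `^ be.

Let half : R := 2^-1 `^ (al + be).

Let half_lt : 2 * half < 1.
Proof.
have l0 : ln 2^-1 < 0 :> R by rewrite -[ltRHS](@ln1 R) ltr_ln ?posrE//; lra.
suff : half < 2^-1 by lra.
rewrite /half /powR gt_eqF ?invr_gt0// -[ltRHS](@lnK R) ?posrE ?invr_gt0//.
rewrite ltr_expR; have s1 : 0 < al + be - 1 by move: ab1; lra.
by have := l0; rewrite -(pmulr_rlt0 _ s1); lra.
Qed.

(** The solution [C] of the bisection recursion [C = K1 K2 + 2 half C], where [2 half < 1] because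
    [al + be > 1]. *)
Definition young_const : R := K1 * K2 / (1 - 2 * 2^-1 `^ (al + be)).

Lemma young_const_ge0 : 0 <= young_const.
Proof. by rewrite divr_ge0 ?mulr_ge0// subr_ge0; exact: ltW half_lt. Qed.

(** A bisection moves the tag of the right half from [u] to the midpoint, at a cost
    [K1 K2 (h / 2) ^ (al + be)]; the two halves then contribute [2 half] times the bound, uniformly
    in the depth. *)
Lemma dyadic_young p u h : 0 <= u -> 0 < h -> u + h <= T ->
  `|dyadic_sum f g p u h - f u * (g (u + h) - g u)| <= young_const * h `^ (al + be).
Proof.
have C0 := young_const_ge0.
elim: p u h => [|p ih] u h u0 h0 uT /=; first by rewrite subrr normr0 mulr_ge0 ?powR_ge0.
have h20 : 0 < h / 2 by rewrite divr_gt0.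
have := ih u (h / 2) u0 h20 _; have := ih (u + h / 2) (h / 2) _ h20 _.
have -> : u + h / 2 + h / 2 = u + h by field.
set a := dyadic_sum _ _ _ _ _; set c := dyadic_sum _ _ _ _ _.
move=> h1 h2.
have {}h1 : `|a - f (u + h / 2) * (g (u + h) - g (u + h / 2))| <= young_const * (h / 2) `^ (al + be) by apply: h1; lra.
have {}h2 : `|c - f u * (g (u + h / 2) - g u)| <= young_const * (h / 2) `^ (al + be) by apply: h2; lra.
have e1 : `|(f (u + h / 2) - f u) * (g (u + h) - g (u + h / 2))| <= K1 * K2 * (h / 2) `^ (al + be).
  rewrite powRD; last by rewrite (gt_eqF h20) implybT.
  have -> : K1 * K2 * ((h / 2) `^ al * (h / 2) `^ be) = (K1 * (h / 2) `^ al) * (K2 * (h / 2) `^ be) by ring.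
  rewrite normrM; apply: ler_pM => //.
    have := @hf (u + h / 2) u _ _; rewrite addrAC subrr add0r (gtr0_norm h20); apply; lra.
  have := @hg (u + h) (u + h / 2) _ _.
  have -> : u + h - (u + h / 2) = h / 2 by field.
  by rewrite (gtr0_norm h20); apply; lra.
have e2 : (h / 2) `^ (al + be) = half * h `^ (al + be).
  by rewrite powRM ?(ltW h0)// mulrC.
have -> : c + a - f u * (g (u + h) - g u) = (c - f u * (g (u + h / 2) - g u)) +
   (a - f (u + h / 2) * (g (u + h) - g (u + h / 2))) + (f (u + h / 2) - f u) * (g (u + h) - g (u + h / 2)) by ring.
apply: le_trans (ler_normD _ _) _; apply: le_trans (lerD (ler_normD _ _) (lexx _)) _.
have half0 : 0 <= half by exact: powR_ge0.
have Ck : young_const * (1 - 2 * half) = K1 * K2.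
  by rewrite /young_const -/half divfK//; move: half_lt; rewrite -subr_gt0 => /gt_eqF ->.
have i1 : K1 * K2 * half <= K1 * K2 by rewrite ler_piMr ?mulr_ge0//; move: half_lt; lra.
have i2 : 0 <= (K1 * K2 - K1 * K2 * half) * h `^ (al + be) by rewrite mulr_ge0 ?powR_ge0//; lra.
have i3 : young_const * half * h `^ (al + be) * 2 + K1 * K2 * h `^ (al + be) = young_const * h `^ (al + be).
  by rewrite -Ck; ring.
move: h1 h2 e1; rewrite e2; lra.
Qed.

(** Both end points are multiples of [h], so one dyadically refined grid approximates both
    integrals, and their difference is the dyadic sum over the last interval. *)
Lemma young_increment (l : nat) (h I1 I2 : R) : 0 < h -> l.+1%:R * h <= T ->
  is_stieltjes_integral f g 0 (l%:R * h) I1 -> is_stieltjes_integral f g 0 (l.+1%:R * h) I2 ->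
  `|I2 - I1 - f (l%:R * h) * (g (l.+1%:R * h) - g (l%:R * h))| <= young_const * h `^ (al + be).
Proof.
move=> h0 lT hI1 hI2; apply/ler_addgt0Pr => e e0.
have e20 : 0 < e / 2 by rewrite divr_gt0.
have [d1 d10 hd1] := stieltjes_gsum hI1 e20; have [d2 d20 hd2] := stieltjes_gsum hI2 e20.
pose m := Num.min d1 d2; have m0 : 0 < m by rewrite lt_min d10.
pose p := (Num.truncn (h / m)).+1; pose r := h / (2 ^ p)%:R.
have p2 : 0 < (2 ^ p)%:R :> R by rewrite ltr0n expn_gt0.
have r0 : 0 < r by rewrite divr_gt0.
have rm : r < m.
  rewrite /r ltr_pdivrMr// mulrC -ltr_pdivrMr//.
  apply: lt_le_trans (truncnS_gt _) _; rewrite ler_nat.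
  by apply: ltnW; exact: ltn_expl.
have rl k : (k * 2 ^ p)%:R * r = k%:R * h by rewrite /r natrM; field; rewrite gt_eqF.
have := hd1 r _ r0 _ (rl l); have := hd2 r _ r0 _ (rl l.+1).
have r1 : r < d1 by apply: lt_le_trans rm _; rewrite ge_min lexx.
have r2 : r < d2 by apply: lt_le_trans rm _; rewrite ge_min lexx orbT.
move=> /(_ r2) a2 /(_ r1) a1.
have := @dyadic_young p (l%:R * h) h; rewrite mulr_ge0 ?(ltW h0)// => /(_ isT h0).
have -> : l%:R * h + h = l.+1%:R * h by rewrite -natr1; ring.
move=> /(_ lT) a3; move: a2; rewrite gsum_dyadic -/r => a2.
set D := dyadic_sum _ _ _ _ _ in a2 a3; set Q := f _ * _ in a3 *; set S := gsum _ _ _ _ in a1 a2.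
have -> : I2 - I1 - Q = (D - Q) - (S + D - I2) + (S - I1) by ring.
apply: le_trans (ler_normD _ _) _; apply: le_trans (lerD (ler_normB _ _) (lexx _)) _.
lra.
Qed.

End young_loeve.

Lemma stieltjes_integral00 {R : realType} (f g : R -> R) (I : R) :
  is_stieltjes_integral f g 0 0 I -> I = 0.
Proof.
move=> hI; apply/eqP; rewrite -normr_eq0 eq_le normr_ge0 andbT.
apply/ler_addgt0Pr => e e0; rewrite add0r.
have [delta d0 hd] := stieltjes_gsum hI e0.
have d20 : 0 < delta / 2 by rewrite divr_gt0.
have dd : delta / 2 < delta by lra.
have := hd (delta / 2) 0%N d20 dd (mul0r _).
by rewrite /gsum big_ord0 sub0r normrN => /ltW.
Qed.

(** The intermediate point of the mean value theorem is a value of the path at some time [r] in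
    between, so regularity in time of [dF (x s)] applies to it. *)
Lemma path_mean_value {R : realType} (F dF x : R -> R) (u v : R) :
  (forall y, is_derive y (1 : R) F (dF y)) -> u <= v -> {within `[u, v], continuous x} ->
  exists2 r, u <= r <= v & F (x v) - F (x u) = dF (x r) * (x v - x u).
Proof.
move=> hF uv cx.
have cF : continuous F by exact: is_derive_continuous hF.
have [xi [hxi e]] : exists xi, Num.min (x u) (x v) <= xi <= Num.max (x u) (x v) /\
    F (x v) - F (x u) = dF xi * (x v - x u).
  case: (leP (x u) (x v)) => [h|/ltW h].
    have [|c ci ->] := @MVT_segment _ F dF _ _ h; first exact: continuous_subspaceT.
    by exists c; move: ci; rewrite in_itv.
  have [|c ci e] := @MVT_segment _ F dF _ _ h; first exact: continuous_subspaceT.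
  exists c; move: ci; rewrite in_itv /= => ->; split => //.
  by rewrite -opprB e -mulrN opprB.
have [r ri er] := IVT uv cx hxi.
by exists r; [move: ri; rewrite in_itv|rewrite er].
Qed.

Lemma within_sub {R : realType} (x : R -> R) (u v : R) : 0 <= u ->
  {within `[0, +oo[, continuous x} -> {within `[u, v], continuous x}.
Proof.
move=> u0; apply: continuous_subspaceW => s /=; rewrite !in_itv/= => /andP[us _].
by rewrite andbT; exact: le_trans us.
Qed.

Lemma hoelder_on_ge0 {R : realType} (A : set R) al (f : R -> R) : hoelder_on A al f ->
  exists2 K : R, 0 <= K & forall x y, A x -> A y -> `|f x - f y| <= K * `|x - y| `^ al.
Proof.
move=> [K hK]; exists `|K| => // x y Ax Ay; apply: le_trans (hK x y Ax Ay) _.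
by rewrite ler_wpM2r ?powR_ge0// ler_norm.
Qed.

Lemma step_lt {R : realType} (t m : R) : 0 < t -> 0 < m -> \forall n \near \oo, t / n.+1%:R < m.
Proof.
move=> t0 m0; exists (Num.truncn (t / m)) => // n /= hn.
rewrite ltr_pdivrMr// mulrC -ltr_pdivrMr//.
by apply: lt_le_trans (truncnS_gt _) _; rewrite ler_nat.
Qed.

Section young_chain_rule.
Context {R : realType}.
Notation leb := (@lebesgue_measure R).
Variables (b sigma F : R -> R) (b0 s0 s1 x0 : R) (x be : R -> R).
Hypotheses (hb : cbdd b0 b) (hs : cbdd s1 sigma).
Hypotheses (s00 : 0 < s0) (ell : forall y, s0 <= `|sigma y|).
Hypothesis dF : forall y, is_derive y (1 : R) F (sigma y)^-1.
Hypothesis cx : {within `[0, +oo[, continuous x}.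
Hypothesis sol : forall t, 0 <= t -> exists2 I : R,
  is_young_integral (fun s => sigma (x s)) be 0 t I &
  x t = x0 + \int[leb]_(s in `[0, t]) b (x s) + I.

Let sn0 y : sigma y != 0.
Proof. by rewrite -normr_gt0; exact: lt_le_trans (ell y). Qed.

Let b00 : 0 <= b0. Proof. by apply: le_trans (hb.2 0). Qed.
Let s10 : 0 <= s1. Proof. by apply: le_trans (hs.2 0). Qed.

Let sV y : `|(sigma y)^-1| <= s0^-1.
Proof. by rewrite normfV lef_pV2 ?posrE// normr_gt0. Qed.

Let cdiv : continuous (fun y => b y / sigma y).
Proof. by move=> y; apply: cvgM; [exact: hb.1|apply: cvgV => //; exact: hs.1]. Qed.

Let comp_within (g : R -> R) : continuous g -> {within `[0, +oo[, continuous (fun s => g (x s))}.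
Proof. by move=> cg y; apply: continuous_comp; [exact: cx|exact: cg]. Qed.

Let x00 : x 0 = x0.
Proof.
have [I [_ hI] ->] := sol (lexx 0).
by rewrite (stieltjes_integral00 hI) set_itv1 Rintegral_set1 !addr0.
Qed.

(* [F (x t) - int b / sigma - be t] is constant: its increments over a grid step [h] are [o(h)]. *)
Lemma young_chain_rule t : 0 <= t ->
  F (x t) = F x0 + \int[leb]_(s in `[0, t]) (b (x s) / sigma (x s)) + (be t - be 0).
Proof.
rewrite le_eqVlt => /predU1P[<-|t0].
  by rewrite set_itv1 Rintegral_set1 x00 addr0 subrr addr0.
have [Gb dGb IGb] := path_antiderivative (comp_within hb.1).
have [A dA IA] := path_antiderivative (comp_within cdiv).
rewrite [\int[_]_(_ in _) _]IA ?(ltW t0)//.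
have [It [[al [be' [/andP[al0 al1] /andP[be0 be1] ab hf hg]]] _] _] := sol (ltW t0).
have [K1 K10 {}hf] := hoelder_on_ge0 hf; have [K2 K20 {}hg] := hoelder_on_ge0 hg.
set f := fun s => sigma (x s) in hf.
have hf' y z : 0 <= y <= t -> 0 <= z <= t -> `|f y - f z| <= K1 * `|y - z| `^ al.
  by move=> hy hz; apply: hf; rewrite /= in_itv.
have hg' y z : 0 <= y <= t -> 0 <= z <= t -> `|be y - be z| <= K2 * `|y - z| `^ be'.
  by move=> hy hz; apply: hg; rewrite /= in_itv.
set th := al + be'; pose C := young_const K1 K2 al be'.
pose Q := (b0 + C + s1 * K2) * (s0 ^- 2 * K1) + C / s0.
have C0 : 0 <= C := young_const_ge0 ab K10 K20.
pose D s := F (x s) - A s - be s.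
suff DE : D t = D 0 by move: DE; rewrite /D x00; lra.
apply/eqP; rewrite -subr_eq0 -normr_eq0 eq_le normr_ge0 andbT.
apply/ler_addgt0Pr => e e0; rewrite add0r.
(* Half of [e] pays for the two drift approximations over the total time [t], the other half for the
   Young errors. *)
pose e1 := e / (2 * t * (s0^-1 + 1)).
have sp : 0 < s0^-1 + 1 by rewrite addr_gt0 ?invr_gt0.
have e10 : 0 < e1 by rewrite divr_gt0// !mulr_gt0.
have [d1 d10 hd1] := is_derive_increment_modulus t dGb (clip_continuous (comp_within hb.1)) e10.
have [d2 d20 hd2] := is_derive_increment_modulus t dA (clip_continuous (comp_within cdiv)) e10.
have th1 : 0 < th - 1 by rewrite subr_gt0.
have cv : t * Q * ((t / n.+1%:R) `^ al + (t / n.+1%:R) `^ (th - 1)) @[n --> \oo] --> t * Q * (0 + 0).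
  by apply: cvgM; [exact: cvg_cst|apply: cvgD; exact: powR_step_cvg0].
rewrite addr0 mulr0 in cv.
have e20 : 0 < e / 2 by rewrite divr_gt0.
have /cvgrPdist_le /(_ _ e20) cv' := cv.
have near1 : \forall n \near \oo, t / n.+1%:R < Num.min 1 (Num.min d1 d2) :> R.
  have m0 : 0 < Num.min 1 (Num.min d1 d2) by rewrite !lt_min ltr01 d10.
  exact: step_lt.
have [n [hn1 hn2]] : exists n, (t / n.+1%:R < Num.min 1 (Num.min d1 d2)) /\
    `|0 - t * Q * ((t / n.+1%:R) `^ al + (t / n.+1%:R) `^ (th - 1))| <= e / 2.
  near \oo => n; exists n; split; first by near: n.
  by near: n; exact: cv'.
set h := t / n.+1%:R in hn1 hn2.
have h0 : 0 < h by rewrite divr_gt0.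
move: hn1; rewrite !lt_min => /and3P[h1 hd1' hd2'].
have nh : n.+1%:R * h = t by rewrite /h mulrCA mulfV ?mulr1// pnatr_eq0.
have lt_h (l : nat) : (l <= n.+1)%N -> 0 <= l%:R * h <= t.
  by move=> ln; rewrite mulr_ge0 ?(ltW h0)//= -nh ler_wpM2r ?(ltW h0)// ler_nat.
have step (l : nat) : (l <= n)%N ->
    `|D (l.+1%:R * h) - D (l%:R * h)| <= h * (Q * (h `^ al + h `^ (th - 1))) + h * (e1 * (s0^-1 + 1)).
  move=> ln; set u := l%:R * h; set v := l.+1%:R * h.
  have /andP[u0 ut] : 0 <= u <= t by apply: lt_h; exact: leqW.
  have /andP[v0 vt] : 0 <= v <= t by exact: lt_h.
  have vu : v - u = h by rewrite /u /v -natr1; ring.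
  have uv : u <= v by lra.
  have [Iu [_ hIu] eu] := sol u0; have [Iv [_ hIv] ev] := sol v0.
  have i1 := young_increment ab K10 K20 hf' hg' h0 vt hIu hIv.
  rewrite -/u -/v -/C -/th in i1.
  rewrite [\int[_]_(_ in _) _]IGb// in eu; rewrite [\int[_]_(_ in _) _]IGb// in ev.
  have xvu : x v - x u = (Gb v - Gb u) + (Iv - Iu) by rewrite ev eu; ring.
  have [r /andP[ur rv] Fr] := path_mean_value dF uv (within_sub u0 cx).
  have hv := hd1 u v u0 uv vt; have hA := hd2 u v u0 uv vt.
  rewrite vu max_r//= in hv hA; have {}hv := hv hd1'; have {}hA := hA hd2'.
  have i2 : `|Gb v - Gb u| <= b0 * h.
    rewrite -vu -[v - u](ger0_norm (_ : 0 <= _)) ?subr_ge0//.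
    by apply: (is_derive_MVT u v dGb) => y; exact: hb.2.
  have i3 : `|f u * (be v - be u)| <= s1 * (K2 * h `^ be').
    rewrite normrM; apply: ler_pM => //; first exact: hs.2.
    have := @hg' v u; rewrite vu (gtr0_norm h0) u0 ut v0 vt; exact.
  have i4 : `|(sigma (x r))^-1 - (sigma (x u))^-1| <= s0 ^- 2 * (K1 * h `^ al).
    have -> : (sigma (x r))^-1 - (sigma (x u))^-1 = (sigma (x r))^-1 * (sigma (x u))^-1 * (f u - f r).
      by rewrite /f; field; rewrite !sn0.
    rewrite normrM; apply: ler_pM => //.
      by rewrite normrM -exprVn expr2; apply: ler_pM.
    have r0 : 0 <= r <= t by apply/andP; split; lra.
    have ur' : 0 <= u <= t by rewrite u0.
    apply: le_trans (hf' u r ur' r0) _; rewrite ler_wpM2l//.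
    apply: powR_le; rewrite ?(ltW al0)//.
    by rewrite ler0_norm; lra.
  have hth : h `^ th = h * h `^ (th - 1).
    rewrite -{2}(powRr1 (ltW h0)) -powRD; last by rewrite (gt_eqF h0) implybT.
    by congr (_ `^ _); ring.
  have hth2 : h `^ be' * h `^ al = h `^ th.
    by rewrite -powRD; [rewrite addrC|rewrite (gt_eqF h0) implybT].
  have hal : 0 <= h `^ al <= 1.
    by have := powR_le (ltW al0) (ltW h0) (ltW h1); rewrite powR1 powR_ge0.
  case/andP: hal => hal0 hal1.
  have ht0 : 0 <= h `^ (th - 1) by exact: powR_ge0.
  have i5 : `|x v - x u| <= b0 * h + C * h `^ th + s1 * (K2 * h `^ be').
    rewrite xvu; have -> : Gb v - Gb u + (Iv - Iu) = Gb v - Gb u + (Iv - Iu - f u * (be v - be u)) + f u * (be v - be u) by ring.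
    apply: le_trans (ler_normD _ _) _; apply: lerD => //.
    by apply: le_trans (ler_normD _ _) _; exact: lerD.
  (* The critical product: an increment of [x] of size [h ^ be'] times a change of [1 / sigma] of
     size [h ^ al]. It is of order [h ^ th] with [th > 1], hence [o(h)]. *)
  have i6 : `|(x v - x u) * ((sigma (x r))^-1 - (sigma (x u))^-1)| <=
      h * ((b0 + C + s1 * K2) * (s0 ^- 2 * K1) * (h `^ al + h `^ (th - 1))).
    rewrite normrM; apply: le_trans (ler_pM (normr_ge0 _) (normr_ge0 _) i5 i4) _.
    have -> : (b0 * h + C * h `^ th + s1 * (K2 * h `^ be')) * (s0 ^- 2 * (K1 * h `^ al)) =
       (s0 ^- 2 * K1) * (b0 * h * h `^ al + C * h `^ th * h `^ al + s1 * K2 * (h `^ be' * h `^ al)) by ring.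
    rewrite hth2 hth.
    have -> : h * ((b0 + C + s1 * K2) * (s0 ^- 2 * K1) * (h `^ al + h `^ (th - 1))) =
      (s0 ^- 2 * K1) * ((b0 + C + s1 * K2) * h * (h `^ al + h `^ (th - 1))) by ring.
    rewrite ler_wpM2l ?mulr_ge0 ?invr_ge0 ?exprn_ge0 ?(ltW s00)//.
    have h00 := ltW h0.
    have j1 : 0 <= C * h * h `^ (th - 1) by do ?[done|apply: mulr_ge0].
    have j2 : C * h * h `^ (th - 1) * h `^ al <= C * h * h `^ (th - 1) by rewrite ler_piMr.
    have j3 : 0 <= b0 * h * h `^ (th - 1) by do ?[done|apply: mulr_ge0].
    have j4 : 0 <= (C + s1 * K2) * h * h `^ al by do ?[done|apply: mulr_ge0|apply: addr_ge0].
    lra.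
  have i7 : `|(Iv - Iu - f u * (be v - be u)) * (sigma (x u))^-1| <= h * (C / s0 * (h `^ al + h `^ (th - 1))).
    rewrite normrM; apply: le_trans (ler_pM (normr_ge0 _) (normr_ge0 _) i1 (sV _)) _.
    rewrite hth; have h00 := ltW h0; have s0V : 0 <= s0^-1 by rewrite invr_ge0 ltW.
    have : 0 <= h * (C / s0 * h `^ al) by do ?[done|apply: mulr_ge0].
    lra.
  have i8 : `|(Gb v - Gb u - b (x u) * h) * (sigma (x u))^-1| <= e1 * h * s0^-1.
    by rewrite normrM; apply: ler_pM.
  (* [1 / sigma] is moved from the intermediate time [r] to [u]; the increment of [x] then splits
     into drift, Young remainder and [sigma (x u)] times the increment of [be], and the last cancels
     exactly after the division. *)
  have -> : D v - D u = (x v - x u) * ((sigma (x r))^-1 - (sigma (x u))^-1) +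
     (Iv - Iu - f u * (be v - be u)) * (sigma (x u))^-1 +
     (Gb v - Gb u - b (x u) * h) * (sigma (x u))^-1 - (A v - A u - b (x u) / sigma (x u) * h).
    rewrite /D; have -> : F (x v) - A v - be v - (F (x u) - A u - be u) =
      (F (x v) - F (x u)) - (A v - A u) - (be v - be u) by ring.
    by rewrite Fr xvu /f; field; rewrite !sn0.
  apply: le_trans (ler_normB _ _) _.
  have := lerD (le_trans (ler_normD _ _) (lerD (le_trans (ler_normD _ _) (lerD i6 i7)) i8)) hA.
  move/le_trans; apply; rewrite /Q le_eqVlt; apply/orP; left; apply/eqP; ring.
have tot (m : nat) : (m <= n.+1)%N -> `|D (m%:R * h) - D 0| <=
    m%:R * (h * (Q * (h `^ al + h `^ (th - 1))) + h * (e1 * (s0^-1 + 1))).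
  elim: m => [|m ih] mn; first by rewrite !mul0r subrr normr0.
  have := step m mn; have := ih (ltnW mn); move=> j1 j2.
  rewrite -[m.+1%:R in leRHS]natr1 mulrDl mul1r.
  have -> : D (m.+1%:R * h) - D 0 = (D (m%:R * h) - D 0) + (D (m.+1%:R * h) - D (m%:R * h)) by ring.
  by apply: le_trans (ler_normD _ _) _; exact: lerD.
have := tot _ (leqnn n.+1); rewrite nh -[_ * _ + _ * _ in leRHS]mulrDr mulrA nh => j; apply: le_trans j _.
move: hn2; rewrite sub0r normrN ler_norml => /andP[_ j].
have : t * e1 * (s0^-1 + 1) = e / 2.
  by rewrite /e1; field; rewrite !gt_eqF// addr_gt0.
by move: j; lra.
Unshelve. all: by end_near.
Qed.

End young_chain_rule.

(** * Convergence in probability *)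

Section fourth_moment.
Context {R : realType}.

Lemma rint_fatou d (T : measurableType d) (mu : {measure set T -> \bar R}) (f_ : nat -> T -> R) (f : T -> R) (C : R) :
  (forall n, rint mu (f_ n)) -> measurable_fun setT f -> (forall n w, 0 <= f_ n w) ->
  (forall w, f_ n w @[n --> \oo] --> f w) -> (forall n, \int[mu]_w f_ n w <= C) ->
  rint mu f /\ \int[mu]_w f w <= C.
Proof.
move=> i_ mf f0 cf hC.
have fge0 w : 0 <= f w.
  have := ler_cvg_to (cvg_cst 0) (cf w); apply; near=> n; exact: f0.
have le : (\int[mu]_w (f w)%:E <= C%:E)%E.
  have := @fatou _ _ _ mu setT measurableT (fun n w => (f_ n w)%:E).
  have -> : (fun w => limn_einf ((fun n w0 => (f_ n w0)%:E) ^~ w)) = (fun w => (f w)%:E).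
    apply/funext => w; apply: (cvg_limn_einf_sup _).1.
    by apply: cvg_EFin; [near=> n|exact: cf].
  move=> h; apply: le_trans (h _ _) _.
  - by move=> n; apply/measurable_EFinP; exact: rint_measurable (i_ n).
  - by move=> n w _; rewrite lee_fin.
  rewrite limn_einf_lim; apply: lime_le; first exact: is_cvg_einfs.
  near=> n; apply: le_trans (_ : (\int[mu]_w (f_ n w)%:E <= _)%E); last by rewrite rint_EFin// lee_fin.
  by apply: ereal_inf_lbound; exists n => /=.
have fi : rint mu f.
  apply/integrableP; split; first exact/measurable_EFinP.
  apply: le_lt_trans (ltry C); apply: le_trans le; apply: ge0_le_integral => //.
  - by apply: measurableT_comp; [exact: abse_measurable|exact/measurable_EFinP].
  - exact/measurable_EFinP.
  - by move=> w _; rewrite /= lee_fin ger0_norm.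
by split=> //; move: le; rewrite rint_EFin// lee_fin.
Unshelve. all: by end_near.
Qed.

Variable s : R.
Hypothesis s0 : 0 < s.
Notation g := (gauss 0 (Num.sqrt s)).

(* Integration by parts against [x ^+ 3 / (1 + x ^+ 2 / n)], whose derivative is bounded. *)
Lemma gauss_fourth : rint g (fun x => x ^+ 4) /\ \int[g]_x (x ^+ 4) <= 3 * s ^+ 2.
Proof.
have sq0 : Num.sqrt s != 0 by rewrite gt_eqF// sqrtr_gt0.
pose e n : R := n.+1%:R^-1.
have e0 n : 0 < e n by rewrite invr_gt0.
pose D n x : R := 1 + e n * x ^+ 2.
have D1 n x : 1 <= D n x by rewrite lerDl mulr_ge0 ?sqr_ge0 ?(ltW (e0 n)).
have D0 n x : D n x != 0 by apply: lt0r_neq0; have := D1 n x; lra.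
pose G n x : R := x ^+ 3 / D n x.
pose G' n x : R := (3 * x ^+ 2 + e n * x ^+ 4) / D n x ^+ 2.
have dG n x : is_derive x (1 : R) (G n) (G' n x).
  have dD : is_derive x (1 : R) (D n) (e n * (2 * x)).
    by apply: is_derive_eq; rewrite /GRing.scale/=; ring.
  have dN : is_derive x (1 : R) (fun x : R => x ^+ 3) (3 * x ^+ 2).
    by apply: is_derive_eq; rewrite /GRing.scale/=; ring.
  have := is_deriveM dN (is_deriveV (D0 n x) dD).
  move=> h; apply: (is_derive_eq h); rewrite /G' /GRing.scale/= /D.
  by field; exact: D0.
have cD n : continuous (D n).
  move=> x; apply: cvgD; first exact: cvg_cst.
  by apply: cvgM; [exact: cvg_cst|exact: exprn_continuous].
have cG' n : continuous (G' n).
  move=> x; apply: cvgM.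
    apply: cvgD; apply: cvgM; try exact: cvg_cst; exact: exprn_continuous.
  apply: cvgV; first by rewrite expf_neq0.
  by apply: (@cvg_comp _ _ _ (D n) (fun y => y ^+ 2)); [exact: cD|exact: exprn_continuous].
(* The bound [3 x ^+ 2], uniform in [n], produces the constant 3; the bound [G'C] only makes
   [gauss_ibp] applicable. *)
have G'3 n x : 0 <= G' n x <= 3 * x ^+ 2.
  have x2 := sqr_ge0 x; have x4 : 0 <= x ^+ 4 by rewrite (exprM x 2 2) sqr_ge0.
  have e00 := e0 n; have d1 := D1 n x.
  have e000 := ltW e00; apply/andP; split.
    by apply: divr_ge0; [do ?[done|apply: addr_ge0|apply: mulr_ge0]|exact: sqr_ge0].
  rewrite /G'.
  rewrite ler_pdivrMr ?exprn_gt0//; last lra.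
  have e2 : x ^+ 4 = x ^+ 2 * x ^+ 2 by rewrite -exprD.
  have : 3 * x ^+ 2 * D n x <= 3 * x ^+ 2 * D n x ^+ 2.
    have dd : D n x <= D n x ^+ 2 by rewrite expr2 ler_peMl//; lra.
    by rewrite ler_wpM2l// mulr_ge0.
  have : 0 <= e n * x ^+ 4 by rewrite mulr_ge0 ?(ltW e00).
  rewrite /D e2; lra.
have G'C n x : `|G' n x| <= 3 / e n.
  have /andP[h1 h2] := G'3 n x; rewrite ger0_norm//.
  have d1 := D1 n x; have x2 := sqr_ge0 x.
  rewrite /G' ler_pdivrMr ?exprn_gt0//; last lra.
  have -> : 3 / e n * D n x ^+ 2 = 3 / e n + 6 * x ^+ 2 + 3 * e n * x ^+ 4.
    by rewrite /D; field; rewrite gt_eqF.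
  have x4 : 0 <= x ^+ 4 by rewrite (exprM x 2 2) sqr_ge0.
  have : 0 <= 3 / e n by rewrite divr_ge0 ?(ltW (e0 n)).
  have : 0 <= e n * x ^+ 4 by rewrite mulr_ge0 ?(ltW (e0 n)).
  lra.
have ibp n := gauss_ibp 0 sq0 (dG n) (cG' n) (G'C n).
have [iq q] := gauss_sq s0.
apply: (rint_fatou (mu := g) (f_ := fun n x => x ^+ 4 / D n x)).
- move=> n; have [h _] := ibp n; move: h; congr (rint _ _); apply/funext => x.
  by rewrite subr0 /G mulrA -exprS.
- by apply: continuous_measurable; exact: exprn_continuous.
- move=> n x; rewrite divr_ge0//; last by have := D1 n x; lra.
  by rewrite (exprM x 2 2) sqr_ge0.
- move=> x; rewrite -[X in _ --> X]mulr1 -[X in _ * X]invr1.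
  apply: cvgM; first exact: cvg_cst.
  apply: cvgV; first exact: oner_neq0.
  rewrite -[X in _ --> X]addr0; apply: cvgD; first exact: cvg_cst.
  rewrite -[X in _ --> X](mul0r (x ^+ 2)); apply: cvgM; last exact: cvg_cst.
  exact: cvg_harmonic.
- move=> n; have [_] := ibp n; rewrite sqr_sqrtr ?(ltW s0)// => E.
  have -> : \int[g]_x (x ^+ 4 / D n x) = \int[g]_x ((x - 0) * G n x).
    by apply: Rint_eq => x; rewrite subr0 /G mulrA -exprS.
  rewrite E; have -> : 3 * s ^+ 2 = s * (3 * s) by ring.
  rewrite ler_wpM2l ?(ltW s0)//.
  apply: le_trans (_ : \int[g]_x (3 * x ^+ 2) <= _); last by rewrite RintZ// q.
  apply: Rint_le; [|exact: rintZ|by move=> x; case/andP: (G'3 n x)].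
  by apply: (@rint_bounded _ _ _ _ (3 / e n)) => //; exact: continuous_measurable.
Qed.

Lemma gauss_sq_var : rint g (fun x => (x ^+ 2 - s) ^+ 2) /\ \int[g]_x ((x ^+ 2 - s) ^+ 2) <= 2 * s ^+ 2.
Proof.
have [i4 h4] := gauss_fourth; have [i2 h2] := gauss_sq s0.
have E x : (x ^+ 2 - s) ^+ 2 = x ^+ 4 - (2 * s * x ^+ 2 - s ^+ 2) by ring.
have i2' : rint g (fun x => 2 * s * x ^+ 2) by exact: rintZ.
have i3 : rint g (fun x => 2 * s * x ^+ 2 - s ^+ 2) by apply: rintB => //; exact: rint_cst.
split; first by under eq_fun do rewrite E; exact: rintB.
under Rint_eq do rewrite E.
rewrite RintB// RintB//; last exact: rint_cst.
by rewrite RintZ// h2 Rint_cst; lra.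
Qed.

End fourth_moment.

Section pdist.
Context d (T : measurableType d) (R : realType) (P : probability T R).
Implicit Types (Z U V : T -> R).

(** A distance to 0 that metrizes convergence in probability, so that limits in probability become
    limits of real sequences. *)
Definition pdist Z : R := \int[P]_w Num.min 1 `|Z w|.

Lemma min1_bound (x : R) : 0 <= Num.min 1 `|x| <= 1.
Proof. by rewrite le_min ler01 normr_ge0 ge_min lexx. Qed.

Lemma rint_min1 Z : measurable_fun setT Z -> rint P (fun w => Num.min 1 `|Z w|).
Proof.
move=> mZ; apply: (@rint_bounded _ _ _ _ 1).
  by apply: measurable_minr => //; exact: measurableT_comp.
by move=> w; have /andP[h1 h2] := min1_bound (Z w); rewrite ger0_norm.
Qed.

Lemma pdist_ge0 Z : 0 <= pdist Z.
Proof. by apply: Rint_ge0 => w; case/andP: (min1_bound (Z w)). Qed.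

Lemma pdist_le Z U : measurable_fun setT Z -> measurable_fun setT U ->
  {ae P, forall w, `|Z w| <= `|U w|} -> pdist Z <= pdist U.
Proof.
(* [V] equals [|Z|] almost everywhere and is below [|U|] everywhere, which lets the pointwise
   monotonicity of the integral be used. *)
move=> mZ mU hZU; pose V w := Num.min `|Z w| `|U w|.
have mV : measurable_fun setT V by apply: measurable_minr; exact: measurableT_comp.
have -> : pdist Z = pdist V.
  apply: Rint_ae_eq; [exact: rint_measurable (rint_min1 mZ)|exact: rint_measurable (rint_min1 mV)|].
  apply: filterS hZU => w h; rewrite /V; have /min_idPl -> := h.
  by rewrite normr_id.
apply: Rint_le; [exact: rint_min1|exact: rint_min1|].
move=> w; rewrite /V ger0_norm; last by rewrite le_min !normr_ge0.
by rewrite le_min !ge_min !lexx/= !orbT.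
Qed.

Lemma pdistD Z U : measurable_fun setT Z -> measurable_fun setT U ->
  pdist (fun w => Z w + U w) <= pdist Z + pdist U.
Proof.
move=> mZ mU; rewrite -RintD; [|exact: rint_min1..].
apply: Rint_le; [by apply: rint_min1; exact: measurable_funD|by apply: rintD; exact: rint_min1|].
move=> w; have := ler_normD (Z w) (U w).
have := normr_ge0 (Z w); have := normr_ge0 (U w); rewrite /Num.min.
by do 3 case: ifPn; rewrite -?leNgt; lra.
Qed.

Lemma pdist_abs_le Z : rint P Z -> pdist Z <= \int[P]_w `|Z w|.
Proof.
move=> iZ; apply: Rint_le; [exact: rint_min1 (rint_measurable iZ)|exact: rint_abs|].
by move=> w; rewrite ge_min lexx orbT.
Qed.

Lemma pdist_sq_le Z : measurable_fun setT Z -> rint P (fun w => Z w ^+ 2) ->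
  pdist Z <= Num.sqrt (\int[P]_w Z w ^+ 2).
Proof.
move=> mZ iZ; apply: le_trans (pdist_abs_le (rint_sq mZ iZ)) _.
exact: Rint_abs_sq.
Qed.

Lemma pdist_prob_le Z (e eta : R) : measurable_fun setT Z -> 0 <= e -> 0 <= eta ->
  (P [set w | (e < `|Z w|)%R] <= eta%:E)%E -> pdist Z <= e + eta.
Proof.
move=> mZ e0 eta0 h; set A := [set w | _] in h.
have mA : measurable A.
  have -> : A = setT `&` (fun w => `|Z w|) @^-1` `]e, +oo[.
    by rewrite setTI; apply/seteqP; split => w /=; rewrite in_itv/= andbT.
  by apply: measurableT_comp.
have iA : rint P (\1_A : T -> R).
  apply: (@rint_bounded _ _ _ _ 1); first exact: measurable_indic.
  by move=> w; rewrite indicE; case: (_ \in _); rewrite ?normr1 ?normr0.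
apply: le_trans (_ : \int[P]_w (e + \1_A w) <= _).
  apply: Rint_le; [exact: rint_min1|by apply: rintD => //; exact: rint_cst|].
  move=> w; rewrite indicE; case: (boolP (w \in A)) => wA.
    by rewrite ge_min; apply/orP; left; rewrite lerDr.
  rewrite addr0 ge_min; apply/orP; right; rewrite leNgt; apply/negP => h'.
  by move/negP: wA; apply; rewrite inE.
rewrite RintD//; last exact: rint_cst.
rewrite Rint_cst lerD2l Rint_indic// -lee_fin finePK//.
Qed.

Lemma pdist_eq0 Z : measurable_fun setT Z -> pdist Z = 0 -> {ae P, forall w, Z w = 0}.
Proof.
move=> mZ h; have iZ := rint_min1 mZ.
have : (\int[P]_w (Num.min 1 `|Z w|)%:E = 0)%E by rewrite rint_EFin// -/(pdist Z) h.
move=> h0.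
have m1 : measurable_fun setT (fun w => (Num.min 1 `|Z w|)%:E) by apply/measurable_EFinP; exact: rint_measurable iZ.
have h1 : (\int[P]_(w in setT) `|(Num.min 1 `|Z w|)%:E| = 0)%E.
  rewrite -[RHS]h0; by apply: eq_integral => w _; rewrite gee0_abs.
have := (ae_eq_integral_abs P measurableT m1).1 h1.
apply: filterS => w /(_ I) /= [] e.
apply/eqP; rewrite -normr_eq0; apply/eqP; move: e; rewrite /Num.min; case: ifPn => // _ /eqP.
by rewrite oner_eq0.
Qed.

Definition pcvg0 (Z : nat -> T -> R) : Prop :=
  (forall n, measurable_fun setT (Z n)) /\ pdist (Z n) @[n --> \oo] --> 0.

Lemma squeeze0 (u v : nat -> R) : (forall n, 0 <= u n <= v n) -> v n @[n --> \oo] --> 0 ->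
  u n @[n --> \oo] --> 0.
Proof.
move=> uv cv; apply: (squeeze_cvgr _ (cvg_cst 0) cv); by near=> n.
Unshelve. all: by end_near.
Qed.

Lemma pcvg0_le (Z U : nat -> T -> R) : pcvg0 U -> (forall n, measurable_fun setT (Z n)) ->
  (forall n, {ae P, forall w, `|Z n w| <= `|U n w|}) -> pcvg0 Z.
Proof.
move=> [mU cU] mZ h; split => //; apply: squeeze0 cU => n.
by rewrite pdist_ge0 pdist_le.
Qed.

Lemma pcvg0D (Z U : nat -> T -> R) : pcvg0 Z -> pcvg0 U -> pcvg0 (fun n w => Z n w + U n w).
Proof.
move=> [mZ cZ] [mU cU]; split; first by move=> n; exact: measurable_funD.
apply: (@squeeze0 _ (fun n => pdist (Z n) + pdist (U n))).
  by move=> n; rewrite pdist_ge0 pdistD.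
by rewrite -[X in _ --> X]addr0; exact: cvgD.
Qed.

Lemma pcvg0Z (r : R) (Z : nat -> T -> R) : pcvg0 Z -> pcvg0 (fun n w => r * Z n w).
Proof.
move=> [mZ cZ]; split; first by move=> n; exact: measurable_funM.
apply: (@squeeze0 _ (fun n => (1 + `|r|) * pdist (Z n))); last first.
  by rewrite -[X in _ --> X](mulr0 (1 + `|r|)); apply: cvgM => //; exact: cvg_cst.
move=> n; rewrite pdist_ge0/= -RintZ; last exact: rint_min1.
apply: Rint_le; [by apply: rint_min1; exact: measurable_funM|by apply: rintZ; exact: rint_min1|].
move=> w; rewrite normrM; have := normr_ge0 (Z n w); have := normr_ge0 r.
have : 0 <= `|r| * `|Z n w| by [].
rewrite /Num.min; do 2 case: ifPn; rewrite -?leNgt; nra.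
Qed.

Lemma pcvg0B (Z U : nat -> T -> R) : pcvg0 Z -> pcvg0 U -> pcvg0 (fun n w => Z n w - U n w).
Proof.
move=> hZ hU; have := pcvg0D hZ (pcvg0Z (-1) hU); congr pcvg0.
by apply/funext => n; apply/funext => w; rewrite mulN1r.
Qed.

Lemma pcvg0_ae (Z : nat -> T -> R) : (forall n, measurable_fun setT (Z n)) ->
  {ae P, forall w, Z n w @[n --> \oo] --> 0} -> pcvg0 Z.
Proof.
move=> mZ h; split => //.
rewrite -[X in _ --> X](Rint_cst P 0).
apply: (Rint_dominated (g := fun=> 1)).
- by move=> n; exact: rint_measurable (rint_min1 (mZ n)).
- exact: measurable_cst.
- apply: filterS h => w /cvg_norm; rewrite normr0 => c.
  by apply: squeeze0 c => n; have /andP[h1 _] := min1_bound (Z n w); rewrite h1 ge_min lexx orbT.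
- exact: rint_cst.
- by move=> n w; have /andP[h1 h2] := min1_bound (Z n w); rewrite ger0_norm.
Qed.

Lemma pcvg0_L2 (Z : nat -> T -> R) : (forall n, measurable_fun setT (Z n)) ->
  (forall n, rint P (fun w => Z n w ^+ 2)) -> \int[P]_w Z n w ^+ 2 @[n --> \oo] --> 0 -> pcvg0 Z.
Proof.
move=> mZ iZ c; split => //; apply: squeeze0 (sqrt_comp_cvg0 c) => n.
by rewrite pdist_ge0 pdist_sq_le.
Qed.

End pdist.

(** * The chain rule for Stratonovich equations *)

Section brownian_filtration.
Context d (T : measurableType d) (R : realType) (P : probability T R).
Variables (F : R -> set (set T)) (B : R -> T -> R).
Hypotheses (hF : is_filtration F) (hB : is_brownian_motion P F B).

(** Measurability with respect to [F s], phrased on the generated sigma-algebra because [decoupling]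
    expects that type; for [s >= 0] the set [F s] is a sigma-algebra already, so generating adds
    nothing. *)
Definition fmeas (s : R) (U : T -> R) := measurable_fun [set: g_sigma_algebraType (F s)] U.

Let fbm : is_fbm P 2^-1 B. Proof. by case: hB. Qed.

Let Fm s : 0 <= s -> F s `<=` measurable. Proof. by case: hF => _ + _ => h /h. Qed.

Lemma fmeas_adapted X s : adapted F X -> 0 <= s -> fmeas s (X s).
Proof. by move=> aX s0 _ A mA; rewrite setTI; apply: sub_sigma_algebra; exact: aX. Qed.

Lemma fmeas_le s u U : 0 <= s -> s <= u -> fmeas s U -> fmeas u U.
Proof.
move=> s0 su mU _ A mA; have := mU measurableT A mA; rewrite !setTI.
apply: smallest_sub; first exact: smallest_sigma_algebra.
move=> E FE; apply: sub_sigma_algebra; case: hF => _ _ h; exact: (h s u).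
Qed.

Lemma fmeas_measurable s U : 0 <= s -> fmeas s U -> measurable_fun setT U.
Proof. by move=> s0; apply: measurable_coarsen; exact: Fm. Qed.

Lemma fmeas_B s u : 0 <= s -> s <= u -> fmeas u (B s).
Proof. by move=> s0 su; apply: (fmeas_le s0 su); apply: fmeas_adapted => //; case: hB. Qed.

Section one_increment.
Variables (s u : R).
Hypotheses (s0 : 0 <= s) (su : s < u).
Notation dl := (u - s).
Notation W := (fun w => B u w - B s w).

Let dl0 : 0 < dl. Proof. by rewrite subr_gt0. Qed.

Let W_span : gspan B W /\ gcov P W W = dl.
Proof.
have [h1 _ h3] := bm_incr fbm s0 (ltW dl0).
by move: h1 h3; rewrite (addrC s) subrK.
Qed.

Let mW : measurable_fun setT W. Proof. exact (gspan_measurable fbm W_span.1). Qed.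

Let indep A C : <<s F s >> A -> measurable C ->
  P (A `&` W @^-1` C) = (P A * gauss 0 (Num.sqrt dl) C)%E.
Proof.
move=> sA mC; have FA : F s A.
  by apply: (smallest_sub _ _ sA) => //; case: hF => h _ _; exact: h.
have [_ _ _ /(_ s u s0 (ltW su) A C FA mC)] := hB.
have v : \int[P]_w (W w ^+ 2) = dl by rewrite gcov_sq W_span.2.
have := gspan_law fbm W_span.1; rewrite v => /(_ dl0 C mC) <-.
exact.
Qed.

Lemma increment_decoupling (U : T -> R) (k : R -> R) : fmeas s U -> rint P U ->
  measurable_fun setT k -> rint (gauss 0 (Num.sqrt dl)) k ->
  rint P (fun w => U w * k (W w)) /\
  \int[P]_w (U w * k (W w)) = \int[P]_w U w * \int[gauss 0 (Num.sqrt dl)]_x k x.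
Proof.
move=> mU iU mk ik.
have [] := @decoupling _ _ _ P (F s) W (gauss 0 (Num.sqrt dl)) (Fm s0) mW indep
  (fun q => U q.1 * k q.2) (fun w => `|U w|) (fun x => `|k x|).
- apply: measurable_funM; first exact: (measurableT_comp mU (@measurable_fst _ _ _ _)).
  exact: (measurableT_comp mk (@measurable_snd _ _ _ _)).
- exact: measurableT_comp.
- exact: rint_abs.
- exact: rint_abs.
- by move=> w x /=; rewrite normrM.
move=> h1 _ h2; split; first exact: h1.
rewrite [LHS]h2 -RintZr//; apply: Rint_eq => w /=; exact: RintZ.
Qed.

Lemma increment_mean (U : T -> R) : fmeas s U -> rint P U ->
  rint P (fun w => U w * W w) /\ \int[P]_w (U w * W w) = 0.
Proof.
move=> mU iU; have [h1 h2] := increment_decoupling mU iU (@measurable_id _ _ setT) (gauss_id dl0).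
split => //; rewrite h2; have sq0 : Num.sqrt dl != 0 by rewrite gt_eqF// sqrtr_gt0.
have := gauss_mean 0 sq0; under Rint_eq do rewrite subr0.
by move=> ->; rewrite mulr0.
Qed.

Lemma increment_sq (U : T -> R) : fmeas s U -> rint P U ->
  rint P (fun w => U w * W w ^+ 2) /\ \int[P]_w (U w * W w ^+ 2) = dl * \int[P]_w U w.
Proof.
move=> mU iU; have [i2 e2] := gauss_sq dl0.
have [h1 h2] := increment_decoupling mU iU (rint_measurable i2) i2.
by split => //; rewrite h2 e2 mulrC.
Qed.

Lemma increment_sq_var (U : T -> R) : fmeas s U -> rint P U -> (forall w, 0 <= U w) ->
  rint P (fun w => U w * (W w ^+ 2 - dl) ^+ 2) /\
  \int[P]_w (U w * (W w ^+ 2 - dl) ^+ 2) <= 2 * dl ^+ 2 * \int[P]_w U w.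
Proof.
move=> mU iU U0; have [i2 e2] := gauss_sq_var dl0.
have [h1 h2] := increment_decoupling mU iU (rint_measurable i2) i2.
by split => //; rewrite h2 mulrC ler_wpM2r// Rint_ge0.
Qed.

End one_increment.

Section grid_sums.
Variables (dl C : R) (xi : nat -> T -> R).
Hypothesis dl0 : 0 < dl.
Hypothesis mxi : forall k, fmeas (k%:R * dl) (xi k).
Hypothesis bxi : forall k w, `|xi k w| <= C.

Let t0 (k : nat) : 0 <= k%:R * dl. Proof. by rewrite mulr_ge0// ltW. Qed.
Let tS (k : nat) : k%:R * dl < k.+1%:R * dl. Proof. by rewrite ltr_pM2r// ltr_nat. Qed.
Let dlE (k : nat) : k.+1%:R * dl - k%:R * dl = dl. Proof. by rewrite -natr1; ring. Qed.
Let mono (j k : nat) : (j <= k)%N -> j%:R * dl <= k%:R * dl.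
Proof. by move=> jk; rewrite ler_wpM2r ?(ltW dl0)// ler_nat. Qed.
Let C0 : 0 <= C. Proof. exact: le_trans (bxi 0%N point). Qed.

Definition itosum N w := \sum_(k < N) xi k w * bincr B dl k w.

Definition qvsum N w := \sum_(k < N) xi k w * (bincr B dl k w ^+ 2 - dl).

Let fxi j k : (j <= k)%N -> fmeas (k%:R * dl) (xi j).
Proof. by move=> jk; apply: (fmeas_le (t0 j) (mono jk)). Qed.

Let fincr (j k : nat) : (j < k)%N -> fmeas (k%:R * dl) (bincr B dl j).
Proof.
move=> jk; apply: measurable_funB; first exact: (fmeas_B (t0 j.+1) (mono jk)).
exact: (fmeas_B (t0 j) (mono (ltnW jk))).
Qed.

Lemma fmeas_itosum N : fmeas (N%:R * dl) (itosum N).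
Proof.
suff h k : (k <= N)%N -> measurable_fun [set: g_sigma_algebraType (F (N%:R * dl))] (itosum k).
  exact: h.
elim: k => [|k ih] kN.
  by rewrite /itosum; under eq_fun do rewrite big_ord0; exact: measurable_cst.
rewrite /itosum; under eq_fun do rewrite big_ord_recr/=.
apply: measurable_funD; first by apply: ih; exact: ltnW.
by apply: measurable_funM; [exact: fxi (ltnW kN)|exact: fincr].
Qed.

Lemma fmeas_qvsum N : fmeas (N%:R * dl) (qvsum N).
Proof.
suff h k : (k <= N)%N -> measurable_fun [set: g_sigma_algebraType (F (N%:R * dl))] (qvsum k).
  exact: h.
elim: k => [|k ih] kN.
  by rewrite /qvsum; under eq_fun do rewrite big_ord0; exact: measurable_cst.
rewrite /qvsum; under eq_fun do rewrite big_ord_recr/=.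
apply: measurable_funD; first by apply: ih; exact: ltnW.
apply: measurable_funM; first exact: fxi (ltnW kN).
by apply: measurable_funB => //; apply: measurable_funX; exact: fincr.
Qed.

Let rint_bM (U V : T -> R) (K : R) : rint P V -> measurable_fun setT U -> (forall w, `|U w| <= K) ->
  rint P (fun w => V w * U w).
Proof.
move=> iV mU bU; apply: (rint_le (g := fun w => `|V w| * K)).
- by apply: measurable_funM => //; exact: rint_measurable iV.
- by apply: rintZr; exact: rint_abs.
- by move=> w; rewrite normrM ler_wpM2l.
Qed.

Let mx k : measurable_fun setT (xi k).
Proof. exact (fmeas_measurable (t0 k) (@mxi k)). Qed.

(** Induction on the number of steps: in the new square the cross term is a variable known at time
    [N dl] times an increment, so it has mean zero. *)
Lemma ito_isometry N : rint P (fun w => itosum N w ^+ 2) /\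
  \int[P]_w itosum N w ^+ 2 = dl * \sum_(k < N) \int[P]_w xi k w ^+ 2.
Proof.
elim: N => [|N [i1 e1]].
  rewrite big_ord0 mulr0 /itosum; under eq_fun do rewrite big_ord0 expr0n.
  by split; [exact: rint_cst|rewrite Rint_cst].
have mS := @fmeas_itosum N; have mS' := fmeas_measurable (t0 N) mS.
have iS : rint P (itosum N) by exact: rint_sq.
have mU : fmeas (N%:R * dl) (fun w => itosum N w * xi N w) by apply: measurable_funM => //; exact: mxi.
have iU := rint_bM iS (mx N) (bxi N).
have [i2 e2] := increment_mean (t0 N) (tS N) mU iU.
have mV : fmeas (N%:R * dl) (fun w => xi N w ^+ 2) by apply: measurable_funX; exact: mxi.
have iV : rint P (fun w => xi N w ^+ 2).
  apply: (@rint_bounded _ _ _ _ (C ^+ 2)); first by apply: measurable_funX; exact: mx.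
  by move=> w; rewrite normrX lerXn2r// nnegrE.
have [i3 e3] := increment_sq (t0 N) (tS N) mV iV; rewrite dlE in e3.
have E w : itosum N.+1 w ^+ 2 = itosum N w ^+ 2 + (2 * (itosum N w * xi N w * bincr B dl N w) +
    xi N w ^+ 2 * bincr B dl N w ^+ 2).
  by rewrite /itosum big_ord_recr/=; ring.
have i4 : rint P (fun w => 2 * (itosum N w * xi N w * bincr B dl N w)) by exact: rintZ.
have i5 := rintD i4 i3.
split; first by under eq_fun do rewrite E; exact: rintD.
under Rint_eq do rewrite E.
by rewrite RintD// RintD// RintZ// e2 e3 mulr0 add0r e1 big_ord_recr/= mulrDr.
Qed.

(** The variables [D ^+ 2 - dl] are centred given the past, so the summands are orthogonal. For
    [N dl = t] the bound is [2 t C ^+ 2 dl], which vanishes with the mesh. *)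
Lemma qvsum_L2 N : rint P (fun w => qvsum N w ^+ 2) /\
  \int[P]_w qvsum N w ^+ 2 <= 2 * dl ^+ 2 * (N%:R * C ^+ 2).
Proof.
elim: N => [|N [i1 e1]].
  rewrite mul0r mulr0 /qvsum; under eq_fun do rewrite big_ord0 expr0n.
  by split; [exact: rint_cst|rewrite Rint_cst].
have mS := @fmeas_qvsum N; have mS' := fmeas_measurable (t0 N) mS.
have iS : rint P (qvsum N) by exact: rint_sq.
have mU : fmeas (N%:R * dl) (fun w => qvsum N w * xi N w) by apply: measurable_funM => //; exact: mxi.
have iU := rint_bM iS (mx N) (bxi N).
have [i2 e2] := increment_sq (t0 N) (tS N) mU iU; rewrite dlE in e2.
have mV : fmeas (N%:R * dl) (fun w => xi N w ^+ 2) by apply: measurable_funX; exact: mxi.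
have iV : rint P (fun w => xi N w ^+ 2).
  apply: (@rint_bounded _ _ _ _ (C ^+ 2)); first by apply: measurable_funX; exact: mx.
  by move=> w; rewrite normrX lerXn2r// nnegrE.
have [i3 e3] := increment_sq_var (t0 N) (tS N) mV iV (fun w => sqr_ge0 _); rewrite dlE in i3 e3.
have E w : qvsum N.+1 w ^+ 2 = qvsum N w ^+ 2 + (2 * (qvsum N w * xi N w * bincr B dl N w ^+ 2 -
    dl * (qvsum N w * xi N w)) + xi N w ^+ 2 * (bincr B dl N w ^+ 2 - dl) ^+ 2).
  by rewrite /qvsum big_ord_recr/=; ring.
have i6 : rint P (fun w => dl * (qvsum N w * xi N w)) by exact: rintZ.
have i7 := rintB i2 i6.
have i4 := rintZ 2 i7.
have i5 := rintD i4 i3.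
split; first by under eq_fun do rewrite E; exact: rintD.
under Rint_eq do rewrite E.
rewrite RintD// RintD// RintZ// RintB// e2 RintZ// subrr mulr0 add0r -natr1.
have V2 : \int[P]_w xi N w ^+ 2 <= C ^+ 2.
  rewrite -[leRHS](Rint_cst P); apply: Rint_le => //; first exact: rint_cst.
  by move=> w; rewrite -[leLHS]ger0_norm ?sqr_ge0// normrX lerXn2r// nnegrE.
have := le_trans e3 (ler_wpM2l _ V2); rewrite mulr_ge0 ?sqr_ge0// => /(_ isT) h.
by move: e1; lra.
Qed.

End grid_sums.

End brownian_filtration.

Section pcvg0_tightness.
Context d (T : measurableType d) (R : realType) (P : probability T R).

(* For [Z = U V]: [|U V| <= lam |V|] where [|U| <= lam], and [1 <= |U| / lam] elsewhere. *)
Lemma pcvg0_tight (Z U V : nat -> T -> R) (C : R) : (forall n, measurable_fun setT (Z n)) ->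
  pcvg0 P U -> (forall n, rint P (V n)) -> (forall n, \int[P]_w `|V n w| <= C) ->
  (forall (lam : R) n w, 0 < lam < 1 -> Num.min 1 `|Z n w| <= lam * `|V n w| + lam^-1 * Num.min 1 `|U n w|) ->
  pcvg0 P Z.
Proof.
move=> mZ [mU cU] iV hC h; split => //.
have C0 : 0 <= C by apply: le_trans (hC 0%N); apply: Rint_ge0.
apply/cvgrPdist_le => e e0.
pose lam := Num.min (2^-1) (e / (2 * (C + 1))).
have C1 : 0 < C + 1 by lra.
have l0 : 0 < lam by rewrite lt_min invr_gt0 ltr0n/= divr_gt0// mulr_gt0.
have l1 : lam < 1 by rewrite gt_min; apply/orP; left; lra.
have lC : lam * C <= e / 2.
  have : lam <= e / (2 * (C + 1)) by rewrite ge_min lexx orbT.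
  move=> /(ler_wpM2r C0) h1; apply: le_trans h1 _.
  rewrite -mulrA ler_wpM2l ?(ltW e0)// invfM -mulrA ler_piMr ?invr_ge0//.
  by rewrite mulrC ler_pdivrMr//; lra.
have e20 : 0 < lam * (e / 2) by rewrite mulr_gt0// divr_gt0.
have /cvgrPdist_le /(_ _ e20) := cU; apply: filterS => n.
rewrite !sub0r !normrN !ger0_norm ?pdist_ge0// => hn.
have iU := rint_min1 P (mU n).
have i1 : rint P (fun w => lam * `|V n w|) by apply: rintZ; exact: rint_abs.
have i2 : rint P (fun w => lam^-1 * Num.min 1 `|U n w|) by exact: rintZ.
apply: le_trans (_ : \int[P]_w (lam * `|V n w| + lam^-1 * Num.min 1 `|U n w|) <= _).
  by apply: Rint_le; [exact: rint_min1|exact: rintD|move=> w; apply: h; rewrite l0].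
rewrite RintD// RintZ; last exact: rint_abs.
rewrite RintZ//.
have : lam^-1 * pdist P (U n) <= e / 2 by rewrite mulrC ler_pdivrMr// mulrC.
have := ler_wpM2l (ltW l0) (hC n); rewrite /pdist; lra.
Qed.

Lemma pcvg0_mul (U V : nat -> T -> R) (C : R) : pcvg0 P U -> (forall n, rint P (V n)) ->
  (forall n, \int[P]_w `|V n w| <= C) -> pcvg0 P (fun n w => U n w * V n w).
Proof.
move=> hU iV hC; apply: (pcvg0_tight _ hU iV hC).
  by move=> n; apply: measurable_funM; [case: hU|exact: rint_measurable].
move=> lam n w /andP[l0 l1]; rewrite normrM.
have a0 := normr_ge0 (U n w); have v0 := normr_ge0 (V n w).
set a := `|U n w| in a0 *; set v := `|V n w| in v0 *.
have lV0 : 0 < lam^-1 by rewrite invr_gt0.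
have lv0 : 0 <= lam * v by rewrite mulr_ge0 ?(ltW l0).
have lV1 : 1 < lam^-1 by rewrite invf_gt1.
case: (leP 1 a) => a1; first by rewrite ge_min; apply/orP; left; lra.
case: (leP v lam^-1) => vl.
  by rewrite ge_min; apply/orP; right; have := ler_wpM2l a0 vl; lra.
have : 1 <= lam * v by rewrite -ler_pdivrMl// mulr1 ltW.
have : 0 <= lam^-1 * a by rewrite mulr_ge0 ?(ltW lV0).
by rewrite ge_min; move=> *; apply/orP; left; lra.
Qed.

Lemma pcvg0_split (Z U V : nat -> T -> R) (C : R) : (forall n, measurable_fun setT (Z n)) ->
  pcvg0 P U -> (forall n, rint P (V n)) -> (forall n, \int[P]_w `|V n w| <= C) ->
  (forall (lam : R) n w, 0 < lam < 1 -> `|Z n w| <= lam * `|V n w| + lam^-1 * `|U n w|) ->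
  pcvg0 P Z.
Proof.
move=> mZ hU iV hC h; apply: (pcvg0_tight mZ hU iV hC) => lam n w l01.
have := h lam n w l01; case/andP: l01 => l0 l1.
have a0 := normr_ge0 (U n w); have v0 := normr_ge0 (V n w).
set a := `|U n w| in a0 *; set v := `|V n w| in v0 *; set z := `|Z n w|.
have lV1 : 1 < lam^-1 by rewrite invf_gt1.
have lv0 : 0 <= lam * v by rewrite mulr_ge0 ?(ltW l0).
move=> hz; case: (leP 1 a) => a1.
  by rewrite ge_min; apply/orP; left; lra.
by rewrite ge_min hz orbT.
Qed.

(** Fatou's lemma for [min 1 |Z n|]. Its lower limit is measurable in any case and agrees with
    [min 1 |V|] almost everywhere, so it can be used in place of the latter. *)
Lemma pcvg0_ae_limit (Z : nat -> T -> R) (V : T -> R) : pcvg0 P Z ->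
  {ae P, forall w, Z n w @[n --> \oo] --> V w} -> {ae P, forall w, V w = 0}.
Proof.
move=> [mZ cZ] hV.
pose m n w := (Num.min 1 `|Z n w|)%:E.
have mm n : measurable_fun setT (m n) by apply/measurable_EFinP; exact: rint_measurable (rint_min1 P (mZ n)).
have m0 n w : (0 <= m n w)%E by rewrite lee_fin; case/andP: (min1_bound (Z n w)).
have f := fatou P measurableT mm (fun n w _ => m0 n w).
have e0 : limn_einf (fun n => \int[P]_(w in setT) m n w)%E = 0%E.
  apply: (cvg_limn_einf_sup _).1.
  rewrite (_ : (fun n => _) = EFin \o (fun n => pdist P (Z n))); last first.
    by apply/funext => n; rewrite /m rint_EFin//; exact: rint_min1.
  by apply: cvg_EFin => //; near=> n.
rewrite e0 in f.
have mL : measurable_fun setT (fun w => limn_einf (m ^~ w)).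
  have -> : (fun w => limn_einf (m ^~ w)) = (fun w => (- limn_esup (fun n => - m n w))%E).
    apply/funext => w; have /(congr1 -%E) := limn_esupN (m ^~ w).
    by rewrite oppeK => <-.
  apply: (@measurableT_comp _ _ _ _ _ _ -%E) => //.
  apply: (@measurable_fun_limn_esup _ _ _ _ (fun n w => - m n w)%E) => n.
  exact: measurableT_comp.
have L0 w : (0 <= limn_einf (m ^~ w))%E.
  rewrite limn_einf_lim; apply: lime_ge; first exact: is_cvg_einfs.
  by near=> n; apply: le_ereal_inf_tmp => _ [k /= _ <-].
have h1 : (\int[P]_(w in setT) `|limn_einf (m ^~ w)| = 0)%E.
  apply/eqP; rewrite eq_le; apply/andP; split.
    apply: le_trans f; rewrite le_eqVlt; apply/orP; left; apply/eqP.
    by apply: eq_integral => w _; rewrite gee0_abs.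
  by apply: integral_ge0 => w _; exact: abse_ge0.
have := (ae_eq_integral_abs P measurableT mL).1 h1.
apply: filterS2 hV => w cw /(_ I).
have -> : limn_einf (m ^~ w) = (Num.min 1 `|V w|)%:E.
  apply: (cvg_limn_einf_sup _).1; apply: cvg_EFin; first by near=> n.
  apply: (@continuous_cvg _ _ _ _ _ _ (fun y : R => Num.min 1 `|y|)) => //.
  by apply: (@continuous_min _ _ (cst 1) (fun y : R => `|y|)); [exact: cvg_cst|exact: norm_continuous].
move=> [] e; apply/eqP; rewrite -normr_eq0; apply/eqP; move: e; rewrite /Num.min.
by case: ifPn => // _ /eqP; rewrite oner_eq0.
Unshelve. all: by end_near.
Qed.

Lemma pdist_sqr (Z : T -> R) : measurable_fun setT Z -> pdist P (fun w => Z w ^+ 2) <= pdist P Z.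
Proof.
move=> mZ; apply: Rint_le; [by apply: rint_min1; exact: measurable_funX|exact: rint_min1|].
move=> w; rewrite normrX; have := normr_ge0 (Z w); set a := `|_|.
by rewrite /Num.min => a0; do 2 case: ifPn; rewrite -?leNgt; nra.
Qed.

Lemma pcvg0_sqr (Z : nat -> T -> R) : pcvg0 P Z -> pcvg0 P (fun n w => Z n w ^+ 2).
Proof.
move=> [mZ cZ]; split; first by move=> n; exact: measurable_funX.
by apply: squeeze0 cZ => n; rewrite pdist_ge0 pdist_sqr.
Qed.

Lemma pcvg0_sum (N : nat) (Z : nat -> nat -> T -> R) : (forall i, pcvg0 P (Z i)) ->
  pcvg0 P (fun n w => \sum_(i < N) Z i n w).
Proof.
move=> h; elim: N => [|N ih].
  apply: pcvg0_ae; first by move=> n; under eq_fun do rewrite big_ord0; exact: measurable_cst.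
  by apply: aeW => w; under eq_fun do rewrite big_ord0; exact: cvg_cst.
have := pcvg0D ih (h N); congr pcvg0.
by apply/funext => n; apply/funext => w; rewrite big_ord_recr.
Qed.

Lemma pcvg0_mulb (C : R) (c : T -> R) (Z : nat -> T -> R) : pcvg0 P Z -> measurable_fun setT c ->
  (forall w, `|c w| <= C) -> pcvg0 P (fun n w => c w * Z n w).
Proof.
move=> hZ mc bc; apply: pcvg0_le (pcvg0Z C hZ) _ _.
  by move=> n; apply: measurable_funM => //; case: hZ.
have C0 : 0 <= C by exact: le_trans (bc point).
by move=> n; apply: aeW => w; rewrite !normrM (ger0_norm C0) ler_wpM2r.
Qed.

End pcvg0_tightness.

Section riemann_sums.
Context {R : realType}.

Lemma riemann_cvg (g : R -> R) (t : R) : {within `[0, +oo[, continuous g} -> 0 < t ->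
  \sum_(i < n.+1) g (i%:R * (t / n.+1%:R)) * (t / n.+1%:R) @[n --> \oo]
    --> \int[lebesgue_measure]_(s in `[0, t]) g s.
Proof.
move=> cg t0; have [G dG IG] := path_antiderivative cg; rewrite IG ?(ltW t0)//.
apply/cvgrPdist_le => e e0; have e1 : 0 < e / t by rewrite divr_gt0.
have [delta d0 hd] := is_derive_increment_modulus t dG (clip_continuous cg) e1.
apply: filterS (step_lt t0 d0) => n; set h := t / n.+1%:R => hdelta.
have h0 : 0 < h by rewrite divr_gt0.
have nh : n.+1%:R * h = t by rewrite /h mulrCA mulfV ?mulr1// pnatr_eq0.
have -> : G t - G 0 = \sum_(i < n.+1) (G (i.+1%:R * h) - G (i%:R * h)).
  rewrite -(big_mkord xpredT (fun i => G (i.+1%:R * h) - G (i%:R * h))) telescope_sumr//.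
  by rewrite nh mul0r.
rewrite -sumrB; apply: le_trans (ler_norm_sum _ _ _) _.
apply: le_trans (_ : \sum_(i < n.+1) (e / t * h) <= _); last first.
  by rewrite sumr_const card_ord -mulr_natl mulrCA nh divfK// gt_eqF.
apply: ler_sum => i _; have ii := ltn_ord i.
have i0 : 0 <= i%:R * h by rewrite mulr_ge0 ?(ltW h0).
have ih : i.+1%:R * h - i%:R * h = h by rewrite -natr1; ring.
have le1 : i%:R * h <= i.+1%:R * h by rewrite -subr_ge0 ih ltW.
have le2 : i.+1%:R * h <= t by rewrite -[leRHS]nh ler_wpM2r ?(ltW h0)// ler_nat.
by have := hd _ _ i0 le1 le2; rewrite ih max_r//; apply.
Qed.

Lemma sum_blocks (N M : nat) (G : nat -> R) :
  \sum_(k < N * M) G k = \sum_(i < N) \sum_(j < M) G (i * M + j)%N.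
Proof.
elim: N => [|N ih]; first by rewrite mul0n !big_ord0.
by rewrite mulSnr big_split_ord/= ih big_ord_recr.
Qed.

End riemann_sums.

(** * Local errors of left-point sums for the Ito integral *)

Section ito_residuals.
Context d (T : measurableType d) (R : realType) (P : probability T R).
Variables (F : R -> set (set T)) (B : R -> T -> R).
Hypotheses (hF : is_filtration F) (hB : is_brownian_motion P F B).
Variables (Y J : R -> T -> R) (C : R).
Hypotheses (aY : adapted F Y) (cY : continuous_paths P Y) (bY : forall s w, `|Y s w| <= C).
Hypothesis pJ : is_process J.
Hypothesis hJ : forall u, 0 <= u -> cvg_in_probability_mesh P u (left_sum Y B u) (J u).
Variable t : R.
Hypothesis t0 : 0 < t.

Notation h n := (t / n.+1%:R).
Notation dl n m := (t / n.+1%:R / m.+1%:R).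

Definition residual n i w : R :=
  J (i.+1%:R * h n) w - J (i%:R * h n) w - Y (i%:R * h n) w * bincr B (h n) i w.

Let h0 n : 0 < h n. Proof. by rewrite divr_gt0. Qed.
Let d0 n m : 0 < dl n m. Proof. by rewrite divr_gt0. Qed.
Let dlh n m : m.+1%:R * dl n m = h n.
Proof. by rewrite mulrCA mulfV ?mulr1// pnatr_eq0. Qed.
Let hE n : n.+1%:R * h n = t.
Proof. by rewrite mulrCA mulfV ?mulr1// pnatr_eq0. Qed.
Let C0 : 0 <= C. Proof. exact: le_trans (bY 0 point). Qed.

Let fbm : is_fbm P 2^-1 B. Proof. by case: hB. Qed.

Let mY s : 0 <= s -> measurable_fun setT (Y s).
Proof. by move=> s0; apply: (fmeas_measurable hF s0); exact: fmeas_adapted. Qed.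

Let mB s : 0 <= s -> measurable_fun setT (B s).
Proof. by move=> s0; case: fbm => hp _ _ _; exact: hp. Qed.

Let tm (k : nat) (r : R) : 0 < r -> 0 <= k%:R * r.
Proof. by move=> r0; rewrite mulr_ge0// ltW. Qed.

Let mincr r k : 0 < r -> measurable_fun setT (bincr B r k).
Proof. by move=> r0; apply: measurable_funB; apply: mB; exact: tm. Qed.

Let lsum (r : R) (N : nat) w := gsum (Y ^~ w) (B ^~ w) r N.

Let mlsum r N : 0 < r -> measurable_fun setT (lsum r N).
Proof.
move=> r0; apply: measurable_sum => k; apply: measurable_funM; first by apply: mY; exact: tm.
exact: mincr.
Qed.

Lemma left_sum_grid u r N w : N%:R * r = u -> left_sum Y B u (grid r N) w = lsum r N w.
Proof.
move=> Nr; rewrite /left_sum size_grid big_mkord; apply: eq_bigr => k _.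
by rewrite /increment !ppoint_grid// 1?ltnW//.
Qed.

(** The integral is given at each fixed time as a limit of left sums; dividing every coarse step
    into [m.+1] parts gives fine grids that contain all coarse times. *)
Lemma left_sum_pcvg0 n i : pcvg0 P (fun m w => J (i%:R * h n) w - lsum (dl n m) (i * m.+1) w).
Proof.
have i0 := tm i (h0 n).
have mZ m : measurable_fun setT (fun w => J (i%:R * h n) w - lsum (dl n m) (i * m.+1) w).
  by apply: measurable_funB; [exact: pJ|exact: mlsum].
split => //; apply/cvgrPdist_le => e e0; have e20 : 0 < e / 2 by rewrite divr_gt0.
have [delta dp hd] := hJ i0 e20 e20.
apply: filterS (step_lt (h0 n) dp) => m hm.
rewrite sub0r normrN ger0_norm ?pdist_ge0// [leRHS]splitr.
apply: pdist_prob_le; rewrite ?(ltW e20)//.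
have Ne : (i * m.+1)%:R * dl n m = i%:R * h n by rewrite natrM -mulrA dlh.
have := hd (grid (dl n m) (i * m.+1)) (grid_itv_partition (d0 n m) Ne) (@grid_mesh_lt _ _ _ _ _ hm).
congr (P _ <= _)%E; apply/seteqP; split => w /=; rewrite left_sum_grid// distrC; exact.
Qed.

(** The integrand of the residual on the fine grid: [Y] minus its value at the last coarse time,
    whose index is [k %/ m.+1]. *)
Let xi n m k w := Y (k%:R * dl n m) w - Y ((k %/ m.+1)%:R * h n) w.

Let rapp n m i w := \sum_(j < m.+1) xi n m (i * m.+1 + j) w * bincr B (dl n m) (i * m.+1 + j) w.

Lemma lsum_block n m i w : lsum (dl n m) (i.+1 * m.+1) w = lsum (dl n m) (i * m.+1) w +
  \sum_(j < m.+1) Y ((i * m.+1 + j)%:R * dl n m) w * bincr B (dl n m) (i * m.+1 + j) w.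
Proof. by rewrite /lsum /gsum mulSnr big_split_ord. Qed.

Lemma bincr_block n m i w : bincr B (h n) i w = \sum_(j < m.+1) bincr B (dl n m) (i * m.+1 + j) w.
Proof.
rewrite -(big_mkord xpredT (fun j => bincr B (dl n m) (i * m.+1 + j) w)).
under eq_bigr => j _ do rewrite /bincr -addnS.
rewrite (telescope_sumr (fun j => B ((i * m.+1 + j)%:R * dl n m) w))// addn0 -mulSnr.
by rewrite /bincr !natrM -(mulrA i.+1%:R) -(mulrA i%:R) !dlh.
Qed.

Lemma residual_approx n i : pcvg0 P (fun m w => residual n i w - rapp n m i w).
Proof.
have := pcvg0B (left_sum_pcvg0 n i.+1) (left_sum_pcvg0 n i); congr (pcvg0 P _).
apply/funext => m; apply/funext => w; rewrite lsum_block /residual (bincr_block n m).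
have -> : rapp n m i w = \sum_(j < m.+1) Y ((i * m.+1 + j)%:R * dl n m) w * bincr B (dl n m) (i * m.+1 + j) w -
   Y (i%:R * h n) w * \sum_(j < m.+1) bincr B (dl n m) (i * m.+1 + j) w.
  rewrite mulr_sumr -sumrB; apply: eq_bigr => j _.
  by rewrite /xi divnMDl// divn_small// addn0 mulrBl.
ring.
Qed.

Let div_le n m k : (k %/ m.+1)%:R * h n <= k%:R * dl n m.
Proof.
have -> : (k %/ m.+1)%:R * h n = (k %/ m.+1 * m.+1)%:R * dl n m by rewrite natrM -mulrA dlh.
by rewrite ler_wpM2r ?(ltW (d0 n m))// ler_nat leq_divM.
Qed.

Let fxi n m k : fmeas F (k%:R * dl n m) (xi n m k).
Proof.
have a := tm k (d0 n m); have b := tm (k %/ m.+1) (h0 n).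
apply: measurable_funB; first exact: fmeas_adapted.
by apply: (fmeas_le hF b (div_le n m k)); exact: fmeas_adapted.
Qed.

Let bxi n m k w : `|xi n m k w| <= C + C.
Proof. by apply: le_trans (ler_normB _ _) _; exact: lerD. Qed.

Let mxi n m k : measurable_fun setT (xi n m k).
Proof. exact (fmeas_measurable hF (tm k (d0 n m)) (@fxi n m k)). Qed.

Let qpath n m w := dl n m * \sum_(k < n.+1 * m.+1) xi n m k w ^+ 2.

Let mq n m : measurable_fun setT (qpath n m).
Proof.
apply: measurable_funM => //; apply: measurable_sum => k; apply: measurable_funX; exact: mxi.
Qed.

Let dlN n m : (n.+1 * m.+1)%:R * dl n m = t.
Proof. by rewrite natrM -mulrA dlh hE. Qed.

Let qle n m w e : 0 <= e -> (forall k, (k < n.+1 * m.+1)%N -> `|xi n m k w| <= e) ->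
  0 <= qpath n m w <= t * e ^+ 2.
Proof.
move=> e0 hx; have dd := ltW (d0 n m).
rewrite mulr_ge0 ?sumr_ge0//=; last by move=> k _; exact: sqr_ge0.
apply: (@le_trans _ _ (dl n m * \sum_(k < n.+1 * m.+1) e ^+ 2)).
  rewrite ler_wpM2l//; apply: ler_sum => k _.
  by rewrite -[leLHS]ger0_norm ?sqr_ge0// normrX lerXn2r ?nnegrE// hx.
by rewrite sumr_const card_ord -[(_ ^+ 2) *+ _]mulr_natl mulrA [dl n m * _]mulrC dlN.
Qed.

Let qbound n m w : `|qpath n m w| <= t * (C + C) ^+ 2.
Proof.
have CC : 0 <= C + C by exact: addr_ge0.
have /andP[a b] := qle CC (fun k _ => bxi n m k w).
by rewrite ger0_norm.
Qed.

Let rint_xi2 n m k : rint P (fun w => xi n m k w ^+ 2).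
Proof.
apply: (@rint_bounded _ _ _ _ ((C + C) ^+ 2)); first by apply: measurable_funX; exact: mxi.
by move=> w; rewrite normrX lerXn2r ?nnegrE// addr_ge0.
Qed.

Let Eq n m : \int[P]_w qpath n m w = dl n m * \sum_(k < n.+1 * m.+1) \int[P]_w xi n m k w ^+ 2.
Proof.
rewrite RintZ; last by apply: rint_sum => [|k]; [exact: rint_cst|exact: rint_xi2].
by rewrite Rint_sum.
Qed.

(** Uniformity in [m] is essential: [n] is fixed first by the energy, and [m] is chosen afterwards
    in terms of that [n]. *)
Lemma residual_energy e : 0 < e -> \forall n \near \oo, forall m, \int[P]_w qpath n m w <= e.
Proof.
move=> e0.
(* A worst case for each [n]: [mb n] violates the bound as soon as some [m] does. Path continuity
   and dominated convergence send the energy along [mb] to 0, so eventually no [m] violates it. *)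
pose mb n := if pselect (exists m, e < \int[P]_w qpath n m w) is left p then projT1 (cid p) else 0%N.
have mbP n m : e < \int[P]_w qpath n m w -> e < \int[P]_w qpath n (mb n) w.
  move=> h; rewrite /mb; case: pselect => [p|]; last by case; exists m.
  exact: projT2 (cid p).
have c : \int[P]_w qpath n (mb n) w @[n --> \oo] --> \int[P]_w (0 : R).
  apply: (Rint_dominated (g := fun=> t * (C + C) ^+ 2)).
  - by move=> n; exact: mq.
  - exact: measurable_cst.
  - apply: filterS cY => w cw; apply/cvgrPdist_le => e1 e10.
    pose e2 := Num.sqrt (e1 / t); have e20 : 0 < e2 by rewrite sqrtr_gt0 divr_gt0.
    have [delta dp hd] := uniform_modulus 0 t (clip_continuous cw) e20.
    apply: filterS (step_lt t0 dp) => n hn; rewrite sub0r normrN.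
    have := @qle n (mb n) w e2 (ltW e20) _.
    rewrite sqr_sqrtr ?divr_ge0 ?(ltW e10) ?(ltW t0)// mulrCA mulfV ?gt_eqF// mulr1.
    move=> hh; have /andP[a b] : 0 <= qpath n (mb n) w <= e1.
      apply: hh => k kN; set m := mb n in kN *.
      have a := tm k (d0 n m); have b := tm (k %/ m.+1) (h0 n).
      have kt : k%:R * dl n m <= t by rewrite -[leRHS](dlN n m) ler_wpM2r ?(ltW (d0 n m))// ler_nat ltnW.
      have := hd (k%:R * dl n m) ((k %/ m.+1)%:R * h n); rewrite !max_r// a kt => /(_ isT) h1.
      apply: ltW; apply: h1.
      rewrite ger0_norm ?subr_ge0 ?div_le//; apply: le_lt_trans hn.
      have -> : k%:R * dl n m - (k %/ m.+1)%:R * h n = (k %% m.+1)%:R * dl n m.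
        by rewrite {1}(divn_eq k m.+1) natrD natrM mulrDl -mulrA dlh addrAC subrr add0r.
      by rewrite -[leRHS](dlh n m) ler_wpM2r ?(ltW (d0 n m))// ler_nat ltnW// ltn_mod.
    by rewrite ger0_norm.
  - exact: rint_cst.
  - by move=> n w; exact: qbound.
rewrite Rint_cst in c.
have /cvgrPdist_le /(_ _ e0) := c; apply: filterS => n; rewrite sub0r normrN => hn m.
by rewrite leNgt; apply/negP => /mbP; rewrite ltNge (le_trans (ler_norm _) hn).
Qed.

Let mres n i : measurable_fun setT (residual n i).
Proof.
apply: measurable_funB; first by apply: measurable_funB; apply: pJ; exact: tm.
by apply: measurable_funM; [apply: mY; exact: tm|exact: mincr].
Qed.

Let mrapp n m i : measurable_fun setT (rapp n m i).
Proof. by apply: measurable_sum => j; apply: measurable_funM; [exact: mxi|exact: mincr]. Qed.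

Let rapp_sum (cc : nat -> T -> R) (K : R) n m :
  (forall i, fmeas F (i%:R * h n) (cc i)) -> (forall i w, `|cc i w| <= K) ->
  rint P (fun w => (\sum_(i < n.+1) cc i w * rapp n m i w) ^+ 2) /\
  \int[P]_w (\sum_(i < n.+1) cc i w * rapp n m i w) ^+ 2 =
    dl n m * \sum_(k < n.+1 * m.+1) \int[P]_w (xi n m k w * cc (k %/ m.+1)%N w) ^+ 2.
Proof.
move=> fc bc.
have E w : \sum_(i < n.+1) cc i w * rapp n m i w =
    itosum B (dl n m) (fun k w => xi n m k w * cc (k %/ m.+1)%N w) (n.+1 * m.+1) w.
  rewrite /itosum (sum_blocks _ _ (fun k => xi n m k w * cc (k %/ m.+1)%N w * bincr B (dl n m) k w)).
  apply: eq_bigr => i _; rewrite mulr_sumr; apply: eq_bigr => j _.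
  by rewrite divnMDl// divn_small// addn0; ring.
have := @ito_isometry _ _ _ _ _ _ hF hB (dl n m) ((C + C) * K) (fun k w => xi n m k w * cc (k %/ m.+1)%N w)
  (d0 n m) _ _ (n.+1 * m.+1)%N.
case.
- move=> k; apply: measurable_funM; first exact: fxi.
  exact: (fmeas_le hF (tm (k %/ m.+1) (h0 n)) (div_le n m k)).
- by move=> k w; rewrite normrM; apply: ler_pM.
move=> h1 h2; split; first by under eq_fun do rewrite E.
by under Rint_eq do rewrite E.
Qed.

(** For each large [n] some [m] makes the residuals close to [rapp] in probability; the weighted sum
    of the [rapp] is an Ito sum on the fine grid, with second moment at most [K ^+ 2] times the
    energy. *)
Lemma residual_sum (c : nat -> nat -> T -> R) (K : R) :
  (forall n i, fmeas F (i%:R * h n) (c n i)) -> (forall n i w, `|c n i w| <= K) ->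
  pcvg0 P (fun n w => \sum_(i < n.+1) c n i w * residual n i w).
Proof.
move=> fc bc; have K0 : 0 <= K by exact: le_trans (bc 0%N 0%N point).
have mc n i : measurable_fun setT (c n i) := fmeas_measurable hF (tm i (h0 n)) (fc n i).
split; first by move=> n; apply: measurable_sum => i; exact: measurable_funM.
apply/cvgrPdist_le => e e0; pose e1 := (e / (2 * (K + 1))) ^+ 2.
have K1 : 0 < K + 1 by lra.
have e10 : 0 < e1 by rewrite exprn_gt0// divr_gt0// mulr_gt0.
apply: filterS (residual_energy e10) => n hn.
rewrite sub0r normrN ger0_norm ?pdist_ge0//.
have [_ ca] := @pcvg0_sum _ _ _ P n.+1 _ (fun i => pcvg0_mulb (residual_approx n i) (mc n i) (bc n i)).
have e20 : 0 < e / 2 by rewrite divr_gt0.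
have /cvgrPdist_le /(_ _ e20) [m _ /(_ m (leqnn m))] := ca.
rewrite sub0r normrN ger0_norm ?pdist_ge0// => hm.
have mS : measurable_fun setT (fun w => \sum_(i < n.+1) c n i w * rapp n m i w).
  by apply: measurable_sum => i; exact: measurable_funM.
have mD : measurable_fun setT (fun w => \sum_(i < n.+1) c n i w * (residual n i w - rapp n m i w)).
  by apply: measurable_sum => i; apply: measurable_funM => //; exact: measurable_funB.
have [i1 e1'] := rapp_sum m (fc n) (bc n).
have p1 : pdist P (fun w => \sum_(i < n.+1) c n i w * rapp n m i w) <= e / 2.
  apply: le_trans (pdist_sq_le mS i1) _.
  have -> : e / 2 = Num.sqrt ((K + 1) ^+ 2 * e1).
    have -> : (K + 1) ^+ 2 * e1 = (e / 2) ^+ 2 by rewrite /e1; field; rewrite gt_eqF.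
    by rewrite sqrtr_sqr gtr0_norm.
  apply: ler_wsqrtr; rewrite e1'.
  apply: le_trans (_ : K ^+ 2 * \int[P]_w qpath n m w <= _).
    rewrite Eq mulrCA ler_wpM2l ?(ltW (d0 n m))// mulr_sumr; apply: ler_sum => k _.
    rewrite -RintZ//; apply: Rint_le.
    - apply: (@rint_bounded _ _ _ _ (((C + C) * K) ^+ 2)).
        by apply: measurable_funX; apply: measurable_funM.
      move=> w; rewrite normrX lerXn2r ?nnegrE ?mulr_ge0 ?addr_ge0// normrM.
      exact: ler_pM.
    - exact: rintZ.
    - move=> w; rewrite exprMn mulrC ler_wpM2r ?sqr_ge0//.
      by rewrite -[leLHS]ger0_norm ?sqr_ge0// normrX lerXn2r ?nnegrE.
  apply: ler_pM; rewrite ?sqr_ge0//.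
    by apply: Rint_ge0 => w; have /andP[] := qle (addr_ge0 C0 C0) (fun k _ => bxi n m k w).
  by rewrite lerXn2r ?nnegrE ?(ltW K1)//; lra.
have -> : (fun w => \sum_(i < n.+1) c n i w * residual n i w) =
  (fun w => \sum_(i < n.+1) c n i w * (residual n i w - rapp n m i w) + \sum_(i < n.+1) c n i w * rapp n m i w).
  by apply/funext => w; rewrite -big_split/=; apply: eq_bigr => i _; ring.
apply: le_trans (pdistD P mD mS) _; rewrite [leRHS]splitr; exact: lerD.
Qed.

Lemma residual_sq : pcvg0 P (fun n w => \sum_(i < n.+1) residual n i w ^+ 2).
Proof.
split; first by move=> n; apply: measurable_sum => i; exact: measurable_funX.
apply/cvgrPdist_le => e e0.
have e40 : 0 < e / 4 by rewrite divr_gt0.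
apply: filterS (residual_energy e40) => n hn.
rewrite sub0r normrN ger0_norm ?pdist_ge0//.
have [_ ca] := pcvg0Z 2 (@pcvg0_sum _ _ _ P n.+1 _ (fun i => pcvg0_sqr (residual_approx n i))).
have e20 : 0 < e / 2 by rewrite divr_gt0.
have /cvgrPdist_le /(_ _ e20) [m _ /(_ m (leqnn m))] := ca.
rewrite sub0r normrN ger0_norm ?pdist_ge0// => hm.
(* Indicator coefficients isolate one block, so that [rapp_sum] also yields the second moment of a
   single [rapp n m i]. *)
pose ind i (i' : nat) (w : T) := (i' == i)%:R : R.
have find i i' : fmeas F (i'%:R * h n) (ind i i') by exact: measurable_cst.
have bind i i' w : `|ind i i' w| <= 1 by rewrite /ind; case: eqP; rewrite ?normr1 ?normr0.
have pick (A : nat -> R) (i : 'I_n.+1) : \sum_(i' < n.+1) ((i' : nat) == i)%:R * A i' = A i.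
  rewrite (bigD1 i)//= eqxx mul1r big1 ?addr0// => i' ne.
  by rewrite (_ : (i' : nat) == i = false) ?mul0r//; apply/negbTE.
have E i : (i < n.+1)%N -> rint P (fun w => rapp n m i w ^+ 2) /\
    \int[P]_w rapp n m i w ^+ 2 = dl n m * \sum_(j < m.+1) \int[P]_w xi n m (i * m.+1 + j) w ^+ 2.
  move=> ni; have [h1 h2] := rapp_sum m (find i) (bind i).
  have Ew w : \sum_(i' < n.+1) ind i i' w * rapp n m i' w = rapp n m i w.
    exact: (pick (fun i' => rapp n m i' w) (Ordinal ni)).
  split; first by move: h1; under eq_fun do rewrite Ew.
  move: h2; under Rint_eq do rewrite Ew.
  move=> ->; congr (_ * _).
  rewrite (sum_blocks _ _ (fun k => \int[P]_w (xi n m k w * ind i (k %/ m.+1)%N w) ^+ 2)).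
  rewrite -[RHS](pick (fun i' => \sum_(j < m.+1) \int[P]_w xi n m (i' * m.+1 + j) w ^+ 2) (Ordinal ni)).
  apply: eq_bigr => i' _; rewrite mulr_sumr; apply: eq_bigr => j _.
  rewrite -RintZ//; apply: Rint_eq => w.
  rewrite divnMDl// divn_small// addn0 /ind/= exprMn mulrC; congr (_ * _).
  by case: eqP => _; rewrite ?expr1n// expr0n.
have iS : rint P (fun w => \sum_(i < n.+1) rapp n m i w ^+ 2).
  have h (N : nat) : (N <= n.+1)%N -> rint P (fun w => \sum_(i < N) rapp n m i w ^+ 2).
    elim: N => [|N ih] Nn; first by under eq_fun do rewrite big_ord0; exact: rint_cst.
    under eq_fun do rewrite big_ord_recr/=.
    by apply: rintD; [exact: ih (ltnW Nn)|case: (E N Nn)].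
  exact: h.
have ES : \int[P]_w (\sum_(i < n.+1) rapp n m i w ^+ 2) = \int[P]_w qpath n m w.
  have h (N : nat) : (N <= n.+1)%N -> \int[P]_w (\sum_(i < N) rapp n m i w ^+ 2) =
      dl n m * \sum_(i < N) \sum_(j < m.+1) \int[P]_w xi n m (i * m.+1 + j) w ^+ 2 /\
      rint P (fun w => \sum_(i < N) rapp n m i w ^+ 2).
    elim: N => [|N ih] Nn.
      by under eq_fun do rewrite big_ord0; rewrite Rint_cst big_ord0 mulr0; split => //; exact: rint_cst.
    have [ih1 ih2] := ih (ltnW Nn); have [e1 e2] := E N Nn.
    have -> : (fun w => \sum_(i < N.+1) rapp n m i w ^+ 2) = (fun w => \sum_(i < N) rapp n m i w ^+ 2 + rapp n m N w ^+ 2).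
      by apply/funext => w; rewrite big_ord_recr.
    split; last exact: rintD.
    by rewrite RintD// ih1 e2 -mulrDr [in RHS]big_ord_recr.
  have [-> _] := h n.+1 (leqnn _).
  by rewrite Eq (sum_blocks _ _ (fun k => \int[P]_w xi n m k w ^+ 2)).
have m1 : measurable_fun setT (fun w => 2 * \sum_(i < n.+1) (residual n i w - rapp n m i w) ^+ 2).
  apply: measurable_funM => //; apply: measurable_sum => i; apply: measurable_funX; exact: measurable_funB.
have i2 : rint P (fun w => 2 * \sum_(i < n.+1) rapp n m i w ^+ 2) by exact: rintZ.
have p2 : pdist P (fun w => 2 * \sum_(i < n.+1) rapp n m i w ^+ 2) <= e / 2.
  apply: le_trans (pdist_abs_le i2) _.
  have -> : \int[P]_w `|2 * \sum_(i < n.+1) rapp n m i w ^+ 2| = \int[P]_w (2 * \sum_(i < n.+1) rapp n m i w ^+ 2).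
    by apply: Rint_eq => w; rewrite ger0_norm// mulr_ge0// sumr_ge0// => i _; exact: sqr_ge0.
  by rewrite RintZ// ES; have := hn m; lra.
apply: le_trans (_ : pdist P (fun w => 2 * \sum_(i < n.+1) (residual n i w - rapp n m i w) ^+ 2 +
    2 * \sum_(i < n.+1) rapp n m i w ^+ 2) <= _); last first.
  by apply: le_trans (pdistD P m1 (rint_measurable i2)) _; rewrite [leRHS]splitr; exact: lerD.
apply: pdist_le.
- by apply: measurable_sum => i; exact: measurable_funX.
- by apply: measurable_funD => //; exact: rint_measurable i2.
- apply: aeW => w; rewrite !ger0_norm.
  + rewrite !mulr_sumr -big_split/=; apply: ler_sum => i _.
    have := sqr_ge0 (residual n i w - rapp n m i w - rapp n m i w).
    by set x := residual n i w; set y := rapp n m i w; nra.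
  + by rewrite addr_ge0// mulr_ge0// sumr_ge0// => i _; exact: sqr_ge0.
  + by rewrite sumr_ge0// => i _; exact: sqr_ge0.
Qed.

End ito_residuals.

(** * Taylor remainders and continuity along paths *)

Section local_expansions.
Context {R : realType}.

Lemma taylor1_modulus (g g' : R -> R) (p q e : R) : (forall y, is_derive y (1 : R) g (g' y)) ->
  continuous g' -> 0 < e -> exists2 delta : R, 0 < delta &
    forall x y, p <= x <= q -> `|y| < delta -> `|g (x + y) - g x - g' x * y| <= e * `|y|.
Proof.
move=> dg cg e0; have [delta d0 hd] := uniform_modulus p q cg e0.
exists delta => // x y xpq yd.
have dk z : is_derive z (1 : R) (fun z => g (x + z) - g' x * z) (g' (x + z) - g' x).
  have := is_deriveB (is_derive_shift (dg (x + z))) (is_deriveZ (g' x) (is_derive_id z (1 : R))).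
  by rewrite /GRing.scale/= mulr1.
have := @is_derive_MVT_near _ _ _ e 0 y dk.
rewrite mulr0 addr0 !subr0.
have -> : g (x + y) - g' x * y - g x = g (x + y) - g x - g' x * y by ring.
apply=> z; rewrite subr0 => zy; rewrite distrC; apply: ltW; apply: hd => //.
by rewrite opprD addrA subrr add0r normrN; exact: le_lt_trans zy yd.
Qed.

Lemma taylor2_modulus (f g g' : R -> R) (p q e : R) : (forall y, is_derive y (1 : R) f (g y)) ->
  (forall y, is_derive y (1 : R) g (g' y)) -> continuous g' -> 0 < e ->
  exists2 delta : R, 0 < delta & forall x y, p <= x <= q -> `|y| < delta ->
    `|f (x + y) - f x - g x * y - 2^-1 * g' x * y ^+ 2| <= e * y ^+ 2.
Proof.
move=> df dg cg e0; have [delta d0 hd] := taylor1_modulus p q dg cg e0.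
exists delta => // x y xpq yd.
have dk z : is_derive z (1 : R) (fun z => f (x + z) - (g x * z + 2^-1 * g' x * z ^+ 2))
    (g (x + z) - g x - g' x * z).
  have d2 : is_derive z (1 : R) (fun z => 2^-1 * g' x * z ^+ 2) (g' x * z).
    have -> : (fun r : R => 2^-1 * g' x * r ^+ 2) = (fun r => (2^-1 * g' x) *: (r * r)).
      by apply/funext => r; rewrite expr2.
    have dd := is_deriveZ (2^-1 * g' x) (is_deriveM (is_derive_id z (1 : R)) (is_derive_id z (1 : R))).
    by apply: (is_derive_eq dd); rewrite /GRing.scale/= mulr1; field.
  have := is_deriveB (is_derive_shift (df (x + z))) (is_deriveD (is_deriveZ (g x) (is_derive_id z (1 : R))) d2).
  by move=> dd; apply: (is_derive_eq dd); rewrite /GRing.scale/= mulr1; ring.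
have := @is_derive_MVT_near _ _ _ (e * `|y|) 0 y dk.
have -> : e * `|y| * `|y - 0| = e * y ^+ 2.
  by rewrite subr0 -mulrA -expr2 -normrX ger0_norm// sqr_ge0.
have -> : f (x + y) - (g x * y + 2^-1 * g' x * y ^+ 2) - (f (x + 0) - (g x * 0 + 2^-1 * g' x * 0 ^+ 2)) =
  f (x + y) - f x - g x * y - 2^-1 * g' x * y ^+ 2 by rewrite addr0; ring.
rewrite subr0; apply=> z; rewrite subr0 => zy; apply: le_trans (hd x z xpq _) _; first exact: le_lt_trans zy yd.
by rewrite ler_wpM2l// ltW.
Qed.

Lemma path_range (x : R -> R) (t : R) : {within `[0, +oo[, continuous x} -> 0 <= t ->
  exists p q, forall s, 0 <= s <= t -> p <= x s <= q.
Proof.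
move=> /clip_continuous cx t0.
have [c1 _ h1] := @EVT_max _ _ 0 t t0 (continuous_subspaceT cx).
have [c2 _ h2] := @EVT_min _ _ 0 t t0 (continuous_subspaceT cx).
exists (x (Num.max 0 c2)), (x (Num.max 0 c1)) => s st.
have si : s \in `[0, t] by rewrite in_itv.
have sE : Num.max 0 s = s by apply: max_r; case/andP: st.
by have := h1 s si; have := h2 s si; rewrite sE => -> ->.
Qed.

Lemma path_steps_small (x : R -> R) (t e : R) : {within `[0, +oo[, continuous x} -> 0 < t -> 0 < e ->
  \forall n \near \oo, forall i, (i <= n)%N ->
    `|x (i.+1%:R * (t / n.+1%:R)) - x (i%:R * (t / n.+1%:R))| < e.
Proof.
move=> cx t0 e0; have [delta d0 hd] := uniform_modulus 0 t (clip_continuous cx) e0.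
apply: filterS (step_lt t0 d0) => n; set h := t / n.+1%:R => hn i ni.
have h0 : 0 < h by rewrite divr_gt0.
have nh : n.+1%:R * h = t by rewrite /h mulrCA mulfV ?mulr1// pnatr_eq0.
have i0 : 0 <= i%:R * h by rewrite mulr_ge0 ?(ltW h0).
have i1 : 0 <= i.+1%:R * h by rewrite mulr_ge0 ?(ltW h0).
have ih : i.+1%:R * h - i%:R * h = h by rewrite -natr1; ring.
have it : i.+1%:R * h <= t by rewrite -[leRHS]nh ler_wpM2r ?(ltW h0)// ler_nat.
have := hd (i.+1%:R * h) (i%:R * h); rewrite !max_r// i1 it => /(_ isT); apply.
by rewrite ih gtr0_norm.
Qed.

(** Almost sure identities at fixed times can be collected over countably many times only;
    continuity extends them from the positive rationals to all times, including 0. *)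
Lemma agree_on_rationals (f g : R -> R) : {within `[0, +oo[, continuous f} ->
  {within `[0, +oo[, continuous g} -> (forall p n : nat, f (p.+1%:R / n.+1%:R) = g (p.+1%:R / n.+1%:R)) ->
  forall t, 0 <= t -> f t = g t.
Proof.
move=> /clip_continuous cf /clip_continuous cg fg t t0.
pose u (n : nat) : R := (Num.truncn (t * n.+1%:R)).+1%:R / n.+1%:R.
have u0 n : 0 <= u n by rewrite divr_ge0.
have cu : u n @[n --> \oo] --> t.
  apply/cvgrPdist_le => e e0; apply: filterS (step_lt ltr01 e0) => n hn.
  have n0 : 0 < n.+1%:R :> R by [].
  have tn0 : 0 <= t * n.+1%:R by rewrite mulr_ge0.
  have /andP[h1 h2] := truncn_itv tn0.
  have a : t <= u n by rewrite /u ler_pdivlMr// ltW.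
  have b : u n <= t + 1 / n.+1%:R.
    by rewrite /u ler_pdivrMr// mulrDl divfK ?gt_eqF// -natr1 lerD2r.
  rewrite distrC ger0_norm ?subr_ge0//; apply: le_trans (ltW hn); rewrite lerBlDl.
  exact: b.
have a1 := cvg_comp _ _ cu (cf t); have a2 := cvg_comp _ _ cu (cg t).
rewrite /= max_r// in a1 a2.
have a3 : g (Num.max 0 (u n)) @[n --> \oo] --> f t.
  rewrite (_ : (fun n => g (Num.max 0 (u n))) = (fun n => f (Num.max 0 (u n)))); first exact: a1.
  by apply/funext => n; rewrite max_r// /u fg.
exact: (cvg_unique _ a3 a2).
Qed.

End local_expansions.

Section stratonovich_chain_rule.
Context d (T : measurableType d) (R : realType) (P : probability T R).
Variables (F : R -> set (set T)) (B : R -> T -> R).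
Hypotheses (hF : is_filtration F) (hB : is_brownian_motion P F B).
Variables (b sigma sigma' Phi : R -> R) (b0 s0 s1 s2 x0 : R).
Hypotheses (hb : cbdd b0 b) (hs : cbdd s1 sigma) (hs' : cbdd s2 sigma').
Hypothesis ds : forall y, is_derive y (1 : R) sigma (sigma' y).
Hypotheses (s00 : 0 < s0) (ell : forall y, s0 <= `|sigma y|).
Hypothesis dPhi : forall y, is_derive y (1 : R) Phi (sigma y)^-1.
Variables (X J K : R -> T -> R).
Hypotheses (aX : adapted F X) (cX : continuous_paths P X).
Hypothesis pJ : is_process J.
Hypothesis hJ : forall u, 0 <= u ->
  cvg_in_probability_mesh P u (left_sum (fun s w => sigma (X s w)) B u) (J u).
Hypotheses (pK : is_process K) (cK : continuous_paths P K).
Hypothesis bvK : {ae P, forall w, forall u, 0 <= u -> bounded_variation 0 u (K ^~ w)}.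
Hypothesis hK : forall u, 0 <= u ->
  cvg_in_probability_mesh P u (cross_sum (fun s w => sigma (X s w)) B u) (K u).
Hypothesis hX : {ae P, forall w, forall u, 0 <= u ->
  X u w = x0 + drift_integral b X u w + (J u w + 2^-1 * K u w)}.

Let sn0 y : sigma y != 0.
Proof. by rewrite -normr_gt0; exact: lt_le_trans (ell y). Qed.

Let b00 : 0 <= b0. Proof. by apply: le_trans (hb.2 0). Qed.
Let s10 : 0 <= s1. Proof. by apply: le_trans (hs.2 0). Qed.
Let s20 : 0 <= s2. Proof. by apply: le_trans (hs'.2 0). Qed.

Let fbm : is_fbm P 2^-1 B. Proof. by case: hB. Qed.

Let mX s : 0 <= s -> measurable_fun setT (X s).
Proof. by move=> sp; apply: (fmeas_measurable hF sp); exact: fmeas_adapted. Qed.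

Let mB s : 0 <= s -> measurable_fun setT (B s).
Proof. by move=> sp; case: fbm => hp _ _ _; exact: hp. Qed.

Let mc (f : R -> R) (Z : T -> R) : continuous f -> measurable_fun setT Z -> measurable_fun setT (fun w => f (Z w)).
Proof. by move=> cf mZ; exact: measurableT_comp (continuous_measurable cf) mZ. Qed.

Let comp_within (f : R -> R) (x : R -> R) : continuous f -> {within `[0, +oo[, continuous x} ->
  {within `[0, +oo[, continuous (fun s => f (x s))}.
Proof. by move=> cf cx y; apply: continuous_comp; [exact: cx|exact: cf]. Qed.

Section fixed_time.
Variable t : R.
Hypothesis t0 : 0 < t.

Notation h n := (t / n.+1%:R).
Notation tau n i := (i%:R * (t / n.+1%:R)).
Notation dX n i w := (X (tau n i.+1) w - X (tau n i) w).
Notation dB n i w := (bincr B (t / n.+1%:R) i w).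
Notation res n i w := (residual B (fun s w => sigma (X s w)) J t n i w).

Let h0 n : 0 < h n. Proof. by rewrite divr_gt0. Qed.
Let hE n : n.+1%:R * h n = t.
Proof. by rewrite mulrCA mulfV ?mulr1// pnatr_eq0. Qed.
Let tau0 n i : 0 <= tau n i. Proof. by rewrite mulr_ge0// ltW. Qed.
Let tauS n i : tau n i.+1 - tau n i = h n. Proof. by rewrite -natr1; ring. Qed.
Let tau_le n i : tau n i <= tau n i.+1. Proof. by rewrite -subr_ge0 tauS ltW. Qed.
Let tau_t n i : (i < n.+1)%N -> tau n i.+1 <= t.
Proof. by move=> ni; rewrite -[leRHS](hE n) ler_wpM2r ?(ltW (h0 n))// ler_nat. Qed.

Let mdX n i : measurable_fun setT (fun w => dX n i w).
Proof. by apply: measurable_funB; exact: mX. Qed.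

Let mdB n i : measurable_fun setT (fun w => dB n i w).
Proof. by apply: measurable_funB; exact: mB. Qed.

Let mXc (f : R -> R) n i : continuous f -> measurable_fun setT (fun w => f (X (tau n i) w)).
Proof. by move=> cf; apply: mc cf _; exact: mX. Qed.

Definition noise_defect n i w := dX n i w - sigma (X (tau n i) w) * dB n i w.

Definition drift_part n i w :=
  dX n i w - (J (tau n i.+1) w - J (tau n i) w) - 2^-1 * (K (tau n i.+1) w - K (tau n i) w).

Lemma noise_defectE n i w : noise_defect n i w =
  drift_part n i w + res n i w + 2^-1 * (K (tau n i.+1) w - K (tau n i) w).
Proof. by rewrite /noise_defect /drift_part /residual; ring. Qed.

Lemma drift_partE : {ae P, forall w, exists2 G : R -> R,
  forall s, is_derive s (1 : R) G (b (X (Num.max 0 s) w)) &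
  forall n i, drift_part n i w = G (tau n i.+1) - G (tau n i)}.
Proof.
apply: filterS2 cX hX => w cx hx.
have [G dG IG] := path_antiderivative (comp_within hb.1 cx).
exists G => // n i; rewrite /drift_part !hx// /drift_integral !IG//; ring.
Qed.

Let mdrift n i : measurable_fun setT (drift_part n i).
Proof.
apply: measurable_funB; first by apply: measurable_funB => //; apply: measurable_funB; exact: pJ.
by apply: measurable_funM => //; apply: measurable_funB; exact: pK.
Qed.

Let mdefect n i : measurable_fun setT (noise_defect n i).
Proof.
apply: measurable_funB => //; apply: measurable_funM => //; exact: mXc hs.1.
Qed.

Let scst (n : nat) (r : R) : \sum_(i < n.+1) r = n.+1%:R * r.
Proof. by rewrite sumr_const card_ord mulr_natl. Qed.

Let cvg_h : (h n @[n --> \oo] --> (0 : R)).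
Proof. by apply: cvg_trans (step_cvg_right t0) _; exact: cvg_within. Qed.

Lemma drift_sq_cvg : {ae P, forall w, \sum_(i < n.+1) drift_part n i w ^+ 2 @[n --> \oo] --> 0}.
Proof.
apply: filterS drift_partE => w [G dG Gd].
have c : t * b0 ^+ 2 * h n @[n --> \oo] --> 0.
  by rewrite -[X in _ --> X](mulr0 (t * b0 ^+ 2)); apply: cvgM; [exact: cvg_cst|exact: cvg_h].
apply: squeeze0 c => n; rewrite sumr_ge0/=; last by move=> i _; exact: sqr_ge0.
apply: (@le_trans _ _ (\sum_(i < n.+1) (b0 * h n) ^+ 2)).
  have bd x : `|b (X (Num.max 0 x) w)| <= b0 by exact: hb.2.
  have dle (i : nat) : `|drift_part n i w| <= b0 * h n.
    by rewrite Gd; apply: le_trans (is_derive_MVT _ _ dG bd) _; rewrite tauS (gtr0_norm (h0 n)).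
  apply: ler_sum => i _; rewrite -[leLHS]ger0_norm ?sqr_ge0// normrX.
  by rewrite lerXn2r ?nnegrE// mulr_ge0// ltW.
rewrite scst le_eqVlt; apply/orP; left; apply/eqP.
by rewrite exprMn -{3}(hE n); ring.
Qed.

(** A sum of squares is at most the largest increment times the variation: the first tends to 0 by
    continuity, the second stays bounded. *)
Lemma covariation_sq_cvg :
  {ae P, forall w, \sum_(i < n.+1) (K (tau n i.+1) w - K (tau n i) w) ^+ 2 @[n --> \oo] --> 0}.
Proof.
apply: filterS2 cK bvK => w ck bv.
have [V hV] := bv t (ltW t0).
have hV' n : \sum_(i < n.+1) `|K (tau n i.+1) w - K (tau n i) w| <= V.
  apply: hV; exists (grid (h n) n.+1); first exact: grid_itv_partition.
  rewrite /variation size_grid big_mkord; apply: eq_bigr => i _ /=.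
  rewrite -[nth t (grid _ _) i]/(ppoint 0 t (grid (h n) n.+1) i.+1).
  rewrite -[nth t (0 :: grid _ _) i]/(ppoint 0 t (grid (h n) n.+1) i).
  by rewrite !ppoint_grid// 1?ltnW//.
have V0 : 0 <= V by apply: le_trans (hV' 0%N); apply: sumr_ge0.
apply/cvgrPdist_le => e e0.
have V1 : 0 < V + 1 by lra.
have e1 : 0 < e / (V + 1) by rewrite divr_gt0.
apply: filterS (path_steps_small ck t0 e1) => n hn.
rewrite sub0r normrN ger0_norm; last by apply: sumr_ge0 => i _; exact: sqr_ge0.
apply: (@le_trans _ _ (\sum_(i < n.+1) e / (V + 1) * `|K (tau n i.+1) w - K (tau n i) w|)).
  apply: ler_sum => i _; rewrite -[leLHS]ger0_norm ?sqr_ge0// normrX expr2 ler_wpM2r//.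
  by apply: ltW; apply: hn; rewrite -ltnS.
rewrite -mulr_sumr; apply: (@le_trans _ _ (e / (V + 1) * V)).
  by rewrite ler_wpM2l// ltW.
by rewrite mulrAC ler_pdivrMr// ler_wpM2l ?(ltW e0)//; lra.
Qed.

Let adY : adapted F (fun s w => sigma (X s w)).
Proof.
move=> u u0 A mA.
have ms : measurable_fun setT sigma := continuous_measurable hs.1.
have := aX u0 (ms measurableT A mA); rewrite setTI; exact.
Qed.

Let cY : continuous_paths P (fun s w => sigma (X s w)).
Proof. by apply: filterS cX => w; exact: comp_within hs.1. Qed.

(** Drift, Ito residuals and covariation increments each have vanishing sums of squares, so [X]
    moves like [sigma dB] up to a part of zero quadratic variation. *)
Lemma noise_defect_sq : pcvg0 P (fun n w => \sum_(i < n.+1) noise_defect n i w ^+ 2).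
Proof.
have h1 : pcvg0 P (fun n w => \sum_(i < n.+1) drift_part n i w ^+ 2).
  apply: pcvg0_ae drift_sq_cvg => n; apply: measurable_sum => i; exact: measurable_funX.
have h2 : pcvg0 P (fun n w => \sum_(i < n.+1) (K (tau n i.+1) w - K (tau n i) w) ^+ 2).
  apply: pcvg0_ae covariation_sq_cvg => n; apply: measurable_sum => i; apply: measurable_funX.
  by apply: measurable_funB; exact: pK.
have h3 := residual_sq hF hB adY cY (fun s w => hs.2 (X s w)) pJ hJ t0.
apply: pcvg0_le (pcvg0Z 3 (pcvg0D (pcvg0D h1 h3) h2)) _ _.
  by move=> n; apply: measurable_sum => i; exact: measurable_funX.
move=> n; apply: aeW => w; rewrite !ger0_norm.
- rewrite -!big_split/= mulr_sumr; apply: ler_sum => i _; rewrite noise_defectE.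
  set x := drift_part n i w; set y := residual _ _ _ _ _ _ _; set z := K _ _ - K _ _.
  have := sqr_ge0 (x - y); have := sqr_ge0 (x - 2^-1 * z); have := sqr_ge0 (y - 2^-1 * z).
  by have := sqr_ge0 z; nra.
- by rewrite mulr_ge0// -!big_split/= sumr_ge0// => i _; rewrite !addr_ge0 ?sqr_ge0.
- by rewrite sumr_ge0// => i _; exact: sqr_ge0.
Qed.

Let V n w := \sum_(i < n.+1) dB n i w ^+ 2.

Let gI n i : gspan B (bincr B (h n) i). Proof. exact: gspan_bincr. Qed.

Let rintV n : rint P (V n).
Proof.
rewrite /V; apply: rint_sum => [|i]; first exact: rint_cst.
exact (gspan_sq fbm (gI n i)).
Qed.

Let EV n : \int[P]_w V n w = t.
Proof.
rewrite Rint_sum; last by move=> i; exact (gspan_sq fbm (gI n i)).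
rewrite -[RHS](hE n) -scst; apply: eq_bigr => i _.
by rewrite gcov_sq (bincr_var fbm (lexx _) (h0 n)) mulfV// powRr1// ltW.
Qed.

Let V0 n w : 0 <= V n w. Proof. by apply: sumr_ge0 => i _; exact: sqr_ge0. Qed.

Let EaV n : \int[P]_w `|V n w| = t.
Proof. by rewrite -[RHS](EV n); apply: Rint_eq => w; rewrite ger0_norm. Qed.

Lemma quadratic_variation (c : R -> R) (Cc : R) : cbdd Cc c ->
  pcvg0 P (fun n w => \sum_(i < n.+1) c (X (tau n i) w) * (dB n i w ^+ 2 - h n)).
Proof.
move=> hc; have Cc0 : 0 <= Cc by apply: le_trans (hc.2 0).
have fc n i : fmeas F (tau n i) (fun w => c (X (tau n i) w)).
  apply: (measurableT_comp (continuous_measurable hc.1)); exact: fmeas_adapted.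
have q n := @qvsum_L2 _ _ _ _ _ _ hF hB (h n) Cc (fun i w => c (X (tau n i) w)) (h0 n) (fc n) (fun i w => hc.2 _) n.+1.
apply: pcvg0_L2.
- move=> n; apply: measurable_sum => i; apply: measurable_funM; first exact: mXc hc.1.
  by apply: measurable_funB => //; exact: measurable_funX.
- by move=> n; case: (q n).
- have c0 : 2 * t * Cc ^+ 2 * h n @[n --> \oo] --> 0.
    by rewrite -[X in _ --> X](mulr0 (2 * t * Cc ^+ 2)); apply: cvgM; [exact: cvg_cst|exact: cvg_h].
  apply: squeeze0 c0 => n; rewrite Rint_ge0/=; last by move=> w; exact: sqr_ge0.
  have [_ hh] := q n; apply: le_trans hh _.
  by rewrite le_eqVlt; apply/orP; left; apply/eqP; rewrite -{3}(hE n); ring.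
Qed.

(** Cauchy-Schwarz in the split form [|x y| <= lam y ^+ 2 + x ^+ 2 / lam]: the noise energy has mean
    [t], while the energy of the defect vanishes in probability. *)
Lemma defect_noise (c : R -> R) (Cc : R) : cbdd Cc c ->
  pcvg0 P (fun n w => \sum_(i < n.+1) c (X (tau n i) w) * (noise_defect n i w * dB n i w)).
Proof.
move=> hc; have Cc0 : 0 <= Cc by apply: le_trans (hc.2 0).
apply: (@pcvg0_split _ _ _ P _ (fun n w => Cc * \sum_(i < n.+1) noise_defect n i w ^+ 2)
   (fun n w => Cc * V n w) (Cc * t)).
- move=> n; apply: measurable_sum => i; apply: measurable_funM; first exact: mXc hc.1.
  exact: measurable_funM.
- exact: pcvg0Z noise_defect_sq.
- by move=> n; exact: rintZ.
- move=> n; under Rint_eq do rewrite normrM (ger0_norm Cc0).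
  by rewrite RintZ ?EaV//; exact: rint_abs.
move=> lam n w /andP[l0 l1].
have E0 : 0 <= \sum_(i < n.+1) noise_defect n i w ^+ 2 by apply: sumr_ge0 => i _; exact: sqr_ge0.
rewrite (ger0_norm (mulr_ge0 Cc0 (V0 n w))) (ger0_norm (mulr_ge0 Cc0 E0)).
rewrite /V !mulr_sumr -big_split/=.
apply: le_trans (ler_norm_sum _ _ _) _; apply: ler_sum => i _.
rewrite normrM normrM.
set x := noise_defect n i w; set y := bincr _ _ _ _.
have -> : lam * (Cc * y ^+ 2) + lam^-1 * (Cc * x ^+ 2) = Cc * (lam * y ^+ 2 + lam^-1 * x ^+ 2) by ring.
apply: ler_pM => //; first exact: hc.2.
have lV : 0 < lam^-1 by rewrite invr_gt0.
have a := sqr_ge0 (`|x| - lam * `|y|).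
have -> : x ^+ 2 = `|x| ^+ 2 by rewrite -normrX ger0_norm// sqr_ge0.
have -> : y ^+ 2 = `|y| ^+ 2 by rewrite -normrX ger0_norm// sqr_ge0.
have : 0 <= lam^-1 * (`|x| - lam * `|y|) ^+ 2 by rewrite mulr_ge0 ?sqr_ge0// ltW.
have -> : lam^-1 * (`|x| - lam * `|y|) ^+ 2 = lam^-1 * `|x| ^+ 2 + lam * `|y| ^+ 2 - 2 * (`|x| * `|y|).
  by field; rewrite gt_eqF.
have : 0 <= `|x| * `|y| by rewrite mulr_ge0.
lra.
Qed.

(* A remainder bounded by [e Q] and [M Q] vanishes because [Q = sum (dX^2 + dB^2)] is tight. *)
Lemma small_remainder (rho : nat -> nat -> T -> R) (M : R) : 0 <= M ->
  (forall n i, measurable_fun setT (rho n i)) ->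
  (forall n i w, `|rho n i w| <= M * (dX n i w ^+ 2 + dB n i w ^+ 2)) ->
  {ae P, forall w, forall e, 0 < e -> \forall n \near \oo, forall i, (i <= n)%N ->
     `|rho n i w| <= e * (dX n i w ^+ 2 + dB n i w ^+ 2)} ->
  pcvg0 P (fun n w => \sum_(i < n.+1) rho n i w).
Proof.
move=> M0 mrho brho srho.
pose Q n w := \sum_(i < n.+1) (dX n i w ^+ 2 + dB n i w ^+ 2).
pose S n w := \sum_(i < n.+1) `|rho n i w|.
have Q0 n w : 0 <= Q n w by apply: sumr_ge0 => i _; rewrite addr_ge0 ?sqr_ge0.
have S0 n w : 0 <= S n w by apply: sumr_ge0.
have mQ n : measurable_fun setT (Q n).
  by apply: measurable_sum => i; apply: measurable_funD; exact: measurable_funX.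
have mS n : measurable_fun setT (S n).
  by apply: measurable_sum => i; exact: measurableT_comp.
have SQ n w : S n w <= M * Q n w by rewrite /S /Q mulr_sumr; apply: ler_sum => i _.
(* [S / (1 + Q)] is at most [M] and tends to 0 almost surely. Multiplying back by [1 + Q] is
   harmless, since [Q <= c V + 2 E] where [V] has mean [t] and [E], the sum of squared defects,
   tends to 0 in probability. *)
pose U n w := S n w * (1 + `|Q n w|)^-1.
have Q1 n w : 0 < 1 + Q n w by rewrite ltr_pwDl.
have US n w : U n w * (1 + Q n w) = S n w.
  by rewrite /U ger0_norm// divfK// gt_eqF.
have U0 n w : 0 <= U n w by rewrite /U mulr_ge0// invr_ge0 addr_ge0.
have UM n w : U n w <= M.
  rewrite /U ger0_norm// ler_pdivrMr//; apply: le_trans (SQ n w) _.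
  by rewrite ler_wpM2l// lerDr.
have cinv : continuous (fun y : R => (1 + `|y|)^-1).
  move=> y; apply: cvgV; first by rewrite gt_eqF// ltr_pwDl.
  by apply: cvgD; [exact: cvg_cst|exact: norm_continuous].
have mU n : measurable_fun setT (U n) by apply: measurable_funM => //; exact: mc cinv (mQ n).
have pU : pcvg0 P U.
  apply: pcvg0_ae => //; apply: filterS srho => w hw; apply/cvgrPdist_le => e e0.
  apply: filterS (hw e e0) => n hn; rewrite sub0r normrN ger0_norm//.
  rewrite /U ger0_norm// ler_pdivrMr//.
  apply: (@le_trans _ _ (e * Q n w)); last by rewrite ler_wpM2l ?(ltW e0)// lerDr.
  by rewrite /S /Q mulr_sumr; apply: ler_sum => i _; apply: hn; rewrite -ltnS.
pose c := 2 * s1 ^+ 2 + 1.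
have c0 : 0 <= c by rewrite addr_ge0// mulr_ge0// sqr_ge0.
have p1 : pcvg0 P (fun n w => U n w * (1 + c * V n w)).
  apply: (@pcvg0_mul _ _ _ P _ _ (1 + c * t)) => //.
    by move=> n; apply: rintD; [exact: rint_cst|exact: rintZ].
  move=> n; rewrite -[t](EV n).
  have -> : \int[P]_w `|1 + c * V n w| = \int[P]_w (1 + c * V n w).
    by apply: Rint_eq => w; rewrite ger0_norm// addr_ge0// mulr_ge0.
  by rewrite RintD ?Rint_cst ?RintZ//; [exact: rint_cst|exact: rintZ].
have p2 := pcvg0D p1 (pcvg0Z (2 * M) noise_defect_sq).
apply: pcvg0_le p2 _ _; first by move=> n; exact: measurable_sum.
move=> n; apply: aeW => w.
set E := \sum_(i < n.+1) noise_defect n i w ^+ 2.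
have E0 : 0 <= E by apply: sumr_ge0 => i _; exact: sqr_ge0.
have QV : Q n w <= c * V n w + 2 * E.
  rewrite /Q /V /E !mulr_sumr -big_split/=; apply: ler_sum => i _.
  have -> : dX n i w = sigma (X (tau n i) w) * dB n i w + noise_defect n i w by rewrite /noise_defect; ring.
  set y := bincr _ _ _ _; set z := noise_defect n i w; set s := sigma _.
  have ss : s ^+ 2 * y ^+ 2 <= s1 ^+ 2 * y ^+ 2.
    rewrite ler_wpM2r ?sqr_ge0// -[leLHS]ger0_norm ?sqr_ge0// normrX lerXn2r ?nnegrE//.
    exact: hs.2.
  have := sqr_ge0 (s * y - z); rewrite /c; nra.
rewrite [leRHS]ger0_norm; last first.
  by rewrite addr_ge0// mulr_ge0// ?addr_ge0 ?mulr_ge0.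
apply: le_trans (ler_norm_sum _ _ _) _; rewrite -/(S n w) -US.
have UE : U n w * (2 * E) <= M * (2 * E) by rewrite ler_wpM2r// mulr_ge0.
have UQ : U n w * (1 + Q n w) <= U n w * (1 + c * V n w + 2 * E).
  by rewrite ler_wpM2l// -addrA lerD2l.
lra.
Qed.

(** In the cross sum [sigma (X)] is expanded to first order, [dX] is replaced by [sigma dB] and
    [dB ^+ 2] by [h]; the three errors are [rho], [defect_noise] and [quadratic_variation], and a
    Riemann sum remains. *)
Lemma covariation_fixed : {ae P, forall w,
  K t w = \int[lebesgue_measure]_(s in `[0, t]) (sigma' (X s w) * sigma (X s w))}.
Proof.
pose rho n i w := (sigma (X (tau n i.+1) w) - sigma (X (tau n i) w) - sigma' (X (tau n i) w) * dX n i w) * dB n i w.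
have am (u v : R) : `|u| * `|v| <= u ^+ 2 + v ^+ 2.
  have := sqr_ge0 (`|u| - `|v|); have -> : u ^+ 2 = `|u| ^+ 2 by rewrite -normrX ger0_norm// sqr_ge0.
  have -> : v ^+ 2 = `|v| ^+ 2 by rewrite -normrX ger0_norm// sqr_ge0.
  by have := mulr_ge0 (normr_ge0 u) (normr_ge0 v); nra.
have prho : pcvg0 P (fun n w => \sum_(i < n.+1) rho n i w).
  apply: (@small_remainder rho (2 * s2)); first by rewrite mulr_ge0.
  - move=> n i; apply: measurable_funM => //; apply: measurable_funB.
      by apply: measurable_funB; exact: mXc hs.1.
    by apply: measurable_funM => //; exact: mXc hs'.1.
  - move=> n i w; rewrite /rho normrM; set x := X (tau n i.+1) w; set x' := X (tau n i) w.
    have e1 : `|sigma x - sigma x' - sigma' x' * (x - x')| <= 2 * s2 * `|x - x'|.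
      have -> : 2 * s2 * `|x - x'| = s2 * `|x - x'| + s2 * `|x - x'| by ring.
      apply: le_trans (ler_normB _ _) _; apply: lerD; first exact: (is_derive_MVT _ _ ds hs'.2).
      by rewrite normrM ler_wpM2r//; exact: hs'.2.
    apply: le_trans (ler_wpM2r (normr_ge0 _) e1) _.
    by rewrite -(mulrA (2 * s2)) ler_wpM2l ?mulr_ge0.
  - apply: filterS cX => w cx e e0.
    have [p [q pq]] := path_range cx (ltW t0).
    have [delta d0 hd] := taylor1_modulus p q ds hs'.1 e0.
    apply: filterS (path_steps_small cx t0 d0) => n hn i ni.
    have xr : p <= X (tau n i) w <= q.
      by apply: pq; rewrite tau0/=; apply: le_trans (tau_le n i) _; exact: tau_t.
    have := hd _ _ xr (hn i ni); rewrite subrKC => h1.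
    rewrite /rho normrM; apply: le_trans (ler_wpM2r (normr_ge0 _) h1) _.
    by rewrite -mulrA ler_wpM2l ?(ltW e0)//; exact: am.
pose cs n w := \sum_(i < n.+1) (sigma (X (tau n i.+1) w) - sigma (X (tau n i) w)) * dB n i w.
have mcs n : measurable_fun setT (cs n).
  apply: measurable_sum => i; apply: measurable_funM => //.
  by apply: measurable_funB; exact: mXc hs.1.
have pcs : pcvg0 P (fun n w => K t w - cs n w).
  have mZ n : measurable_fun setT (fun w => K t w - cs n w).
    by apply: measurable_funB => //; apply: pK; exact: ltW.
  split => //; apply/cvgrPdist_le => e e0; have e20 : 0 < e / 2 by rewrite divr_gt0.
  have [delta dp hd] := hK (ltW t0) e20 e20.
  apply: filterS (step_lt t0 dp) => n hn.
  rewrite sub0r normrN ger0_norm ?pdist_ge0// [leRHS]splitr.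
  apply: pdist_prob_le; rewrite ?(ltW e20)//.
  have := hd (grid (h n) n.+1) (grid_itv_partition (h0 n) (hE n)) (@grid_mesh_lt _ _ _ _ _ hn).
  have E w : cross_sum (fun s w => sigma (X s w)) B t (grid (h n) n.+1) w = cs n w.
    rewrite /cross_sum size_grid big_mkord; apply: eq_bigr => k _.
    by rewrite /increment !ppoint_grid// 1?ltnW//.
  congr (P _ <= _)%E; apply/seteqP; split => w /=; rewrite E distrC; exact.
have hss : cbdd (s2 * s1) (fun y => sigma' y * sigma y) by exact: cbddM.
have p := pcvg0D (pcvg0D pcs prho) (pcvg0D (quadratic_variation hss) (defect_noise hs')).
have p' : pcvg0 P (fun n w => K t w - \sum_(i < n.+1) sigma' (X (tau n i) w) * sigma (X (tau n i) w) * h n).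
  move: p; congr (pcvg0 P _); apply/funext => n; apply/funext => w.
  suff -> : cs n w = \sum_(i < n.+1) rho n i w +
     (\sum_(i < n.+1) sigma' (X (tau n i) w) * sigma (X (tau n i) w) * (dB n i w ^+ 2 - h n) +
     \sum_(i < n.+1) sigma' (X (tau n i) w) * (noise_defect n i w * dB n i w)) +
     \sum_(i < n.+1) sigma' (X (tau n i) w) * sigma (X (tau n i) w) * h n by ring.
  rewrite -!big_split/=; apply: eq_bigr => i _; rewrite /rho /noise_defect; ring.
have := pcvg0_ae_limit (V := fun w => K t w - \int[lebesgue_measure]_(s in `[0, t]) (sigma' (X s w) * sigma (X s w))) p' _.
move=> hh; apply: filterS (hh _); first by move=> w /eqP; rewrite subr_eq0 => /eqP.
apply: filterS cX => w cx; apply: cvgB; first exact: cvg_cst.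
exact: (riemann_cvg (g := fun s => sigma' (X s w) * sigma (X s w)) (comp_within hss.1 cx) t0).
Qed.

Let cinv : cbdd s0^-1 (fun y => (sigma y)^-1).
Proof.
split; first by move=> y; apply: cvgV => //; exact: hs.1.
by move=> y; rewrite normfV lef_pV2 ?posrE// normr_gt0.
Qed.

Let inv' (y : R) : R := - (sigma y ^- 2) * sigma' y.

Let dinv y : is_derive y (1 : R) (fun y => (sigma y)^-1) (inv' y).
Proof. exact: is_deriveV (sn0 y) (ds y). Qed.

Let Ma := s0^-1 * s0^-1 * s2.

Let cinv' : cbdd Ma inv'.
Proof.
split.
  by move=> y; apply: cvgM; [apply: cvgN; apply: cvgV; [exact: expf_neq0|by rewrite expr2; apply: cvgM; exact: hs.1]|exact: hs'.1].
move=> y; rewrite /inv' normrM normrN normfV normrX /Ma -exprVn.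
apply: ler_pM => //; last exact: hs'.2.
by rewrite expr2; apply: ler_pM; rewrite ?invr_ge0// lef_pV2 ?posrE// normr_gt0.
Qed.

(* Taylor expansion of [Phi] at the left endpoints: the quadratic terms cancel [K / 2]. *)
Lemma ito_fixed :
  {ae P, forall w, forall u, 0 <= u -> K u w = \int[lebesgue_measure]_(s in `[0, u]) (sigma' (X s w) * sigma (X s w))} ->
  {ae P, forall w, Phi (X t w) - Phi (X 0 w) =
    \int[lebesgue_measure]_(s in `[0, t]) (b (X s w) / sigma (X s w)) + (B t w - B 0 w)}.
Proof.
move=> hKid; have Ma0 : 0 <= Ma by apply: le_trans (cinv'.2 0).
have cPhi : continuous Phi := is_derive_continuous dPhi.
pose rho n i w := Phi (X (tau n i.+1) w) - Phi (X (tau n i) w) - (sigma (X (tau n i) w))^-1 * dX n i w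
  - 2^-1 * inv' (X (tau n i) w) * dX n i w ^+ 2.
have prho : pcvg0 P (fun n w => \sum_(i < n.+1) rho n i w).
  apply: (@small_remainder rho (2 * Ma)); first by rewrite mulr_ge0.
  - move=> n i; apply: measurable_funB.
      apply: measurable_funB; first by apply: measurable_funB; exact: mXc cPhi.
      by apply: measurable_funM => //; exact: mXc cinv.1.
    apply: measurable_funM; last exact: measurable_funX.
    by apply: measurable_funM => //; exact: mXc cinv'.1.
  - move=> n i w; rewrite /rho; set x := X (tau n i) w; set z := X (tau n i.+1) w.
    have -> : Phi z = Phi (x + (z - x)) by rewrite addrC subrK.
    set y := z - x.
    have e1 := taylor2 dPhi dinv cinv' x y.
    have e2 : `|2^-1 * inv' x * y ^+ 2| <= Ma * y ^+ 2.
      rewrite normrM (ger0_norm (sqr_ge0 y)) ler_wpM2r ?sqr_ge0// normrM gtr0_norm ?invr_gt0//.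
      have := cinv'.2 x; have := normr_ge0 (inv' x); lra.
    apply: le_trans (ler_normB _ _) _; apply: le_trans (lerD e1 e2) _.
    have : 0 <= Ma * dB n i w ^+ 2 by rewrite mulr_ge0// sqr_ge0.
    lra.
  - apply: filterS cX => w cx e e0.
    have [pp [qq pq]] := path_range cx (ltW t0).
    have [delta d0 hd] := taylor2_modulus pp qq dPhi dinv cinv'.1 e0.
    apply: filterS (path_steps_small cx t0 d0) => n hn i ni.
    have xr : pp <= X (tau n i) w <= qq.
      by apply: pq; rewrite tau0/=; apply: le_trans (tau_le n i) _; exact: tau_t.
    have := hd _ _ xr (hn i ni); rewrite subrKC => h1.
    by rewrite /rho; apply: le_trans h1 _; rewrite ler_wpM2l ?(ltW e0)// lerDl sqr_ge0.
(* The finite-variation part of [dX / sigma] minus its density: with [K] identified, half of its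
   increment is about [sigma' sigma h / 2], which division by [sigma] turns into the [sigma' h / 2]
   subtracted here. *)
pose pth n i w := (sigma (X (tau n i) w))^-1 * (drift_part n i w + 2^-1 * (K (tau n i.+1) w - K (tau n i) w))
  - b (X (tau n i) w) / sigma (X (tau n i) w) * h n - 2^-1 * sigma' (X (tau n i) w) * h n.
have ppth : pcvg0 P (fun n w => \sum_(i < n.+1) pth n i w).
  apply: pcvg0_ae.
    move=> n; apply: measurable_sum => i; apply: measurable_funB; last first.
      by apply: measurable_funM => //; apply: measurable_funM => //; exact: mXc hs'.1.
    apply: measurable_funB; last first.
      by apply: measurable_funM => //; apply: measurable_funM; [exact: mXc hb.1|exact: mXc cinv.1].
    apply: measurable_funM; first exact: mXc cinv.1.
    apply: measurable_funD => //; apply: measurable_funM => //.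
    by apply: measurable_funB; exact: pK.
  apply: filterS3 drift_partE cX hKid => w [G dG Gd] cx kid.
  have css : continuous (fun y => sigma' y * sigma y) by exact: (cbddM hs' hs).1.
  have [G2 dG2 IG2] := path_antiderivative (comp_within css cx).
  apply/cvgrPdist_le => e e0; pose e1 := e * s0 / (2 * t).
  have e10 : 0 < e1 by rewrite divr_gt0 ?mulr_gt0.
  have [d1 d10 h1] := is_derive_increment_modulus t dG (clip_continuous (comp_within hb.1 cx)) e10.
  have [d2 d20 h2] := is_derive_increment_modulus t dG2 (clip_continuous (comp_within css cx)) e10.
  apply: filterS2 (step_lt t0 d10) (step_lt t0 d20) => n n1 n2; rewrite sub0r normrN.
  apply: le_trans (ler_norm_sum _ _ _) _.
  apply: (@le_trans _ _ (\sum_(i < n.+1) (2 * s0^-1 * e1 * h n))); last first.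
    rewrite scst le_eqVlt; apply/orP; left; apply/eqP.
    have -> : n.+1%:R * (2 * s0^-1 * e1 * h n) = 2 * s0^-1 * e1 * (n.+1%:R * h n) by ring.
    by rewrite hE /e1; field; rewrite !gt_eqF.
  apply: ler_sum => i _; have ti := tau_t (ltn_ord i).
  have g1 := h1 _ _ (tau0 n i) (tau_le n i) ti; have g2 := h2 _ _ (tau0 n i) (tau_le n i) ti.
  rewrite tauS max_r// in g1 g2; have {}g1 := g1 n1; have {}g2 := g2 n2.
  have kE : K (tau n i.+1) w - K (tau n i) w = G2 (tau n i.+1) - G2 (tau n i).
    by rewrite !kid// !IG2//; ring.
  rewrite /pth Gd kE; set x := X (tau n i) w in g1 g2 *.
  set D1 := G _ - G _ in g1 *; set D2 := G2 _ - G2 _ in g2 *.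
  have -> : (sigma x)^-1 * (D1 + 2^-1 * D2) - b x / sigma x * h n - 2^-1 * sigma' x * h n =
    (sigma x)^-1 * ((D1 - b x * h n) + 2^-1 * (D2 - sigma' x * sigma x * h n)).
    by generalize (h n) => k; field; rewrite sn0.
  have e2 : `|(D1 - b x * h n) + 2^-1 * (D2 - sigma' x * sigma x * h n)| <= 2 * e1 * h n.
    apply: le_trans (ler_normD _ _) _; rewrite normrM (gtr0_norm (_ : 0 < 2^-1 :> R)) ?invr_gt0//.
    have half (u1 u2 m : R) : u1 <= m -> u2 <= m -> 0 <= u2 -> u1 + 2^-1 * u2 <= 2 * m by lra.
    by rewrite -(mulrA 2 e1); exact: half.
  rewrite normrM; have -> : 2 * s0^-1 * e1 * h n = s0^-1 * (2 * e1 * h n) by ring.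
  by apply: ler_pM => //; exact: cinv.2.
have pres : pcvg0 P (fun n w => \sum_(i < n.+1) (sigma (X (tau n i) w))^-1 * res n i w).
  apply: (@residual_sum _ _ _ P F B hF hB _ J s1 adY cY (fun s w => hs.2 (X s w)) pJ hJ t t0
    (fun n i w => (sigma (X (tau n i) w))^-1) s0^-1).
    move=> n i; apply: (measurableT_comp (continuous_measurable cinv.1)); exact: fmeas_adapted.
  by move=> n i w; exact: cinv.2.
have pqv := pcvg0Z 2^-1 (quadratic_variation hs').
have pdn := defect_noise (cbddM cinv' hs).
have pdd : pcvg0 P (fun n w => \sum_(i < n.+1) 2^-1 * inv' (X (tau n i) w) * noise_defect n i w ^+ 2).
  apply: pcvg0_le (pcvg0Z Ma noise_defect_sq) _ _.
    move=> n; apply: measurable_sum => i; apply: measurable_funM; last exact: measurable_funX.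
    by apply: measurable_funM => //; exact: mXc cinv'.1.
  move=> n; apply: aeW => w; apply: le_trans (ler_norm_sum _ _ _) _.
  rewrite ger0_norm; last by rewrite mulr_ge0// sumr_ge0// => i _; exact: sqr_ge0.
  rewrite mulr_sumr; apply: ler_sum => i _.
  rewrite normrM (ger0_norm (sqr_ge0 _)) ler_wpM2r ?sqr_ge0// normrM gtr0_norm ?invr_gt0//.
  have := cinv'.2 (X (tau n i) w); have := normr_ge0 (inv' (X (tau n i) w)); lra.
(* Expanding the square of [dX = sigma dB + noise_defect] times [inv' / 2] gives
   [- sigma' dB ^+ 2 / 2] and the summands of [pdn] and [pdd]. The first is [- sigma' h / 2] minus
   the summand of [pqv], and [pth] compensates that [- sigma' h / 2]. *)
have p := pcvg0D (pcvg0D (pcvg0D prho ppth) (pcvg0B pres pqv)) (pcvg0D pdn pdd).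
have p' : pcvg0 P (fun n w => (Phi (X t w) - Phi (X 0 w) - (B t w - B 0 w)) -
    \sum_(i < n.+1) b (X (tau n i) w) / sigma (X (tau n i) w) * h n).
  move: p; congr (pcvg0 P _); apply/funext => n; apply/funext => w.
  have e1 : Phi (X t w) - Phi (X 0 w) = \sum_(i < n.+1) (Phi (X (tau n i.+1) w) - Phi (X (tau n i) w)).
    rewrite -(big_mkord xpredT (fun i => Phi (X (tau n i.+1) w) - Phi (X (tau n i) w))).
    by rewrite (telescope_sumr (fun i => Phi (X (tau n i) w)))// hE mul0r.
  have e2 : B t w - B 0 w = \sum_(i < n.+1) dB n i w.
    rewrite -(big_mkord xpredT (fun i => dB n i w)) /bincr.
    by rewrite (telescope_sumr (fun i => B (tau n i) w))// hE mul0r.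
  rewrite e1 e2 mulr_sumr; do ?[rewrite -sumrB/=|rewrite -big_split/=]; apply: eq_bigr => i _.
  rewrite /rho /pth /drift_part /residual.
  have -> : noise_defect n i w = dX n i w - sigma (X (tau n i) w) * dB n i w by [].
  rewrite /inv'; set x := X (tau n i) w; set D := X _ w - x; set bb := bincr _ _ _ _.
  by generalize (h n) => k; field; rewrite sn0.
have := pcvg0_ae_limit (V := fun w => (Phi (X t w) - Phi (X 0 w) - (B t w - B 0 w)) -
   \int[lebesgue_measure]_(s in `[0, t]) (b (X s w) / sigma (X s w))) p' _.
move=> hh; apply: filterS (hh _).
  by move=> w /eqP; rewrite subr_eq0 subr_eq => /eqP ->.
apply: filterS cX => w cx; apply: cvgB; first exact: cvg_cst.
exact: (riemann_cvg (g := fun s => b (X s w) / sigma (X s w)) (comp_within (cbddM hb cinv).1 cx) t0).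
Qed.

End fixed_time.

Let integral_within (g : R -> R) : {within `[0, +oo[, continuous g} ->
  {within `[0, +oo[, continuous (fun u : R => \int[lebesgue_measure]_(s in `[0, u]) g s : R)}.
Proof.
move=> cg; have [G dG IG] := path_antiderivative cg.
apply: (@subspace_eq_continuous _ _ _ (fun u : R => G u - G 0)).
  by move=> u; rewrite inE/= in_itv/= andbT => u0; exact: esym (IG u u0).
apply: continuous_subspaceT => y; apply: cvgB; last exact: cvg_cst.
exact: (is_derive_continuous dG).
Qed.

(** On [[0, 0]] the empty list is a partition of arbitrarily small mesh, so the limit in probability
    must equal the empty sum. *)
Let cvg_mesh00 (Sigma : seq R -> T -> R) (Z : T -> R) : measurable_fun setT Z ->
  (forall w, Sigma [::] w = 0) -> cvg_in_probability_mesh P 0 Sigma Z ->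
  {ae P, forall w, Z w = 0}.
Proof.
move=> mZ S0 hZ; apply: pdist_eq0 => //; apply/eqP; rewrite eq_le pdist_ge0 andbT.
apply/ler_addgt0Pr => e e0; have e20 : 0 < e / 2 by rewrite divr_gt0.
rewrite add0r [leRHS]splitr; have [delta _ hd] := hZ _ _ e20 e20.
have p0 : itv_partition 0 (0 : R) [::] by split.
have := hd [::] p0 (fun i => _); set A := [set w | _] => hA.
apply: pdist_prob_le; rewrite ?(ltW e20)//.
have := hA ltac:(by []); congr (P _ <= _)%E; apply/seteqP.
by rewrite /A; split => w /=; rewrite S0 sub0r normrN.
Qed.

Lemma initial_value : {ae P, forall w, X 0 w = x0}.
Proof.
have j0 : {ae P, forall w, J 0 w = 0}.
  by apply: (cvg_mesh00 (pJ (lexx 0)) _ (hJ (lexx 0))) => w; rewrite /left_sum big_nil.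
have k0 : {ae P, forall w, K 0 w = 0}.
  by apply: (cvg_mesh00 (pK (lexx 0)) _ (hK (lexx 0))) => w; rewrite /cross_sum big_nil.
apply: filterS3 j0 k0 hX => w jw kw hw.
by rewrite hw// jw kw /drift_integral set_itv1 Rintegral_set1 mulr0 !addr0.
Qed.

(** [ito_fixed] evaluates [K] at all grid times of all meshes, which calls for one null set valid at
    every time. *)
Lemma covariation_all : {ae P, forall w, forall u, 0 <= u ->
  K u w = \int[lebesgue_measure]_(s in `[0, u]) (sigma' (X s w) * sigma (X s w))}.
Proof.
have q0 (p n : nat) : 0 < p.+1%:R / n.+1%:R :> R by rewrite divr_gt0.
have h := ae_foralln (fun p => ae_foralln (fun n => covariation_fixed (q0 p n))).
apply: filterS3 h cX cK => w hw cx ck.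
apply: (agree_on_rationals ck) hw; apply: integral_within.
exact: (comp_within (cbddM hs' hs).1 cx).
Qed.

Theorem stratonovich_chain_rule : {ae P, forall w, forall u, 0 <= u ->
  Phi (X u w) = Phi x0 + \int[lebesgue_measure]_(s in `[0, u]) (b (X s w) / sigma (X s w)) +
    (B u w - B 0 w)}.
Proof.
have q0 (p n : nat) : 0 < p.+1%:R / n.+1%:R :> R by rewrite divr_gt0.
have h := ae_foralln (fun p => ae_foralln (fun n => ito_fixed (q0 p n) covariation_all)).
have cB : continuous_paths P B by case: hB.
apply: filterS2 (filterI initial_value h) (filterI cX cB) => w [x0w hw] [cx cb].
have cPhi : continuous Phi := is_derive_continuous dPhi.
have cdiv : continuous (fun y => b y / sigma y).
  by move=> y; apply: cvgM; [exact: hb.1|apply: cvgV => //; exact: hs.1].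
apply: (agree_on_rationals (comp_within cPhi cx)).
  move=> y; apply: cvgD; last by apply: cvgB; [exact: cb|exact: cvg_cst].
  apply: cvgD; first exact: cvg_cst.
  exact: (integral_within (comp_within cdiv cx)).
by move=> p n; rewrite -x0w -addrA -hw addrC subrK.
Qed.

End stratonovich_chain_rule.

(** * The Lamperti transform and the rate *)

Section hoelder_regularity.
Context {R : realType}.

Lemma hoelder_continuous (al : R) (f : R -> R) : 0 < al -> hoelder_on setT al f -> continuous f.
Proof.
move=> al0 /hoelder_on_ge0[K K0 hK] x; apply/cvgrPdist_le => e e0.
have K1 : 0 < K + 1 by rewrite ltr_pwDr.
have r0 : 0 < (e / (K + 1)) `^ al^-1 by rewrite powR_gt0// divr_gt0.
near=> y; have xy : `|x - y| <= (e / (K + 1)) `^ al^-1 by near: y; exact: cvgr_dist_le.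
apply: le_trans (hK x y I I) _.
have h : `|x - y| `^ al <= e / (K + 1).
  apply: le_trans (powR_le (ltW al0) (normr_ge0 _) xy) _.
  by rewrite -powRrM mulVf ?gt_eqF// powRr1// divr_ge0// ltW.
apply: le_trans (ler_wpM2l K0 h) _.
by rewrite mulrCA ger_pMr// ler_pdivrMr// mul1r lerDl.
Unshelve. all: by end_near. Qed.

(** Since the fractional part is at most 1, an order above [m] forces [k >= m]. Derivatives below
    order [k] are continuous because they are differentiable, the one of order [k] by the Hoelder
    condition. *)
Lemma hoelder_space_smooth (m : nat) (r : R) (f : R -> R) : m%:R < r -> hoelder_space r f ->
  (forall i x, (i < m)%N -> is_derive x (1 : R) (derive1n i f) (derive1n i.+1 f x)) /\
  forall i, (i <= m)%N -> exists C, cbdd C (derive1n i f).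
Proof.
move=> mr [k [al [[/andP[al0 al1] rE] dk bk hk]]].
have mk : (m <= k)%N.
  by rewrite -ltnS -(ltr_nat R) -natr1; apply: lt_le_trans mr _; rewrite rE lerD2l.
have D i x : (i < k)%N -> is_derive x (1 : R) (derive1n i f) (derive1n i.+1 f x).
  by move=> ik; rewrite derive1nS derive1E; apply: derivableP; exact: dk.
split=> [i x im|i im]; first by apply: D; exact: leq_trans mk.
have ik := leq_trans im mk; have [M [_ hM]] := bk i ik.
exists (M + 1); split; last by move=> x; apply: (hM (M + 1)) => //; rewrite ltrDl.
move: ik; rewrite leq_eqVlt => /predU1P[->|ik]; first exact: hoelder_continuous hk.
exact: is_derive_continuous (fun x => D i x ik).
Qed.

End hoelder_regularity.

(** * Construction of the Lamperti transform *)

Section lamperti_transform.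
Context {R : realType}.
Variables (sigma : R -> R) (s0 s1 : R).
Hypotheses (hs : cbdd s1 sigma) (s00 : 0 < s0) (ell : forall y, s0 <= `|sigma y|).

Let sn0 y : sigma y != 0.
Proof. by rewrite -normr_gt0; exact: lt_le_trans (ell y). Qed.

Lemma elliptic_inv_cbdd : cbdd s0^-1 (fun y => (sigma y)^-1).
Proof.
split; first by move=> y; apply: cvgV => //; exact: hs.1.
by move=> y; rewrite normfV lef_pV2 ?posrE// normr_gt0.
Qed.

Lemma elliptic_same_sign x y : 0 < sigma x * sigma y.
Proof.
wlog xy : x y / x <= y => [h|].
  by case: (leP x y) => [|/ltW] /h//; rewrite mulrC.
rewrite ltNge; apply/negP => sxy.
have cs : {within `[x, y], continuous sigma} by apply: continuous_subspaceT; exact: hs.1.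
have hv : Num.min (sigma x) (sigma y) <= 0 <= Num.max (sigma x) (sigma y).
  have nx := sn0 x; have ny := sn0 y.
  rewrite ge_min le_max; case: (ltgtP (sigma x) 0) nx => //= sx _.
  - have := sxy; rewrite nmulr_rle0// => ->.
  - by have := sxy; rewrite pmulr_rle0// => ->.
by have [c _ c0] := IVT xy cs hv; have := sn0 c; rewrite c0 eqxx.
Qed.

(** Injectivity is the mean value theorem with a nonvanishing derivative. Surjectivity uses that
    [1 / sigma] has constant sign and is at least [1 / s1] in absolute value, so [Phi] is unbounded
    in both directions. *)
Lemma lamperti_exists : exists Phi psi : R -> R,
  [/\ forall y, is_derive y (1 : R) Phi (sigma y)^-1, cancel Phi psi, cancel psi Phi &
      forall y, is_derive y (1 : R) psi (sigma (psi y))].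
Proof.
have [Phi dPhi] := continuous_antiderivative elliptic_inv_cbdd.1.
have cPhi : continuous Phi := is_derive_continuous dPhi.
have s10 : 0 < s1 by apply: lt_le_trans s00 _; apply: le_trans (ell 0) _; exact: hs.2.
have mv x y : x <= y -> exists c, Phi y - Phi x = (y - x) / sigma c.
  move=> xy; have [c _ ->] := MVT_segment xy (fun z _ => dPhi z) (continuous_subspaceT cPhi).
  by exists c; rewrite mulrC.
have injPhi : injective Phi.
  move=> x y; wlog xy : x y / x <= y => [h e|e].
    by case: (leP x y) => [|/ltW] /h; [exact|move=> /(_ (esym e))].
  have [c] := mv _ _ xy; rewrite e subrr => /esym/eqP.
  by rewrite mulf_eq0 invr_eq0 (negbTE (sn0 c)) orbF subr_eq0 => /eqP.
have sur v : exists y, Phi y = v.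
  (* At distance [M] from 0 the function has moved by at least [|v - Phi 0|], in opposite directions
     on the two sides because [sigma] keeps its sign. *)
  pose M := s1 * `|v - Phi 0|; have M0 : 0 <= M by rewrite mulr_ge0// ltW.
  have NM : - M <= M by rewrite ge0_cp.
  have [c1 e1] := mv 0 M M0; have [c2 e2] := mv (- M) 0 (eqbRL (oppr_le0 M) M0).
  rewrite subr0 in e1; rewrite sub0r opprK in e2.
  have far c : `|v - Phi 0| <= M / `|sigma c|.
    by rewrite /M ler_pdivlMr ?normr_gt0// mulrC ler_wpM2r//; exact: hs.2.
  have hv : Num.min (Phi (- M)) (Phi M) <= v <= Num.max (Phi (- M)) (Phi M).
    rewrite ge_min le_max; have := far c1; have := far c2.
    have := elliptic_same_sign c1 c2; case: (ltgtP (sigma c1) 0) (sn0 c1) => // h1 _.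
    - rewrite nmulr_rgt0// => h2; rewrite (ltr0_norm h1) (ltr0_norm h2) !invrN !mulrN -e1 -e2 !ler_norml.
      move=> /andP[a1 a2] /andP[a3 a4].
      by apply/andP; split; apply/orP; [right|left]; lra.
    - rewrite pmulr_rgt0// => h2; rewrite (gtr0_norm h1) (gtr0_norm h2) -e1 -e2 !ler_norml.
      move=> /andP[a1 a2] /andP[a3 a4].
      by apply/andP; split; apply/orP; [left|right]; lra.
  by have [c _ <-] := IVT NM (continuous_subspaceT cPhi) hv; exists c.
have [psi psiK] := boolp.choice sur.
have PhiK : cancel Phi psi by move=> x; apply: injPhi; rewrite psiK.
exists Phi, psi; split => // y.
rewrite -{1}(psiK y) -[sigma _]invrK; apply: (@is_derive_inverse _ Phi) => //.
- by near=> z; exact: PhiK.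
- by near=> z; exact: cPhi.
- by rewrite invr_eq0.
Unshelve. all: by end_near. Qed.

End lamperti_transform.

Section lamperti_rate.
Context d (T : measurableType d) (R : realType) (P : probability T R).
Variables (b b' sigma sigma' phi phi' phi'' : R -> R) (b0 b1 s0 s1 s2 f0 f1 f2 : R).
Hypotheses (db : forall y, is_derive y (1 : R) b (b' y)) (hb : cbdd b0 b) (hb' : cbdd b1 b').
Hypotheses (ds : forall y, is_derive y (1 : R) sigma (sigma' y)) (hs : cbdd s1 sigma)
  (hs' : cbdd s2 sigma').
Hypotheses (df : forall y, is_derive y (1 : R) phi (phi' y))
  (df' : forall y, is_derive y (1 : R) phi' (phi'' y)).
Hypotheses (hf : cbdd f0 phi) (hf' : cbdd f1 phi') (hf'' : cbdd f2 phi'').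
Hypotheses (s00 : 0 < s0) (ell : forall y, s0 <= `|sigma y|).

Let sn0 y : sigma y != 0.
Proof. by rewrite -normr_gt0; exact: lt_le_trans (ell y). Qed.

Variables (Phi psi : R -> R).
Hypothesis dPhi : forall y, is_derive y (1 : R) Phi (sigma y)^-1.
Hypothesis PhiK : cancel Phi psi.
Hypothesis dpsi : forall y, is_derive y (1 : R) psi (sigma (psi y)).

Let cPhi : continuous Phi := is_derive_continuous dPhi.
Let cpsi : continuous psi := is_derive_continuous dpsi.

Let comp_psi (g g' : R -> R) : (forall y, is_derive y (1 : R) g (g' y)) ->
  forall y, is_derive y (1 : R) (fun y => g (psi y)) (g' (psi y) * sigma (psi y)).
Proof. by move=> dg y; apply: (@is_derive1_comp _ g psi). Qed.

Let cbdd_psi (C : R) (g : R -> R) : cbdd C g -> cbdd C (fun y => g (psi y)).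
Proof. exact: cbdd_comp. Qed.

Definition unit_noise_drift (y : R) : R := b (psi y) / sigma (psi y).

Let q' (y : R) : R := b' y * (sigma y)^-1 + -1 * (b y * (sigma' y * ((sigma y)^-1 * (sigma y)^-1))).

Let dq y : is_derive y (1 : R) (fun y => b y / sigma y) (q' y).
Proof.
have dV := is_deriveV (sn0 y) (ds y).
apply: (is_derive_eq (is_deriveM (db y) dV)).
by rewrite /q' /GRing.scale/= -exprVn expr2; ring.
Qed.

Let hV := elliptic_inv_cbdd hs s00 ell.
Let hq : cbdd (b0 * s0^-1) (fun y => b y / sigma y). Proof. exact: cbddM hb hV. Qed.

Let hq' := cbddD (cbddM hb' hV) (cbddM (cbdd_cst (-1)) (cbddM hb (cbddM hs' (cbddM hV hV)))).

(** [weak_const] at bounds for the transformed data: the drift, its derivative, and the first two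
    derivatives of [phi] composed with [psi]. Each differentiation through [psi] brings a factor
    [sigma (psi y)] of size at most [s1]. *)
Definition rate_const (Tm : R) : R := weak_const (b0 * s0^-1)
  ((b1 * s0^-1 + `|-1| * (b0 * (s2 * (s0^-1 * s0^-1)))) * s1)
  (f1 * s1) ((f2 * s1 + f1 * s2) * s1) Tm.

Lemma lamperti_rate (H : R) (B B2 X X2 : R -> T -> R) (x0 t Tm : R) :
  is_fbm P H B -> is_fbm P 2^-1 B2 -> 2^-1 < H -> H < 1 ->
  additive_solution P unit_noise_drift (Phi x0) B (fun t w => Phi (X t w)) ->
  additive_solution P unit_noise_drift (Phi x0) B2 (fun t w => Phi (X2 t w)) ->
  measurable_fun setT (X t) -> measurable_fun setT (X2 t) -> 0 < t -> t <= Tm ->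
  `|\int[P]_w phi (X t w) - \int[P]_w phi (X2 t w)| <=
    (2 * H - 1) * rate_const Tm.
Proof.
move=> hB hB2 H1 H2 sX sX2 mX mX2 t0 tT.
pose f y := phi (psi y); pose g y := phi' (psi y) * sigma (psi y).
pose g' y := (phi'' (psi y) * sigma (psi y) + phi' (psi y) * sigma' (psi y)) * sigma (psi y).
have dg y : is_derive y (1 : R) g (g' y).
  apply: (@comp_psi (fun y => phi' y * sigma y) (fun y => phi'' y * sigma y + phi' y * sigma' y)) => z.
  by apply: (is_derive_eq (is_deriveM (df' z) (ds z))); rewrite /GRing.scale/=; ring.
have mPhi Z : measurable_fun setT Z -> measurable_fun setT (fun w : T => Phi (Z w)).
  exact: measurableT_comp (continuous_measurable cPhi).
have := additive_weak_rate (comp_psi dq) (cbdd_psi hq) (cbddM (cbdd_psi hq') (cbdd_psi hs))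
  (comp_psi df) dg (cbdd_psi hf) (cbddM (cbdd_psi hf') (cbdd_psi hs))
  (cbddM (cbddD (cbddM (cbdd_psi hf'') (cbdd_psi hs)) (cbddM (cbdd_psi hf') (cbdd_psi hs'))) (cbdd_psi hs))
  hB hB2 H1 H2 sX sX2 (mPhi _ mX) (mPhi _ mX2) t0 tT.
under Rint_eq do rewrite PhiK.
under [X in _ - X]Rint_eq do rewrite PhiK.
exact.
Qed.

Let drift_eq (x : R -> R) (t : R) : \int[lebesgue_measure]_(s in `[0, t]) (b (x s) / sigma (x s)) =
  \int[lebesgue_measure]_(s in `[0, t]) unit_noise_drift (Phi (x s)).
Proof. by apply: eq_Rintegral => s _; rewrite /unit_noise_drift PhiK. Qed.

Let Phi_within (x : R -> R) : {within `[0, +oo[, continuous x} ->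
  {within `[0, +oo[, continuous (fun s => Phi (x s))}.
Proof. by move=> cx y; apply: continuous_comp; [exact: cx|exact: cPhi]. Qed.

Lemma young_lamperti (B X : R -> T -> R) (x0 : R) : young_solution P b sigma x0 B X ->
  additive_solution P unit_noise_drift (Phi x0) B (fun t w => Phi (X t w)).
Proof.
move=> [_ cX sX]; apply: filterS2 cX sX => w cx sx; split; first exact: Phi_within.
move=> t t0; rewrite (young_chain_rule hb hs s00 ell dPhi cx sx t0).
by rewrite drift_eq.
Qed.

Lemma stratonovich_lamperti (B X : R -> T -> R) (x0 : R) :
  stratonovich_solution P b sigma x0 B X ->
  additive_solution P unit_noise_drift (Phi x0) B (fun t w => Phi (X t w)).
Proof.
move=> [F [S [hF aX cX [J [K [[[_ hB] _ [pJ _] hJ] [pK cK bvK hK] SE]] sX]]]].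
have hX : {ae P, forall w, forall u, 0 <= u ->
    X u w = x0 + drift_integral b X u w + (J u w + 2^-1 * K u w)}.
  by apply: filterS sX => w sw u u0; rewrite sw// SE.
have h := stratonovich_chain_rule hF hB hb hs hs' ds s00 ell dPhi aX cX pJ hJ pK cK bvK hK hX.
apply: filterS2 cX h => w cx hw; split; first exact: Phi_within.
by move=> t t0; rewrite hw// drift_eq.
Qed.

Lemma additive_initial (B X : R -> T -> R) (x0 : R) :
  additive_solution P unit_noise_drift (Phi x0) B (fun t w => Phi (X t w)) ->
  measurable_fun setT (X 0) -> \int[P]_w phi (X 0 w) = phi x0.
Proof.
move=> sX mX; rewrite -[RHS](Rint_cst P); apply: Rint_ae_eq.
- exact: measurableT_comp (continuous_measurable hf.1) mX.
- exact: measurable_cst.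
- apply: filterS sX => w [_ /(_ 0 (lexx 0))].
  rewrite /drift_integral set_itv1 Rintegral_set1 subrr !addr0 => e.
  by rewrite -(PhiK (X 0 w)) e PhiK.
Qed.

End lamperti_rate.

Theorem theorem1p1 (R : realType) (d : measure_display)
    (Omega : measurableType d) (P : probability Omega R)
    (x0 : R) (b sigma : R -> R)
    (hbsigma : exists gamma : R, 0 < gamma < 1 /\
       hoelder_space (1 + gamma) b /\ hoelder_space (1 + gamma) sigma)
    (hell : exists sigma0 : R, 0 < sigma0 /\ forall x, sigma0 <= `|sigma x|)
    (B X : R -> R -> Omega -> R)
    (hB : forall H : R, 2^-1 <= H < 1 -> is_fbm P H (B H))
    (hX : forall H : R, 2^-1 < H < 1 ->
       young_solution P b sigma x0 (B H) (X H))
    (hX_half : stratonovich_solution P b sigma x0 (B 2^-1) (X 2^-1))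
    (phi : R -> R) (hphi_bounded : bounded_fun phi)
    (hphi : exists beta : R, 0 < beta /\ hoelder_space (2 + beta) phi) :
  forall T : R, 0 < T -> exists C : R, 0 < C /\
    forall H : R, 2^-1 <= H < 1 ->
      (ereal_sup [set `|'E_P[fun w => phi (X H t w)] -
                        'E_P[fun w => phi (X 2^-1%R t w)]|
                  | t in `[0%R, T]%classic]
       <= (C * (H - 2^-1))%:E)%E.
Proof.
case: hbsigma => gamma [/andP[gam0 _] [hb hs]].
case: hell => s0 [s00 ell]; case: hphi => beta [beta0 hphi] Tm Tm0.
have g1 : 1%:R < 1 + gamma by rewrite ltrDl.
have g2 : 2%:R < 2 + beta by rewrite ltrDl.
have [Db Cb] := hoelder_space_smooth g1 hb; have [Ds Cs] := hoelder_space_smooth g1 hs.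
have [Df Cf] := hoelder_space_smooth g2 hphi.
have [b0 cb] := Cb 0%N isT; have [b1 cb'] := Cb 1%N isT.
have [s1 cs] := Cs 0%N isT; have [s2 cs'] := Cs 1%N isT.
have [f0 cf] := Cf 0%N isT; have [f1 cf'] := Cf 1%N isT; have [f2 cf''] := Cf 2%N isT.
have db y := Db 0%N y isT; have ds y := Ds 0%N y isT.
have df y := Df 0%N y isT; have df' y := Df 1%N y isT.
have [Phi [psi [dPhi PhiK _ dpsi]]] := lamperti_exists cs s00 ell.
pose K := rate_const b0 b1 s0 s1 s2 f1 f2 Tm.
have sH := stratonovich_lamperti cb ds cs cs' s00 ell dPhi PhiK hX_half.
have mH t : 0 <= t -> measurable_fun setT (X 2^-1 t).
  move=> t0; case: hX_half => F [S [hF aX _ _ _]].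
  by apply: (fmeas_measurable hF t0); exact: fmeas_adapted.
have rphi Z : measurable_fun setT Z -> rint P (fun w => phi (Z w)).
  move=> mZ; apply: (@rint_bounded _ _ _ _ f0); last by move=> w; exact: cf.2.
  exact: measurableT_comp (continuous_measurable cf.1) mZ.
(* The factor 2 turns [2 H - 1] into [H - 1/2]; the absolute value and the added 1 make the constant
   positive. *)
exists (2 * `|K| + 1); split; first by rewrite ltr_wpDl// mulr_ge0.
move=> H /andP[H1 H2].
have HK : (2 * H - 1) * K <= (2 * `|K| + 1) * (H - 2^-1).
  have -> : (2 * H - 1) * K = (2 * K) * (H - 2^-1) by field.
  rewrite ler_wpM2r ?subr_ge0//; have := ler_norm K; lra.
have c0 : 0 <= (2 * `|K| + 1) * (H - 2^-1).
  by rewrite mulr_ge0 ?subr_ge0// addr_ge0// mulr_ge0.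
have [mXH key] : (forall t, 0 <= t -> measurable_fun setT (X H t)) /\
    forall t, 0 <= t -> t <= Tm ->
    `|\int[P]_w phi (X H t w) - \int[P]_w phi (X 2^-1 t w)| <= (2 * `|K| + 1) * (H - 2^-1).
  (* At [H = 1/2] the two processes coincide; the Young equation is available only above 1/2. *)
  move: H1; rewrite le_eqVlt => /predU1P[<-|H1].
    by split=> // t t0 tT; rewrite !subrr normr0 mulr0.
  have hXH := hX H (introT andP (conj H1 H2)).
  have mX t (t0 : 0 <= t) : measurable_fun setT (X H t) by case: hXH => mX _ _; exact: mX.
  have sX := young_lamperti cb cs s00 ell dPhi PhiK hXH.
  (* The Euler comparison needs a positive horizon; at [t = 0] both expectations are [phi x0]. *)
  split=> // t; rewrite le_eqVlt => /predU1P[<- _|t0 tT].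
    rewrite (additive_initial cf PhiK sX (mX _ (lexx 0))).
    by rewrite (additive_initial cf PhiK sH (mH _ (lexx 0))) subrr normr0.
  apply: le_trans HK.
  have B1 : is_fbm P H (B H) by apply: hB; rewrite (ltW H1).
  have B2 : is_fbm P 2^-1 (B 2^-1) by apply: hB; rewrite lexx/=; lra.
  exact (lamperti_rate db cb cb' ds cs cs' df df' cf cf' cf'' s00 ell dPhi PhiK dpsi
    B1 B2 H1 H2 sX sH (mX t (ltW t0)) (mH t (ltW t0)) t0 tT).
apply: ge_ereal_sup => _ [t /= + <-]; rewrite in_itv/= => /andP[t0 tT].
rewrite unlock !rint_EFin; [|exact: rphi (mH t t0)|exact: rphi (mXH t t0)].
by rewrite -EFinB/= lee_fin; exact: key.
Qed.
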